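(* Let $k_1\ge2$, $k_2\ge2$ be integers and let $(\varepsilon_i)_{i\in\mathbb{Z}}$ be i.i.d. random variables with mean $0$ and variance $1$ such that $\mathbb{E}|\varepsilon_i|^{2+2k_2+\delta}<\infty$ for some $\delta>0$. For $j=1,2$ let $g^{(j)}$ be a symmetric GHK(B) on $\mathbb{R}_+^{k_j}$ with homogeneity exponent $\alpha_j\in(-k_j/2-1/2,-k_j/2)$, let $a^{(j)}(\mathbf{i})=g^{(j)}(\mathbf{i})L^{(j)}(\mathbf{i})$, $\mathbf{i}\in\mathbb{Z}_+^{k_j}$, be symmetric, where $L^{(j)}$ is an admissible factor, so that $H_j:=\alpha_j+k_j/2+1\in(1/2,1)$. Define $$X(n)=Y_1'(n)Y_2(n),\qquad Y_1'(n)=\sum_{\mathbf{i}\in\mathbb{Z}_+^{k_1}}{}^{'}\,a^{(1)}(\mathbf{i})\,\varepsilon_{n-i_1}\cdots\varepsilon_{n-i_{k_1}},\qquad Y_2(n)=\sum_{\mathbf{i}\in\mathbb{Z}_+^{k_2}}a^{(2)}(\mathbf{i})\,\varepsilon_{n-i_1}\cdots\varepsilon_{n-i_{k_2}}$$ (diagonals excluded in $Y_1'$, included in $Y_2$). Let $c_2$ be the constant defined in the context. If $c_2\ne0$, then, with $H_1=\alpha_1+k_1/2+1$, as $N\to\infty$, $$N^{-H_1}\sum_{n=1}^{[Nt]}\bigl[X(n)-\mathbb{E}X(n)\bigr]\Rightarrow Z(t)=c_2\,I_{k_1}(h_{t,1})\quad\text{in } D[0,1],$$ where $h_{t,1}(\mathbf{x})=\int_0^t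 g^{(1)}(s\mathbf{1}-\mathbf{x})\,1_{\{s\mathbf{1}>\mathbf{x}\}}\,\mathrm{d}s$, $\mathbf{x}\in\mathbb{R}^{k_1}$.
   Context: Notation: $\mathbb{Z}_+=\{1,2,\ldots\}$, $\mathbb{R}_+=(0,\infty)$, $\mathbf{1}=(1,\ldots,1)$; vector inequalities are componentwise; $[\cdot]$ is the integer part (componentwise for vectors); $\|\cdot\|$ is the $\ell^1$-norm. A prime on a sum means that the diagonals $i_p=i_q$, $p\ne q$, are excluded. $\Rightarrow$ denotes weak convergence. $I_m(h)$ is the $m$-fold Wiener--It\^o integral of $h\in L^2(\mathbb{R}^m)$ with respect to Brownian motion. GHK: a measurable function $g$ on $\mathbb{R}_+^k$ is a generalized Hermite kernel (GHK) with homogeneity exponent $\alpha\in(-\frac{k+1}{2},-\frac{k}{2})$ if (1) $g(\lambda\mathbf{x})=\lambda^\alpha g(\mathbf{x})$ for all $\lambda>0$, and (2) $\int_{\mathbb{R}_+^k}|g(\mathbf{1}+\mathbf{x})g(\mathbf{x})|\,\mathrm{d}\mathbf{x}<\infty$. A GHK $g$ is of Class (B), written GHK(B), if it is a.e. continuous on $\mathbb{R}_+^k$ and $|g(\mathbf{x})|\le c\|\mathbf{x}\|^{\alpha}=c(x_1+\cdots+x_k)^\alpha$ for some constant $c>0$. Admissible factor: a bounded function $L$ on $\mathbb{Z}_+^k$ such that $\lim_{n\to\infty}L([n\mathbf{x}]+\mathbf{B}(n))=1$ for every $\mathbf{x}\in\mathbb{R}_+^k$ and every bounded $\mathbb{Z}_+^k$-valued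 function $\mathbf{B}(n)$. Identification of variables: for a partition $\pi=(P_1,\ldots,P_m)$ of a $k$-element ordered index set (blocks ordered by smallest element) and a function $a$ on $\mathbb{Z}_+^k$, $a_\pi(i_1,\ldots,i_m)$ is the value of $a$ when all variables with index in $P_t$ are set equal to $i_t$, $t=1,\ldots,m$. Meaning of the sum with diagonals: $\sum_{\mathbf{i}\in\mathbb{Z}_+^k}a(\mathbf{i})\varepsilon_{n-i_1}\cdots\varepsilon_{n-i_k}$ is decomposed by which indices coincide, as $\sum_{\pi}\sum'_{\mathbf{i}\in\mathbb{Z}_+^m}a_\pi(\mathbf{i})\varepsilon_{n-i_1}^{p_1}\cdots\varepsilon_{n-i_m}^{p_m}$, $p_t=|P_t|$, over all partitions $\pi$ of $\{1,\ldots,k\}$; each power is expanded as $\varepsilon^p=\sum_{l=0}^p\binom{p}{l}\mu_{p-l}A_l(\varepsilon)$, with $A_l$ the Appell polynomials of the law of $\varepsilon_i$ ($A_0=1$, $A_l'=lA_{l-1}$, $\mathbb{E}A_l(\varepsilon)=0$ for $l\ge1$), the variables carrying $A_0$ are summed out, and the resulting off-diagonal sums converge in $L^2(\Omega)$. Constant $c_2$: let $\mathcal{C}_2^2$ be the collection of partitions of $\{k_1+1,\ldots,k_1+k_2\}$ (indexing the variables of $a^{(2)}$) each of whose blocks contains at least $2$ elements. For $\pi=(P_1,\ldots,P_m)$ with $p_i=|P_i|$ put $\mu_\pi=\mu_{p_1}\cdots\mu_{p_m}$, $\mu_p=\mathbb{E}\varepsilon_i^p$. Then $$c_2=\sum_{\pi\in\mathcal{C}_2^2}\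 \sum_{\mathbf{i}>\mathbf{0}}{}^{'}\,a^{(2)}_\pi(\mathbf{i})\,\mu_\pi.$$ *)

(* Defs.v *)
From HB Require Import structures.
From mathcomp Require Import all_boot all_order all_algebra perm finmap.
From mathcomp Require Import all_classical all_reals all_analysis.

Set Implicit Arguments.
Unset Strict Implicit.
Unset Printing Implicit Defensive.
Import Order.TTheory GRing.Theory Num.Theory.
Import numFieldNormedType.Exports.

Local Open Scope classical_set_scope.
Local Open Scope ring_scope.

(* Lebesgue measure on R^k. It lives on [k.-tuple R], which carries the product
   sigma-algebra; points of R^k are otherwise row vectors, see [row_tuple]. *)
Section lebesgue_tuple.
Context {R : realType}.

Section cons_measure.
Context (k : nat) (mu : {sigma_finite_measure set (k.-tuple R) -> \bar R}).

Definition cons_pair (x : measurableTypeR R * k.-tuple R) : k.+1.-tuple R :=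
  [the k.+1.-tuple R of x.1 :: x.2].

Lemma measurable_cons_pair : measurable_fun setT cons_pair.
Proof.
by apply: measurable_cons; [exact: measurable_fst | exact: measurable_snd].
Qed.

Definition cons_measure : set (k.+1.-tuple R) -> \bar R :=
  pushforward (@lebesgue_measure R \x mu)%E cons_pair.

Let cons_measure0 : cons_measure set0 = 0%E.
Proof. by rewrite /cons_measure /pushforward preimage_set0 measure0. Qed.

Let cons_measure_ge0 A : (0 <= cons_measure A)%E.
Proof. by rewrite /cons_measure /pushforward measure_ge0. Qed.

Let cons_measure_sigma_additive : semi_sigma_additive cons_measure.
Proof.
move=> F mF tF mUF; rewrite /cons_measure /pushforward preimage_bigcup.
have mpre A : measurable A -> measurable (cons_pair @^-1` A).
  by move=> mA; rewrite -[X in measurable X]setTI; exact: measurable_cons_pair.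
apply: measure_semi_sigma_additive => [n||]; first exact: mpre.
- apply/trivIsetP => /= i j _ _ ij; rewrite -preimage_setI.
  by move/trivIsetP : tF => /(_ _ _ _ _ ij) ->//; rewrite preimage_set0.
- by rewrite -preimage_bigcup; exact: mpre.
Qed.

HB.instance Definition _ := isMeasure.Build _ _ _ cons_measure
  cons_measure0 cons_measure_ge0 cons_measure_sigma_additive.

Lemma sigma_finite_cons_measure : sigma_finite setT cons_measure.
Proof.
have /sigma_finiteP[F [FT ndF mF]] := sigma_finiteT (@lebesgue_measure R).
have /sigma_finiteP[G [GT ndG mG]] := sigma_finiteT mu.
pose uncons (t : k.+1.-tuple R) : measurableTypeR R * k.-tuple R :=
  (thead t, [tuple of behead t]).
have consK : cancel cons_pair uncons.
  by move=> [x t]; rewrite /uncons /cons_pair theadE; congr pair; exact: val_inj.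
have muncons : measurable_fun setT uncons.
  apply: measurable_fun_pair; last exact: measurable_behead.
  exact: measurable_tnth.
exists (fun n => uncons @^-1` (F n `*` G n)).
  apply/esym; rewrite -subTset => t _.
  have [n _ Fn] : (\bigcup_n F n) (thead t) by rewrite -FT.
  have [m _ Gm] : (\bigcup_n G n) [tuple of behead t] by rewrite -GT.
  exists (maxn n m) => //; split => /=.
  - by move: Fn; exact/subsetPset/ndF/leq_maxl.
  - by move: Gm; exact/subsetPset/ndG/leq_maxr.
move=> n; have [mFn Fn] := mF n; have [mGn Gn] := mG n.
have mFG : measurable (F n `*` G n) by exact: measurableX.
split; first by rewrite -[X in measurable X]setTI; exact: muncons.
rewrite /cons_measure /pushforward.
have -> : cons_pair @^-1` (uncons @^-1` (F n `*` G n)) = F n `*` G n.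
  by rewrite -comp_preimage (_ : uncons \o cons_pair = id)//; exact/funext.
by rewrite product_measure1E// lte_mul_pinfty// ge0_fin_numE.
Qed.

HB.instance Definition _ :=
  Measure_isSigmaFinite.Build _ _ _ cons_measure sigma_finite_cons_measure.
End cons_measure.

Fixpoint lebesgue_tuple (k : nat) :
    {sigma_finite_measure set (k.-tuple R) -> \bar R} :=
  match k return {sigma_finite_measure set (k.-tuple R) -> \bar R} with
  | 0 => [the {sigma_finite_measure set (0.-tuple R) -> \bar R} of dirac [tuple]]
  | k'.+1 => [the {sigma_finite_measure set (k'.+1.-tuple R) -> \bar R} of
      cons_measure (lebesgue_tuple k')]
  end.
End lebesgue_tuple.

Definition row_tuple (R : Type) (k : nat) (t : k.-tuple R) : 'rV[R]_k :=
  \row_q tnth t q.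

Section kernels.
Context {R : realType} {k : nat}.
Implicit Type g : 'rV[R]_k -> R.

Definition orthant : set 'rV[R]_k := [set x | forall q, 0 < x ord0 q].

(* Lebesgue (not only Borel) measurability: equal almost everywhere to a Borel
   function. Almost everywhere continuous functions need not be Borel. *)
Definition lebesgue_measurable_on_orthant g :=
  exists2 f : k.-tuple R -> R, measurable_fun setT f &
    \forall t \ae lebesgue_tuple k, orthant (row_tuple t) -> g (row_tuple t) = f t.

Definition is_GHK (alpha : R) g :=
  [/\ - (k%:R + 1) / 2 < alpha < - k%:R / 2,
      lebesgue_measurable_on_orthant g,
      forall lam x, 0 < lam -> orthant x -> g (lam *: x) = lam `^ alpha * g x &
      (\int[lebesgue_tuple k]_(t in [set t | orthant (row_tuple t)])
         `|g (const_mx 1 + row_tuple t) * g (row_tuple t)|%:E < +oo)%E].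

Definition is_GHKB (alpha : R) g :=
  [/\ is_GHK alpha g,
      \forall t \ae lebesgue_tuple k,
        orthant (row_tuple t) -> {for row_tuple t, continuous g} &
      exists2 c, 0 < c &
        forall x, orthant x -> `|g x| <= c * (\sum_q x ord0 q) `^ alpha].

Definition symmetric_kernel g :=
  forall (s : 'S_k) x, orthant x -> g (col_perm s x) = g x.

Definition row_of_index (i : {ffun 'I_k -> nat}) : 'rV[R]_k :=
  \row_q (i q)%:R.

Definition symmetric_coef (a : {ffun 'I_k -> nat} -> R) :=
  forall (s : 'S_k) (i : {ffun 'I_k -> nat}), (forall q, 0 < i q)%N ->
    a [ffun q => i (s q)] = a i.

Definition admissible (L : {ffun 'I_k -> nat} -> R) :=
  (exists C, forall i : {ffun 'I_k -> nat}, (forall q, 0 < i q)%N -> `|L i| <= C)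
  /\ forall (x : 'rV[R]_k) (b : nat -> {ffun 'I_k -> nat}), orthant x ->
       (forall n q, 0 < b n q)%N -> (exists M, forall n q, b n q <= M)%N ->
       L [ffun q => (Num.truncn (n%:R * x ord0 q) + b n q)%N]
         @[n --> \oo] --> (1 : R).

(* h_t(x) = \int_0^t g(s1 - x) 1_{s1 > x} ds *)
Definition time_kernel g (t : R) (x : 'rV[R]_k) : R :=
  \int[lebesgue_measure]_(s in `[0, t])
    (if [forall q, x ord0 q < s] then g (const_mx s - x) else 0).
End kernels.

Section sums.

(* Unordered sum of an absolutely summable family of reals. *)
Definition abs_sum {R : realType} {I : choiceType} (D : set I) (f : I -> R) : R :=
  fine (\esum_(i in D) (Num.max (f i) 0)%:E)
  - fine (\esum_(i in D) (Num.max (- f i) 0)%:E).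

(* Y is the sum of the family F over D, unconditionally in L^2. *)
Definition L2_sum {d} {T : measurableType d} {R : realType}
    (P : probability T R) {I : choiceType} (D : set I) (F : I -> T -> R)
    (Y : T -> R) :=
  forall e : R, 0 < e -> exists2 J0 : {fset I}, {in J0, forall i, D i} &
    forall J : {fset I}, {in J, forall i, D i} -> (J0 `<=` J)%fset ->
      ('E_P[fun w => ((Y w - \sum_(i <- J) F i w) ^+ 2)%R] < e%:E)%E.

(* Multi-indices in Z_+^S without diagonals. An index on S is a function on the
   ambient type V that is positive exactly on S. *)
Definition offdiag {V : finType} (S : {set V}) : set {ffun V -> nat} :=
  [set i | (forall v, (v \in S) = (0 < i v)%N) /\ {in S &, injective i}].
End sums.

Section probability.
Context {d} {T : measurableType d} {R : realType} (P : probability T R).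

Definition mutually_independent {I : choiceType} (X : I -> T -> R) :=
  forall (J : {fset I}) (A : I -> set R), (forall i, measurable (A i)) ->
    P [set w | forall i, i \in J -> A i (X i w)] =
    (\prod_(i <- J) P (X i @^-1` A i))%E.

Definition identically_distributed {I : Type} (X : I -> T -> R) :=
  forall i j A, measurable A -> P (X i @^-1` A) = P (X j @^-1` A).

Definition moment (X : T -> R) (p : nat) : R := fine 'E_P[fun w => (X w ^+ p)%R].

(* Only the Appell polynomials of degree at most k: those of higher degree
   require more moments. *)
Definition is_appell (X : T -> R) (k : nat) (A : nat -> {poly R}) :=
  A 0%N = 1 /\ forall l, (l < k)%N ->
    (A l.+1)^`() = l.+1%:R *: A l /\
    ('E_P[fun w => (A l.+1).[X w]%R] = 0)%E.
End probability.

Section chaos.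
Context {d} {T : measurableType d} {R : realType} (P : probability T R).
Context {k : nat}.
Implicit Types (a : {ffun 'I_k -> nat} -> R) (mu : nat -> R).
Implicit Types (pi : {set {set 'I_k}}) (eps : int -> T -> R).

(* Y is a version of the off-diagonal sum of a(i) eps_{n-i_1} ... eps_{n-i_k} *)
Definition is_offdiag_chaos eps a (n : nat) (Y : T -> R) :=
  L2_sum P (offdiag [set: 'I_k]%SET)
    (fun i w => a i * \prod_q eps (n%:Z - (i q)%:Z) w) Y.

(* The variables obtained by identification along the partition pi are labelled
   by the blocks of pi themselves. *)
Definition identify a pi (i : {ffun {set 'I_k} -> nat}) : R :=
  a [ffun q => i (finset.pblock pi q)].

Definition is_partition pi : bool := finset.partition pi [set: 'I_k]%SET.

(* Choices of one term A_l, l <= #|B|, in the Appell expansion of the power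
   eps^#|B|, for each block B of pi; outside pi the value is 0. *)
Definition expansion pi (l : {ffun {set 'I_k} -> 'I_k.+1}) : bool :=
  [forall B, l B <= (if B \in pi then #|B| else 0)]%N.

Definition expansion_coef mu pi (l : {ffun {set 'I_k} -> 'I_k.+1}) : R :=
  \prod_(B in pi) ('C(#|B|, l B)%:R * mu (#|B| - l B)%N).

Definition remaining pi (l : {ffun {set 'I_k} -> 'I_k.+1}) : {set {set 'I_k}} :=
  [set B in pi | 0 < l B]%SET%N.

(* The variables carrying A_0 are summed out. The coefficient stays inside the
   sum because mu 1 = 0 multiplies sums that need not converge. *)
Definition reduced_coef mu a pi l (i : {ffun {set 'I_k} -> nat}) : R :=
  let join j : {ffun {set 'I_k} -> nat} := [ffun B => i B + j B]%N in
  abs_sum [set j | offdiag (pi :\: remaining pi l)%SET j /\ offdiag pi (join j)]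
    (fun j => expansion_coef mu pi l * identify a pi (join j)).

(* Y is a version of the sum, diagonals included, of
   a(i) eps_{n-i_1} ... eps_{n-i_k} *)
Definition is_diag_chaos eps (A : nat -> {poly R}) a (n : nat) (Y : T -> R) :=
  let mu := moment P (eps 0) in
  exists2 U : {set {set 'I_k}} -> {ffun {set 'I_k} -> 'I_k.+1} -> {RV P >-> R},
    forall pi l, is_partition pi -> expansion pi l ->
      L2_sum P (offdiag (remaining pi l))
        (fun i w => reduced_coef mu a pi l i *
           \prod_(B in remaining pi l) (A (l B)).[eps (n%:Z - (i B)%:Z) w])
        (U pi l) &
    forall w, Y w = \sum_(pi | is_partition pi) \sum_(l | expansion pi l) U pi l w.

Definition mean_const mu a : R :=
  \sum_(pi | is_partition pi && [forall (B | B \in pi), 1 < #|B|]%N)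
    abs_sum (offdiag pi) (fun i => identify a pi i * \prod_(B in pi) mu #|B|).
End chaos.

Section wiener_ito.
Context {d} {T : measurableType d} {R : realType} (P : probability T R).

(* Standard two-sided Brownian motion, indexed by the whole real line. *)
Definition is_brownian (B : R -> T -> R) :=
  [/\ \forall w \ae P, B 0 w = 0,
      \forall w \ae P, continuous (fun t => B t w),
      forall s t A, s < t -> measurable A ->
        P [set w | A (B t w - B s w)] = normal_prob 0 (Num.sqrt (t - s)) A &
      forall t : nat -> R, (forall n, t n < t n.+1) ->
        mutually_independent P (fun n w => B (t n.+1) w - B (t n) w)].

Section simple.
Context {m K : nat} (t : nat -> R) (c : {ffun 'I_m -> 'I_K} -> R).

Definition simple_kernel (x : 'rV[R]_m) : R :=
  \sum_j c j * \prod_(q < m) (\1_(`]t (j q), t (j q).+1]%classic) (x ord0 q) : R).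

Definition simple_integral (B : R -> T -> R) (w : T) : R :=
  \sum_j c j * \prod_(q < m) (B (t (j q).+1) w - B (t (j q)) w).
End simple.

(* I is a version of the m-fold Wiener-Ito integral of h with respect to B: the
   L^2 limit of the integrals of simple kernels that vanish on the diagonal
   cells and converge to h in L^2(R^m). *)
Definition is_wiener_ito (B : R -> T -> R) {m : nat} (h : 'rV[R]_m -> R)
    (I : T -> R) :=
  forall e : R, 0 < e ->
  exists K (t : nat -> R) (c : {ffun 'I_m -> 'I_K} -> R),
    [/\ forall n, t n < t n.+1,
        forall j, c j != 0 -> injective j,
        (\int[lebesgue_tuple m]_x
           ((h (row_tuple x) - simple_kernel t c (row_tuple x)) ^+ 2)%:E < e%:E)%E &
        ('E_P[fun w => ((I w - simple_integral t c B w) ^+ 2)%R] < e%:E)%E].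
End wiener_ito.

(* The Skorokhod space D[0,1]. Its elements are represented by functions on R of
   which only the restriction to [0,1] matters. *)
Section skorokhod.
Context {R : realType}.

Definition cadlag (x : R -> R) :=
  (forall t, 0 <= t < 1 -> x s @[s --> t^'+] --> x t) /\
  (forall t, 0 < t <= 1 -> cvg (x s @[s --> t^'-])).

Definition time_change (lam : R -> R) :=
  [/\ lam 0 = 0, lam 1 = 1, {in `[0, 1] &, {homo lam : s t / s < t}} &
      {within `[0, 1], continuous lam}].

(* Closed balls of Skorokhod's J1 metric. *)
Definition skorokhod_ball (x : R -> R) (r : R) : set (R -> R) :=
  [set y | cadlag y /\ exists2 lam, time_change lam &
     forall t, 0 <= t <= 1 -> `|lam t - t| <= r /\ `|x t - y (lam t)| <= r].

Definition skorokhod_open (U : set (R -> R)) :=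
  forall x, cadlag x -> U x -> exists2 r, 0 < r & skorokhod_ball x r `<=` U.

Definition skorokhod_continuous (f : (R -> R) -> R) :=
  forall x, cadlag x -> forall e, 0 < e ->
    exists2 r, 0 < r & forall y, skorokhod_ball x r y -> `|f x - f y| < e.

Definition random_cadlag {d} {T : measurableType d} (X : T -> R -> R) :=
  (forall w, cadlag (X w)) /\
  forall U, skorokhod_open U -> measurable (X @^-1` U).

Definition weak_cvg_skorokhod {d d'} {T : measurableType d}
    {T' : measurableType d'} (P : probability T R) (X : nat -> T -> R -> R)
    (P' : probability T' R) (Z : T' -> R -> R) :=
  [/\ forall N, random_cadlag (X N), random_cadlag Z &
      forall f, skorokhod_continuous f ->
        (exists C, forall x, cadlag x -> `|f x| <= C) ->
        ('E_P[fun w => f (X N w)] @[N --> \oo] --> 'E_P'[fun w => f (Z w)])%E].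
End skorokhod.

(* N^{-H} \sum_{n=1}^{[Nt]} (X(n) - E X(n)) *)
Definition normalized_sum {d} {T : measurableType d} {R : realType}
    (P : probability T R) (H : R) (X : nat -> T -> R) (N : nat) (w : T) (t : R) : R :=
  N%:R `^ (- H) *
  \sum_(1 <= n < (Num.truncn (N%:R * t)).+1) (X n w - fine 'E_P[X n]).

(* Main.v *)
(* Expanding Y_2 over partitions and Appell polynomials, X - E X splits into
   c_2 Y_1' and terms whose partial sums over windows of length b have second
   moment O(b^theta) with theta < 2 H_1; a dyadic maximal inequality makes these
   negligible uniformly in t. The normalized sum of Y_1' is close in L^2,
   uniformly in t, to a step function of t with values off-diagonal polynomials
   in finitely many block averages of the noise. Lindeberg's replacement trick
   exchanges these averages with increments of B, and the resulting polynomials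
   converge in L^2 to the Wiener-Ito integral. Weak convergence is tested on
   functionals that are Lipschitz for the supremum norm, through inf-convolution. *)
From HB Require Import structures.
Require Import Defs.
From mathcomp Require Import all_boot all_order all_algebra perm finmap.
From mathcomp Require Import all_classical all_reals all_analysis.
From mathcomp Require Import measurable_realfun.
From mathcomp Require Import ring lra zify.

Set Implicit Arguments.
Unset Strict Implicit.
Unset Printing Implicit Defensive.
Import Order.TTheory GRing.Theory Num.Theory.
Import numFieldNormedType.Exports.
Local Open Scope classical_set_scope.
Local Open Scope ring_scope.

(** The obstacle: a product [Y1 n * Y2 n] of square integrable chaoses is a priori only integrable,
    while partial sums need second moments. Finite truncations are estimated with constants free of
    the truncation and of the probability space, and the bounds pass to the limit in L^1 by lower
    semicontinuity. Products of chaoses are never re-expanded: a variance bound over sets of sites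
    sums over the ways in which variables of the two factors meet, and homogeneity is spent by
    distributing exponents over the variables. A term of Y_2 that keeps a variable gains an exponent
    q, so theta = 2 H_1 - q; the terms without variables add up to c_2. The local factor ['X * A l],
    of degree up to k_2 + 1, explains the 2 + 2 k_2 moments. Uniform constants let one approximation
    serve both the noise and the increments of B. On the Brownian space the levels i, with errors
    16^(- i), converge uniformly along paths, which builds Z on the given space. Cubic splines
    supply smooth test functions with explicit Taylor errors, and also prove measurability of
    functionals of finitely many variables. *)

Local Notation mfunT := (measurable_fun setT).


(** * Discrete power sums *)

Section power_sums.
Context {R : realType}.
Implicit Types (p g e : R) (x h M b : nat).

Lemma powR_succB p x : (0 < x)%N -> exists2 xi : R,
 x%:R < xi < x.+1%:R & x.+1%:R `^ p - x%:R `^ p = p * xi `^ (p - 1).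
Proof.
move=> x0; have xx : (x%:R : R) < x.+1%:R by rewrite ltr_nat.
have pos (y : R) : x%:R <= y -> 0 < y by apply: lt_le_trans; rewrite ltr0n.
have [||xi xiI ->] := @MVT R (fun y => y `^ p) (fun y => p * y `^ (p - 1)) _ _ xx.
- by move=> y /[!in_itv]/= /andP[xy _]; exact: is_derive1_powR (pos _ (ltW xy)).
- apply: continuous_in_subspaceT => y /[!inE]/= /[!in_itv]/= /andP[xy _].
 apply: differentiable_continuous; apply/derivable1_diffP.
 by apply: derivable_powR; rewrite in_itv/= andbT pos.
by exists xi; [rewrite in_itv/= in xiI | rewrite -natr1 addrAC subrr add0r mulr1].
Qed.

Lemma powR_succB_ge p x : (0 < x)%N -> 0 < p <= 1 ->
 p * x.+1%:R `^ (p - 1) <= x.+1%:R `^ p - x%:R `^ p.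
Proof.
move=> x0 /andP[p0 p1]; have [xi /andP[xxi xix] ->] := powR_succB p x0.
have xi0 : 0 < xi by apply: lt_trans xxi; rewrite ltr0n.
rewrite ler_pM2l// -(opprB 1) !powRN lef_pV2 ?posrE ?powR_gt0// ge0_ler_powR//.
all: by rewrite ?nnegrE ?subr_ge0// ltW.
Qed.

Lemma powR_succB_le p x : (0 < x)%N -> p < 0 ->
 - p * x.+1%:R `^ (p - 1) <= x%:R `^ p - x.+1%:R `^ p.
Proof.
move=> x0 p0; have [xi /andP[xxi xix] E] := powR_succB p x0.
rewrite -[leRHS]opprB E -mulNr.
have xi0 : 0 < xi by apply: lt_trans xxi; rewrite ltr0n.
rewrite ler_pM2l ?oppr_gt0// -(opprB 1) !powRN.
rewrite lef_pV2 ?posrE ?powR_gt0// ge0_ler_powR//.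
all: by rewrite ?nnegrE ?subr_ge0 ltW//; lra.
Qed.

(** Telescoping: by the mean value theorem the increment of x^(1 - g) is at least (1 - g) (x + 1)^(-
    g). The first term is treated apart because that bound needs x > 0. *)
Lemma sum_powRN_head g h : 0 <= g < 1 ->
 \sum_(x < h) x.+1%:R `^ (- g) <= (1 - g)^-1 * h%:R `^ (1 - g).
Proof.
move=> /andP[g0 g1]; have g1' : 0 < 1 - g by rewrite subr_gt0.
elim: h => [|[|h] IH]; first by rewrite big_ord0 mulr_ge0 ?invr_ge0 ?powR_ge0 ?ltW.
 by rewrite big_ord_recr big_ord0/= add0r !powR1 mulr1 invf_ge1//; lra.
rewrite big_ord_recr/=.
have p01 : 0 < 1 - g <= 1 by lra.
have := @powR_succB_ge (1 - g) h.+1 isT p01.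
rewrite (_ : 1 - g - 1 = - g); last by ring.
rewrite mulrC -ler_pdivlMr// => H; apply: (le_trans (lerD IH H)).
by rewrite mulrC -mulrDl addrC subrK mulrC.
Qed.

Lemma sum_powRN_tail g h M : 1 < g -> (0 < h)%N ->
 \sum_(x < M) (h + x).+1%:R `^ (- g) <= (g - 1)^-1 * h%:R `^ (1 - g).
Proof.
move=> g1 h0; have g1' : 0 < g - 1 by rewrite subr_gt0.
(* The bound is strengthened by the telescoped remainder, without which the induction on M would not
   close. *)
suff : \sum_(x < M) (h + x).+1%:R `^ (- g) <=
  (g - 1)^-1 * (h%:R `^ (1 - g) - (h + M)%:R `^ (1 - g)).
 move/le_trans; apply; rewrite ler_wpM2l ?invr_ge0 ?(ltW g1')//.
 by rewrite lerBlDr lerDl powR_ge0.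
elim: M => [|M IH]; first by rewrite big_ord0 addn0 subrr mulr0.
rewrite big_ord_recr/=; have g1'' : 1 - g < 0 by lra.
have hM : (0 < h + M)%N by rewrite addn_gt0 h0.
have := @powR_succB_le (1 - g) (h + M) hM g1''.
rewrite (_ : 1 - g - 1 = - g); last by ring.
rewrite opprB mulrC -ler_pdivlMr// => H; apply: (le_trans (lerD IH H)).
by rewrite mulrC -mulrDl addrA subrK mulrC addnS.
Qed.

Lemma sum_powRN_bounded g : 1 < g -> exists2 C : R, 0 < C &
 forall M, \sum_(x < M) x.+1%:R `^ (- g) <= C.
Proof.
move=> g1; have g1' : 0 < (g - 1)^-1 by rewrite invr_gt0 subr_gt0.
exists (1 + (g - 1)^-1) => [|[|M]]; first by lra.
 by rewrite big_ord0; lra.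
rewrite big_ord_recl/= powR1 lerD2l.
apply: le_trans (@sum_powRN_tail g 1 M g1 isT) _.
by rewrite powR1 mulr1.
Qed.

(* The two ranges x <= h and x > h contribute h^-g * h^(1 - g) and the tail of
  a convergent series. *)
Lemma sum_powRN_shift g : 1 / 2 < g < 1 -> exists2 C : R, 0 < C &
 forall h M, (0 < h)%N ->
 \sum_(x < M) x.+1%:R `^ (- g) * (x.+1 + h)%:R `^ (- g) <=
  C * h%:R `^ (1 - 2 * g).
Proof.
move=> /andP[g2 g1]; have g1' : 0 < (1 - g)^-1 by rewrite invr_gt0 subr_gt0.
have g2' : 0 < (2 * g - 1)^-1 by rewrite invr_gt0; lra.
exists ((1 - g)^-1 + (2 * g - 1)^-1) => [|h M h0]; first exact: addr_gt0.
have decr (u v : nat) : (0 < u)%N -> (u <= v)%N ->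
  (v%:R : R) `^ (- g) <= u%:R `^ (- g).
 move=> u0 uv; rewrite !powRN lef_pV2 ?posrE ?powR_gt0 ?ltr0n//; last exact: leq_trans uv.
 by rewrite ge0_ler_powR ?nnegrE ?ler_nat//; lra.
have h0' : h%:R != 0 :> R by rewrite pnatr_eq0 -lt0n.
pose F x : R := x.+1%:R `^ (- g) * (x.+1 + h)%:R `^ (- g).
have F0 x : 0 <= F x by rewrite mulr_ge0 ?powR_ge0.
(* Lengthening the range to h + M lets the sum be cut at h whatever the order of h and M. *)
apply: (@le_trans _ _ (\sum_(x < h + M) F x)).
 rewrite -!(big_mkord xpredT F) [leRHS](@big_cat_nat _ _ _ M)//= ?leq_addl// lerDl.
 by rewrite sumr_ge0.
rewrite big_split_ord/= mulrDl; apply: lerD.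
 apply: (@le_trans _ _ (\sum_(x < h) h%:R `^ (- g) * x.+1%:R `^ (- g))).
  apply: ler_sum => x _; rewrite /F/= mulrC ler_wpM2r ?powR_ge0//.
  by apply: decr => //; rewrite leq_addl.
 rewrite -mulr_sumr.
 apply: (@le_trans _ _ (h%:R `^ (- g) * ((1 - g)^-1 * h%:R `^ (1 - g)))).
  by rewrite ler_wpM2l ?powR_ge0// sum_powRN_head//; lra.
 rewrite mulrCA -powRD ?h0' ?implybT//.
 by rewrite (_ : - g + (1 - g) = 1 - 2 * g)//; ring.
apply: (@le_trans _ _ (\sum_(x < M) (h + x).+1%:R `^ (- (2 * g)))).
 apply: ler_sum => x _; rewrite /F/=.
 rewrite (_ : - (2 * g) = - g + - g); last by ring.
 rewrite powRD ?pnatr_eq0 ?implybT// ler_wpM2l ?powR_ge0// decr// leq_addr//.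
by apply: sum_powRN_tail => //; lra.
Qed.

(** The weight |n - m|^(- e). The diagonal gets the value 1, because the power of 0 is 0 for e != 0
    and would give no upper bound there. *)
Definition lagpow e (n m : nat) : R :=
 if n == m then 1 else `|(n%:Z - m%:Z)|%N%:R `^ (- e).

Lemma lagpow_ge0 e n m : 0 <= lagpow e n m.
Proof. by rewrite /lagpow; case: ifP => // _; exact: powR_ge0. Qed.

(** A row splits at the diagonal into two one-sided sums of order b^(1 - e), and there are b
    rows. *)
Lemma sum_lagpow e : 0 < e < 1 -> exists2 C : R, 0 < C &
 forall b, \sum_(n < b) \sum_(m < b) lagpow e n m <= C * b%:R `^ (2 - e).
Proof.
move=> /andP[e0 e1]; have e1' : 0 < (1 - e)^-1 by rewrite invr_gt0 subr_gt0.
exists (1 + 2 * (1 - e)^-1) => [|[|b]]; first by lra.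
 by rewrite big_ord0 mulr_ge0 ?powR_ge0//; lra.
set B := b.+1.
have B1 : 1 <= (B%:R : R) `^ (1 - e).
 by rewrite -[leLHS](powRr0 B%:R) ler_powR ?ler1n//; lra.
have key (n : 'I_B) : \sum_(m < B) lagpow e n m <=
  (1 + 2 * (1 - e)^-1) * B%:R `^ (1 - e).
 pose G (x : nat) : R := x.+1%:R `^ (- e).
 have G0 x : 0 <= G x by exact: powR_ge0.
 have S : \sum_(x < B) G x <= (1 - e)^-1 * B%:R `^ (1 - e).
  by apply: sum_powRN_head; lra.
 have Sle c : (c <= B)%N -> \sum_(x < c) G x <= (1 - e)^-1 * B%:R `^ (1 - e).
  move=> cB; apply: le_trans S.
  rewrite -!(big_mkord xpredT G) [leRHS](@big_cat_nat _ _ _ c)//= lerDl.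
  by rewrite sumr_ge0.
 have -> : \sum_(m < B) lagpow e n m =
   \sum_(x < n) G x + (1 + \sum_(x < B - n.+1) G x).
  rewrite -(big_mkord xpredT (lagpow e n)) (@big_cat_nat _ _ _ n)//=; last exact/ltnW.
  rewrite (@big_ltn _ _ _ n)//; congr (_ + (_ + _)).
  - rewrite big_mkord (reindex_inj rev_ord_inj)/=; apply: eq_bigr => x _.
   have xn := ltn_ord x.
   rewrite /lagpow /G gtn_eqF; last by rewrite /=; lia.
   by congr (_%:R `^ _); lia.
  - by rewrite /lagpow eqxx.
  - rewrite -{1}[n.+1]addn0 addnC big_addn big_mkord; apply: eq_bigr => x _.
   rewrite /lagpow /G ltn_eqF; last by lia.
   by congr (_%:R `^ _); lia.
 have := Sle n (ltnW (ltn_ord n)); have := Sle (B - n.+1)%N (leq_subr _ _).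
 by rewrite mulrDl mul1r; lra.
apply: (le_trans (ler_sum _ (fun n _ => key n))).
rewrite sumr_const card_ord -[_ *+ B]mulr_natr -mulrA.
rewrite (_ : 2 - e = (1 - e) + 1); last by ring.
by rewrite [X in _ <= _ * X]powRD ?pnatr_eq0 ?implybT// [X in _ <= _ * (_ * X)]powRr1.
Qed.

End power_sums.

(** * Second moments and square integrability *)

Section second_moment.
Context {d} {T : measurableType d} {R : realType}.
Variable mu : {measure set T -> \bar R}.
Implicit Types f g : T -> R.

(* Unlike [ge0_le_integral], no measurability is required. *)
Lemma ge0_le_integral_any (f g : T -> \bar R) :
 (forall x, 0 <= f x)%E -> (forall x, f x <= g x)%E ->
 (\int[mu]_x f x <= \int[mu]_x g x)%E.
Proof.
move=> f0 fg; rewrite !ge0_integralTE//; last by move=> x; exact: le_trans (fg x).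
by apply: le_ereal_sup => _ [h hf <-]; exists h => // x; exact: le_trans (fg x).
Qed.

(** Valued in the extended reals, so that a bound can be stated before square integrability is
    known. *)
Definition e2 f : \bar R := \int[mu]_x (f x ^+ 2)%:E.

Lemma e2_ge0 f : (0 <= e2 f)%E.
Proof. by apply: integral_ge0 => x _; rewrite lee_fin sqr_ge0. Qed.

Lemma eq_e2 f g : f =1 g -> e2 f = e2 g.
Proof. by move=> /funext ->. Qed.

Lemma measurable_sqr f : mfunT f ->
 mfunT (EFin \o (fun x => f x ^+ 2)).
Proof. by move=> mf; apply/measurable_EFinP; exact: measurable_funX. Qed.
Hint Resolve measurable_sqr : core.

Lemma e2D f g : mfunT f -> mfunT g ->
 (e2 (fun x => f x + g x)%R <= 2%:E * e2 f + 2%:E * e2 g)%E.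
Proof.
move=> mf mg; have m2 (h : T -> R) : mfunT h -> mfunT (fun x => 2%:E * (h x ^+ 2)%:E)%E.
 by move=> mh; apply: emeasurable_funM => //; exact: measurable_sqr.
have h20 (h : T -> R) x : (0 <= 2%:E * (h x ^+ 2)%:E :> \bar R)%E.
 by rewrite -EFinM lee_fin mulr_ge0 ?sqr_ge0.
rewrite /e2 -!ge0_integralZl_EFin//; try exact: measurable_sqr.
all: try by move=> x _; rewrite lee_fin sqr_ge0.
rewrite -ge0_integralD//; try exact: m2.
apply: ge0_le_integral_any => x; rewrite -?EFinM -?EFinD lee_fin ?sqr_ge0//.
by have := sqr_ge0 (f x - g x); nra.
Qed.

Lemma e2Z (c : R) f : mfunT f ->
 (e2 (fun x => c * f x)%R = (c ^+ 2)%:E * e2 f)%E.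
Proof.
move=> mf; rewrite /e2 -ge0_integralZl_EFin ?sqr_ge0//; try exact: measurable_sqr.
all: try by move=> x _; rewrite lee_fin sqr_ge0.
by apply: eq_integral => x _; rewrite -EFinM exprMn.
Qed.

Definition L2 f := mfunT f /\ (e2 f < +oo)%E.

Lemma L2D f g : L2 f -> L2 g -> L2 (fun x => f x + g x).
Proof.
move=> [mf f2] [mg g2]; split; first exact: measurable_funD.
apply: le_lt_trans (e2D mf mg) _.
by rewrite lte_add_pinfty// lte_mul_pinfty.
Qed.

Lemma L2Z c f : L2 f -> L2 (fun x => c * f x).
Proof.
move=> [mf f2]; split; first exact: measurable_funM.
by rewrite e2Z// lte_mul_pinfty// lee_fin sqr_ge0.
Qed.

Lemma L20 : L2 (fun=> 0).
Proof.
split=> //; rewrite /e2; under eq_integral do rewrite expr0n/=.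
by rewrite integral0.
Qed.

Lemma L2_big (I : Type) (s : seq I) (Q : pred I) (f : I -> T -> R) :
 (forall i, Q i -> L2 (f i)) -> L2 (fun x => \sum_(i <- s | Q i) f i x).
Proof.
move=> fL2; elim: s => [|i s IH].
 by under eq_fun do rewrite big_nil; exact: L20.
have [Qi|/negbTE nQi] := boolP (Q i); last by under eq_fun do rewrite big_cons nQi.
by under eq_fun do rewrite big_cons Qi; apply: L2D => //; exact: fL2.
Qed.

Lemma L2B f g : L2 f -> L2 g -> L2 (fun x => f x - g x).
Proof.
move=> fL gL; under eq_fun do rewrite -mulN1r.
by apply: L2D => //; exact: L2Z.
Qed.

Lemma integrable_L2M f g : L2 f -> L2 g ->
 mu.-integrable setT (fun x => (f x * g x)%:E).
Proof.
move=> fL gL; have [mf f2] := fL; have [mg g2] := gL.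
apply/integrableP; split; first by apply/measurable_EFinP; exact: measurable_funM.
apply: (@le_lt_trans _ _ (e2 f + e2 g)%E); last by rewrite lte_add_pinfty.
rewrite /e2 -ge0_integralD//; try exact: measurable_sqr.
all: try by move=> x _; rewrite lee_fin sqr_ge0.
apply: ge0_le_integral_any => x; first exact: abse_ge0.
rewrite -EFinD lee_fin normrM.
rewrite -[f x ^+ 2]real_normK ?num_real// -[g x ^+ 2]real_normK ?num_real//.
by have := sqr_ge0 (`|f x| - `|g x|); nra.
Qed.

End second_moment.

Section expectation.
Context {d} {T : measurableType d} {R : realType} (P : probability T R).
Implicit Types f g : T -> R.

Definition integ f := P.-integrable setT (EFin \o f).
Definition Ex f : R := fine (\int[P]_x (f x)%:E).

Lemma integ_meas f : integ f -> mfunT f.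
Proof. by move=> /integrableP[/measurable_EFinP]. Qed.

Lemma ExE f : integ f -> (\int[P]_x (f x)%:E)%E = (Ex f)%:E.
Proof. by move=> fi; rewrite /Ex fineK//; exact: integrable_fin_num. Qed.

Lemma integD f g : integ f -> integ g -> integ (fun x => f x + g x).
Proof. by move=> fi gi; have := integrableD measurableT fi gi. Qed.

Lemma integZ c f : integ f -> integ (fun x => c * f x).
Proof. by move=> fi; have := integrableZl measurableT c fi. Qed.

Lemma integB f g : integ f -> integ g -> integ (fun x => f x - g x).
Proof. by move=> fi gi; have := integrableB measurableT fi gi. Qed.

Lemma integ_cst c : integ (fun=> c).
Proof. exact: finite_measure_integrable_cst. Qed.

Lemma integ_abs f : integ f -> integ (fun x => `|f x|).
Proof. exact: integrable_norm. Qed.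

Lemma integ_big (I : Type) (s : seq I) (Q : pred I) (f : I -> T -> R) :
 (forall i, Q i -> integ (f i)) -> integ (fun x => \sum_(i <- s | Q i) f i x).
Proof.
move=> fi; elim: s => [|i s IH].
 by under eq_fun do rewrite big_nil; exact: integ_cst.
have [Qi|/negbTE nQi] := boolP (Q i); last by under eq_fun do rewrite big_cons nQi.
by under eq_fun do rewrite big_cons Qi; apply: integD => //; exact: fi.
Qed.

Lemma integ_le f g : mfunT f -> (forall x, `|f x| <= `|g x|) ->
 integ g -> integ f.
Proof.
move=> mf fg gi; apply: (le_integrable measurableT _ _ gi).
 exact/measurable_EFinP.
by move=> x _; rewrite lee_fin.
Qed.

Lemma integ_bounded f (C : R) : mfunT f ->
 (forall x, `|f x| <= C) -> integ f.
Proof.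
move=> mf fC; apply: (@integ_le _ (fun=> C)) => //; last exact: integ_cst.
by move=> x; exact: le_trans (ler_norm _).
Qed.

Lemma eq_Ex f g : f =1 g -> Ex f = Ex g.
Proof. by move=> /funext ->. Qed.

Lemma ExD f g : integ f -> integ g -> Ex (fun x => f x + g x) = Ex f + Ex g.
Proof.
move=> fi gi; rewrite /Ex.
under eq_integral do rewrite EFinD.
by rewrite integralD// fineD//; exact: integrable_fin_num.
Qed.

Lemma ExZ c f : integ f -> Ex (fun x => c * f x) = c * Ex f.
Proof.
move=> fi; rewrite /Ex; under eq_integral do rewrite EFinM.
by rewrite integralZl// fineM//; exact: integrable_fin_num.
Qed.

Lemma ExB f g : integ f -> integ g -> Ex (fun x => f x - g x) = Ex f - Ex g.
Proof.
move=> fi gi; under eq_fun do rewrite -mulN1r.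
by rewrite ExD ?ExZ ?mulN1r//; exact: integZ.
Qed.

Lemma Ex_cst c : Ex (fun=> c) = c.
Proof. by rewrite /Ex integral_cst//= probability_setT mule1. Qed.

Lemma Ex_big (I : Type) (s : seq I) (Q : pred I) (f : I -> T -> R) :
 (forall i, Q i -> integ (f i)) ->
 Ex (fun x => \sum_(i <- s | Q i) f i x) = \sum_(i <- s | Q i) Ex (f i).
Proof.
move=> fi; elim: s => [|i s IH].
 by under eq_fun do rewrite big_nil; rewrite big_nil Ex_cst.
have [Qi|/negbTE nQi] := boolP (Q i); last first.
 by rewrite big_cons nQi -IH; apply: eq_Ex => x; rewrite big_cons nQi.
rewrite big_cons Qi; under eq_fun do rewrite big_cons Qi.
rewrite ExD ?IH//; first exact: fi.
exact: integ_big.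
Qed.

Lemma Ex_le f g : integ f -> integ g -> (forall x, f x <= g x) -> Ex f <= Ex g.
Proof.
move=> fi gi fg; rewrite -lee_fin -!ExE//.
by apply: le_integral => // x _; rewrite lee_fin.
Qed.

Lemma Ex_ge0 f : (forall x, 0 <= f x) -> 0 <= Ex f.
Proof. by move=> f0; apply/fine_ge0/integral_ge0 => x _; rewrite lee_fin. Qed.

Lemma Ex_abs f : integ f -> `|Ex f| <= Ex (fun x => `|f x|).
Proof.
move=> fi; rewrite ler_norml -mulN1r -ExZ; last exact: integ_abs.
apply/andP; split; apply: Ex_le => //; try exact: integ_abs.
- exact/integZ/integ_abs.
- by move=> x; rewrite mulN1r lerNl -normrN ler_norm.
- by move=> x; exact: ler_norm.
Qed.

Lemma L2_integ f : L2 P f -> integ f.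
Proof.
move=> fL; have oL : L2 P (fun=> 1 : R).
 split=> //; rewrite /e2; under eq_integral do rewrite expr1n.
 by rewrite integral_cst//= probability_setT mule1 ltry.
have := integrable_L2M fL oL.
by rewrite /integ; under eq_fun do rewrite mulr1.
Qed.

Lemma L2_cst c : L2 P (fun=> c).
Proof.
split=> //; rewrite /e2 integral_cst//= probability_setT mule1.
by rewrite ltry.
Qed.

Lemma L2M_integ f g : L2 P f -> L2 P g -> integ (fun x => f x * g x).
Proof. exact: integrable_L2M. Qed.

Lemma L2_sqr_integ f : L2 P f -> integ (fun x => f x ^+ 2).
Proof. by move=> fL; under eq_fun do rewrite expr2; exact: L2M_integ. Qed.

Lemma integ_sqr_L2 f : mfunT f -> integ (fun x => f x ^+ 2) -> L2 P f.
Proof.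
move=> mf fi; split=> //; rewrite /e2 (ExE fi) ltry//.
Qed.

Lemma L2_e2E f : L2 P f -> e2 P f = (Ex (fun x => f x ^+ 2))%:E.
Proof. by move=> /L2_sqr_integ /ExE. Qed.

(** This is the nonnegativity of the variance. *)
Lemma Ex_sqr_le f : L2 P f -> Ex f ^+ 2 <= Ex (fun x => f x ^+ 2).
Proof.
move=> fL; have fi := L2_integ fL; have f2i := L2_sqr_integ fL.
have : 0 <= Ex (fun x => (f x - Ex f) ^+ 2) by apply: Ex_ge0 => x; exact: sqr_ge0.
rewrite (@eq_Ex _ (fun x => f x ^+ 2 + ((- 2 * Ex f) * f x + Ex f ^+ 2))); last first.
 by move=> x; ring.
rewrite ExD//; last by apply: integD; [exact: integZ|exact: integ_cst].
rewrite ExD//; [|exact: integZ|exact: integ_cst].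
by rewrite ExZ// Ex_cst; nra.
Qed.

End expectation.

(** * Product laws on tuples and factorisation of expectations *)

Section product_law.
Context {R : realType}.
Local Notation law := (probability R R).

Definition consR n (x : R * n.-tuple R) : n.+1.-tuple R :=
 [the n.+1.-tuple R of x.1 :: x.2].

Lemma measurable_consR n : mfunT (@consR n).
Proof. by apply: measurable_cons; [exact: measurable_fst|exact: measurable_snd]. Qed.

HB.instance Definition _ n := @isMeasurableFun.Build _ _ _ _
 (@consR n) (@measurable_consR n).

(** Built by recursion on the first coordinate, so that Fubini and the later coordinate exchange can
    peel off one coordinate at a time. *)
Fixpoint ptuple n (mu : nat -> law) : probability (n.-tuple R) R :=
 match n return probability (n.-tuple R) R with
 | 0 => [the probability (0.-tuple R) R of dirac [tuple]]
 | n'.+1 => [the probability _ R of distribution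
   (mu 0%N \x ptuple n' (fun i => mu i.+1))%E (@consR n')]
 end.

Definition rect n (A : nat -> set R) : set (n.-tuple R) :=
 [set t | forall i : 'I_n, A i (tnth t i)].

Lemma measurable_rect n A : (forall i, measurable (A i)) -> measurable (@rect n A).
Proof.
move=> mA; have -> : rect A = \bigcap_(i in [set: 'I_n]) ((@tnth n R)^~ i @^-1` A i).
 by apply/seteqP; split=> [t tA i _|t tA i]; [exact: tA|exact: tA].
apply: fin_bigcap_measurable => // i _.
by rewrite -[X in measurable X]setTI; exact: measurable_tnth.
Qed.

Lemma ptuple_rect n mu (A : nat -> set R) : (forall i, measurable (A i)) ->
 ptuple n mu (rect A) = (\prod_(i < n) mu i (A i))%E.
Proof.
elim: n mu A => [|n IH] mu A mA.
 rewrite big_ord0/= diracE mem_set//; by case.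
rewrite big_ord_recl/= /distribution/= /pushforward.
rewrite (_ : @consR n @^-1` _ = A 0%N `*` @rect n (fun i => A i.+1)); last first.
 apply/seteqP; split=> [[x t] H|[x t] [/= A0 H]].
  split=> /=; first by have := H ord0.
  by move=> i; have := H (lift ord0 i); rewrite /consR/= tnthS.
 move=> i; rewrite /consR/=; case: (unliftP ord0 i) => [j|] ->.
  by rewrite tnthS; exact: H.
 by rewrite tnth0.
rewrite product_measure1E; [|exact: mA|exact: measurable_rect].
exact: (congr1 (fun z => mu 0%N (A 0%N) * z)%E
 (IH (fun i => mu i.+1) (fun i => A i.+1) (fun i => mA i.+1))).
Qed.

Lemma measurable_tuple_rect n : @measurable _ (n.-tuple R) =
 <<s [set rect A | A in [set A : nat -> set R | forall i, measurable (A i)]] >>.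
Proof.
apply/seteqP; split; last first.
 apply: smallest_sub; first exact: sigma_algebra_measurable.
 by move=> _ [A mA <-]; exact: measurable_rect.
apply: smallest_sub; first exact: smallest_sigma_algebra.
rewrite -bigcup_seq/= => B [i /= _ [C mC <-]]; apply: sub_sigma_algebra.
exists (fun j => if j == i :> nat then C else setT) => /=.
 by move=> j; case: ifP.
rewrite setTI; apply/seteqP; split=> t.
 by move=> /(_ i); rewrite eqxx.
by move=> tC j; case: eqP => // /val_inj ->.
Qed.

(** Rectangles are stable under intersection and generate the product sigma-algebra, so a finite
    measure is determined by its values on them. *)
Lemma eq_ptuple n (mu : {measure set (n.-tuple R) -> \bar R}) (nu : nat -> law) :
 (mu setT < +oo)%E ->
 (forall A, (forall i, measurable (A i)) -> mu (rect A) = (\prod_(i < n) nu i (A i))%E) ->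
 forall B, measurable B -> mu B = ptuple n nu B.
Proof.
move=> muT muA B mB.
have TE : setT = @rect n (fun=> setT) by apply/seteqP; split.
apply: (@measure_unique _ R (n.-tuple R)
 [set rect A | A in [set A : nat -> set R | forall i, measurable (A i)]]
 (fun=> setT)) => //.
- exact: measurable_tuple_rect.
- move=> _ _ [A mA <-] [C mC <-]; exists (fun i => A i `&` C i).
  by move=> i; apply: measurableI.
 apply/seteqP; split=> t; first by move=> H; split=> i; have [] := H i.
 by move=> [HA HC] i; split.
- by move=> _; rewrite TE; exists (fun=> setT).
- by rewrite bigcup_const.
- move=> _ [A mA <-]; rewrite muA//; apply/esym; exact: ptuple_rect.
Qed.

Lemma measurable_prod_tuple n (h : nat -> R -> R) :
 (forall i, mfunT (h i)) ->
 mfunT (fun t : n.-tuple R => \prod_(i < n) h i (tnth t i)).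
Proof.
move=> mh; apply: measurable_prod => i _.
by apply: measurableT_comp => //; exact: measurable_tnth.
Qed.

Lemma prod_consR n (h : nat -> R -> R) x (t : n.-tuple R) :
 \prod_(i < n.+1) h i (tnth (consR (x, t)) i) =
 h 0%N x * \prod_(i < n) h i.+1 (tnth t i).
Proof.
rewrite big_ord_recl/= tnth0; congr (_ * _).
by apply: eq_bigr => i _; rewrite /consR/= tnthS.
Qed.

(** Tonelli for absolute values gives integrability, then Fubini gives the value, one coordinate at
    a time. *)
Lemma integ_ptuple_prod n (mu : nat -> law) (h : nat -> R -> R) :
 (forall i, mfunT (h i)) ->
 (forall i, (i < n)%N -> integ (mu i) (h i)) ->
 integ (ptuple n mu) (fun t => \prod_(i < n) h i (tnth t i)) /\
 Ex (ptuple n mu) (fun t => \prod_(i < n) h i (tnth t i)) =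
  \prod_(i < n) Ex (mu i) (h i).
Proof.
elim: n mu h => [|n IH] mu h mh hi.
 under eq_fun do rewrite big_ord0; rewrite big_ord0 Ex_cst; split=> //.
 exact: integ_cst.
pose mu' i := mu i.+1; pose h' i := h i.+1.
pose W (t : n.-tuple R) := \prod_(i < n) h' i (tnth t i).
have [Wi WE] := IH mu' h' (fun i => mh i.+1) (fun i ilt => hi i.+1 ilt).
have h0i : integ (mu 0%N) (h 0%N) by exact: hi.
pose m2 := (mu 0%N \x ptuple n mu')%E.
have mW : mfunT W by exact: integ_meas Wi.
have mf : mfunT (EFin \o (fun z : R * n.-tuple R => h 0%N z.1 * W z.2)).
 apply/measurable_EFinP; apply: measurable_funM.
  exact: measurableT_comp (mh 0%N) measurable_fst.
 exact: measurableT_comp mW measurable_snd.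
have i2 : m2.-integrable setT (fun z => (h 0%N z.1 * W z.2)%:E).
 apply/integrable12ltyP => //=.
 have mWa : mfunT (abse \o (EFin \o W)).
  by apply: measurableT_comp => //; exact/measurable_EFinP.
 have mha : mfunT (abse \o (EFin \o h 0%N)).
  by apply: measurableT_comp => //; exact/measurable_EFinP.
 have absE x : (\int[ptuple n mu']_y `|(h 0%N x * W y)%:E| =
   `|(h 0%N x)%:E| * \int[ptuple n mu']_y `|(W y)%:E|)%E.
  rewrite -ge0_integralZl//.
  by apply: eq_integral => y _; rewrite EFinM abseM.
 under eq_integral do rewrite absE.
 rewrite ge0_integralZr//; last exact: integral_ge0.
 have /integrableP[_ hfin] := h0i; have /integrableP[_ Wfin] := Wi.
 apply: lte_mul_pinfty => //; first exact: integral_ge0.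
 by rewrite ge0_fin_numE//; exact: integral_ge0.
have mprod := @measurable_prod_tuple n.+1 h mh.
have mprodE : mfunT (EFin \o (fun t : n.+1.-tuple R =>
  \prod_(i < n.+1) h i (tnth t i))) by exact/measurable_EFinP.
have i1 : m2.-integrable setT ((fun t : n.+1.-tuple R =>
  (\prod_(i < n.+1) h i (tnth t i))%:E) \o @consR n).
 apply: eq_integrable i2 => // -[x t] _ /=.
 by rewrite -(prod_consR h x t).
have mcp := @measurable_consR n.
split.
 apply: (integrable_pushforward mcp mprodE) => //; by rewrite preimage_setT.
rewrite /Ex/= integral_distribution//= big_ord_recl/=.
transitivity (fine (\int[m2]_z (h 0%N z.1 * W z.2)%:E)).
 by congr fine; apply: eq_integral => -[x t] _; rewrite -(prod_consR h x t).
rewrite -integral12_prod_meas1//=.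
transitivity (fine (\int[mu 0%N]_x (h 0%N x * Ex (ptuple n mu') W)%:E)).
 congr fine; apply: eq_integral => x _; rewrite /fubini_F/=.
 under eq_integral do rewrite EFinM.
 by rewrite integralZl// (ExE Wi).
have -> : (fun x => (h 0%N x * Ex (ptuple n mu') W)%:E) =
  (fun x => (Ex (ptuple n mu') W * h 0%N x)%:E) by apply/funext => x; rewrite mulrC.
by rewrite -/(Ex _ _) ExZ// mulrC WE.
Qed.

Section law_of_family.
Context {d} {T : measurableType d} (P : probability T R).
Variable X : nat -> {RV P >-> R}.

Definition xtuple n (w : T) : n.-tuple R := [tuple X i w | i < n].

Lemma measurable_xtuple n : mfunT (@xtuple n).
Proof.
apply/measurable_fun_tnthP => i.
rewrite (_ : _ \o _ = X i); first exact: measurable_funP.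
by apply/funext => w /=; rewrite tnth_mktuple.
Qed.

HB.instance Definition _ n := @isMeasurableFun.Build _ _ _ _
 (@xtuple n) (@measurable_xtuple n).

Hypothesis X_indep : mutually_independent P (fun i => X i : T -> R).
Let mu i : law := distribution P (X i).

Lemma law_xtuple n B : measurable B ->
 distribution P (@xtuple n : {mfun T >-> n.-tuple R}) B = ptuple n mu B.
Proof.
move: B; apply: eq_ptuple => [|A mA].
 by rewrite /= /distribution /pushforward preimage_setT probability_setT ltry.
have := @X_indep (seq_fset tt (iota 0 n)) A mA.
rewrite (perm_big (iota 0 n)); last first.
 by apply: uniq_perm; rewrite ?fset_uniq ?iota_uniq// => i; rewrite seq_fsetE.
move=> E; transitivity (\prod_(i <- iota 0 n) P (X i @^-1` A i))%E; last first.
 by rewrite -{1}[n]subn0 -/(index_iota 0 n) big_mkord.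
apply: etrans E; rewrite -[LHS]/(P (@xtuple n @^-1` rect A)).
congr (P _); apply/seteqP; split=> w H i.
 rewrite seq_fsetE mem_iota add0n => /= ilt.
 by have := H (Ordinal ilt); rewrite tnth_mktuple.
by rewrite tnth_mktuple; apply: H; rewrite seq_fsetE mem_iota/= ltn_ord.
Qed.

Lemma integral_xtuple n (F : n.-tuple R -> R) : mfunT F ->
 integ P (fun w => F (xtuple n w)) ->
 Ex P (fun w => F (xtuple n w)) = Ex (ptuple n mu) F.
Proof.
move=> mF Fi; rewrite /Ex.
rewrite -(@integral_distribution _ _ _ _ _ P (@xtuple n : {mfun T >-> n.-tuple R}) (EFin \o F))//.
 by congr fine; apply: eq_measure_integral => A mA _; exact: law_xtuple.
exact/measurable_EFinP.
Qed.

Lemma integ_comp_law i (h : R -> R) : mfunT h ->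
 integ P (fun w => h (X i w)) -> integ (mu i) h /\ Ex (mu i) h = Ex P (fun w => h (X i w)).
Proof.
move=> mh hi; have mhE : mfunT (EFin \o h) by exact/measurable_EFinP.
split; last by rewrite /Ex integral_distribution.
exact: (integrable_pushforward (measurable_funP (X i)) mhE).
Qed.

(** Independence enters through the law of [xtuple], which agrees with the product law on rectangles
    and therefore everywhere. *)
Theorem Ex_indep_prod n (h : nat -> R -> R) :
 (forall i, mfunT (h i)) ->
 (forall i, (i < n)%N -> integ P (fun w => h i (X i w))) ->
 integ P (fun w => \prod_(i < n) h i (X i w)) /\
 Ex P (fun w => \prod_(i < n) h i (X i w)) = \prod_(i < n) Ex P (fun w => h i (X i w)).
Proof.
move=> mh hi.
have hi' i : (i < n)%N -> integ (mu i) (h i) by move=> ilt; have [] := integ_comp_law (mh i) (hi i ilt).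
have [pi pE] := integ_ptuple_prod mh hi'.
have mF := @measurable_prod_tuple n h mh.
have fE : (fun w => \prod_(i < n) h i (X i w)) =
  (fun w => \prod_(i < n) h i (tnth (xtuple n w) i)).
 by apply/funext => w; apply: eq_bigr => i _; rewrite tnth_mktuple.
have ii : integ P (fun w => \prod_(i < n) h i (tnth (xtuple n w) i)).
 apply/integrableP; split.
  by apply/measurable_EFinP; exact: measurableT_comp mF (@measurable_xtuple n).
 have /integrableP[_] := pi; apply: le_lt_trans.
 have mF' : mfunT (abse \o (EFin \o (fun t : n.-tuple R => \prod_(i < n) h i (tnth t i)))).
  by apply: measurableT_comp => //; exact/measurable_EFinP.
 rewrite [leRHS](_ : _ = \int[distribution P (@xtuple n : {mfun T >-> n.-tuple R})]_t
   `|(\prod_(i < n) h i (tnth t i))%:E|)%E; last first.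
  by apply: eq_measure_integral => A mA _; exact/esym/law_xtuple.
 by rewrite ge0_integral_distribution.
rewrite fE; split=> //.
rewrite (integral_xtuple mF ii) pE; apply: eq_bigr => i _.
by have [] := integ_comp_law (mh i) (hi i (ltn_ord i)).
Qed.

End law_of_family.
End product_law.

(** * Variables and the sites that they occupy *)

Section labels.
Context {R : realType} {V : finType} {n : nat}.
Variables (A : {set V}) (p : V -> 'I_n).

(** Partial inverse of [p] on [A]. *)
Definition lab (z : 'I_n) : option V := [pick v in A | p v == z].

Hypothesis p_inj : {in A &, injective p}.

Lemma labP z v : v \in A -> p v = z -> lab z = Some v.
Proof.
move=> vA pv; rewrite /lab; case: pickP => [w /andP[wA /eqP pw]|/(_ v)].
 by congr Some; apply: p_inj => //; rewrite pw pv.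
by rewrite vA pv eqxx.
Qed.

Lemma lab_Some z v : lab z = Some v -> v \in A /\ p v = z.
Proof. by rewrite /lab; case: pickP => // w /andP[wA /eqP pw] [<-]. Qed.

Lemma labN z : lab z = None -> forall v, v \in A -> p v != z.
Proof.
by rewrite /lab; case: pickP => // H _ v vA; have := H v; rewrite /= vA /= => ->.
Qed.

(** Regroups a product over variables into a product over sites, the form in which expectations
    factorise by independence. *)
Lemma prod_lab (F : V -> 'I_n -> R) :
 \prod_(v in A) F v (p v) = \prod_z oapp (F^~ z) 1 (lab z).
Proof.
rewrite (partition_big p xpredT)//=; apply: eq_bigr => z _.
case lz : (lab z) => [v|] /=.
 have [vA pv] := lab_Some lz; rewrite (big_pred1 v) ?pv// => w /=.
 apply/andP/eqP => [[wA /eqP pw]|->]; last by rewrite pv.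
 by apply: p_inj => //; rewrite pw pv.
by rewrite big_pred0// => v; apply/andP => -[vA]; apply/negP/(labN lz).
Qed.

End labels.

(** * Variance of off-diagonal forms, decomposed by sites *)

Section hoeffding.
Context {d} {T : measurableType d} {R : realType} (P : probability T R).
Variable X : nat -> {RV P >-> R}.
Hypothesis X_indep : mutually_independent P (fun i => X i : T -> R).
Context {n : nat} {V1 V2 L : finType}.
Variables (A1 : {set V1}) (A2 : {set V2}) (u1 : V1 -> R -> R) (u2 : V2 -> R -> R).
Hypotheses (mu1 : forall v, mfunT (u1 v))
 (mu2 : forall v, mfunT (u2 v)).
Variable K : R.
Hypothesis K1 : 1 <= K.
Hypothesis u1_0 : forall v z, v \in A1 -> Ex P (fun w => u1 v (X z w)) = 0.
Hypothesis u2_0 : forall v z, v \in A2 -> Ex P (fun w => u2 v (X z w)) = 0.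
Hypothesis u1_2 : forall v z, v \in A1 -> (e2 P (fun w => u1 v (X z w)) <= K%:E)%E.
Hypothesis u2_2 : forall v z, v \in A2 -> (e2 P (fun w => u2 v (X z w)) <= K%:E)%E.
Hypothesis u12_2 : forall v v' z, v \in A1 -> v' \in A2 ->
 (e2 P (fun w => (u1 v (X z w) * u2 v' (X z w))%R) <= K%:E)%E.
Variables (f : L -> R) (p1 : L -> V1 -> 'I_n) (p2 : L -> V2 -> 'I_n).
Hypothesis p1_inj : forall l, {in A1 &, injective (p1 l)}.
Hypothesis p2_inj : forall l, {in A2 &, injective (p2 l)}.

Let l1 l := lab A1 (p1 l).
Let l2 l := lab A2 (p2 l).
(** Injectivity of the placements puts at most one factor of each family at a site. Hence second
    moments of single factors and of products of two suffice. *)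
Let val l z x := oapp (u1^~ x) 1 (l1 l z) * oapp (u2^~ x) 1 (l2 l z).

Let mval l z : mfunT (val l z).
Proof. by apply: measurable_funM; [case: (l1 l z)|case: (l2 l z)]. Qed.

Definition mono l w : R :=
 \prod_(v in A1) u1 v (X (p1 l v) w) * \prod_(v in A2) u2 v (X (p2 l v) w).

Let monoE l : mono l = fun w => \prod_(z < n) val l z (X z w).
Proof.
apply/funext => w; rewrite /mono.
rewrite (prod_lab (@p1_inj l) (fun v (z : 'I_n) => u1 v (X z w))).
by rewrite (prod_lab (@p2_inj l) (fun v (z : 'I_n) => u2 v (X z w))) -big_split.
Qed.

Let mvalX l z z' : mfunT (fun w => val l z (X z' w)).
Proof. by apply: measurableT_comp => //; exact: measurable_funP. Qed.

Let K0 : 0 <= K. Proof. exact: le_trans K1. Qed.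

Let e2val l z z' : (e2 P (fun w => val l z (X z' w)) <= K%:E)%E.
Proof.
rewrite /val; case E1 : (l1 l z) => [v|]; case E2 : (l2 l z) => [v'|] /=.
- by have [? _] := lab_Some E1; have [? _] := lab_Some E2; exact: u12_2.
- have [? _] := lab_Some E1; rewrite (@eq_e2 _ _ _ _ _ (fun w => u1 v (X z' w))) ?u1_2//.
 by move=> w; rewrite mulr1.
- have [? _] := lab_Some E2; rewrite (@eq_e2 _ _ _ _ _ (fun w => u2 v' (X z' w))) ?u2_2//.
 by move=> w; rewrite mul1r.
- rewrite (@eq_e2 _ _ _ _ _ (fun=> 1)); last by move=> w; rewrite mulr1.
 by rewrite (L2_e2E (L2_cst P 1)) expr1n Ex_cst lee_fin.
Qed.

Let L2val l z z' : L2 P (fun w => val l z (X z' w)).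
Proof. by split=> //; apply: le_lt_trans (e2val l z z') _; rewrite ltry. Qed.

Let Eval2 l z z' : Ex P (fun w => val l z (X z' w) ^+ 2) <= K.
Proof. by rewrite -lee_fin -L2_e2E. Qed.

Let m l (z : 'I_n) := Ex P (fun w => val l z (X z w)).
(** Local covariance. The mixed moment at a site is [c + m * m'], and the expansion over sets of
    sites multiplies out these sums. *)
Let c l l' (z : 'I_n) := Ex P (fun w => val l z (X z w) * val l' z (X z w)) - m l z * m l' z.

Let Emono l : L2 P (mono l) /\ Ex P (mono l) = \prod_z m l z.
Proof.
rewrite monoE; have mm : mfunT (fun w => \prod_(z < n) val l z (X z w)).
 by apply: measurable_prod => z _.
pose h z : R -> R := if insub z is Some z' then val l z' else fun=> 1.
have mh z : mfunT (h z) by rewrite /h; case: insubP.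
have hE (z : 'I_n) : h z = val l z by rewrite /h valK.
split.
 apply: integ_sqr_L2 => //.
 have [] := @Ex_indep_prod _ _ _ P X X_indep n (fun z x => h z x ^+ 2).
 - by move=> i; exact: measurable_funX.
 - move=> i ilt; have := L2_sqr_integ (L2val l (Ordinal ilt) i).
  by rewrite -(hE (Ordinal ilt)).
 - move=> + _; rewrite (_ : (fun w => _) = (fun w => (\prod_(z < n) val l z (X z w)) ^+ 2))//.
  by apply/funext => w; rewrite -prodrXl; apply: eq_bigr => z _; rewrite hE.
have [] := @Ex_indep_prod _ _ _ P X X_indep n h mh.
 by move=> i ilt; have := L2_integ (L2val l (Ordinal ilt) i); rewrite -(hE (Ordinal ilt)).
move=> _; rewrite (_ : (fun w => _) = (fun w => \prod_(z < n) val l z (X z w))).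
 by move=> ->; apply: eq_bigr => z _; rewrite hE.
by apply/funext => w; apply: eq_bigr => z _; rewrite hE.
Qed.

Let Emono2 l l' : Ex P (fun w => mono l w * mono l' w) = \prod_z (c l l' z + m l z * m l' z).
Proof.
pose h z : R -> R := if insub z is Some z' then (fun x => val l z' x * val l' z' x) else fun=> 1.
have mh z : mfunT (h z).
 by rewrite /h; case: insubP => // *; exact: measurable_funM.
have hE (z : 'I_n) : h z = (fun x => val l z x * val l' z x) by rewrite /h valK.
have [] := @Ex_indep_prod _ _ _ P X X_indep n h mh.
 move=> i ilt; have := L2M_integ (L2val l (Ordinal ilt) i) (L2val l' (Ordinal ilt) i).
 by rewrite (_ : (fun w => h i _) = (fun w => h (Ordinal ilt) (X i w)))// hE.
move=> _; rewrite (_ : (fun w => _) = (fun w => mono l w * mono l' w)).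
 by move=> ->; apply: eq_bigr => z _; rewrite hE subrK.
by apply/funext => w; rewrite !monoE -big_split; apply: eq_bigr => z _; rewrite hE.
Qed.

(* Off S, a site carries either no factor or one factor of each family: a single
  centred factor integrates to 0. *)
Definition compat (S : {set 'I_n}) l := [forall z : 'I_n,
 if z \in S then l1 l z || l2 l z :> bool else (l1 l z : bool) == (l2 l z : bool)].

(** K to the number of variables at the site: at least K on an occupied site and 1 on an empty one,
    so that the product over all sites is bounded independently of n. *)
Let B l z : R := \prod_(v in A1 | p1 l v == z) K * \prod_(v in A2 | p2 l v == z) K.

Let prodK1 (I : finType) (Q : pred I) : 1 <= \prod_(i | Q i) K.
Proof. by apply: (big_ind (fun x => 1 <= x)) => // x y x1 y1; exact: mulr_ege1. Qed.

Let B1 l z : 1 <= B l z.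
Proof. exact: mulr_ege1. Qed.

Let prodB l : \prod_z B l z <= K ^+ (#|V1| + #|V2|).
Proof.
rewrite big_split/= exprD ler_pM//.
- by apply: prodr_ge0 => z _; rewrite (le_trans ler01).
- by apply: prodr_ge0 => z _; rewrite (le_trans ler01).
- rewrite -(partition_big (p1 l) xpredT)//= prodr_const.
 by rewrite ler_weXn2l// max_card.
- rewrite -(partition_big (p2 l) xpredT)//= prodr_const.
 by rewrite ler_weXn2l// max_card.
Qed.

Let BK l z : (l1 l z : bool) || (l2 l z : bool) -> K <= B l z.
Proof.
move=> /orP[|]; case E : (_ l z) => [v|]// _; have [vA pv] := lab_Some E.
 rewrite /B (bigD1 v) ?vA ?pv ?eqxx//= -mulrA ler_peMr//.
 exact: mulr_ege1.
rewrite /B (bigD1 v (F := fun=> K)) ?vA ?pv ?eqxx//= mulrCA ler_peMr//.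
exact: mulr_ege1.
Qed.

Let abs_m l z : `|m l z| <= B l z.
Proof.
case hit : ((l1 l z : bool) || (l2 l z : bool)); last first.
 move: hit; rewrite /m /val; case: (l1 l z) => //; case: (l2 l z) => //= _.
 by rewrite (@eq_Ex _ _ _ _ _ (fun=> 1)) ?Ex_cst ?normr1// => w; rewrite mulr1.
apply: le_trans (BK hit); have := Ex_sqr_le (L2val l z z); rewrite -/(m l z) => m2.
have := le_trans m2 (Eval2 l z z); rewrite -[m l z ^+ 2]real_normK ?num_real// => H.
rewrite -(@ler_pXn2r _ 2)// ?nnegrE//; apply: le_trans H _.
by rewrite expr2 ler_peMr.
Qed.

(** Expand the nonnegative second moment of (X1 - m) + s (X2 - m') for s = 1 and s = -1. *)
Let abs_c l l' z : `|c l l' z| <= K.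
Proof.
have iM := L2M_integ (L2val l z z) (L2val l' z z).
have [a2 b2] := (L2_sqr_integ (L2val l z z), L2_sqr_integ (L2val l' z z)).
have [a1 b1] := (L2_integ (L2val l z z), L2_integ (L2val l' z z)).
set X1 := fun w => val l z (X z w) in iM a1 a2.
set X2 := fun w => val l' z (X z w) in iM b1 b2.
have m1 := Ex_sqr_le (L2val l z z); have m2 := Ex_sqr_le (L2val l' z z).
rewrite -/(m l z) -/(m l' z) -/X1 -/X2 in m1 m2.
have := Eval2 l z z; have := Eval2 l' z z; rewrite -/X1 -/X2 => E2K E1K.
have pos (s : R) : s ^+ 2 = 1 -> 0 <= Ex P (fun w => X1 w ^+ 2) - m l z ^+ 2 +
  (Ex P (fun w => X2 w ^+ 2) - m l' z ^+ 2) + 2 * s * c l l' z.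
 move=> s2; have := @Ex_ge0 _ _ _ P (fun w => ((X1 w - m l z) + s * (X2 w - m l' z)) ^+ 2)
  (fun w => sqr_ge0 _).
 rewrite (@eq_Ex _ _ _ _ _ (fun w => X1 w ^+ 2 + (X2 w ^+ 2 + ((2 * s) * (X1 w * X2 w) +
  ((- 2 * (m l z + s * m l' z)) * X1 w + ((- 2 * (s * m l z + m l' z)) * X2 w +
   (m l z + s * m l' z) ^+ 2)))))); last first.
  by move=> w; ring: s2.
 rewrite !ExD ?ExZ//; try (by repeat (first [exact: integ_cst | exact: integZ | apply: integD])).
 rewrite Ex_cst /c -/X1 -/X2 -/(m l z) -/(m l' z).
 by move=> H; apply: le_trans H _; rewrite le_eqVlt; apply/orP; left; apply/eqP; ring: s2.
have := pos 1 (expr1n _ 2); have := pos (-1) (etrans (sqrrN 1) (expr1n _ 2)).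
rewrite /X1 /X2 ler_norml => H1 H2.
have := sqr_ge0 (m l z); have := sqr_ge0 (m l' z).
by move=> s1 s2; apply/andP; split; lra.
Qed.

(** A site of S without a factor of one of the monomials has zero covariance, and a site off S with
    a single factor of a monomial has zero mean. The product vanishes unless both monomials are
    compatible with S. *)
Let term_bound (S : {set 'I_n}) l l' :
 `|\prod_z (if z \in S then c l l' z else m l z * m l' z)| <=
 K ^+ (2 * (#|V1| + #|V2|)) * ((compat S l)%:R * (compat S l')%:R).
Proof.
rewrite normr_prod.
have unhit k z : ~~ ((l1 k z : bool) || (l2 k z : bool)) -> val k z = fun=> 1.
 by rewrite /val; case: (l1 k z) => //; case: (l2 k z) => //= _; apply/funext => x; rewrite mulr1.
have m1hit k z : (l1 k z : bool) != (l2 k z : bool) -> m k z = 0.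
 rewrite /m /val; case E1 : (l1 k z) => [v|]; case E2 : (l2 k z) => [v'|] //= _.
 - have [vA _] := lab_Some E1; rewrite -(u1_0 z vA).
  by apply: eq_Ex => w; rewrite mulr1.
 - have [vA _] := lab_Some E2; rewrite -(u2_0 z vA).
  by apply: eq_Ex => w; rewrite mul1r.
have zero k k' : (forall z, c k k' z = c k' k z) -> ~~ compat S k ->
  \prod_z `|if z \in S then c k k' z else m k z * m k' z| = 0.
 move=> _ /forallPn[z Hz]; rewrite (bigD1 z)//=.
 suff -> : (if z \in S then c k k' z else m k z * m k' z) = 0 by rewrite normr0 mul0r.
 move: Hz; case: ifP => zS Hz; last by rewrite m1hit// mul0r.
 rewrite /c /m (unhit _ _ Hz) Ex_cst mul1r.
 by rewrite (@eq_Ex _ _ _ _ _ (fun w => val k' z (X z w))) ?subrr// => w; rewrite mul1r.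
have csym k k' z : c k k' z = c k' k z.
 by rewrite /c [m k z * _]mulrC; congr (_ - _); apply: eq_Ex => w; rewrite mulrC.
case: (boolP (compat S l)) => Cl; last by rewrite zero//= mul0r mulr0.
case: (boolP (compat S l')) => Cl'; last first.
 rewrite mulr0 mulr0 (eq_bigr (fun z => `|if z \in S then c l' l z else m l' z * m l z|)).
  by rewrite zero.
 by move=> z _; rewrite csym [m l z * _]mulrC.
rewrite !mulr1 mul2n -addnn exprD.
apply: le_trans (ler_pM _ _ (prodB l) (prodB l')); last 2 first.
- by apply: prodr_ge0 => z _; rewrite (le_trans ler01).
- by apply: prodr_ge0 => z _; rewrite (le_trans ler01).
rewrite -big_split; apply: ler_prod => z _; rewrite normr_ge0/=.
move/forallP : Cl => /(_ z); case: ifP => zS hz.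
 apply: le_trans (abs_c _ _ _) _; apply: le_trans (BK hz) _.
 by rewrite ler_peMr// (le_trans ler01).
by rewrite normrM ler_pM.
Qed.

Definition form w : R := \sum_l f l * mono l w.

Lemma L2_form : L2 P form.
Proof. by apply: L2_big => l _; apply: L2Z; have [] := Emono l. Qed.

Lemma Ex_mono l : Ex P (mono l) = \prod_z m l z.
Proof. by have [] := Emono l. Qed.

Lemma Ex_mono0 l v : v \in A1 -> A2 = finset.set0 -> Ex P (mono l) = 0.
Proof.
move=> vA A20; rewrite Ex_mono (bigD1 (p1 l v))//= /m /val.
rewrite /l1 (labP (@p1_inj l) vA (erefl _)) /l2; case E : (lab A2 _ _) => [v'|]/=.
 by have [] := lab_Some E; rewrite A20 inE.
rewrite (@eq_Ex _ _ _ _ _ (fun w => u1 v (X (p1 l v) w))) ?u1_0 ?mul0r// => w.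
by rewrite mulr1.
Qed.

(** Covariances of monomials expand over the sets S of sites where the local covariance is taken.
    The bound on each term factorises in the two monomials, which leaves squares of sums indexed by
    S. *)
Theorem variance_form :
 Ex P (fun w => (form w - Ex P form) ^+ 2) <= K ^+ (2 * (#|V1| + #|V2|)) *
  \sum_(S : {set 'I_n} | S != finset.set0) (\sum_(l | compat S l) `|f l|) ^+ 2.
Proof.
have Lm l : L2 P (mono l) by have [] := Emono l.
have EF : Ex P form = \sum_l f l * Ex P (mono l).
 rewrite /form Ex_big; last by move=> l _; exact/integZ/L2_integ.
 by apply: eq_bigr => l _; rewrite ExZ//; exact: L2_integ.
have Lc l : L2 P (fun w => mono l w - Ex P (mono l)).
 by apply: L2B => //; exact: L2_cst.
rewrite (@eq_Ex _ _ _ _ _ (fun w => \sum_l \sum_l' (f l * f l') *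
  ((mono l w - Ex P (mono l)) * (mono l' w - Ex P (mono l'))))); last first.
 move=> w; rewrite EF /form -sumrB expr2 big_distrlr/=.
 by apply: eq_bigr => l _; apply: eq_bigr => l' _; ring.
have iLc l l' := L2M_integ (Lc l) (Lc l').
rewrite Ex_big; last by move=> l _; apply: integ_big => l' _; exact: integZ.
apply: (@le_trans _ _ (\sum_l \sum_l' `|f l| * `|f l'| *
  \sum_(S : {set 'I_n} | S != finset.set0) K ^+ (2 * (#|V1| + #|V2|)) *
   ((compat S l)%:R * (compat S l')%:R))).
 apply: ler_sum => l _; rewrite Ex_big; last by move=> l' _; exact: integZ.
 apply: ler_sum => l' _; rewrite ExZ//; apply: le_trans (ler_norm _) _.
 rewrite !normrM ler_wpM2l ?mulr_ge0//.
 have -> : Ex P (fun w => (mono l w - Ex P (mono l)) * (mono l' w - Ex P (mono l'))) =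
   Ex P (fun w => mono l w * mono l' w) - Ex P (mono l) * Ex P (mono l').
  rewrite (@eq_Ex _ _ _ _ _ (fun w => mono l w * mono l' w +
   ((- Ex P (mono l')) * mono l w + ((- Ex P (mono l)) * mono l' w +
    Ex P (mono l) * Ex P (mono l'))))); last by move=> w; ring.
  have i1 := L2M_integ (Lm l) (Lm l'); have i2 := L2_integ (Lm l); have i3 := L2_integ (Lm l').
  rewrite !ExD ?ExZ//; try (by repeat (first [exact: integ_cst | exact: integZ | apply: integD])).
  by rewrite Ex_cst; ring.
 (* The product over sites is expanded over subsets. The empty subset gives the product of the two
    means and cancels the subtracted term. *)
 rewrite Emono2 !Ex_mono -big_split/= bigA_distr/= (bigD1 finset.set0)//=.
 rewrite [X in X + _ - _](_ : _ = \prod_z (m l z * m l' z)); last first.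
  by apply: eq_bigr => z _; rewrite finset.in_set0.
 rewrite addrAC subrr add0r; apply: le_trans (ler_norm_sum _ _ _) _.
 by apply: ler_sum => S _; exact: term_bound.
rewrite le_eqVlt; apply/orP; left; apply/eqP.
rewrite mulr_sumr; under [RHS]eq_bigr => S _.
 rewrite expr2 !(big_mkcond (compat S)) big_distrlr/= mulr_sumr.
 under eq_bigr do rewrite mulr_sumr.
 over.
rewrite [RHS]exchange_big/=; apply: eq_bigr => l _.
rewrite [RHS]exchange_big/=; apply: eq_bigr => l' _.
rewrite mulr_sumr; apply: eq_bigr => S _.
by case: (compat S l); case: (compat S l'); rewrite ?(mulr0, mul0r, mulr1)//; ring.
Qed.

End hoeffding.

Section finite_sums.
Context {R : realType}.

Lemma sqr_sum_le (I : finType) (Q : pred I) (b : I -> R) :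
 (\sum_(i | Q i) b i) ^+ 2 <= #|Q|%:R * \sum_(i | Q i) b i ^+ 2.
Proof.
rewrite expr2 big_distrlr/=.
apply: (@le_trans _ _ (\sum_(i | Q i) \sum_(j | Q j) (b i ^+ 2 + b j ^+ 2) / 2)).
 apply: ler_sum => i _; apply: ler_sum => j _.
 by have := sqr_ge0 (b i - b j); nra.
rewrite le_eqVlt; apply/orP; left; apply/eqP.
set s := \sum_(i | Q i) b i ^+ 2.
transitivity (\sum_(i | Q i) (#|Q|%:R * b i ^+ 2 + s) / 2).
 apply: eq_bigr => i _; rewrite -mulr_suml big_split/= sumr_const.
 by rewrite -[_ *+ #|_|]mulr_natl.
rewrite -mulr_suml big_split/= -mulr_sumr sumr_const -/s -[_ *+ #|_|]mulr_natl.
by field.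
Qed.

Lemma sum_sqr_fibres (L K : finType) (Q : pred L) (key : L -> K) (g : L -> R) :
 \sum_(k : K) (\sum_(l | Q l && (key l == k)) g l) ^+ 2 =
 \sum_(l | Q l) \sum_(l' | Q l' && (key l' == key l)) g l * g l'.
Proof.
rewrite [RHS](partition_big key xpredT)//=; apply: eq_bigr => k _.
rewrite expr2 big_distrlr/=; apply: eq_bigr => l /andP[_ /eqP <-].
by apply: eq_bigr => l'; rewrite eq_sym.
Qed.

End finite_sums.

(** * Contraction patterns *)

Section patterns.
Context {R : realType} {n : nat} {V1 V2 L : finType}.
Variables (A1 : {set V1}) (A2 : {set V2}).
Variables (f : L -> R) (p1 : L -> V1 -> 'I_n) (p2 : L -> V2 -> 'I_n).
Hypothesis p1_inj : forall l, {in A1 &, injective (p1 l)}.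
Hypothesis p2_inj : forall l, {in A2 &, injective (p2 l)}.

Local Notation pat := ({set V1} * {set V2})%type.
Local Notation keyT := ({ffun V1 -> option 'I_n} * {ffun V2 -> option 'I_n})%type.

Definition free_sites (V : finType) (A D : {set V}) (p : V -> 'I_n) :
 {ffun V -> option 'I_n} := [ffun v => if v \in A :\: D then Some (p v) else None].

(** Only the sites of uncontracted variables are recorded. For the pattern that a monomial acquires
    from S they recover S itself. *)
Definition pkey (D : pat) l : keyT := (free_sites A1 D.1 (p1 l), free_sites A2 D.2 (p2 l)).

(** Equality of images suffices: placements are injective, so this is a pairing of the contracted
    variables. *)
Definition contracted (D : pat) l := p1 l @: D.1 == p2 l @: D.2.

(** Contracting every variable of both families is excluded: it would leave S empty, which is the
    term removed by centring. *)
Definition proper_pattern (D : pat) :=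
 [&& D.1 \subset A1, D.2 \subset A2 & D != (A1, A2)].

(** A monomial compatible with S chooses its own pattern: the variables placed outside S are the
    contracted ones. *)
Let theta (S : {set 'I_n}) l : pat * keyT :=
 let D := ([set v in A1 | p1 l v \notin S], [set v in A2 | p2 l v \notin S])%SET in
 (D, pkey D l).

Let im (t : pat * keyT) : {set 'I_n} :=
 [set z | [exists v, t.2.1 v == Some z] || [exists v, t.2.2 v == Some z]]%SET.

(** Since S can be read off the key, distinct sets S use disjoint families of patterns and keys. *)
Let im_theta S l : compat A1 A2 p1 p2 S l -> im (theta S l) = S.
Proof.
move=> /forallP cS; apply/setP => z; rewrite inE; apply/orP/idP.
 by case=> /existsP[v]; rewrite ffunE !inE; case: ifP => // /andP[+ vA] /eqP[<-];
  rewrite vA/= negbK.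
move=> zS; have := cS z; rewrite zS => /orP[]; case E : (lab _ _ _) => [v|]// _.
 left; apply/existsP; exists v; rewrite ffunE; have [vA pv] := lab_Some E.
 by rewrite !inE vA pv zS.
right; apply/existsP; exists v; rewrite ffunE; have [vA pv] := lab_Some E.
by rewrite !inE vA pv zS.
Qed.

Let contracted_theta S l : compat A1 A2 p1 p2 S l -> contracted (theta S l).1 l.
Proof.
move=> /forallP cS; apply/eqP/setP => z; apply/imsetP/imsetP => -[v].
 rewrite inE => /andP[vA vS] zE; have := cS z; rewrite zE (negbTE vS).
 rewrite (labP (@p1_inj l) vA (erefl _))/=; case E : (lab _ _ _) => [v'|]// _.
 have [v'A pv'] := lab_Some E; exists v'; last by rewrite pv'.
 by rewrite inE v'A pv' vS.
rewrite inE => /andP[vA vS] zE; have := cS z; rewrite zE (negbTE vS).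
rewrite (labP (@p2_inj l) vA (erefl _))/=; case E : (lab _ _ _) => [v'|]// _.
have [v'A pv'] := lab_Some E; exists v'; last by rewrite pv'.
by rewrite inE v'A pv' vS.
Qed.

Let proper_theta S l : S != finset.set0 -> compat A1 A2 p1 p2 S l ->
 proper_pattern (theta S l).1.
Proof.
move=> S0 cS; apply/and3P; split.
- by apply/fintype.subsetP => v; rewrite inE => /andP[].
- by apply/fintype.subsetP => v; rewrite inE => /andP[].
- apply: contraNneq S0 => -[E1 E2]; rewrite -(im_theta cS); apply/eqP/setP => z.
 rewrite !inE; apply/negbTE; rewrite negb_or; apply/andP; split; apply/existsPn => v.
  by rewrite ffunE /theta/= E1 finset.setDv inE.
 by rewrite ffunE /theta/= E2 finset.setDv inE.
Qed.

Definition nkeys : nat := let m := (#|V1| + #|V2|)%N in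
 ((2 ^ #|V1| * 2 ^ #|V2|) * (m.+1 ^ #|V1| * m.+1 ^ #|V2|))%N.

(** The count is free of n: the sites in a key lie in S, or are absent, and S has at most |V1| +
    |V2| elements because the key covers it. *)
Let card_im (S : {set 'I_n}) : (#|[pred t | im t == S]| <= nkeys)%N.
Proof.
case: (pickP [pred t | im t == S]) => [t0 /eqP tS|/eq_card0 ->//].
have SV : (#|S| <= #|V1| + #|V2|)%N.
 have : (#|(Some : 'I_n -> _) @: S| <= #|t0.2.1 @: V1| + #|t0.2.2 @: V2|)%N.
  apply: leq_trans (leq_card_setU _ _); apply: subset_leq_card.
  apply/fintype.subsetP => _ /imsetP[z zS ->]; move: zS; rewrite -tS inE => /orP[] /existsP[v /eqP <-];
   by rewrite inE imset_f ?orbT.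
 rewrite card_imset; last by move=> x y [].
 by move/leq_trans; apply; apply: leq_add; apply: leq_imset_card.
pose B : {set option 'I_n} := None |: ((Some : 'I_n -> _) @: S).
have cB : (#|B| <= (#|V1| + #|V2|).+1)%N.
 rewrite cardsU1 card_imset; last by move=> x y [].
 by apply: leq_trans (_ : 1 + #|S| <= _)%N; rewrite ?leq_add2r ?leq_b1 ?add1n.
have : [pred t | im t == S] \subset [predX [predX (predT : pred {set V1}) & (predT : pred {set V2})] &
  [predX (ffun_on (mem B) : pred {ffun V1 -> option 'I_n}) &
      (ffun_on (mem B) : pred {ffun V2 -> option 'I_n})]].
 apply/fintype.subsetP.
 move=> -[[D1 D2] [k1 k2]] /eqP tS1; apply/andP; split=> //.
 have mB (o : option 'I_n) : (forall z, o = Some z -> z \in S) -> o \in B.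
  case: o => [z|] H; rewrite /B finset.in_setU1 ?eqxx//=.
  by apply/imset_f/H.
 apply/andP; split; apply/ffun_onP => v; apply: mB => z E; rewrite -tS1 inE/=.
  by apply/orP; left; apply/existsP; exists v; rewrite E.
 by apply/orP; right; apply/existsP; exists v; rewrite E.
move=> /subset_leq_card/leq_trans; apply.
rewrite !cardX !card_ffun_on !(@eq_card _ predT predT)// -!cardsT.
have cs (V : finType) : #|[set: {set V}]%SET| = (2 ^ #|V|)%N.
 by rewrite -powersetT card_powerset cardsT.
rewrite !cs !cardsT /nkeys leq_mul2l; apply/orP; right.
have le_exp (a b e : nat) : (a <= b -> a ^ e <= b ^ e)%N.
 by move=> ab; case: e => // e; rewrite leq_exp2r.
by apply: leq_mul; apply: le_exp.
Qed.

(** Split each inner sum by pattern and key, apply Cauchy-Schwarz with at most [nkeys] classes, then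
    forget S. The squares that remain count pairs of monomials with equal free sites. *)
Theorem pattern_bound :
 \sum_(S : {set 'I_n} | S != finset.set0)
   (\sum_(l | compat A1 A2 p1 p2 S l) `|f l|) ^+ 2 <=
 nkeys%:R * \sum_(D | proper_pattern D)
   \sum_(l | contracted D l) \sum_(l' | contracted D l' && (pkey D l' == pkey D l))
    `|f l| * `|f l'|.
Proof.
pose b (t : pat * keyT) := \sum_(l | contracted t.1 l && (pkey t.1 l == t.2)) `|f l|.
have b0 t : 0 <= b t by apply: sumr_ge0.
apply: (@le_trans _ _ (\sum_(S : {set 'I_n} | S != finset.set0) nkeys%:R *
  \sum_(t | (im t == S) && proper_pattern t.1) b t ^+ 2)).
 apply: ler_sum => S S0.
 apply: (@le_trans _ _ ((\sum_(t | (im t == S) && proper_pattern t.1) b t) ^+ 2)).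
  rewrite lerXn2r ?nnegrE ?sumr_ge0//.
  rewrite (partition_big (theta S) (fun t => (im t == S) && proper_pattern t.1)); last first.
   by move=> l cl; rewrite im_theta// eqxx proper_theta.
  apply: ler_sum => t _; rewrite /b big_mkcond [leRHS]big_mkcond/=.
  apply: ler_sum => l _; case: ifPn => [/andP[cl /eqP <-]|_]; last by case: ifP.
  by rewrite contracted_theta// /theta/= eqxx.
 apply: le_trans (sqr_sum_le _ _) _.
 rewrite ler_wpM2r ?sumr_ge0// => [t _|]; first exact: sqr_ge0.
 rewrite ler_nat (leq_trans _ (card_im S))//.
 by apply: subset_leq_card; apply/fintype.subsetP => t; rewrite !inE => /andP[].
rewrite -mulr_sumr ler_wpM2l ?ler0n//.
apply: (@le_trans _ _ (\sum_(t | proper_pattern t.1) b t ^+ 2)).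
 rewrite [leRHS](partition_big im xpredT)//=.
 rewrite [leRHS](bigID (fun S => S != finset.set0))/=.
 rewrite -[leLHS]addr0; apply: lerD.
 - apply: ler_sum => S _; rewrite le_eqVlt; apply/orP; left; apply/eqP.
  by apply: eq_bigl => t; rewrite andbC.
 - by apply: sumr_ge0 => S _; apply: sumr_ge0 => t _; exact: sqr_ge0.
have -> : \sum_(t | proper_pattern t.1) b t ^+ 2 =
  \sum_(D | proper_pattern D) \sum_(k : keyT) b (D, k) ^+ 2.
 by rewrite pair_big_dep/=; apply: eq_big => -[D k]//=; rewrite andbT.
apply: ler_sum => D _.
by rewrite (sum_sqr_fibres (contracted D) (pkey D)).
Qed.

End patterns.

(** * Two power weights tied by a common site *)

Section lagpow_facts.
Context {R : realType}.
Implicit Types r s : R.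

Let dist_gt0 (n m : nat) : n != m -> (0 < `|(n%:Z - m%:Z)|)%N.
Proof. by move=> nm; lia. Qed.

Lemma lagpowD r s n m : lagpow (r + s) n m = lagpow r n m * lagpow s n m.
Proof.
rewrite /lagpow; case: (eqVneq n m) => [_|nm]; first by rewrite mulr1.
by rewrite opprD powRD// pnatr_eq0 -lt0n dist_gt0// implybT.
Qed.

Lemma lagpowX r k n m : lagpow r n m ^+ k = lagpow (k%:R * r) n m.
Proof.
elim: k => [|k IH]; last by rewrite exprS IH -lagpowD -natr1 mulrDl mul1r addrC.
by rewrite expr0 mul0r /lagpow oppr0 powRr0 if_same.
Qed.

Lemma lagpow_le r s n m : r <= s -> lagpow s n m <= lagpow r n m.
Proof.
rewrite /lagpow; case: (eqVneq n m) => // nm rs.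
by rewrite ler_powR ?lerN2// ler1n dist_gt0.
Qed.

(** Here x and x' are the lags of one site seen from times n and m. For m <= n only x = x' + (n - m)
    survives, and a lag 0 contributes nothing because its power is 0. This leaves the shifted
    series, or a convergent one when n = m. *)
Lemma sum_pair_shift (g : R) : 1 / 2 < g < 1 -> exists2 C : R, 0 < C &
 forall n m M, \sum_(x < M.+1) \sum_(x' < M.+1)
   (n + x' == m + x)%N%:R * (x%:R `^ (- g) * x'%:R `^ (- g)) <=
   C * lagpow (2 * g - 1) n m.
Proof.
move=> gI; have [C1 C10 H1] := sum_powRN_shift gI.
have [|C2 C20 H2] := @sum_powRN_bounded R (2 * g); first by move: gI; lra.
have ng0 : - g != 0 by rewrite oppr_eq0; move: gI; case: eqP => // ->; lra.
exists (C1 + C2) => [|n m M]; first exact: addr_gt0.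
wlog nm : n m / (m <= n)%N.
 move=> H; case/orP: (leq_total m n) => nm; first exact: H.
 rewrite (_ : lagpow _ n m = lagpow (2 * g - 1) m n); last first.
  by rewrite /lagpow eq_sym distnC.
 apply: le_trans (H _ _ nm); rewrite exchange_big/= le_eqVlt; apply/orP; left.
 apply/eqP; apply: eq_bigr => x _; apply: eq_bigr => x' _.
 by rewrite eq_sym [X in _ * X]mulrC.
have inner h (x' : 'I_M.+1) : (n - m)%N = h ->
  \sum_(x < M.+1) (n + x' == m + x)%N%:R * (x%:R `^ (- g) * x'%:R `^ (- g)) <=
  (x' + h)%:R `^ (- g) * x'%:R `^ (- g).
 move=> hE; have [lt|ge] := ltnP (x' + h)%N M.+1.
  rewrite (bigD1 (Ordinal lt))//= big1 => [|x xne].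
   by rewrite (_ : (_ == _)%N) ?mul1r ?addr0//; apply/eqP; lia.
  rewrite (_ : (_ == _)%N = false) ?mul0r//; apply/negbTE.
  by apply: contraNneq xne => E; apply/eqP/val_inj => /=; lia.
 rewrite big1 ?mulr_ge0 ?powR_ge0// => x _.
 rewrite (_ : (_ == _)%N = false) ?mul0r//; apply/negbTE/eqP.
 by have := ltn_ord x; lia.
have zero : (0%:R : R) `^ (- g) = 0 by rewrite powR0.
apply: (@le_trans _ _ (\sum_(x' < M.+1) (x' + (n - m))%:R `^ (- g) * x'%:R `^ (- g))).
 by rewrite exchange_big/=; apply: ler_sum => x' _; exact: inner.
rewrite big_ord_recl/= zero mulr0 add0r.
have [->|nme] := eqVneq n m.
 rewrite subnn /lagpow eqxx mulr1; apply: le_trans (_ : C2 <= _); last by rewrite lerDr ltW.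
 apply: le_trans (H2 M); apply: ler_sum => x _.
 rewrite addn0 /bump leq0n add1n -powRD ?pnatr_eq0 ?implybT//.
 by rewrite (_ : - g + - g = - (2 * g))//; ring.
have nm0 : (0 < n - m)%N by lia.
apply: (@le_trans _ _ (C1 * (n - m)%:R `^ (1 - 2 * g))).
 apply: le_trans (H1 _ M nm0); apply: ler_sum => x _.
 by rewrite /bump leq0n add1n mulrC.
rewrite /lagpow (negbTE nme) (_ : - (2 * g - 1) = 1 - 2 * g); last by ring.
rewrite (_ : `|n%:Z - m%:Z|%N = (n - m)%N); last by lia.
by rewrite ler_wpM2r ?powR_ge0// lerDl ltW.
Qed.

Lemma sum2_prod (V J : finType) (Q : V -> J -> J -> R) :
 \sum_(i : {ffun V -> J}) \sum_(i' : {ffun V -> J}) \prod_v Q v (i v) (i' v) =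
 \prod_v \sum_x \sum_x' Q v x x'.
Proof.
rewrite bigA_distr_bigA/=; apply: eq_bigr => i _.
by rewrite bigA_distr_bigA.
Qed.

End lagpow_facts.

(** Decidable counterpart of [offdiag] for indices in a box, so that the sums become finite sums
    over a finite type. *)
Definition offb (V : finType) M (A : {set V}) (i : {ffun V -> 'I_M}) : bool :=
 [forall v, (v \in A) == (0 < i v)%N] &&
 [forall v in A, forall w in A, (i v == i w) ==> (v == w)].

Lemma offb_pos (V : finType) M (A : {set V}) (i : {ffun V -> 'I_M}) v :
 offb A i -> (v \in A) = (0 < i v)%N.
Proof. by move=> /andP[/forallP/(_ v)/eqP]. Qed.

Lemma offb_inj (V : finType) M (A : {set V}) (i : {ffun V -> 'I_M}) :
 offb A i -> {in A &, injective i}.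
Proof.
move=> /andP[_ /forall_inP H] v w vA wA E.
by move/forall_inP: (H v vA) => /(_ w wA); rewrite E eqxx => /eqP.
Qed.

(* |a i| is at most c times the product of (i v)^-(e v) as soon as the weights
  e sum to at most #|A|/2 + kappa; this is how the homogeneity of degree
  -(#|A|/2 + kappa) is used. *)
Definition powbound {R : realType} {V : finType} (A : {set V})
  (a : {ffun V -> nat} -> R) (kappa c : R) :=
 forall e : V -> R, (forall v, 0 <= e v) -> \sum_(v in A) e v <= #|A|%:R / 2 + kappa ->
 forall i : {ffun V -> nat}, (forall v, (v \in A) = (0 < i v)%N) ->
  `|a i| <= c * \prod_(v in A) (i v)%:R `^ (- e v).

Definition tonat (V : finType) M (i : {ffun V -> 'I_M}) : {ffun V -> nat} :=
 [ffun v => i v : nat].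

(** * Sums over one contraction pattern *)

Section window_pattern.
Context {R : realType} {V1 V2 : finType}.
Variables (A1 : {set V1}) (A2 : {set V2}) (D1 : {set V1}) (D2 : {set V2}).
Hypotheses (DA1 : D1 \subset A1) (DA2 : D2 \subset A2).
Variables (a : {ffun V1 -> nat} -> R) (u : {ffun V2 -> nat} -> R).
Variables (ka ku ca cu : R).
Hypotheses (ca0 : 0 <= ca) (cu0 : 0 <= cu).
Hypotheses (pa : powbound A1 a ka ca) (pu : powbound A2 u ku cu).
Variables (ein eout fin fout rho : R).
Hypotheses (ein0 : 0 <= ein) (fin0 : 0 <= fin).
Hypotheses (eoutI : 1 / 2 < eout < 1) (foutI : 1 / 2 < fout < 1).
Hypothesis Esum : #|D1|%:R * ein + #|A1 :\: D1|%:R * eout <= #|A1|%:R / 2 + ka.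
Hypothesis Fsum : #|D2|%:R * fin + #|A2 :\: D2|%:R * fout <= #|A2|%:R / 2 + ku.
Hypothesis EF : D1 != finset.set0 -> 1 < ein + fin.
Hypothesis rhoI : 0 < rho < 1.
Hypothesis rhole : rho <= #|A1 :\: D1|%:R * (2 * eout - 1) + #|A2 :\: D2|%:R * (2 * fout - 1).

Section fixed.
Variables (M : nat).
Local Notation I1 := {ffun V1 -> 'I_M.+1}.
Local Notation I2 := {ffun V2 -> 'I_M.+1}.

(** Total weight of a contracted pair, charged entirely to the variable of the first family. *)
Definition wpsi (x : 'I_M.+1) : R := x%:R `^ (- (ein + fin)).
Definition wom1 (x : 'I_M.+1) : R := x%:R `^ (- eout).
Definition wom2 (x : 'I_M.+1) : R := x%:R `^ (- fout).

Definition wt1 (i : I1) v : R :=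
 if v \in A1 then if v \in D1 then wpsi (i v) else wom1 (i v) else (i v == 0%N :> nat)%:R.
(** A contracted variable of the second family carries no weight of its own. It only has to fall in
    [B], the image of the contracted variables of the first family, which leaves at most |V1|
    values. *)
Definition wt2 (B : {set 'I_M.+1}) (i : I2) v : R :=
 if v \in A2 then if v \in D2 then (i v \in B)%:R else wom2 (i v)
 else (i v == 0%N :> nat)%:R.

Let split_prod (V : finType) (A D : {set V}) (DA : D \subset A) (i : {ffun V -> 'I_M.+1})
  (F G H : V -> R) : (forall v, v \notin A -> H v = 1) ->
 \prod_v (if v \in A then if v \in D then F v else G v else H v) =
 \prod_(v in D) F v * \prod_(v in A :\: D) G v.
Proof.
move=> H1; rewrite (bigID (mem A))/= [X in _ * X]big1 ?mulr1; last first.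
 by move=> v vA; rewrite (negbTE vA) H1.
rewrite (bigID (mem D))/=; congr (_ * _).
 rewrite (eq_bigl (mem D)); last first.
  move=> v /=; case: (boolP (v \in D)) => vD; rewrite ?andbF ?andbT//.
  by rewrite (fintype.subsetP DA).
 by apply: eq_bigr => v vD; rewrite (fintype.subsetP DA)// (vD : _ \in _).
rewrite (eq_bigl (fun v => v \in A :\: D)); last by move=> v; rewrite /= !inE andbC.
by apply: eq_bigr => v; rewrite !inE => /andP[/negbTE -> ->].
Qed.

(** Both coefficients are bounded with inner exponents on contracted variables and outer ones
    elsewhere. Injectivity transports the weights of [i2] on [D2] to [i1] on [D1], where the two
    inner exponents add up. *)
Lemma term_le (i1 : I1) (i2 : I2) : offb A1 i1 -> offb A2 i2 ->
 i1 @: D1 = i2 @: D2 ->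
 `|a (tonat i1) * u (tonat i2)| <=
  (ca * cu) * (\prod_v wt1 i1 v * \prod_v wt2 (i1 @: D1) i2 v).
Proof.
move=> o1 o2 DE; rewrite normrM.
pose e v := if v \in D1 then ein else eout; pose f v := if v \in D2 then fin else fout.
have sumIf (V : finType) (A D : {set V}) (x y : R) : D \subset A ->
  \sum_(v in A) (if v \in D then x else y) = #|D|%:R * x + #|A :\: D|%:R * y.
 move=> DA; rewrite (bigID (mem D))/=; congr (_ + _).
  rewrite (eq_bigl (mem D)); last first.
   move=> v /=; case: (boolP (v \in D)) => vD; rewrite ?andbF ?andbT//.
   by rewrite (fintype.subsetP DA).
  rewrite (eq_bigr (fun=> x)); last by move=> v vD; rewrite (vD : _ \in _).
  by rewrite sumr_const mulr_natl.
 rewrite (eq_bigl (fun v => v \in A :\: D)); last by move=> v; rewrite /= !inE andbC.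
 rewrite (eq_bigr (fun=> y)); last by move=> v; rewrite !inE => /andP[/negbTE ->].
 by rewrite sumr_const mulr_natl.
have Pa : `|a (tonat i1)| <= ca * \prod_(v in A1) (i1 v)%:R `^ (- e v).
 have := pa (e := e); move=> /(_ _ _ (tonat i1)) H; apply: le_trans (H _ _ _) _.
 - by move=> v; rewrite /e; case: ifP => // _; move: eoutI; lra.
 - by rewrite /e sumIf.
 - by move=> v; rewrite ffunE; exact: offb_pos.
 - rewrite le_eqVlt; apply/orP; left; apply/eqP; congr (_ * _).
  by apply: eq_bigr => v _; rewrite ffunE.
have Pu : `|u (tonat i2)| <= cu * \prod_(v in A2) (i2 v)%:R `^ (- f v).
 have := pu (e := f); move=> /(_ _ _ (tonat i2)) H; apply: le_trans (H _ _ _) _.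
 - by move=> v; rewrite /f; case: ifP => // _; move: foutI; lra.
 - by rewrite /f sumIf.
 - by move=> v; rewrite ffunE; exact: offb_pos.
 - rewrite le_eqVlt; apply/orP; left; apply/eqP; congr (_ * _).
  by apply: eq_bigr => v _; rewrite ffunE.
apply: le_trans (ler_pM _ _ Pa Pu) _ => //.
rewrite mulrACA ler_wpM2l ?mulr_ge0// le_eqVlt; apply/orP; left; apply/eqP.
have pw (V : finType) (A D : {set V}) (DA : D \subset A) (i : {ffun V -> 'I_M.+1}) x y :
  \prod_(v in A) (i v)%:R `^ (- (if v \in D then x else y)) =
  \prod_(v in D) (i v)%:R `^ (- x) * \prod_(v in A :\: D) (i v)%:R `^ (- y) :> R.
 rewrite -(@split_prod _ A D DA i _ _ (fun=> 1))// big_mkcond/=.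
 by apply: eq_bigr => v _; case: ifP => // _; case: ifP.
rewrite /e /f (pw _ A1 D1 DA1 i1) (pw _ A2 D2 DA2 i2).
rewrite (@split_prod _ A1 D1 DA1 i1); last first.
 by move=> v vA; rewrite (offb_pos _ o1) -eqn0Ngt in vA; rewrite vA.
rewrite (@split_prod _ A2 D2 DA2 i2); last first.
 by move=> v vA; rewrite (offb_pos _ o2) -eqn0Ngt in vA; rewrite vA.
rewrite [X in _ = _ * (X * _)](_ : _ = 1) ?mul1r; last first.
 by apply: big1 => v vD; rewrite DE imset_f.
rewrite mulrA; congr (_ * _); rewrite mulrAC; congr (_ * _).
have inj2 : {in D2 &, injective i2}.
 by move=> v w vD wD; apply: (offb_inj o2); exact: (fintype.subsetP DA2).
have inj1 : {in D1 &, injective i1}.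
 by move=> v w vD wD; apply: (offb_inj o1); exact: (fintype.subsetP DA1).
rewrite -(big_imset (fun x : 'I_M.+1 => (x%:R : R) `^ (- fin)) inj2)/= -DE.
rewrite (big_imset (fun x : 'I_M.+1 => (x%:R : R) `^ (- fin)) inj1)/= -big_split/=.
apply: eq_bigr => v vD; rewrite /wpsi opprD powRD//.
rewrite pnatr_eq0 -lt0n -(offb_pos _ o1) (fintype.subsetP DA1)// implybT//.
Qed.

(** Encodes that a free variable occupies the same site in the monomials at times n and m; a factor
    1 leaves the other variables unconstrained. *)
Definition link1 n m (i i' : I1) v : R :=
 if v \in A1 :\: D1 then (n + i' v == m + i v)%N%:R else 1.
Definition link2 n m (i i' : I2) v : R :=
 if v \in A2 :\: D2 then (n + i' v == m + i v)%N%:R else 1.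

Lemma factor_le (V : finType) (A D : {set V}) (C L : R)
  (Q : V -> 'I_M.+1 -> 'I_M.+1 -> R) : 0 <= L -> 1 <= C ->
 (forall v, v \notin A :\: D -> 0 <= \sum_x \sum_x' Q v x x' <= C) ->
 (forall v, v \in A :\: D -> 0 <= \sum_x \sum_x' Q v x x' <= C * L) ->
 \prod_v \sum_x \sum_x' Q v x x' <= C ^+ #|V| * L ^+ #|A :\: D|.
Proof.
move=> L0 C1 H1 H2.
have -> : C ^+ #|V| * L ^+ #|A :\: D| = \prod_v (C * if v \in A :\: D then L else 1).
 by rewrite big_split/= prodr_const -big_mkcond/= prodr_const.
apply: ler_prod => v _; case: (boolP (v \in A :\: D)) => vA; first exact: H2.
by rewrite mulr1; exact: H1.
Qed.

(** With the image of the contracted variables fixed, everything splits over single variables.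
    Contracted ones contribute constants since 1 < ein + fin, and each free one contributes a power
    of |n - m| with exponent 2 eout - 1 or 2 fout - 1. The accumulated decay is at least [rho]. *)
Lemma pair_sum_le C n m : 1 <= C -> (#|V1|%:R ^+ 2 <= C) ->
 (D1 != finset.set0 -> (\sum_(x < M.+1) x%:R `^ (- (ein + fin))) ^+ 2 <= C) ->
 (\sum_(x < M.+1) \sum_(x' < M.+1)
   (n + x' == m + x)%N%:R * (x%:R `^ (- eout) * x'%:R `^ (- eout)) <=
   C * lagpow (2 * eout - 1) n m) ->
 (\sum_(x < M.+1) \sum_(x' < M.+1)
   (n + x' == m + x)%N%:R * (x%:R `^ (- fout) * x'%:R `^ (- fout)) <=
   C * lagpow (2 * fout - 1) n m) ->
 \sum_(i1 : I1) \sum_(i1' : I1) \sum_(i2 : I2) \sum_(i2' : I2)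
   (\prod_v wt1 i1 v * \prod_v wt2 (i1 @: D1) i2 v) *
   (\prod_v wt1 i1' v * \prod_v wt2 (i1' @: D1) i2' v) *
   (\prod_v link1 n m i1 i1' v * \prod_v link2 n m i2 i2' v) <=
 C ^+ (#|V1| + #|V2|) * lagpow rho n m.
Proof.
move=> C1 CV Cpsi Ce Cf.
have C0 : 0 <= C by exact: le_trans C1.
have sum0 : \sum_(x < M.+1) \sum_(x' < M.+1) ((x == 0%N :> nat)%:R * (x' == 0%N :> nat)%:R) = 1 :> R.
 have s1 : \sum_(x < M.+1) (x == 0%N :> nat)%:R = 1 :> R.
  by rewrite big_ord_recl/= big1 ?addr0.
 by rewrite -big_distrlr/= s1 mulr1.
have inner (B B' : {set 'I_M.+1}) : (#|B| <= #|V1|)%N -> (#|B'| <= #|V1|)%N ->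
  \sum_(i2 : I2) \sum_(i2' : I2) \prod_v wt2 B i2 v * \prod_v wt2 B' i2' v *
    \prod_v link2 n m i2 i2' v <= C ^+ #|V2| * lagpow (2 * fout - 1) n m ^+ #|A2 :\: D2|.
 move=> BV BV'.
 pose Q v (x x' : 'I_M.+1) : R :=
  (if v \in A2 then if v \in D2 then (x \in B)%:R else wom2 x else (x == 0%N :> nat)%:R) *
  (if v \in A2 then if v \in D2 then (x' \in B')%:R else wom2 x' else (x' == 0%N :> nat)%:R) *
  (if v \in A2 :\: D2 then (n + x' == m + x)%N%:R else 1).
 rewrite (eq_bigr (fun i2 : I2 => \sum_(i2' : I2) \prod_v Q v (i2 v) (i2' v))); last first.
  by move=> i2 _; apply: eq_bigr => i2' _; rewrite -!big_split.
 have Q0 v x x' : 0 <= Q v x x'.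
  rewrite /Q !mulr_ge0//; do ?[case: ifP => _]; rewrite ?ler0n ?powR_ge0//.
 rewrite sum2_prod; apply: (@factor_le _ A2 D2 C) => //.
 - exact: lagpow_ge0.
 - move=> v vAD; rewrite sumr_ge0/=; last by move=> x _; exact: sumr_ge0.
  rewrite /Q (negbTE vAD); have := vAD; rewrite inE negb_and negbK.
  case: (boolP (v \in A2)) => vA /=; last first.
   move=> _; under eq_bigr do under eq_bigr do rewrite mulr1.
   by rewrite sum0.
  rewrite orbF => ->; under eq_bigr do under eq_bigr do rewrite mulr1.
  apply: le_trans CV; rewrite -big_distrlr/= expr2.
  have cB (E : {set 'I_M.+1}) : (#|E| <= #|V1|)%N -> \sum_x (x \in E)%:R <= #|V1|%:R :> R.
   move=> EV; rewrite (_ : \sum_x _ = #|E|%:R) ?ler_nat//.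
   by rewrite -sum1_card natr_sum [RHS]big_mkcond/=; apply: eq_bigr => x _; case: (x \in E).
  by rewrite ler_pM ?cB// sumr_ge0.
 - move=> v vAD; rewrite sumr_ge0/=; last by move=> x _; exact: sumr_ge0.
  apply: le_trans Cf; rewrite /Q vAD; move: vAD; rewrite inE => /andP[/negbTE -> ->].
  by apply: ler_sum => x _; apply: ler_sum => x' _; rewrite mulrC.
pose Lf := C ^+ #|V2| * lagpow (2 * fout - 1) n m ^+ #|A2 :\: D2|.
have Lf0 : 0 <= Lf by rewrite mulr_ge0 ?exprn_ge0 ?lagpow_ge0.
apply: (@le_trans _ _ (\sum_(i1 : I1) \sum_(i1' : I1)
  (\prod_v wt1 i1 v * \prod_v wt1 i1' v * \prod_v link1 n m i1 i1' v) * Lf)).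
 apply: ler_sum => i1 _; apply: ler_sum => i1' _.
 rewrite (eq_bigr (fun i2 => \prod_v wt1 i1 v * \prod_v wt1 i1' v * \prod_v link1 n m i1 i1' v *
   (\sum_(i2' : I2) \prod_v wt2 (i1 @: D1) i2 v * \prod_v wt2 (i1' @: D1) i2' v *
    \prod_v link2 n m i2 i2' v))); last first.
  by move=> i2 _; rewrite mulr_sumr; apply: eq_bigr => i2' _; ring.
 rewrite -mulr_sumr ler_wpM2l//; last first.
  apply: inner; apply: leq_trans (leq_imset_card _ _) _; exact: max_card.
 rewrite !mulr_ge0//; apply: prodr_ge0 => v _; rewrite /wt1 /link1; do ?[case: ifP => _];
  by rewrite ?ler0n ?powR_ge0.
pose Q v (x x' : 'I_M.+1) : R :=
 (if v \in A1 then if v \in D1 then wpsi x else wom1 x else (x == 0%N :> nat)%:R) *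
 (if v \in A1 then if v \in D1 then wpsi x' else wom1 x' else (x' == 0%N :> nat)%:R) *
 (if v \in A1 :\: D1 then (n + x' == m + x)%N%:R else 1).
have Q0 v x x' : 0 <= Q v x x'.
 rewrite /Q !mulr_ge0//; do ?[case: ifP => _]; rewrite ?ler0n ?powR_ge0//.
rewrite (eq_bigr (fun i1 : I1 => (\sum_(i1' : I1) \prod_v Q v (i1 v) (i1' v)) * Lf)); last first.
 by move=> i1 _; rewrite -mulr_suml; congr (_ * _); apply: eq_bigr => i1' _; rewrite -!big_split.
rewrite -mulr_suml sum2_prod.
apply: (@le_trans _ _ (C ^+ #|V1| * lagpow (2 * eout - 1) n m ^+ #|A1 :\: D1| * Lf)).
 rewrite ler_wpM2r//; apply: (@factor_le _ A1 D1 C) => //.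
 - exact: lagpow_ge0.
 - move=> v vAD; rewrite sumr_ge0/=; last by move=> x _; exact: sumr_ge0.
  rewrite /Q (negbTE vAD); have := vAD; rewrite inE negb_and negbK.
  case: (boolP (v \in A1)) => vA /=; last first.
   move=> _; under eq_bigr do under eq_bigr do rewrite mulr1.
   by rewrite sum0.
  rewrite orbF => vD; rewrite vD; under eq_bigr do under eq_bigr do rewrite mulr1.
  rewrite -big_distrlr/= -expr2; apply: Cpsi.
  by apply/set0Pn; exists v.
 - move=> v vAD; rewrite sumr_ge0/=; last by move=> x _; exact: sumr_ge0.
  apply: le_trans Ce; rewrite /Q vAD; move: vAD; rewrite inE => /andP[/negbTE -> ->].
  by apply: ler_sum => x _; apply: ler_sum => x' _; rewrite mulrC.
rewrite /Lf mulrACA -exprD ler_wpM2l ?exprn_ge0// !lagpowX -lagpowD.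
exact: lagpow_le.
Qed.

End fixed.

End window_pattern.

(** * Choice of the exponents *)

Section exponents.
Context {R : realType}.

(* s is the number of contracted pairs. The weights on a contracted pair sum to
  slightly more than 1, and the remaining weights are as large as possible. *)
Lemma exponents (k r s : nat) (k1 q : R) : (0 < k)%N -> (s <= k)%N -> (s <= r)%N ->
 (s < k)%N || (s < r)%N -> 0 < k1 < 1 / 2 -> 0 < q -> k1 + q < 1 / 2 ->
 exists ein eout fin fout : R,
  [/\ 0 <= ein, 0 <= fin, 1 / 2 < eout < 1 & 1 / 2 < fout < 1] /\
  [/\ s%:R * ein + (k - s)%:R * eout <= k%:R / 2 + k1,
    s%:R * fin + (r - s)%:R * fout <= r%:R / 2 + q,
    (0 < s)%N -> 1 < ein + fin &
    (if r == 0%N then 2 * k1 else 2 * k1 + q) <=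
     (k - s)%:R * (2 * eout - 1) + (r - s)%:R * (2 * fout - 1)].
Proof.
move=> k0 sk sr slt /andP[k10 k12] q0 k1q.
have kR : (1 : R) <= k%:R by rewrite ler1n.
have sR : (0 : R) <= s%:R by rewrite ler0n.
have rR : (0 : R) <= r%:R by rewrite ler0n.
have skR : (s%:R : R) <= k%:R by rewrite ler_nat.
have srR : (s%:R : R) <= r%:R by rewrite ler_nat.
rewrite !natrB//.
(* Slack that pushes a contracted pair above 1. The denominator makes x * eta, for x up to k + r, at
   most a quarter of q and of k1. *)
pose eta := Num.min q k1 / (4 * (k%:R + r%:R)).
have mqk : 0 < Num.min q k1 by rewrite lt_min q0.
have eta0 : 0 < eta by rewrite divr_gt0//; lra.
have etaE : eta * (4 * (k%:R + r%:R)) = Num.min q k1 by rewrite divfK//; lra.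
have [mq mk] : Num.min q k1 <= q /\ Num.min q k1 <= k1 by rewrite !ge_min !lexx orbT.
have seta (x : R) : 0 <= x <= k%:R + r%:R -> 4 * (x * eta) <= q /\ 4 * (x * eta) <= k1.
 by move=> xI; split; nra.
have [r0|r0] := eqVneq r 0%N.
 have s0 : s = 0%N by move: sr; rewrite r0 leqn0 => /eqP.
 exists 1, (1 / 2 + k1 / k%:R), 1, (3 / 4); rewrite s0 r0/=.
 have kk : 0 < k1 / k%:R <= k1.
  by rewrite divr_gt0 ?ler_pdivrMr//=; nra.
 have E : k%:R * (k1 / k%:R) = k1 by rewrite mulrCA divff ?mulr1//; lra.
 by split; split => //; lra.
have rR1 : (1 : R) <= r%:R by rewrite ler1n lt0n.
have [sklt|skge] := ltnP s k; have [srlt|srge] := ltnP s r.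
- have ks : 1 <= k%:R - s%:R :> R by rewrite -natrB// ler1n subn_gt0.
 have rs : 1 <= r%:R - s%:R :> R by rewrite -natrB// ler1n subn_gt0.
 have [sq sk1] := seta s%:R ltac:(lra).
 set x := (k1 - s%:R * eta) / (k%:R - s%:R); set y := (q - s%:R * eta) / (r%:R - s%:R).
 have xE : (k%:R - s%:R) * x = k1 - s%:R * eta by rewrite /x mulrCA divff ?mulr1//; lra.
 have yE : (r%:R - s%:R) * y = q - s%:R * eta by rewrite /y mulrCA divff ?mulr1//; lra.
 have xI : 0 < x < 1 / 2 by rewrite divr_gt0 ?ltr_pdivrMr//=; nra.
 have yI : 0 < y < 1 / 2 by rewrite divr_gt0 ?ltr_pdivrMr//=; nra.
 (* Both families keep free variables: a pair weighs 1 + 2 eta, and each family spends the rest of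
    its own budget on its free variables. *)
 exists (1 / 2 + eta), (1 / 2 + x), (1 / 2 + eta), (1 / 2 + y).
 by split; split => //; lra.
- have sE : s = r by apply/eqP; rewrite eqn_leq sr.
 have ks : 1 <= k%:R - r%:R :> R by rewrite -natrB ?ler1n ?subn_gt0 -?sE.
 have [sq sk1] := seta r%:R ltac:(lra).
 rewrite sE; set x := (k1 + q - r%:R * eta) / (k%:R - r%:R); set y := q / r%:R.
 have xE : (k%:R - r%:R) * x = k1 + q - r%:R * eta by rewrite /x mulrCA divff ?mulr1//; lra.
 have yE : r%:R * y = q by rewrite /y mulrCA divff ?mulr1//; lra.
 have xI : 0 < x < 1 / 2 by rewrite divr_gt0 ?ltr_pdivrMr//=; nra.
 have yI : 0 < y < 1 / 2 by rewrite divr_gt0 ?ltr_pdivrMr//=; nra.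
 (* The second family is entirely contracted. Its surplus q goes into the pairs, which lowers the
    share asked of the first family and leaves it about k1 + q for its free variables. The value 3 /
    4 is a dummy exponent for an empty set of variables. *)
 exists (1 / 2 - y + eta), (1 / 2 + x), (1 / 2 + y), (3 / 4).
 by split; split => //; lra.
- have sE : s = k by apply/eqP; rewrite eqn_leq sk.
 have rs : 1 <= r%:R - k%:R :> R by rewrite -natrB ?ler1n ?subn_gt0 -?sE.
 have [sq sk1] := seta k%:R ltac:(lra).
 rewrite sE; set x := (k1 + q - k%:R * eta) / (r%:R - k%:R); set y := k1 / k%:R.
 have xE : (r%:R - k%:R) * x = k1 + q - k%:R * eta by rewrite /x mulrCA divff ?mulr1//; lra.
 have yE : k%:R * y = k1 by rewrite /y mulrCA divff ?mulr1//; lra.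
 have xI : 0 < x < 1 / 2 by rewrite divr_gt0 ?ltr_pdivrMr//=; nra.
 have yI : 0 < y < 1 / 2 by rewrite divr_gt0 ?ltr_pdivrMr//=; nra.
 exists (1 / 2 + y), (3 / 4), (1 / 2 - y + eta), (1 / 2 + x).
 by split; split => //; lra.
- by move: slt; rewrite ltnNge skge ltnNge srge.
Qed.

End exponents.

(** * Windows of a product of two truncated chaoses *)

Section window.
Context {R : realType} {V1 V2 : finType}.
Variables (A1 : {set V1}) (A2 : {set V2}).
Variables (a : {ffun V1 -> nat} -> R) (u : {ffun V2 -> nat} -> R).
Section indices.
Variables (b M : nat).
Local Notation raw := ('I_b * {ffun V1 -> 'I_M.+1} * {ffun V2 -> 'I_M.+1})%type.

Definition offdiag2 : {pred raw} := [pred x | offb A1 x.1.2 && offb A2 x.2].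
Local Notation L := {x in offdiag2}.

(** Time n at lag x reads the noise at n - x; adding M makes this a natural number below b + M. *)
Definition site (n x : nat) : 'I_(b + M).+1 := inord (n + M - x).
Definition site1 (l : L) v := site (\val l).1.1 ((\val l).1.2 v).
Definition site2 (l : L) v := site (\val l).1.1 ((\val l).2 v).
Definition coef2 (l : L) := a (tonat (\val l).1.2) * u (tonat (\val l).2).

Lemma site_inj (n m : 'I_b) (x y : 'I_M.+1) : site n x = site m y -> (n + y = m + x)%N.
Proof.
move=> /(congr1 val)/=; rewrite !inordK.
- by have := ltn_ord x; have := ltn_ord y; lia.
- by have := ltn_ord m; lia.
- by have := ltn_ord n; lia.
Qed.

Lemma site1_inj l : {in A1 &, injective (site1 l)}.
Proof.
move=> v w vA wA /site_inj /addnI/esym/val_inj E.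
by move: E; case: l => [[[n i1] i2] /andP[ o1 o2]] /= E; exact: (offb_inj o1).
Qed.

Lemma site2_inj l : {in A2 &, injective (site2 l)}.
Proof.
move=> v w vA wA /site_inj /addnI/esym/val_inj E.
by move: E; case: l => [[[n i1] i2] /andP[ o1 o2]] /= E; exact: (offb_inj o2).
Qed.

End indices.

Variables (ka ku ca cu q : R).
Hypotheses (A10 : (0 < #|A1|)%N) (ca0 : 0 <= ca) (cu0 : 0 <= cu).
Hypotheses (pa : powbound A1 a ka ca) (pu : powbound A2 u ku cu).
Hypotheses (kaI : 0 < ka < 1 / 2) (q0 : 0 < q) (kaq : ka + q < 1 / 2).
Hypothesis qku : q <= ku.

Let rho := if #|A2| == 0%N then 2 * ka else 2 * ka + q.

Let rhoI : 0 < rho < 1.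
Proof. by rewrite /rho; case: ifP => _; move: kaI kaq q0; lra. Qed.

(** Equal keys force the free lags to satisfy the link equations, so pairs of monomials are
    dominated by a sum that factorises. Summing |n - m|^(- rho) over the window then gives b^(2 -
    rho). *)
Lemma pattern_sum_le (D : {set V1} * {set V2}) : proper_pattern A1 A2 D ->
 exists2 C : R, 0 < C & forall b M,
 \sum_(l | contracted (@site1 b M) (@site2 b M) D l)
  \sum_(l' | contracted (@site1 b M) (@site2 b M) D l' &&
    (pkey A1 A2 (@site1 b M) (@site2 b M) D l' == pkey A1 A2 (@site1 b M) (@site2 b M) D l))
    `|coef2 l| * `|coef2 l'| <= C * b%:R `^ (2 - rho).
Proof.
case: D => D1 D2 /and3P[/= DA1 DA2 Dne].
have contrE b M (l : {x in @offdiag2 b M}) :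
  contracted (@site1 b M) (@site2 b M) (D1, D2) l -> (\val l).1.2 @: D1 = (\val l).2 @: D2.
 case: l => [[[n i1] i2] V] /= /eqP E; apply/setP => x.
 have E' : site b M n x \in [set site b M n (i1 v) | v in D1]%SET =
      (site b M n x \in [set site b M n (i2 v) | v in D2]%SET).
  by move/setP : E => /(_ (site b M n x)).
 have aux (W : finType) (i : {ffun W -> 'I_M.+1}) (D : {set W}) :
   (site b M n x \in [set site b M n (i v) | v in D]%SET) = (x \in i @: D).
  apply/imsetP/imsetP => -[v vD xE]; exists v => //; last by rewrite xE.
  by have /addnI/val_inj := site_inj xE.
 by rewrite -!aux.
(* If the two contracted sets differ in size no monomial is contracted, because placements are
   injective, and the sum is empty. *)
have [cD|cD] := eqVneq #|D1| #|D2|; last first.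
 exists 1 => // b M; rewrite big_pred0 ?mulr_ge0 ?powR_ge0// => l.
 apply/negP => cl; move: cD; rewrite -(card_in_imset (f := (\val l).1.2)).
  rewrite (contrE _ _ _ cl) card_in_imset ?eqxx// => v w vD wD.
  have /andP[_ o2] := valP l; apply: (offb_inj o2); exact: (fintype.subsetP DA2).
 move=> v w vD wD.
 by have /andP[ o1 _] := valP l; apply: (offb_inj o1); exact: (fintype.subsetP DA1).
have sk : (#|D1| <= #|A1|)%N by exact: subset_leq_card.
have sr : (#|D1| <= #|A2|)%N by rewrite cD; exact: subset_leq_card.
have slt : (#|D1| < #|A1|)%N || (#|D1| < #|A2|)%N.
 rewrite -implyNb -leqNgt; apply/implyP => A1D1; rewrite cD ltn_neqAle subset_leq_card// andbT.
 apply: contra Dne => /eqP E2; rewrite xpair_eqE !eqEcard DA1 DA2 A1D1/= E2.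
 exact: leqnn.
have [ein [eout [fin [fout [[ein0 fin0 eI fI] [Es Fs EF rle]]]]]] :=
 exponents A10 sk sr slt kaI q0 kaq.
have cA1 : #|A1 :\: D1| = (#|A1| - #|D1|)%N by rewrite cardsD (finset.setIidPr DA1).
have cA2 : #|A2 :\: D2| = (#|A2| - #|D2|)%N by rewrite cardsD (finset.setIidPr DA2).
have [Ce Ce0 He] := sum_pair_shift eI; have [Cf Cf0 Hf] := sum_pair_shift fI.
have [Cp Cp0 Hp] : exists2 Cp : R, 0 < Cp & forall M, D1 != finset.set0 ->
  \sum_(x < M.+1) x%:R `^ (- (ein + fin)) <= Cp.
 have [D1E|D10] := eqVneq D1 finset.set0; first by exists 1.
 have ef1 : 1 < ein + fin by apply: EF; rewrite card_gt0.
 have [Cp Cp0 Hp] := sum_powRN_bounded ef1; exists Cp => // M _.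
 rewrite big_ord_recl/= powR0 ?add0r; first by apply: le_trans (Hp M).
 by rewrite oppr_eq0; move: ef1; case: eqP => // ->; lra.
pose C := 1 + #|V1|%:R ^+ 2 + Cp ^+ 2 + Ce + Cf.
have C1 : 1 <= C by have := sqr_ge0 (#|V1|%:R : R); have := sqr_ge0 Cp; rewrite /C; lra.
have C0 : 0 < C by lra.
have [Cl Cl0 Hl] := @sum_lagpow R rho rhoI.
exists ((ca * cu) ^+ 2 * (C ^+ (#|V1| + #|V2|) * Cl) + 1) => [|b M].
 by rewrite ltr_wpDl// !mulr_ge0 ?sqr_ge0 ?exprn_ge0// ltW.
have Fs' : #|D2|%:R * fin + #|A2 :\: D2|%:R * fout <= #|A2|%:R / 2 + ku.
 by rewrite cA2 -cD; apply: le_trans Fs _; rewrite lerD2l.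
have rle' : rho <= #|A1 :\: D1|%:R * (2 * eout - 1) + #|A2 :\: D2|%:R * (2 * fout - 1).
 by rewrite cA1 cA2 -cD.
have Es' : #|D1|%:R * ein + #|A1 :\: D1|%:R * eout <= #|A1|%:R / 2 + ka by rewrite cA1.
have EF' : D1 != finset.set0 -> 1 < ein + fin by rewrite -card_gt0; exact: EF.
have TL := @term_le _ _ _ _ _ _ _ DA1 DA2 _ _ _ _ _ _ ca0 cu0 pa pu _ _ _ _ ein0 fin0 eI fI
  Es' Fs' M.
have PS n m : \sum_(i1 : {ffun V1 -> 'I_M.+1}) \sum_(i1' : {ffun V1 -> 'I_M.+1})
  \sum_(i2 : {ffun V2 -> 'I_M.+1}) \sum_(i2' : {ffun V2 -> 'I_M.+1})
   (\prod_v wt1 A1 D1 ein eout fin i1 v * \prod_v wt2 A2 D2 fout (i1 @: D1) i2 v) *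
   (\prod_v wt1 A1 D1 ein eout fin i1' v * \prod_v wt2 A2 D2 fout (i1' @: D1) i2' v) *
   (\prod_v link1 A1 D1 n m i1 i1' v * \prod_v link2 A2 D2 n m i2 i2' v) <=
 C ^+ (#|V1| + #|V2|) * lagpow rho n m.
 have sV := sqr_ge0 (#|V1|%:R : R); have sp := sqr_ge0 Cp.
 apply: pair_sum_le => //.
 - by rewrite /C; lra.
 - move=> /(Hp M) H; apply: (@le_trans _ _ (Cp ^+ 2)); last by rewrite /C; lra.
  rewrite lerXn2r ?nnegrE ?sumr_ge0 ?(ltW Cp0)// => x _; exact: powR_ge0.
 - apply: le_trans (He n m M) _; rewrite ler_wpM2r ?lagpow_ge0//; rewrite /C; lra.
 - apply: le_trans (Hf n m M) _; rewrite ler_wpM2r ?lagpow_ge0//; rewrite /C; lra.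
pose W (x : 'I_b * {ffun V1 -> 'I_M.+1} * {ffun V2 -> 'I_M.+1}) : R :=
 \prod_v wt1 A1 D1 ein eout fin x.1.2 v * \prod_v wt2 A2 D2 fout (x.1.2 @: D1) x.2 v.
pose Lk (x y : 'I_b * {ffun V1 -> 'I_M.+1} * {ffun V2 -> 'I_M.+1}) : R :=
 \prod_v link1 A1 D1 x.1.1 y.1.1 x.1.2 y.1.2 v * \prod_v link2 A2 D2 x.1.1 y.1.1 x.2 y.2 v.
have W0 x : 0 <= W x.
 by rewrite mulr_ge0//; apply: prodr_ge0 => v _; rewrite /wt1 /wt2; do ?[case: ifP => _];
  rewrite ?ler0n ?powR_ge0.
have Lk0 x y : 0 <= Lk x y.
 by rewrite mulr_ge0//; apply: prodr_ge0 => v _; rewrite /link1 /link2; case: ifP => _.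
pose H x y := (ca * cu) ^+ 2 * (W x * W y * Lk x y).
have H0 x y : 0 <= H x y by apply: mulr_ge0 (sqr_ge0 _) (mulr_ge0 (mulr_ge0 (W0 x) (W0 y)) (Lk0 x y)).
apply: (@le_trans _ _ (\sum_(l : {x in @offdiag2 b M}) \sum_(l' : {x in @offdiag2 b M})
  H (\val l) (\val l'))).
 rewrite big_mkcond/=; apply: ler_sum => l _; case: ifPn => cl; last by apply: sumr_ge0.
 rewrite big_mkcond/=; apply: ler_sum => l' _; case: ifPn => // /andP[cl' /eqP[E1 E2]].
 have /andP[ o1 o2] := valP l; have /andP[ o1' o2'] := valP l'.
 have B1 := TL _ _ o1 o2 (contrE _ _ _ cl); have B2 := TL _ _ o1' o2' (contrE _ _ _ cl').
 have LkE : Lk (\val l) (\val l') = 1.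
  rewrite /Lk [X in X * _]big1; last first.
   move=> v _; rewrite /link1; case: ifP => // vA.
   move/ffunP : E1 => /(_ v); rewrite !ffunE vA => -[/site_inj E].
   by rewrite -E eqxx.
  rewrite mul1r big1// => v _; rewrite /link2; case: ifP => // vA.
  move/ffunP : E2 => /(_ v); rewrite !ffunE vA => -[/site_inj E].
  by rewrite -E eqxx.
 rewrite -[leRHS]/(H (\val l) (\val l')) /H LkE mulr1 expr2 mulrACA.
 by apply: ler_pM; rewrite ?normr_ge0.
rewrite -(big_sub (@offdiag2 b M) (fun x => \sum_(l' : {x in @offdiag2 b M}) H x (\val l'))).
apply: (@le_trans _ _ (\sum_x \sum_y H x y)).
 rewrite [leRHS](bigID (mem (@offdiag2 b M)))/= -[leLHS]addr0 lerD//; last first.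
  by apply: sumr_ge0 => x _; exact: sumr_ge0.
 apply: ler_sum => x _; rewrite -(big_sub (@offdiag2 b M) (H x)).
 by rewrite [leRHS](bigID (mem (@offdiag2 b M)))/= lerDl sumr_ge0.
have triple (F : 'I_b * {ffun V1 -> 'I_M.+1} * {ffun V2 -> 'I_M.+1} -> R) :
  \sum_x F x = \sum_n \sum_i1 \sum_i2 F (n, i1, i2).
 by rewrite pair_bigA/= pair_bigA/=; apply: eq_bigr => -[[n i1] i2].
have -> : \sum_x \sum_y H x y = (ca * cu) ^+ 2 * \sum_(n < b) \sum_(m < b)
  \sum_(i1 : {ffun V1 -> 'I_M.+1}) \sum_(i1' : {ffun V1 -> 'I_M.+1})
  \sum_(i2 : {ffun V2 -> 'I_M.+1}) \sum_(i2' : {ffun V2 -> 'I_M.+1})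
   W (n, i1, i2) * W (m, i1', i2') * Lk (n, i1, i2) (m, i1', i2').
 under eq_bigr do rewrite /H -mulr_sumr.
 rewrite -mulr_sumr triple; congr (_ * _); apply: eq_bigr => n _.
 under eq_bigr do under eq_bigr do rewrite triple.
 under eq_bigr do rewrite exchange_big/=.
 rewrite exchange_big/=; apply: eq_bigr => m _; apply: eq_bigr => i1 _.
 by rewrite exchange_big.
rewrite mulrDl mul1r -[leLHS]addr0 lerD ?powR_ge0// -[leRHS]mulrA ler_wpM2l ?sqr_ge0//.
rewrite -[leRHS]mulrA.
apply: (@le_trans _ _ (\sum_(n < b) \sum_(m < b) C ^+ (#|V1| + #|V2|) * lagpow rho n m)).
 by apply: ler_sum => n _; apply: ler_sum => m _; exact: PS.
under eq_bigr do rewrite -mulr_sumr.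
by rewrite -mulr_sumr ler_wpM2l ?exprn_ge0 ?(ltW C0)//; exact: Hl.
Qed.

End window.

Section truncated_chaos.
Context {R : realType} {d} {T : measurableType d}.

(** Noise is indexed by naturals here: with lags at most M, time n reads entries n + M - i, so a
    window of length b involves finitely many of them. *)
Definition chaosM (V : finType) (A : {set V}) (a : {ffun V -> nat} -> R) (e : V -> R -> R)
  (X : nat -> T -> R) M n w : R :=
 \sum_(i : {ffun V -> 'I_M.+1} | offb A i)
  a (tonat i) * \prod_(v in A) e v (X (n + M - i v)%N w).

End truncated_chaos.

Section window_form.
Context {R : realType} {V1 V2 : finType} (A1 : {set V1}) (A2 : {set V2}).
Variables (a : {ffun V1 -> nat} -> R) (u : {ffun V2 -> nat} -> R).
Context {d : measure_display} {T : measurableType d} (P : probability T R).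
Variables (X : nat -> {RV P >-> R}) (e1 : V1 -> R -> R) (e2' : V2 -> R -> R) (b M : nat).

Lemma window_formE :
 (fun w => \sum_(n < b) chaosM A1 a e1 X M n w * chaosM A2 u e2' X M n w) =
 @form d T R P X (b + M).+1 V1 V2 _ A1 A2 e1 e2' (@coef2 R V1 V2 A1 A2 a u b M) (@site1 V1 V2 A1 A2 b M) (@site2 V1 V2 A1 A2 b M).
Proof.
apply/funext => w; rewrite /form.
 pose G (x : 'I_b * {ffun V1 -> 'I_M.+1} * {ffun V2 -> 'I_M.+1}) : R :=
  a (tonat x.1.2) * u (tonat x.2) *
  (\prod_(v in A1) e1 v (X (x.1.1 + M - x.1.2 v)%N w) *
   \prod_(v in A2) e2' v (X (x.1.1 + M - x.2 v)%N w)).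
 rewrite [RHS](eq_bigr (fun l => G (\val l))); last first.
  move=> l _; rewrite /G /coef2 /mono; congr (_ * (_ * _)); apply: eq_bigr => v _;
   rewrite /site1 /site2 /site inordK//;
   by rewrite ltnS (leq_trans (leq_subr _ _))// leq_add2r ltnW.
 rewrite -(big_sub (@offdiag2 _ _ A1 A2 b M) G)/= [RHS]big_mkcond/=.
 transitivity (\sum_(n < b) \sum_(i1 : {ffun V1 -> 'I_M.+1})
   \sum_(i2 : {ffun V2 -> 'I_M.+1}) if offb A1 i1 && offb A2 i2 then G (n, i1, i2) else 0).
  apply: eq_bigr => n _; rewrite /chaosM big_distrlr/= big_mkcond/=.
  apply: eq_bigr => i1 _; case: (offb A1 i1); last by rewrite big1.
  by rewrite big_mkcond/=; apply: eq_bigr => i2 _; case: (offb A2 i2) => //=; rewrite /G/=; ring.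
 by rewrite pair_bigA/= pair_bigA/=; apply: eq_bigr => -[[n i1] i2].
Qed.

End window_form.

Section window_variance.
Context {R : realType} {V1 V2 : finType}.
Variables (A1 : {set V1}) (A2 : {set V2}).
Variables (a : {ffun V1 -> nat} -> R) (u : {ffun V2 -> nat} -> R).
Variables (ka ku ca cu q K : R).
Hypotheses (A10 : (0 < #|A1|)%N) (ca0 : 0 <= ca) (cu0 : 0 <= cu).
Hypotheses (pa : powbound A1 a ka ca) (pu : powbound A2 u ku cu).
Hypotheses (kaI : 0 < ka < 1 / 2) (q0 : 0 < q) (kaq : ka + q < 1 / 2).
Hypothesis qku : q <= ku.
Hypothesis K1 : 1 <= K.

Let rho := if #|A2| == 0%N then 2 * ka else 2 * ka + q.

(** The patterns are finite in number, so one constant serves them all. It is fixed before the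
    probability space, the noise, the window and the truncation. *)
Theorem window_variance : exists2 C : R, 0 < C &
 forall (d : measure_display) (T : measurableType d) (P : probability T R)
  (X : nat -> {RV P >-> R}) (e1 : V1 -> R -> R) (e2' : V2 -> R -> R) (b M : nat),
 mutually_independent P (fun i => X i : T -> R) ->
 (forall v, mfunT (e1 v)) -> (forall v, mfunT (e2' v)) ->
 (forall v z, v \in A1 -> Ex P (fun w => e1 v (X z w)) = 0) ->
 (forall v z, v \in A2 -> Ex P (fun w => e2' v (X z w)) = 0) ->
 (forall v z, v \in A1 -> (e2 P (fun w => e1 v (X z w)) <= K%:E)%E) ->
 (forall v z, v \in A2 -> (e2 P (fun w => e2' v (X z w)) <= K%:E)%E) ->
 (forall v v' z, v \in A1 -> v' \in A2 ->
  (e2 P (fun w => (e1 v (X z w) * e2' v' (X z w))%R) <= K%:E)%E) ->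
 let F w := \sum_(n < b) chaosM A1 a e1 X M n w * chaosM A2 u e2' X M n w in
 L2 P F /\ Ex P (fun w => (F w - Ex P F) ^+ 2) <= C * b%:R `^ (2 - rho).
Proof.
have ex D : exists C : R, 0 < C /\ (proper_pattern A1 A2 D -> forall b M,
 \sum_(l | contracted (@site1 V1 V2 A1 A2 b M) (@site2 V1 V2 A1 A2 b M) D l)
  \sum_(l' | contracted (@site1 _ _ A1 A2 b M) (@site2 _ _ A1 A2 b M) D l' &&
    (pkey A1 A2 (@site1 _ _ A1 A2 b M) (@site2 _ _ A1 A2 b M) D l' ==
    pkey A1 A2 (@site1 _ _ A1 A2 b M) (@site2 _ _ A1 A2 b M) D l))
    `|coef2 a u l| * `|coef2 a u l'| <= C * b%:R `^ (2 - rho)).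
 case: (boolP (proper_pattern A1 A2 D)) => [pD|_]; last by exists 1.
 by have [C C0 HC] := pattern_sum_le A10 ca0 cu0 pa pu kaI q0 kaq qku pD; exists C; split.
have [C HC] := choice ex.
pose S := \sum_(D : {set V1} * {set V2}) C D.
have S0 : 0 <= S by apply: sumr_ge0 => D _; have [/ltW] := HC D.
have KK : 0 <= K ^+ (2 * (#|V1| + #|V2|)) by rewrite exprn_ge0// (le_trans ler01).
exists (K ^+ (2 * (#|V1| + #|V2|)) * ((@nkeys V1 V2)%:R * S) + 1).
 by rewrite ltr_wpDl// mulr_ge0 ?mulr_ge0.
move=> d T P X e1 e2' b M Xi m1 m2 z1 z2 s1 s2 s12 F.
have FE : F = _ := window_formE A1 A2 a u X e1 e2' b M.
rewrite FE; split.
 exact: (L2_form Xi m1 m2 K1 s1 s2 s12 _ (@site1_inj _ _ A1 A2 b M) (@site2_inj _ _ A1 A2 b M)).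
apply: le_trans (variance_form Xi m1 m2 K1 z1 z2 s1 s2 s12 _
 (@site1_inj _ _ A1 A2 b M) (@site2_inj _ _ A1 A2 b M)) _.
rewrite mulrDl mul1r -[leLHS]addr0 lerD ?powR_ge0//.
rewrite -[leRHS]mulrA ler_wpM2l//.
apply: le_trans (pattern_bound _ (@site1_inj _ _ A1 A2 b M) (@site2_inj _ _ A1 A2 b M)) _.
rewrite -[leRHS]mulrA ler_wpM2l ?ler0n// /S mulr_suml big_mkcond/=.
apply: ler_sum => D _; have [C0 HD] := HC D.
by case: ifPn => [pD|_]; [exact: HD | rewrite mulr_ge0 ?powR_ge0 ?ltW].
Qed.

End window_variance.

(** * Second moments of L^1 limits *)

Section L2_limits.
Context {d} {T : measurableType d} {R : realType} (P : probability T R).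

(* min(x^2, k^2) is 2k-Lipschitz, so it passes to the limit in L^1. *)
Lemma e2_lsc (G : T -> R) (B : R) : mfunT G ->
 (forall e, 0 < e -> exists H, [/\ L2 P H, Ex P (fun w => H w ^+ 2) <= B,
   integ P (fun w => G w - H w) & Ex P (fun w => `|G w - H w|) <= e]) ->
 (e2 P G <= B%:E)%E.
Proof.
move=> mG HG.
pose g (k : nat) w : R := Num.min (G w ^+ 2) (k%:R ^+ 2).
have g0 k w : 0 <= g k w by rewrite /g le_min !sqr_ge0.
have mg k : mfunT (g k).
 by apply: measurable_minr => //; exact: measurable_funX.
have gi k : integ P (g k).
 apply: (@integ_bounded _ _ _ _ _ (k%:R ^+ 2)) => // w.
 by rewrite ger0_norm// /g ge_min lexx orbT.
have gB k : Ex P (g k) <= B.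
 apply/ler_addgt0Pr => e e0; pose e' := e / (2 * k%:R + 1).
 have k0 : 0 <= (k%:R : R) by [].
 have e'0 : 0 < e' by rewrite divr_gt0// ltr_wpDl// mulr_ge0.
 have [H [HL HB HI He]] := HG _ e'0.
 have H2 := L2_sqr_integ HL; have Ha := integ_abs HI.
 apply: (@le_trans _ _ (Ex P (fun w => H w ^+ 2 + 2 * k%:R * `|G w - H w|))).
  apply: Ex_le => //; first by apply: integD => //; exact: integZ.
  move=> w; rewrite /g; set x := G w; set y := H w.
  have [xk|xk] := leP (x ^+ 2) (k%:R ^+ 2).
   have xk' : `|x| <= k%:R.
    by rewrite -(@ler_pXn2r _ 2)// ?nnegrE// real_normK ?num_real.
   have E1 : x * (x - y) <= k%:R * `|x - y|.
    apply: le_trans (ler_norm _) _; rewrite normrM ler_wpM2r//.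
   by have := sqr_ge0 (x - y); nra.
  have [yk|yk] := leP (k%:R ^+ 2) (y ^+ 2).
   by rewrite -[leLHS]addr0 lerD// !mulr_ge0.
  have yk' : `|y| < k%:R.
   by rewrite -(@ltr_pXn2r _ 2)// ?nnegrE// real_normK ?num_real.
  have xk' : k%:R < `|x|.
   by rewrite -(@ltr_pXn2r _ 2)// ?nnegrE// real_normK ?num_real.
  have := ler_dist_dist x y; have := ler_norm (`|x| - `|y|).
  rewrite -[y ^+ 2]real_normK ?num_real//; have := normr_ge0 y; nra.
 rewrite ExD ?ExZ//; last exact: integZ.
 apply: lerD => //; apply: (@le_trans _ _ (2 * k%:R * e')).
  by rewrite ler_wpM2l ?mulr_ge0.
 have : e' * (2 * k%:R + 1) = e by rewrite divfK// gt_eqF// ltr_wpDl// mulr_ge0.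
 by move: e'0; nra.
have cvg w : (g k w)%:E @[k --> \oo] --> (G w ^+ 2)%:E.
 apply/fine_cvgP; split; first exact: nearW.
 apply: cvg_near_cst; near=> k; rewrite /= /g; apply/min_idPl.
 have : `|G w| <= k%:R by near: k; exact: nbhs_infty_ger.
 by rewrite -[G w ^+ 2]real_normK ?num_real// => Gk; rewrite lerXn2r ?nnegrE.
have := @cvg_monotone_convergence _ T R P setT measurableT (fun k w => (g k w)%:E)
 (fun k => (measurable_EFinP _ _).2 (mg k)) (fun k w _ => g0 k w).
move=> /(_ _) H.
have nd w : setT w -> {homo (fun k => (g k w)%:E) : n m / (n <= m)%N >-> (n <= m)%E}.
 move=> _ n m nm; rewrite lee_fin /g le_min ge_min lexx/= ge_min; apply/orP; right.
 by rewrite lerXn2r ?nnegrE ?ler_nat.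
have {}H := H nd.
rewrite /e2 (_ : (\int[P]_x (G x ^+ 2)%:E = \int[P]_x limn (fun k => (g k x)%:E))%E); last first.
 by apply: eq_integral => w _; apply/esym/cvg_lim.
rewrite -(cvg_lim _ H)//; apply: lime_le; first by apply/cvg_ex; eexists; exact: H.
by apply: nearW => k; rewrite (ExE (gi k)) lee_fin.
Unshelve. all: by end_near.
Qed.

(** The means differ by at most the L^1 distance, so centring doubles the error; hence the
    approximation is requested at e / 2. *)
Lemma e2_lsc_centered (S : T -> R) (B : R) : integ P S ->
 (forall e, 0 < e -> exists H, [/\ L2 P H, Ex P (fun w => (H w - Ex P H) ^+ 2) <= B &
   Ex P (fun w => `|S w - H w|) <= e]) ->
 (e2 P (fun w => S w - Ex P S)%R <= B%:E)%E.
Proof.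
move=> Si HS; apply: e2_lsc => [|e e0].
 by apply: measurable_funB => //; exact: integ_meas Si.
have e20 : 0 < e / 2 by rewrite divr_gt0.
have [H [HL HB He]] := HS _ e20; have Hi := L2_integ HL.
exists (fun w => H w - Ex P H); split => //.
- by apply: L2B => //; exact: L2_cst.
- by apply: integB; apply: integB => //; exact: integ_cst.
have iSH := integB Si Hi.
apply: (@le_trans _ _ (Ex P (fun w => `|S w - H w| + Ex P (fun w => `|S w - H w|)))).
 apply: Ex_le.
 - by apply: integ_abs; apply: integB; apply: integB => //; exact: integ_cst.
 - by apply: integD; [exact: integ_abs | exact: integ_cst].
 move=> w; have -> : S w - Ex P S - (H w - Ex P H) = (S w - H w) - (Ex P S - Ex P H) by ring.
 apply: le_trans (ler_normB _ _) _; rewrite lerD2l -ExB//; exact: Ex_abs.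
rewrite ExD ?Ex_cst; [lra|exact: integ_abs|exact: integ_cst].
Qed.

(** From y u - (y - x) (u - z) = y z + x u - x z. Young's inequality with weight s makes the share
    of Y and U small, at the cost of 1 / s in front of the errors p and q. *)
Lemma Ex_prod_diff (Y U p q : T -> R) (s : R) : 0 < s ->
 L2 P Y -> L2 P U -> L2 P p -> L2 P q ->
 Ex P (fun w => `|Y w * U w - (Y w - p w) * (U w - q w)|) <=
 s / 2 * (Ex P (fun w => Y w ^+ 2) + Ex P (fun w => U w ^+ 2)) +
 (s^-1 + 1) / 2 * (Ex P (fun w => p w ^+ 2) + Ex P (fun w => q w ^+ 2)).
Proof.
move=> s0 LY LU Lp Lq.
have [iY iU ip iq] := And4 (L2_sqr_integ LY) (L2_sqr_integ LU) (L2_sqr_integ Lp) (L2_sqr_integ Lq).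
have -> : s / 2 * (Ex P (fun w => Y w ^+ 2) + Ex P (fun w => U w ^+ 2)) +
 (s^-1 + 1) / 2 * (Ex P (fun w => p w ^+ 2) + Ex P (fun w => q w ^+ 2)) =
 Ex P (fun w => s / 2 * (Y w ^+ 2 + U w ^+ 2) + (s^-1 + 1) / 2 * (p w ^+ 2 + q w ^+ 2)).
 by rewrite ExD ?ExZ ?ExD//; do ?[by []|apply: integD|apply: integZ].
apply: Ex_le.
- apply: integ_abs; apply: integB; apply: L2M_integ => //; exact: L2B.
- by apply: integD; apply: integZ; apply: integD.
move=> w; set y := Y w; set u := U w; set x := p w; set z := q w.
have amgm (v t : R) : `|v * t| <= s / 2 * v ^+ 2 + s^-1 / 2 * t ^+ 2.
 rewrite normrM -[v ^+ 2]real_normK ?num_real// -[t ^+ 2]real_normK ?num_real//.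
 have := mulr_ge0 (ltW s0) (sqr_ge0 (`|v| - s^-1 * `|t|)).
 have E : s * s^-1 = 1 by rewrite divff// gt_eqF.
 move: (s^-1) E => si E; set V := `|v|; set W := `|t|.
 have -> : s * (V - si * W) ^+ 2 = s * V ^+ 2 - 2 * (s * si) * (V * W) + (s * si) * (si * W ^+ 2) by ring.
 rewrite E; lra.
have -> : y * u - (y - x) * (u - z) = y * z + x * u - x * z by ring.
apply: le_trans (ler_normB _ _) _; apply: le_trans (lerD (ler_normD _ _) (lexx _)) _.
have := amgm y z; have := amgm u x; rewrite [u * x]mulrC.
have : `|x * z| <= 1 / 2 * x ^+ 2 + 1 / 2 * z ^+ 2.
 rewrite normrM -[x ^+ 2]real_normK ?num_real// -[z ^+ 2]real_normK ?num_real//.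
 by have := sqr_ge0 (`|x| - `|z|); nra.
lra.
Qed.

End L2_limits.

Section box_sums.
Context {d} {T : measurableType d} {R : realType} (P : probability T R).
Context {V : finType} (S : {set V}).

(** Unconditional convergence may be read along boxes: a box larger than the sum of all coordinates
    occurring in [J0] contains [J0]. *)
Lemma L2_sum_box (F : {ffun V -> nat} -> T -> R) (Y : T -> R) :
 L2_sum P (offdiag S) F Y -> forall e, 0 < e -> exists M0, forall M, (M0 <= M)%N ->
 (e2 P (fun w => Y w - \sum_(i : {ffun V -> 'I_M.+1} | offb S i) F (tonat i) w)%R < e%:E)%E.
Proof.
move=> FY e e0; have [J0 J0S HJ] := FY _ e0.
exists (\sum_(i <- J0) \sum_v i v)%N => M M0M.
pose s := [seq tonat i | i <- enum (@offb V M.+1 S)].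
pose J := seq_fset tt s.
have inj : injective (@tonat V M.+1).
 by move=> i j /ffunP E; apply/ffunP => v; apply/val_inj; have := E v; rewrite !ffunE.
have us : uniq s by rewrite map_inj_uniq// enum_uniq.
have offJ : {in J, forall i, offdiag S i}.
 move=> i; rewrite seq_fsetE => /mapP[j]; rewrite mem_enum => oj ->; split.
  by move=> v; rewrite ffunE; exact: offb_pos.
 by move=> v w vS wS; rewrite !ffunE => /val_inj; exact: (offb_inj oj).
have sub : (J0 `<=` J)%fset.
 apply/fsubsetP => i iJ0; rewrite seq_fsetE.
 have [ipos iinj] := J0S _ iJ0.
 have iM v : (i v < M.+1)%N.
  rewrite ltnS; apply: leq_trans M0M; rewrite (big_fsetD1 i)//= (bigD1 v)//= -addnA.
  exact: leq_addr.
 apply/mapP; exists [ffun v => Ordinal (iM v)]; last by apply/ffunP => v; rewrite !ffunE.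
 rewrite mem_enum; apply/andP; split.
  by apply/forallP => v; rewrite ffunE/=; apply/eqP; exact: ipos.
 apply/forall_inP => v vS; apply/forall_inP => w wS; rewrite !ffunE; apply/implyP.
 by move=> /eqP/(congr1 val)/= /iinj => /(_ vS wS) ->.
have := HJ J offJ sub; rewrite unlock /e2; congr (_ < _)%E.
apply: eq_integral => w _; congr ((_ - _) ^+ 2)%:E.
rewrite (perm_big s); last first.
 by apply: uniq_perm; rewrite ?fset_uniq// => i; rewrite seq_fsetE.
by rewrite /= big_map big_enum.
Qed.

End box_sums.

(** * Truncated chaoses of two-sided noise *)

Section noise.
Context {d} {T : measurableType d} {R : realType} (P : probability T R).
Variable eps : int -> {RV P >-> R}.
Hypothesis eps_indep : mutually_independent P (fun i : int => eps i : T -> R).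

Lemma indep_shift (c : int) : mutually_independent P (fun z : nat => eps (z%:Z + c) : T -> R).
Proof.
move=> J A mA.
have := @eps_indep [fset (z%:Z + c : int) | z in J]%fset (fun i => A `|(i - c)|%N) (fun i => mA _).
rewrite big_imfset/=; last by move=> x y _ _ /addIr [].
rewrite (eq_bigr (fun i : nat => P (eps (i%:Z + c) @^-1` A i))); last first.
 by move=> i _; rewrite addrK.
move=> <-; congr (P _); apply/seteqP; split=> w H /=.
 by move=> i /imfsetP[z /= zJ ->]; rewrite addrK; exact: H.
by move=> z zJ; have := H (z%:Z + c); rewrite addrK; apply; apply/imfsetP; exists z.
Qed.

Definition chaosT (V : finType) (A : {set V}) (a : {ffun V -> nat} -> R) (e : V -> R -> R)
  M (N : nat) w : R :=
 \sum_(i : {ffun V -> 'I_M.+1} | offb A i)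
   a (tonat i) * \prod_(v in A) e v (eps (N%:Z - (tonat i v)%:Z) w).

(** Moving the origin to a0 - M reduces noise indexed by the integers to noise indexed by the
    naturals. *)
Lemma chaosTE (V : finType) (A : {set V}) a (e : V -> R -> R) M (a0 n : nat) :
 chaosT A a e M (a0 + n) =
 chaosM A a e (fun z => eps (z%:Z + (a0%:Z - M%:Z))) M n.
Proof.
apply/funext => w; apply: eq_bigr => i _; congr (_ * _); apply: eq_bigr => v _.
rewrite ffunE; congr (e v (eps _ w)).
by move: (ltn_ord (i v)); move: (nat_of_ord (i v)) => k kM; clear -kM; lia.
Qed.

End noise.

Section trivial_factor.
Context {d} {T : measurableType d} {R : realType}.

(** A chaos over no variables with coefficient 1 is the constant 1. A single chaos is treated as a
    product with this second factor, and the estimates for pairs apply to it. *)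
Definition triv_e (v : 'I_0) (x : R) : R := 0.
Definition triv_u (i : {ffun 'I_0 -> nat}) : R := 1.

Lemma chaosM_triv (X : nat -> T -> R) M n w :
 chaosM (finset.set0 : {set 'I_0}) triv_u triv_e X M n w = 1.
Proof.
have u0 (i j : {ffun 'I_0 -> 'I_M.+1}) : i = j by apply/ffunP => -[].
rewrite /chaosM (big_pred1 [ffun=> ord0])/=; last first.
 move=> i; rewrite (u0 i [ffun=> ord0]) /offb /= eqxx; apply/andP; split.
  by apply/forallP => -[].
 by apply/forall_inP => -[].
by rewrite big_set0 mulr1.
Qed.

Lemma powbound_triv (q : R) : powbound (finset.set0 : {set 'I_0}) triv_u q 1.
Proof. by move=> e e0 es i _; rewrite big_set0 mulr1 normr1. Qed.

End trivial_factor.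

Section noise_windows.
Context {d} {T : measurableType d} {R : realType} (P : probability T R).
Variable eps : int -> {RV P >-> R}.
Hypothesis eps_indep : mutually_independent P (fun i : int => eps i : T -> R).

Section single.
Context {V : finType} (A : {set V}) (a : {ffun V -> nat} -> R) (e : V -> R -> R) (K : R).
Hypothesis K1 : 1 <= K.
Hypothesis me : forall v, mfunT (e v).
Hypothesis e0 : forall v z, v \in A -> Ex P (fun w => e v (eps z w)) = 0.
Hypothesis es2 : forall v z, v \in A -> (e2 P (fun w => e v (eps z w)) <= K%:E)%E.

Let X M (a0 : nat) (z : nat) : {RV P >-> R} := eps (z%:Z + (a0%:Z - M%:Z)).

Let me0 (v : 'I_0) : mfunT (@triv_e R v). Proof. by case: v. Qed.

Let chaosT_form M (N : nat) : chaosT eps A a e M N =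
 form (X M N) A finset.set0 e (@triv_e R)
  (@coef2 R V 'I_0 A finset.set0 a (@triv_u R) 1 M)
  (@site1 V 'I_0 A finset.set0 1 M) (@site2 V 'I_0 A finset.set0 1 M).
Proof.
rewrite -window_formE -[N in LHS]addn0 chaosTE; apply/funext => w.
by rewrite big_ord_recl big_ord0 addr0 chaosM_triv mulr1.
Qed.

Lemma L2_chaosT M N : L2 P (chaosT eps A a e M N).
Proof.
rewrite chaosT_form; apply: (@L2_form _ _ _ _ _ (indep_shift eps_indep _) _ _ _ _ _ _ _ _ me me0 K K1).
- by move=> v z; exact: es2.
- by move=> v z; rewrite inE.
- by move=> v v' z _; rewrite inE.
- exact: site1_inj.
- exact: site2_inj.
Qed.

Lemma Ex_chaosT M N : (0 < #|A|)%N -> Ex P (chaosT eps A a e M N) = 0.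
Proof.
move=> /card_gt0P[v vA]; rewrite chaosT_form /form.
have Xi := indep_shift eps_indep (N%:Z - M%:Z).
have s2 (v0 : 'I_0) (z : nat) : v0 \in (finset.set0 : {set 'I_0}) ->
  (e2 P (fun w => triv_e v0 (X M N z w)) <= K%:E)%E by rewrite inE.
have s12 v0 (v' : 'I_0) (z : nat) : v0 \in A -> v' \in (finset.set0 : {set 'I_0}) ->
  (e2 P (fun w => e v0 (X M N z w) * triv_e v' (X M N z w))%R <= K%:E)%E by rewrite inE.
have s1 v0 (z : nat) : v0 \in A -> (e2 P (fun w => e v0 (X M N z w)) <= K%:E)%E by move=> vA'; exact: es2.
have z1 v0 (z : nat) : v0 \in A -> Ex P (fun w => e v0 (X M N z w)) = 0 by move=> vA'; exact: e0.
set p1 := @site1 _ _ _ _ _ _; set p2 := @site2 _ _ _ _ _ _.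
have i1 : forall l, {in A &, injective (p1 l)} by exact: site1_inj.
have i2 : forall l, {in finset.set0 &, injective (p2 l)} by exact: site2_inj.
have Lm l : L2 P (mono (X M N) A finset.set0 e (@triv_e R) p1 p2 l).
 have := @L2_form _ _ _ _ _ Xi _ _ _ _ _ _ _ _ me me0 K K1 s1 s2 s12
  (fun l' => (l' == l)%:R) p1 p2 i1 i2.
 rewrite /form; congr (L2 P _); apply/funext => w.
 rewrite (bigD1 l)//= eqxx mul1r big1 ?addr0// => l' /negbTE ->; exact: mul0r.
rewrite Ex_big; last by move=> l _; apply/integZ/L2_integ.
rewrite big1// => l _; rewrite ExZ; last exact: L2_integ.
by rewrite (@Ex_mono0 _ _ _ _ _ Xi _ _ _ _ _ _ _ _ me me0 K K1 z1 s1 s2 s12 p1 p2 i1 i2 l v)// mulr0.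
Qed.

Variables (Y : nat -> T -> R).
Hypothesis mY : forall N, mfunT (Y N).
Hypothesis Ysum : forall N, L2_sum P (offdiag A)
 (fun i w => a i * \prod_(v in A) e v (eps (N%:Z - (i v)%:Z) w)) (Y N).

Lemma chaosT_cvg N (r : R) : 0 < r -> exists M0, forall M, (M0 <= M)%N ->
 L2 P (fun w => Y N w - chaosT eps A a e M N w) /\
 Ex P (fun w => (Y N w - chaosT eps A a e M N w) ^+ 2) <= r.
Proof.
move=> r0; have [M0 HM] := L2_sum_box (@Ysum N) r0; exists M0 => M M0M.
have H := HM _ M0M; have L : L2 P (fun w => Y N w - chaosT eps A a e M N w).
 split; first by apply: measurable_funB => //; have [] := L2_chaosT M N.
 by apply: lt_trans H _; rewrite ltry.
by split=> //; rewrite -lee_fin -L2_e2E//; exact: ltW.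
Qed.

Lemma L2_chaos N : L2 P (Y N).
Proof.
have [M0 /(_ _ (leqnn M0)) [L _]] := chaosT_cvg N (@ltr01 R).
have := L2D L (L2_chaosT M0 N); congr (L2 P _).
by apply/funext => w; rewrite subrK.
Qed.

Lemma Ex_chaos N : (0 < #|A|)%N -> Ex P (Y N) = 0.
Proof.
move=> A0; apply/eqP; rewrite -sqrf_eq0; apply/eqP/le_anti; rewrite sqr_ge0 andbT.
apply/ler_addgt0Pr => r r0; rewrite add0r.
have [M0 /(_ _ (leqnn M0)) [L Hr]] := chaosT_cvg N r0; apply: le_trans Hr.
apply: le_trans (Ex_sqr_le L).
rewrite ExB ?Ex_chaosT// ?subr0//; apply: L2_integ; [exact: L2_chaos|exact: L2_chaosT].
Qed.

End single.

End noise_windows.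

(** * Windows of untruncated products *)

Section pair_window.
Context {d} {T : measurableType d} {R : realType} (P : probability T R).
Variable eps : int -> {RV P >-> R}.
Hypothesis eps_indep : mutually_independent P (fun i : int => eps i : T -> R).
Context {V1 V2 : finType} (A1 : {set V1}) (A2 : {set V2}).
Variables (a : {ffun V1 -> nat} -> R) (u : {ffun V2 -> nat} -> R).
Variables (e1 : V1 -> R -> R) (e2' : V2 -> R -> R) (K : R).
Hypothesis K1 : 1 <= K.
Hypothesis m1 : forall v, mfunT (e1 v).
Hypothesis m2 : forall v, mfunT (e2' v).
Hypothesis z1 : forall v z, v \in A1 -> Ex P (fun w => e1 v (eps z w)) = 0.
Hypothesis z2 : forall v z, v \in A2 -> Ex P (fun w => e2' v (eps z w)) = 0.
Hypothesis s1 : forall v z, v \in A1 -> (e2 P (fun w => e1 v (eps z w)) <= K%:E)%E.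
Hypothesis s2 : forall v z, v \in A2 -> (e2 P (fun w => e2' v (eps z w)) <= K%:E)%E.
Hypothesis s12 : forall v v' z, v \in A1 -> v' \in A2 ->
 (e2 P (fun w => (e1 v (eps z w) * e2' v' (eps z w))%R) <= K%:E)%E.
Variables (Y U : nat -> T -> R).
Hypothesis mY : forall N, mfunT (Y N).
Hypothesis mU : forall N, mfunT (U N).
Hypothesis Ysum : forall N, L2_sum P (offdiag A1)
 (fun i w => a i * \prod_(v in A1) e1 v (eps (N%:Z - (i v)%:Z) w)) (Y N).
Hypothesis Usum : forall N, L2_sum P (offdiag A2)
 (fun i w => u i * \prod_(v in A2) e2' v (eps (N%:Z - (i v)%:Z) w)) (U N).

Let LY N : L2 P (Y N). Proof. exact: (L2_chaos eps_indep K1 m1 s1 mY Ysum). Qed.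
Let LU N : L2 P (U N). Proof. exact: (L2_chaos eps_indep K1 m2 s2 mU Usum). Qed.

Lemma prod_approx N (e : R) : 0 < e -> exists M0, forall M, (M0 <= M)%N ->
 Ex P (fun w => `|Y N w * U N w -
  chaosT eps A1 a e1 M N w * chaosT eps A2 u e2' M N w|) <= e.
Proof.
move=> e0; pose E0 := Ex P (fun w => Y N w ^+ 2) + Ex P (fun w => U N w ^+ 2).
have E00 : 0 <= E0 by apply: addr_ge0; apply: Ex_ge0 => w; exact: sqr_ge0.
(* This s makes the part with the fixed second moments of Y and U at most e / 2. The tolerance r of
   the truncations is chosen afterwards, since its factor contains 1 / s. *)
pose s := e / (E0 + 1).
have E1 : 0 < E0 + 1 by rewrite ltr_wpDl.
have s0 : 0 < s by rewrite divr_gt0.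
pose r := e / (2 * (s^-1 + 1)).
have si : 0 < s^-1 + 1 by rewrite addr_gt0 ?invr_gt0.
have r0 : 0 < r by rewrite divr_gt0// mulr_gt0.
have [M1 H1] := chaosT_cvg eps_indep K1 m1 s1 mY Ysum N r0.
have [M2 H2] := chaosT_cvg eps_indep K1 m2 s2 mU Usum N r0.
exists (maxn M1 M2) => M; rewrite geq_max => /andP[M1M M2M].
have [L1 B1] := H1 _ M1M; have [L2' B2] := H2 _ M2M.
have := Ex_prod_diff s0 (LY N) (LU N) L1 L2'.
rewrite -/E0; under eq_fun do rewrite ![_ - (_ - _)]subKr.
move=> H; apply: le_trans H _.
have sE : s * (E0 + 1) = e by rewrite /s divfK// gt_eqF.
have rE : (s^-1 + 1) * (2 * r) = e.
 by rewrite mulrA mulrC [_ * 2]mulrC /r divfK// mulf_neq0// gt_eqF.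
apply: (@le_trans _ _ (e / 2 + e / 2)); last by lra.
apply: lerD; first by have := mulr_ge0 (ltW s0) E00; lra.
apply: (@le_trans _ _ ((s^-1 + 1) / 2 * (r + r))).
 by rewrite ler_wpM2l ?lerD// divr_ge0// ltW.
by rewrite -rE; lra.
Qed.

Variables (ka ku ca cu q : R).
Hypotheses (A10 : (0 < #|A1|)%N) (ca0 : 0 <= ca) (cu0 : 0 <= cu).
Hypotheses (pa : powbound A1 a ka ca) (pu : powbound A2 u ku cu).
Hypotheses (kaI : 0 < ka < 1 / 2) (q0 : 0 < q) (kaq : ka + q < 1 / 2).
Hypothesis qku : q <= ku.

(** The variance bound is known for truncations only. Each product converges in L^1, with error e /
    (b + 1) per time, and the bound survives by lower semicontinuity because its constant ignores
    the truncation. *)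
Lemma pair_window : exists2 C : R, 0 < C & forall a0 b : nat,
 (e2 P (fun w => \sum_(n < b) (Y (a0 + n) w * U (a0 + n) w -
   Ex P (fun w => Y (a0 + n) w * U (a0 + n) w)))%R <=
 (C * b%:R `^ (2 - (if #|A2| == 0%N then 2 * ka else 2 * ka + q)))%:E)%E.
Proof.
have [C C0 HC] := window_variance A10 ca0 cu0 pa pu kaI q0 kaq qku K1.
exists C => // a0 b.
have iYU n : integ P (fun w => Y n w * U n w) by apply: L2M_integ.
pose S w := \sum_(n < b) (Y (a0 + n)%N w * U (a0 + n)%N w).
have iS : integ P S by apply: integ_big => n _; exact: iYU.
have -> : (fun w => \sum_(n < b) (Y (a0 + n) w * U (a0 + n) w -
   Ex P (fun w => Y (a0 + n) w * U (a0 + n) w))) = (fun w => S w - Ex P S).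
 by apply/funext => w; rewrite Ex_big// sumrB.
apply: e2_lsc_centered => // e e0.
pose e' := e / b.+1%:R; have e'0 : 0 < e' by rewrite divr_gt0.
have [M0 HM0] := choice (fun n : nat => prod_approx (a0 + n)%N e'0).
pose M := (\sum_(n < b) M0 n)%N.
have HM (n : 'I_b) : (M0 n <= M)%N by rewrite /M (bigD1 n)//= leq_addr.
pose X z : {RV P >-> R} := eps (z%:Z + (a0%:Z - M%:Z)).
have [LF VF] := HC _ _ P X e1 e2' b M (indep_shift eps_indep _) m1 m2
 (fun v z => z1 (z%:Z + (a0%:Z - M%:Z))) (fun v z => z2 (z%:Z + (a0%:Z - M%:Z)))
 (fun v z => s1 (z%:Z + (a0%:Z - M%:Z))) (fun v z => s2 (z%:Z + (a0%:Z - M%:Z)))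
 (fun v v' z => s12 (z%:Z + (a0%:Z - M%:Z))).
set F := (F in L2 P F) in LF VF.
exists F; split => //.
have LT1 n : L2 P (chaosT eps A1 a e1 M n) by exact: (L2_chaosT eps_indep _ K1 m1 s1).
have LT2 n : L2 P (chaosT eps A2 u e2' M n) by exact: (L2_chaosT eps_indep _ K1 m2 s2).
have iD (n : 'I_b) : integ P (fun w => `|Y (a0 + n)%N w * U (a0 + n)%N w -
  chaosT eps A1 a e1 M (a0 + n) w * chaosT eps A2 u e2' M (a0 + n) w|).
 by apply/integ_abs/integB => //; exact: L2M_integ.
apply: (@le_trans _ _ (Ex P (fun w => \sum_(n < b) `|Y (a0 + n)%N w * U (a0 + n)%N w -
  chaosT eps A1 a e1 M (a0 + n) w * chaosT eps A2 u e2' M (a0 + n) w|))).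
 apply: Ex_le; [|by apply: integ_big => n _; exact: iD|].
  by apply/integ_abs/integB => //; exact: L2_integ.
 move=> w; rewrite /S /F -sumrB; apply: le_trans (ler_norm_sum _ _ _) _.
 by apply: ler_sum => n _; rewrite !chaosTE.
rewrite Ex_big; last by move=> n _; exact: iD.
apply: (@le_trans _ _ (\sum_(n < b) e')).
 by apply: ler_sum => n _; apply: HM0; exact: HM.
rewrite sumr_const card_ord -mulr_natr /e' mulrAC ler_pdivrMr//.
by rewrite ler_wpM2l ?ler_nat// ltW.
Qed.

End pair_window.

Section single_window.
Context {d} {T : measurableType d} {R : realType} (P : probability T R).
Variable eps : int -> {RV P >-> R}.
Hypothesis eps_indep : mutually_independent P (fun i : int => eps i : T -> R).
Context {V : finType} (A : {set V}) (a : {ffun V -> nat} -> R) (e : V -> R -> R) (K : R).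
Hypothesis K1 : 1 <= K.
Hypothesis me : forall v, mfunT (e v).
Hypothesis e0 : forall v z, v \in A -> Ex P (fun w => e v (eps z w)) = 0.
Hypothesis es2 : forall v z, v \in A -> (e2 P (fun w => e v (eps z w)) <= K%:E)%E.
Variables (Y : nat -> T -> R).
Hypothesis mY : forall N, mfunT (Y N).
Hypothesis Ysum : forall N, L2_sum P (offdiag A)
 (fun i w => a i * \prod_(v in A) e v (eps (N%:Z - (i v)%:Z) w)) (Y N).
Variables (ka ca : R).
Hypotheses (A0 : (0 < #|A|)%N) (ca0 : 0 <= ca).
Hypotheses (pa : powbound A a ka ca) (kaI : 0 < ka < 1 / 2).

(** The pair estimate with a second factor over no variables. The exponent q only has to be
    admissible there, and half of 1/2 - ka is. *)
Lemma single_window : exists2 C : R, 0 < C & forall a0 b : nat,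
 (e2 P (fun w => \sum_(n < b) Y (a0 + n) w)%R <= (C * b%:R `^ (2 - 2 * ka))%:E)%E.
Proof.
pose U (N : nat) (w : T) : R := 1.
have Usum N : L2_sum P (offdiag (finset.set0 : {set 'I_0}))
  (fun i w => @triv_u R i * \prod_(v in finset.set0) @triv_e R v (eps (N%:Z - (i v)%:Z) w)) (U N).
 move=> r r0; pose i0 : {ffun 'I_0 -> nat} := [ffun=> 0%N].
 have iE (i : {ffun 'I_0 -> nat}) : i = i0 by apply/ffunP => -[].
 exists [fset i0]%fset; first by move=> i _; split=> -[].
 move=> J _ J0; have -> : J = [fset i0]%fset.
  apply/eqP; rewrite eqEfsubset J0 andbT; apply/fsubsetP => i _.
  by rewrite (iE i) inE.
 rewrite unlock; under eq_integral => w _ do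
  rewrite big_seq_fset1 big_set0 mulr1 /triv_u /U subrr expr0n/=.
 by rewrite integral0 lte_fin.
have q0 : 0 < (1 / 2 - ka) / 2 by move/andP: kaI; lra.
have kaq : ka + (1 / 2 - ka) / 2 < 1 / 2 by move/andP: kaI; lra.
have [C C0 HC] := @pair_window _ _ _ P eps eps_indep V 'I_0 A finset.set0 a (@triv_u R) e (@triv_e R)
 K K1 me (fun v => ltac:(by case: v)) e0 (fun v z h => ltac:(by rewrite inE in h)) es2
 (fun v z h => ltac:(by rewrite inE in h)) (fun v v' z _ h => ltac:(by rewrite inE in h)) Y U mY
 (fun N => measurable_cst _) Ysum Usum ka ((1 / 2 - ka) / 2) ca 1 ((1 / 2 - ka) / 2)
 A0 ca0 ler01 pa (@powbound_triv R _) kaI q0 kaq (lexx _).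
exists C => // a0 b; have := HC a0 b; rewrite cards0 eqxx.
congr (_ <= _)%E; apply: eq_e2 => w; apply: eq_bigr => n _.
rewrite /U mulr1; under eq_Ex do rewrite mulr1.
by rewrite (Ex_chaos eps_indep K1 me e0 es2 mY Ysum)// subr0.
Qed.

End single_window.

(** * Absolutely convergent sums over multi-indices *)

Section absolute_sums.
Context {R : realType}.

Lemma abs_sum_le (I : choiceType) (D : set I) (f : I -> R) (B : R) :
 (\esum_(i in D) `|f i|%:E <= B%:E)%E -> `|abs_sum D f| <= B.
Proof.
move=> fB.
have part (h : I -> R) : (forall i, 0 <= h i <= `|f i|) ->
  0 <= fine (\esum_(i in D) (h i)%:E) <= B.
 move=> h0; have H0 : (0 <= \esum_(i in D) (h i)%:E)%E.
  by apply: esum_ge0 => i _; rewrite lee_fin; case/andP: (h0 i).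
 have HB : (\esum_(i in D) (h i)%:E <= B%:E)%E.
  by apply: le_trans fB; apply: le_esum => i _; rewrite lee_fin; case/andP: (h0 i).
 have fin : (\esum_(i in D) (h i)%:E)%E \is a fin_num.
  by rewrite ge0_fin_numE//; exact: le_lt_trans HB (ltry _).
 by rewrite -!lee_fin fineK// H0.
have /andP[p0 pB] : 0 <= fine (\esum_(i in D) (Num.max (f i) 0)%:E) <= B.
 by apply: part => i; rewrite le_max lexx orbT/= ge_max normr_ge0 ler_norm.
have /andP[n0 nB] : 0 <= fine (\esum_(i in D) (Num.max (- f i) 0)%:E) <= B.
 by apply: part => i; rewrite le_max lexx orbT/= ge_max normr_ge0 -normrN ler_norm.
by rewrite /abs_sum ler_norml; lra.
Qed.

(** Every finite set of indices lies in a box, and over a box a product weight sums to a product of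
    one-variable sums. *)
Lemma esum_box (V : finType) (D : set {ffun V -> nat}) (f : {ffun V -> nat} -> R)
  (c : R) (h : V -> nat -> R) (C : V -> R) : 0 <= c ->
 (forall v x, 0 <= h v x) ->
 (forall j, D j -> 0 <= f j <= c * \prod_v h v (j v)) ->
 (forall v M, \sum_(x < M.+1) h v x <= C v) ->
 (\esum_(j in D) (f j)%:E <= (c * \prod_v C v)%:E)%E.
Proof.
move=> c0 h0 fh hC; apply: ge_ereal_sup => _ [J [finJ JD] <-].
rewrite fsbig_finite//= sumEFin lee_fin.
set s := fset_set J.
have sD j : j \in s -> D j by rewrite in_fset_set// inE => /JD.
pose M := (\sum_(j <- s) \sum_v j v)%N.
have jM j v : j \in s -> (j v < M.+1)%N.
 by move=> js; rewrite ltnS /M (big_fsetD1 j)//= (bigD1 v)//= -addnA leq_addr.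
pose G (j : {ffun V -> 'I_M.+1}) := \prod_v h v (j v).
have G0 j : 0 <= G j by apply: prodr_ge0.
apply: (@le_trans _ _ (c * \sum_(j : {ffun V -> 'I_M.+1}) G j)).
 rewrite mulr_sumr.
 pose t (j : {ffun V -> nat}) : {ffun V -> 'I_M.+1} := [ffun v => inord (j v)].
 apply: (@le_trans _ _ (\sum_(j <- [seq t j | j <- s]) c * G j)).
  rewrite big_map big_seq [leRHS]big_seq; apply: ler_sum => j js.
  have /andP[_ le] := fh _ (sD _ js); apply: le_trans le _.
  rewrite le_eqVlt; apply/orP; left; apply/eqP; congr (_ * _); apply: eq_bigr => v _.
  by rewrite /t ffunE inordK// jM.
 have tinj : {in s &, injective t}.
  move=> i j si sj /ffunP E; apply/ffunP => v; have := E v.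
  by rewrite !ffunE => /(congr1 val); rewrite /= !inordK ?jM.
 rewrite -big_enum/= [leRHS](bigID (mem [seq t j | j <- s]))/= -[leLHS]addr0 lerD//; last first.
  by apply: sumr_ge0 => i _; rewrite mulr_ge0.
 rewrite le_eqVlt; apply/orP; left; apply/eqP; rewrite -[RHS]big_filter; apply: perm_big.
 apply: uniq_perm.
 - by rewrite map_inj_in_uniq// fset_uniq.
 - by rewrite filter_uniq// enum_uniq.
 - by move=> i; rewrite mem_filter mem_enum andbT.
rewrite ler_wpM2l// -(bigA_distr_bigA (fun v (x : 'I_M.+1) => h v x))/=.
by apply: ler_prod => v _; rewrite hC andbT sumr_ge0.
Qed.

End absolute_sums.

(** * Homogeneity of coefficients after variables are summed out *)

Section coefficient_bounds.
Context {R : realType} {k : nat}.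
Variables (a : {ffun 'I_k -> nat} -> R) (alpha c : R).
Hypotheses (c0 : 0 <= c) (k0 : (0 < k)%N) (alpha0 : alpha <= 0).
Hypothesis ale : forall i : {ffun 'I_k -> nat}, (forall q, 0 < i q)%N ->
 `|a i| <= c * (\sum_q i q)%N%:R `^ alpha.

Let prod_powN (W : finType) (B : {set W}) (e : W -> R) (i : W -> nat) (s : nat) :
 (forall v, 0 <= e v) -> (forall v, v \in B -> 0 < i v <= s)%N ->
 s%:R `^ (- \sum_(v in B) e v) <= \prod_(v in B) (i v)%:R `^ (- e v).
Proof.
move=> e0 iB; have [->|/set0Pn[v0 v0B]] := eqVneq B finset.set0.
 by rewrite !big_set0 oppr0 powRr0.
have s0 : (0 < s)%N by have /andP[] := iB _ v0B; exact: leq_trans.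
rewrite -sumrN; have -> : s%:R `^ (\sum_(v in B) - e v) = \prod_(v in B) s%:R `^ (- e v) :> R.
 apply: (big_morph (fun x => s%:R `^ x) _ (powRr0 _)) => x y.
 by rewrite powRD// pnatr_eq0 -lt0n s0 implybT.
apply: ler_prod => v vB; rewrite powR_ge0/=; have /andP[iv is'] := iB _ vB.
by rewrite !powRN lef_pV2 ?posrE ?powR_gt0 ?ltr0n// ge0_ler_powR ?nnegrE ?ler_nat.
Qed.

(** The index sum dominates every single index, so its power alpha can be distributed over the
    variables with any weights of total at most - alpha. *)
Lemma powbound_hom : powbound [set: 'I_k]%SET a (- alpha - k%:R / 2) c.
Proof.
move=> e e0; rewrite cardsT card_ord => es i ipos.
have i0 q : (0 < i q)%N by rewrite -ipos inE.
apply: le_trans (ale i0) _; rewrite ler_wpM2l//.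
apply: (@le_trans _ _ ((\sum_q i q)%N%:R `^ (- \sum_(q in [set: 'I_k]%SET) e q))).
 rewrite ler_powR//; first by rewrite ler1n (bigD1 (Ordinal k0))//= addn_gt0 i0.
 by move: es; lra.
apply: prod_powN => // v _; rewrite i0/= (bigD1 v)//= leq_addr//.
Qed.

Variables (mu : nat -> R) (pi : {set {set 'I_k}}) (l : {ffun {set 'I_k} -> 'I_k.+1}) (kappa : R).
Hypotheses (mu1 : mu 1%N = 0) (pip : is_partition pi) (lp : expansion pi l).
Hypotheses (kappa0 : 0 < kappa) (alphaE : alpha = - (k%:R / 2 + 2 * kappa)).

(** Of the excess 2 kappa one half pays for convergence over the blocks that are summed out, and the
    other half remains as the excess of the surviving variables. Blocks summed out hold at least two
    variables, so a weight 1 on each fits into the budget k / 2. *)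
Lemma reduced_bound : exists2 C : R, 0 <= C &
 powbound (remaining pi l) (reduced_coef mu a pi l) kappa C.
Proof.
pose coef := expansion_coef mu pi l.
set rem := remaining pi l; pose B0 := (pi :\: rem)%SET.
(* Exponent on a block that is summed out: strictly above 1, while the surplus over all such blocks,
   at most k of them, does not exceed kappa. *)
pose gam := 1 + kappa / k%:R.
have k0' : 0 < k%:R :> R by rewrite ltr0n.
have gam1 : 1 < gam by rewrite ltrDl divr_gt0.
have [Cg Cg0 HCg] := sum_powRN_bounded gam1.
(* On a block summed out the weight vanishes at 0, since the index is positive there. On all other
   blocks [j] is 0, and the weight is the indicator of 0. *)
pose h (B : {set 'I_k}) (x : nat) : R :=
 if B \in B0 then (if x is y.+1 then y.+1%:R `^ (- gam) else 0) else (x == 0%N)%:R.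
have h0 B x : 0 <= h B x by rewrite /h; case: ifP => _; case: x => * //=; exact: powR_ge0.
pose CC (B : {set 'I_k}) : R := if B \in B0 then Cg else 1.
have hC B M : \sum_(x < M.+1) h B x <= CC B.
 rewrite /h /CC; case: ifP => _; rewrite big_ord_recl/=.
  by rewrite add0r; exact: HCg.
 by rewrite big1 ?addr0.
pose KC := `|coef| * c * \prod_B CC B.
have CC0 : 0 <= \prod_B CC B by apply: prodr_ge0 => B _; rewrite /CC; case: ifP => // _; exact: ltW.
exists KC; first by rewrite !mulr_ge0.
move=> e e0 es i ipos.
have P0 : 0 <= \prod_(v in rem) (i v)%:R `^ (- e v) by apply: prodr_ge0 => v _; exact: powR_ge0.
rewrite /KC /reduced_coef; apply: abs_sum_le.
rewrite -/rem -/coef mulrAC.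
(* A block that leaves exactly one power of the noise carries the factor [mu 1 = 0]. In particular
   singletons are never summed out, which is where the sums might fail to converge. *)
have [/existsP[B /andP[Bpi B1]]|] := boolP [exists B, (B \in pi) && (#|B| - l B == 1)%N].
 have -> : coef = 0.
  by rewrite /coef /expansion_coef (bigD1 B)//= (eqP B1) mu1 mulr0 mul0r.
 rewrite normr0 !mul0r; under eq_esum do rewrite mul0r normr0; by rewrite esum1.
rewrite negb_exists => /forallP noone.
apply: esum_box => //; first by rewrite !mulr_ge0.
move=> j [[jpos _] [joinpos joininj]]; rewrite normr_ge0/= normrM -!mulrA ler_wpM2l//.
set jn : {ffun {set 'I_k} -> nat} := [ffun B => (i B + j B)%N].
have jnpos q : (0 < [ffun q => jn (finset.pblock pi q)] q)%N.
 rewrite ffunE -joinpos; apply: pblock_mem.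
 by rewrite (cover_partition pip) inE.
apply: le_trans (ale jnpos) _; rewrite ler_wpM2l//.
pose e' B := if B \in B0 then gam else e B.
have e'0 B : 0 <= e' B by rewrite /e'; case: ifP => // _; lra.
have rempi : rem \subset pi by apply/fintype.subsetP => B; rewrite inE => /andP[].
have B0sz B : B \in B0 -> (2 <= #|B|)%N.
 rewrite !inE => /andP[H Bpi]; have lB : nat_of_ord (l B) = 0%N.
  by move: H; rewrite Bpi/= -leqNgt leqn0 => /eqP.
 have := noone B; rewrite Bpi lB subn0/= => B1.
 have Bne : B != finset.set0.
  by case/and3P: pip => _ _; apply: contraNneq => <-.
 by move: Bne B1; rewrite -card_gt0; case: #|B| => [|[]].
have szpi : (\sum_(B in pi) #|B| = k)%N by rewrite -(card_partition pip) cardsT card_ord.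
have pisplit (F : {set 'I_k} -> R) : \sum_(B in pi) F B = \sum_(B in rem) F B + \sum_(B in B0) F B.
 rewrite (bigID (mem rem))/=; congr (_ + _); apply: eq_bigl => B.
  by rewrite andb_idl//; move/fintype.subsetP: rempi; exact.
 by rewrite !inE andbC.
(* The budget: the remaining blocks use at most |rem| / 2 + kappa and the others at most |B0| +
   kappa, while 2 |B0| + |rem| is at most k. *)
have sumle : \sum_(B in pi) e' B <= - alpha.
 have kE : (k%:R : R) = \sum_(B in pi) #|B|%:R by rewrite -natr_sum szpi.
 have remcard : #|rem|%:R <= \sum_(B in rem) (#|B|%:R : R).
  rewrite -[leLHS]sumr_const; apply: ler_sum => B Br.
  rewrite ler1n card_gt0; have /fintype.subsetP/(_ _ Br) Bpi := rempi.
  by case/and3P: pip => _ _; apply: contraNneq => <-.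
 have B0card : #|B0|%:R * 2 <= \sum_(B in B0) (#|B|%:R : R).
  rewrite mulr_natl -[leLHS]sumr_const; apply: ler_sum => B Br.
  by rewrite ler_nat B0sz.
 have B0k : #|B0|%:R <= k%:R :> R.
  rewrite kE pisplit; have : 0 <= #|rem|%:R :> R by [].
  by have : 0 <= #|B0|%:R :> R by []; lra.
 have E1 : \sum_(B in rem) e' B = \sum_(B in rem) e B.
  by apply: eq_bigr => B Br; rewrite /e' inE Br.
 have E2 : \sum_(B in B0) e' B = #|B0|%:R * gam.
  rewrite mulr_natl -[RHS]sumr_const; apply: eq_bigr => B Br; by rewrite /e' Br.
 rewrite pisplit E1 E2 alphaE opprK kE pisplit.
 have : #|B0|%:R * gam <= #|B0|%:R + kappa.
  rewrite /gam mulrDr mulr1 lerD2l mulrCA ler_piMr//; first exact: ltW.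
  by rewrite ler_pdivrMr// mul1r.
 by move: es; rewrite -/rem; lra.
apply: (@le_trans _ _ ((\sum_q [ffun q => jn (finset.pblock pi q)] q)%N%:R `^ (- \sum_(B in pi) e' B))).
 apply: ler_powR; last by rewrite lerNr.
 by rewrite ler1n (bigD1 (Ordinal k0))//= addn_gt0 jnpos.
apply: (@le_trans _ _ (\prod_(B in pi) (jn B)%:R `^ (- e' B))).
 apply: prod_powN => // B Bpi; rewrite -joinpos Bpi/=.
 have /set0Pn[q qB] : B != finset.set0.
  by case/and3P: pip => _ _; apply: contraNneq => <-.
 case/and3P: (pip) => _ tI _.
 rewrite (bigD1 q)//= (_ : [ffun q => jn (finset.pblock pi q)] q = jn B) ?leq_addr//.
 by rewrite [LHS]ffunE (def_pblock tI Bpi qB).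
rewrite (bigID (mem rem))/=; apply: ler_pM.
- by apply: prodr_ge0 => B _; exact: powR_ge0.
- by apply: prodr_ge0 => B _; exact: powR_ge0.
- rewrite le_eqVlt; apply/orP; left; apply/eqP.
 apply: eq_big => [B|B /andP[Bpi Br]].
  by rewrite andb_idl//; move/fintype.subsetP: rempi; exact.
 have nB0 : B \notin B0 by rewrite inE Br.
 have jB : j B = 0%N by apply/eqP; rewrite -leqn0 leqNgt -jpos.
 by rewrite /e' (negbTE nB0) /jn ffunE jB addn0.
rewrite [leRHS](bigID (mem B0))/= [X in _ <= _ * X]big1 ?mulr1; last first.
 move=> B nB; rewrite /h (negbTE nB); have := jpos B; rewrite -/B0 (negbTE nB).
 by case: (j B).
rewrite le_eqVlt; apply/orP; left; apply/eqP.
apply: eq_big => [B|B /andP[Bpi nBr]]; first by rewrite !inE andbC.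
have BB0 : B \in B0 by rewrite inE nBr.
have iB : i B = 0%N by apply/eqP; rewrite -leqn0 leqNgt -ipos.
rewrite /h /e' BB0 /jn ffunE iB add0n; have := jpos B; rewrite -/B0 BB0.
by case: (j B).
Qed.

End coefficient_bounds.

(** * Moments of polynomials in the noise *)

Section polynomial_moments.
Context {R : realType}.

Lemma measurable_horner (p : {poly R}) : mfunT (fun x : R => p.[x]).
Proof.
under eq_fun do rewrite horner_coef.
apply: measurable_sum => i; apply: measurable_funM => //; exact: measurable_funX.
Qed.

Lemma horner_bound (p : {poly R}) (m : nat) : (size p <= m.+1)%N ->
 exists2 C : R, 0 <= C & forall x, `|p.[x]| <= C * (1 + `|x| ^+ m).
Proof.
move=> pm; exists (\sum_(i < size p) `|p`_i|); first exact: sumr_ge0.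
move=> x; rewrite horner_coef; apply: le_trans (ler_norm_sum _ _ _) _.
rewrite mulr_suml; apply: ler_sum => i _; rewrite normrM normrX ler_wpM2l//.
have [x1|x1] := leP `|x| 1.
 by rewrite -[leLHS]addr0 lerD// ?exprn_ge0// exprn_ile1.
rewrite -[leLHS]add0r lerD//; apply: ler_weXn2l; first exact: ltW.
by rewrite -ltnS; apply: leq_trans pm.
Qed.

Context {d} {T : measurableType d} (P : probability T R).
Variable eps : int -> {RV P >-> R}.

Lemma appell_size (X : T -> R) (k : nat) (A : nat -> {poly R}) (l : nat) :
 is_appell P X k A -> (l <= k)%N -> (size (A l) <= l.+1)%N.
Proof.
move=> [A0 AS]; elim: l => [_|l IH lk]; first by rewrite A0 size_poly1.
have [dA _] := AS l lk; apply/leq_sizeP => -[//|j] lj.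
have : (A l.+1)^`()`_j = 0.
 by rewrite dA coefZ (leq_sizeP _ _ (IH (ltnW lk))) ?mulr0.
by rewrite coef_deriv => /eqP; rewrite mulrn_eq0/= => /eqP.
Qed.

Lemma integ_pow (z : int) (k : nat) (s : R) : k%:R <= s ->
 ('E_P[fun w => (`|eps z w| `^ s)%R] < +oo)%E -> integ P (fun w => `|eps z w| ^+ k).
Proof.
move=> ks; rewrite unlock => fin.
have s0 : 0 <= s by apply: le_trans ks.
have mabs : mfunT (fun w => `|eps z w|) by apply: measurableT_comp.
have mp : mfunT (fun w => `|eps z w| `^ s).
 exact: (@measurableT_comp _ _ _ _ _ _ (fun y => y `^ s)).
have ip : integ P (fun w => `|eps z w| `^ s).
 apply/integrableP; split; first exact/measurable_EFinP.
 apply: le_lt_trans fin; rewrite le_eqVlt; apply/orP; left; apply/eqP.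
 by apply: eq_integral => w _; rewrite gee0_abs// lee_fin powR_ge0.
apply: (@integ_le _ _ _ _ _ (fun w => 1 + `|eps z w| `^ s)).
- exact: measurable_funX.
- move=> w; set x := `|eps z w|; have x0 : 0 <= x by exact: normr_ge0.
 have p0 : 0 <= x `^ s by exact: powR_ge0.
 rewrite ger0_norm ?exprn_ge0// ger0_norm ?addr_ge0//.
 have [x1|x1] := leP x 1; first by rewrite -[leLHS]addr0 lerD// exprn_ile1.
 by rewrite -[leLHS]add0r lerD// -powR_mulrn// ler_powR// ltW.
- by apply: integD => //; exact: integ_cst.
Qed.

Hypothesis eps_id : identically_distributed P (fun i : int => eps i : T -> R).

Lemma integral_id (z : int) (f : R -> \bar R) : mfunT f -> (forall y, 0 <= f y)%E ->
 (\int[P]_w f (eps z w) = \int[P]_w f (eps 0 w))%E.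
Proof.
move=> mf f0; rewrite -(ge0_integral_distribution (eps z) mf f0).
rewrite -(ge0_integral_distribution (eps 0) mf f0).
by apply: eq_measure_integral => A mA _; exact: eps_id.
Qed.

Lemma integ_id (z : int) (f : R -> R) : mfunT f ->
 integ P (fun w => f (eps 0 w)) -> integ P (fun w => f (eps z w)) /\
 Ex P (fun w => f (eps z w)) = Ex P (fun w => f (eps 0 w)).
Proof.
move=> mf /integrableP[_ fi].
have mfz y : mfunT (fun w => f (eps y w)) by exact: measurableT_comp.
have iz : integ P (fun w => f (eps z w)).
 apply/integrableP; split; first exact/measurable_EFinP.
 have := @integral_id z (fun y => `|f y|%:E); rewrite /= => -> //.
 by apply/measurable_EFinP; exact: measurableT_comp.
split=> //; rewrite /Ex.
have mE : mfunT (EFin \o f) by exact/measurable_EFinP.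
rewrite -(integral_distribution (X := eps z) mE iz).
rewrite -(integral_distribution (X := eps 0) mE); last first.
 by apply/integrableP; split; [exact/measurable_EFinP|].
by congr fine; apply: eq_measure_integral => A mA _; exact: eps_id.
Qed.

Variables (k : nat) (s : R).
Hypothesis ks : (2 * k + 2)%:R <= s.
Hypothesis eps_mom : ('E_P[fun w => (`|eps 0 w| `^ s)%R] < +oo)%E.

(** Degree k + 1 is allowed because a shared site multiplies the noise by an Appell polynomial of
    degree up to k. The square has degree 2 k + 2, the moment granted by [ks]. *)
Lemma L2_horner (p : {poly R}) (z : int) : (size p <= k.+2)%N ->
 L2 P (fun w => p.[eps z w]) /\
 e2 P (fun w => p.[eps z w]) = (Ex P (fun w => p.[eps 0 w] ^+ 2))%:E.
Proof.
move=> sp; have [C C0 HC] := horner_bound sp.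
have mp y : mfunT (fun w => p.[eps y w]).
 by apply: (measurableT_comp (measurable_horner p)); exact: measurable_funP.
have i2 : integ P (fun w => p.[eps 0 w] ^+ 2).
 apply: (@integ_le _ _ _ _ _ (fun w => (2 * C ^+ 2) * (1 + `|eps 0 w| ^+ (2 * k + 2)))).
 - exact: measurable_funX.
 - move=> w; set x := eps 0 w; rewrite ger0_norm ?sqr_ge0//.
  apply: le_trans (ler_norm _); rewrite -[leLHS]real_normK ?num_real//.
  apply: (@le_trans _ _ ((C * (1 + `|x| ^+ k.+1)) ^+ 2)).
   by rewrite lerXn2r ?nnegrE// mulr_ge0// addr_ge0// exprn_ge0.
  rewrite exprMn (_ : 2 * k + 2 = k.+1 * 2)%N; last by lia.
  rewrite exprM [2 * C ^+ 2]mulrC -[leRHS]mulrA ler_wpM2l ?sqr_ge0//.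
  by have := sqr_ge0 (`|x| ^+ k.+1 - 1); nra.
 - apply: integZ; apply: integD; first exact: integ_cst.
  exact: integ_pow ks eps_mom.
have m2 : mfunT (fun x : R => p.[x] ^+ 2).
 by apply: measurable_funX; exact: measurable_horner.
have [iz Ez] := integ_id z m2 i2.
have Lz : L2 P (fun w => p.[eps z w]) by exact: integ_sqr_L2.
by split=> //; rewrite L2_e2E// Ez.
Qed.

End polynomial_moments.

Section second_moment_sums.
Context {d} {T : measurableType d} {R : realType} (P : probability T R).

Lemma e2_sum (I : finType) (f : I -> T -> R) : (forall i, mfunT (f i)) ->
 (e2 P (fun w => \sum_i f i w)%R <= #|I|%:R%:E * \sum_i e2 P (f i))%E.
Proof.
move=> mf; rewrite ge0_sume_distrr//; last by move=> i _; exact: e2_ge0.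
have E i : (#|I|%:R%:E * e2 P (f i) = \int[P]_x (#|I|%:R * f i x ^+ 2)%:E)%E.
 rewrite /e2 -ge0_integralZl_EFin//; last by apply: measurable_sqr.
 by move=> x _; rewrite lee_fin sqr_ge0.
under eq_bigr do rewrite E.
rewrite -ge0_integral_sum//.
- apply: ge0_le_integral_any => x; first by rewrite lee_fin sqr_ge0.
 rewrite sumEFin lee_fin -mulr_sumr; exact: sqr_sum_le.
- by move=> i; apply/measurable_EFinP; apply: measurable_funM => //; exact: measurable_funX.
- by move=> i x _; rewrite lee_fin mulr_ge0// sqr_ge0.
Qed.

(** f vanishes almost everywhere, hence so does the product, without any moment of g. *)
Lemma e2_0_mul (f g : T -> R) : mfunT f -> mfunT g ->
 e2 P f = 0%E -> e2 P (fun w => g w * f w) = 0%E.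
Proof.
move=> mf mg f0.
have : (\int[P]_x `|(f x ^+ 2)%:E|)%E = 0%E.
 by rewrite -f0; apply: eq_integral => x _; rewrite gee0_abs// lee_fin sqr_ge0.
move/(ae_eq_integral_abs P measurableT) => /(_ (measurable_sqr mf)) ae0.
rewrite /e2 (ae_eq_integral (cst 0%E))//; first by rewrite integral0.
- by apply: measurable_sqr; exact: measurable_funM.
- move: ae0; apply: filterS => x /= H _; have /eqP := H I.
 by rewrite eqe sqrf_eq0 => /eqP ->; rewrite mulr0 expr0n.
Qed.

End second_moment_sums.

(** * The remainder X - E X - c_2 Y_1' *)

Section remainder.
Context {d} {T : measurableType d} {R : realType} (P : probability T R).
Variable eps : int -> {RV P >-> R}.
Hypothesis eps_indep : mutually_independent P (fun i : int => eps i : T -> R).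
Hypothesis eps_id : identically_distributed P (fun i : int => eps i : T -> R).
Hypothesis eps_mean : forall z, Ex P (eps z) = 0.
Variables (k1 k2 : nat) (s : R).
Hypotheses (k10 : (0 < k1)%N) (k20 : (0 < k2)%N).
Hypothesis ks : (2 * k2 + 2)%:R <= s.
Hypothesis eps_mom : ('E_P[fun w => (`|eps 0 w| `^ s)%R] < +oo)%E.
Variables (a1 : {ffun 'I_k1 -> nat} -> R) (a2 : {ffun 'I_k2 -> nat} -> R).
Variables (ka ku c1 c2 : R).
Hypotheses (c10 : 0 <= c1) (c20 : 0 <= c2).
Hypotheses (kaI : 0 < ka < 1 / 2) (ku0 : 0 < ku).
Hypothesis a1le : forall i : {ffun 'I_k1 -> nat}, (forall q, 0 < i q)%N ->
 `|a1 i| <= c1 * (\sum_q i q)%N%:R `^ (- (k1%:R / 2 + ka)).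
Hypothesis a2le : forall i : {ffun 'I_k2 -> nat}, (forall q, 0 < i q)%N ->
 `|a2 i| <= c2 * (\sum_q i q)%N%:R `^ (- (k2%:R / 2 + ku)).
Variable A : nat -> {poly R}.
Hypothesis Aapp : is_appell P (eps 0) k2 A.
Variables Y1 Y2 : nat -> {RV P >-> R}.
Hypothesis Y1c : forall n, is_offdiag_chaos P (fun i => eps i) a1 n (Y1 n).
Hypothesis Y2c : forall n, is_diag_chaos P (fun i => eps i) A a2 n (Y2 n).

Let mu := moment P (eps 0).
Let cc := mean_const mu a2.
Let id1 (_ : 'I_k1) (x : R) := x.
(** One bound for the second moments of the three kinds of local factors: eps, [A l] at eps, and
    their product. The summand 1 gives the normalisation 1 <= K. *)
Let K := 1 + Ex P (fun w => eps 0 w ^+ 2) +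
 \sum_(l < k2.+1) (Ex P (fun w => (A l).[eps 0 w] ^+ 2) +
          Ex P (fun w => ('X * A l).[eps 0 w] ^+ 2)).

Let Ex0 (f : T -> R) : 0 <= Ex P (fun w => f w ^+ 2).
Proof. by apply: Ex_ge0 => w; exact: sqr_ge0. Qed.

Let Asize (l : 'I_k2.+1) : (size (A l) <= k2.+1)%N.
Proof. by apply: leq_trans (appell_size Aapp _) _; rewrite ?ltnS// -ltnS. Qed.

Let K0 : 0 <= \sum_(l < k2.+1) (Ex P (fun w => (A l).[eps 0 w] ^+ 2) +
          Ex P (fun w => ('X * A l).[eps 0 w] ^+ 2)).
Proof. by apply: sumr_ge0 => l _; rewrite addr_ge0. Qed.

Let K1 : 1 <= K.
Proof. by rewrite /K -addrA lerDl addr_ge0. Qed.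

Let KA (l : 'I_k2.+1) : Ex P (fun w => (A l).[eps 0 w] ^+ 2) +
 Ex P (fun w => ('X * A l).[eps 0 w] ^+ 2) <= K.
Proof.
rewrite /K (bigD1 l)//= -[leLHS]add0r -[leLHS]addr0 -addrA lerD ?addr_ge0//.
by rewrite lerD// sumr_ge0// => i _; rewrite addr_ge0.
Qed.

Let mid1 v : mfunT (id1 v). Proof. exact: measurable_id. Qed.

Let z1 v z : v \in [set: 'I_k1]%SET -> Ex P (fun w => id1 v (eps z w)) = 0.
Proof. by move=> _; exact: eps_mean. Qed.

Let s1 v z : v \in [set: 'I_k1]%SET -> (e2 P (fun w => id1 v (eps z w)) <= K%:E)%E.
Proof.
move=> _; have [_ E] := L2_horner eps_id ks eps_mom (p := 'X) z ltac:(by rewrite size_polyX).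
move: E; rewrite /id1; under eq_fun do rewrite hornerX; move=> ->.
under eq_fun do rewrite hornerX.
by rewrite lee_fin /K -[leLHS]addr0 lerD// lerDr.
Qed.

Let Y1sum n : L2_sum P (offdiag [set: 'I_k1]%SET)
 (fun i w => a1 i * \prod_(v in [set: 'I_k1]%SET) id1 v (eps (n%:Z - (i v)%:Z) w)) (Y1 n).
Proof.
move: (Y1c n); rewrite /is_offdiag_chaos; congr (L2_sum _ _ _ _).
by apply/funext => i; apply/funext => w; congr (_ * _); apply: eq_bigl => v; rewrite inE.
Qed.

Let mY1 n : mfunT (Y1 n). Proof. exact: measurable_funP. Qed.

Let A10 : (0 < #|[set: 'I_k1]%SET|)%N. Proof. by rewrite cardsT card_ord. Qed.

Let pa1 : powbound [set: 'I_k1]%SET a1 ka c1.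
Proof.
have := powbound_hom c10 k10 a1le; congr (powbound _ _ _ _).
by rewrite opprK addrAC subrr add0r.
Qed.

Lemma L2_Y1 n : L2 P (Y1 n).
Proof. exact: (L2_chaos eps_indep K1 mid1 s1 mY1 Y1sum). Qed.

Lemma Ex_Y1 n : Ex P (Y1 n) = 0.
Proof. exact: (Ex_chaos eps_indep K1 mid1 z1 s1 mY1 Y1sum). Qed.

Let mu1 : mu 1%N = 0.
Proof.
rewrite /mu /moment unlock -[RHS](eps_mean 0) /Ex; congr fine.
Qed.

Section partition_terms.
Variables (pi : {set {set 'I_k2}}) (l : {ffun {set 'I_k2} -> 'I_k2.+1}).
Hypotheses (pip : is_partition pi) (lp : expansion pi l).
Variable U : nat -> {RV P >-> R}.
Hypothesis Usum : forall n, L2_sum P (offdiag (remaining pi l))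
 (fun i w => reduced_coef mu a2 pi l i *
   \prod_(B in remaining pi l) (A (l B)).[eps (n%:Z - (i B)%:Z) w]) (U n).

Let eA (B : {set 'I_k2}) (x : R) := (A (l B)).[x].

Let meA B : mfunT (eA B). Proof. exact: measurable_horner. Qed.

Let zA B z : B \in remaining pi l -> Ex P (fun w => eA B (eps z w)) = 0.
Proof.
move=> Br; have l0 : (0 < l B)%N by move: Br; rewrite inE => /andP[].
have lk : ((l B).-1 < k2)%N by rewrite prednK// -ltnS.
have [_] := Aapp; move=> /(_ _ lk)[_]; rewrite prednK// unlock => E0.
have [L0 _] := L2_horner eps_id ks eps_mom (p := A (l B)) 0 (leqW (Asize (l B))).
have [_ ->] := integ_id eps_id z (meA B) (L2_integ L0).
by rewrite /Ex /eA E0.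
Qed.

Let sA B z : B \in remaining pi l -> (e2 P (fun w => eA B (eps z w)) <= K%:E)%E.
Proof.
move=> _; have [_ E] := L2_horner eps_id ks eps_mom (p := A (l B)) z (leqW (Asize (l B))).
by rewrite E lee_fin; apply: le_trans (KA (l B)); rewrite lerDl.
Qed.

Let s1A v B z : v \in [set: 'I_k1]%SET -> B \in remaining pi l ->
 (e2 P (fun w => (id1 v (eps z w) * eA B (eps z w))%R) <= K%:E)%E.
Proof.
move=> _ _; have sX : (size ('X * A (l B))%R <= k2.+2)%N.
 by apply: leq_trans (size_polyMleq _ _) _; rewrite size_polyX add2n/= ltnS Asize.
have [_ E] := L2_horner eps_id ks eps_mom (p := 'X * A (l B)) z sX.
have -> : (fun w => id1 v (eps z w) * eA B (eps z w)) = (fun w => ('X * A (l B)).[eps z w]).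
 by apply/funext => w; rewrite hornerM hornerX.
by rewrite E lee_fin; apply: le_trans (KA (l B)); rewrite lerDr.
Qed.

Let mU n : mfunT (U n). Proof. exact: measurable_funP. Qed.

Lemma L2_U n : L2 P (U n).
Proof. exact: (L2_chaos eps_indep K1 meA sA mU Usum). Qed.

(** Some variable remains, so the second factor is a genuine chaos. Its coefficient has excess ku /
    2, and this is what yields the extra q in the window exponent. *)
Lemma random_term (q : R) : remaining pi l != finset.set0 -> 0 < q -> ka + q < 1 / 2 -> q <= ku / 2 ->
 exists2 C : R, 0 < C & forall a0 b : nat,
 (e2 P (fun w => \sum_(n < b) (Y1 (a0 + n) w * U (a0 + n) w -
   Ex P (fun w => Y1 (a0 + n) w * U (a0 + n) w)))%R <= (C * b%:R `^ (2 - (2 * ka + q)))%:E)%E.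
Proof.
move=> rne q0 kaq qku.
have ku20 : 0 < ku / 2 by rewrite divr_gt0.
have alE : - (k2%:R / 2 + ku) = - (k2%:R / 2 + 2 * (ku / 2)) by congr (- (_ + _)); lra.
have [C C0 pu] := reduced_bound c20 k20 a2le l mu1 pip ku20 alE.
have [C' C'0 HC'] := pair_window eps_indep K1 mid1 meA z1 zA s1 sA s1A mY1 mU Y1sum Usum
 A10 c10 C0 pa1 pu kaI q0 kaq qku.
by exists C' => // a0 b; have := HC' a0 b; rewrite cards_eq0 (negbTE rne).
Qed.

(** The only off-diagonal index over no blocks is 0, so U is almost surely equal to its coefficient.
    Multiplication by Y1 preserves a vanishing second moment, and the mean of the product is 0 with
    that of Y1. *)
Lemma constant_term n : remaining pi l = finset.set0 ->
 e2 P (fun w => Y1 n w * U n w - Ex P (fun w => Y1 n w * U n w) -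
  reduced_coef mu a2 pi l [ffun=> 0%N] * Y1 n w)%R = 0%E.
Proof.
move=> r0; set rc := reduced_coef _ _ _ _ _.
have U0 : e2 P (fun w => U n w - rc)%R = 0%E.
 apply/eqP; rewrite eq_le e2_ge0 andbT; apply/lee_addgt0Pr => r rpos; rewrite add0e.
 have [J0 J0off HJ] := Usum n rpos.
 pose i0 : {ffun {set 'I_k2} -> nat} := [ffun=> 0%N].
 have off0 : offdiag (remaining pi l) i0.
  by rewrite r0; split=> [v|v w]; rewrite ?ffunE !inE.
 have offE i : offdiag (remaining pi l) i -> i = i0.
  rewrite r0 => -[ipos _]; apply/ffunP => v; apply/eqP.
  by rewrite ffunE -leqn0 leqNgt -ipos inE.
 have J0sub : (J0 `<=` [fset i0])%fset.
  by apply/fsubsetP => i iJ; rewrite (offE _ (J0off _ iJ)) inE.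
 have := HJ [fset i0]%fset (fun i => ltac:(by rewrite inE => /eqP ->)) J0sub.
 rewrite unlock => /ltW; apply: le_trans; rewrite le_eqVlt; apply/orP; left; apply/eqP.
 apply: eq_integral => w _; rewrite big_seq_fset1 r0 big_set0 mulr1.
 by [].
have mUr : mfunT (fun w => U n w - rc) by apply: measurable_funB.
have LUr : L2 P (fun w => U n w - rc) by apply: L2B; [exact: L2_U|exact: L2_cst].
have EYU : Ex P (fun w => Y1 n w * (U n w - rc)) = 0.
 have e0 := e2_0_mul mUr (mY1 n) U0.
 have LYU : L2 P (fun w => Y1 n w * (U n w - rc)).
  by split; [exact: measurable_funM|rewrite e0 ltry].
 have := Ex_sqr_le LYU; rewrite -lee_fin -(L2_e2E LYU) e0 lee_fin => H.
 by apply/eqP; rewrite -sqrf_eq0 eq_le H sqr_ge0.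
have EYU' : Ex P (fun w => Y1 n w * U n w) = 0.
 have -> : (fun w => Y1 n w * U n w) = (fun w => Y1 n w * (U n w - rc) + rc * Y1 n w).
  by apply/funext => w; ring.
 rewrite ExD ?EYU ?ExZ ?Ex_Y1 ?mulr0 ?addr0//.
 - by apply: L2_integ; exact: L2_Y1.
 - by apply: L2M_integ => //; exact: L2_Y1.
 - by apply: integZ; apply: L2_integ; exact: L2_Y1.
rewrite EYU' -(e2_0_mul mUr (mY1 n) U0); apply: eq_e2 => w; ring.
Qed.

End partition_terms.

Let rc pi l := reduced_coef mu a2 pi l [ffun=> 0%N].
Let valid (p : {set {set 'I_k2}} * {ffun {set 'I_k2} -> 'I_k2.+1}) :=
 is_partition p.1 && expansion p.1 p.2.

(** A singleton block brings the factor [mu 1 = 0]; this is why c_2 runs over partitions into blocks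
    of size at least 2. *)
Lemma constant_coef pi : is_partition pi -> rc pi [ffun=> ord0] =
 if [forall (B | B \in pi), 1 < #|B|]%N
 then abs_sum (offdiag pi) (fun i => identify a2 pi i * \prod_(B in pi) mu #|B|) else 0.
Proof.
move=> pip; rewrite /rc /reduced_coef.
have coefE : expansion_coef mu pi [ffun=> ord0] = \prod_(B in pi) mu #|B|.
 by apply: eq_bigr => B _; rewrite ffunE/= bin0 mul1r subn0.
have joinE (j : {ffun {set 'I_k2} -> nat}) : [ffun B => ([ffun=> 0%N] B + j B)%N] = j.
 by apply/ffunP => B; rewrite !ffunE.
have r0 : remaining pi [ffun=> (ord0 : 'I_k2.+1)] = finset.set0.
 by apply/setP => B; rewrite !inE ffunE/= andbF.
rewrite coefE; case: ifPn => [_|].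
 congr abs_sum; last by apply/funext => j; rewrite joinE mulrC.
 by rewrite r0 finset.setD0; apply/seteqP; split=> j /=; rewrite joinE => // -[].
move=> /forallPn[B]; rewrite negb_imply -leqNgt => /andP[Bpi B1].
have -> : \prod_(C in pi) mu #|C| = 0.
 rewrite (bigD1 B)//= (_ : #|B| = 1%N) ?mu1 ?mul0r//.
 apply/eqP; rewrite eqn_leq B1 card_gt0.
 by case/and3P: pip => _ _; apply: contraNneq => <-.
rewrite /abs_sum; rewrite !esum1 ?subrr// => j _; by rewrite mul0r ?oppr0 maxxx.
Qed.

(** When no block remains [l] is identically 0, so each partition contributes exactly one term. *)
Lemma constant_coef_sum :
 \sum_(p | valid p && (remaining p.1 p.2 == finset.set0)) rc p.1 p.2 = cc.
Proof.
rewrite /cc /mean_const [RHS]big_mkcondr/=.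
rewrite (eq_bigl (fun p => is_partition p.1 && (expansion p.1 p.2 && (remaining p.1 p.2 == finset.set0)))); last first.
 by move=> p; rewrite /valid andbA.
rewrite -(pair_big_dep (fun pi => is_partition pi)
 (fun pi l => expansion pi l && (remaining pi l == finset.set0)) (fun pi l => rc pi l))/=.
apply: eq_bigr => pi pip; rewrite -constant_coef// (big_pred1 [ffun=> ord0])// => l /=.
apply/andP/eqP => [[/forallP lp /eqP r0]|->].
 apply/ffunP => B; rewrite ffunE; apply/val_inj/eqP => /=; rewrite -leqn0.
 have := lp B; case: ifP => // Bpi _; rewrite leqNgt; apply/negP => l0.
 have : B \in remaining pi l by rewrite inE Bpi l0.
 by rewrite r0 inE.
split; first by apply/forallP => B; rewrite ffunE.
by apply/eqP/setP => B; rewrite !inE ffunE/= andbF.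
Qed.

Theorem remainder_window : exists C theta : R, [/\ 0 < C, 1 < theta, theta < 2 - 2 * ka &
 forall a0 b : nat,
 (e2 P (fun w => \sum_(n < b) (Y1 (a0 + n) w * Y2 (a0 + n) w -
   Ex P (fun w => Y1 (a0 + n) w * Y2 (a0 + n) w) - cc * Y1 (a0 + n) w))%R <=
 (C * b%:R `^ theta)%:E)%E].
Proof.
(* The first bound is the excess available to the reduced coefficients. The second keeps ka + q
   below 1 / 2, hence theta above 1, as the maximal inequality requires. *)
pose q := Num.min (ku / 2) ((1 / 2 - ka) / 2).
have [ka0 ka1] := andP kaI.
have q0 : 0 < q by rewrite /q lt_min !divr_gt0// subr_gt0.
have qku : q <= ku / 2 by rewrite /q ge_min lexx.
have kaq : ka + q < 1 / 2.
 have : q <= (1 / 2 - ka) / 2 by rewrite /q ge_min lexx orbT.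
 lra.
pose theta := 2 - (2 * ka + q).
have [U0 HU0] := choice (fun n => let: ex_intro2 U HU HY := Y2c n in ex_intro _ U (conj HU HY)).
pose U p n : {RV P >-> R} := U0 n p.1 p.2.
have HU p : valid p -> forall n, L2_sum P (offdiag (remaining p.1 p.2))
 (fun i w => reduced_coef mu a2 p.1 p.2 i *
   \prod_(B in remaining p.1 p.2) (A (p.2 B)).[eps (n%:Z - (i B)%:Z) w]) (U p n).
 by move=> /andP[pip lp] n; have [H _] := HU0 n; exact: H.
have Y2E n w : Y2 n w = \sum_(p | valid p) U p n w.
 have [_ ->] := HU0 n; rewrite (pair_big_dep (fun pi => is_partition pi)
  (fun pi l => expansion pi l) (fun pi l => U0 n pi l w))/=.
 by [].
have LU p n : valid p -> L2 P (U p n).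
 by move=> vp; case/andP: (vp) => pip lp; exact: (L2_U (HU p vp)).
(* One summand for each partition and choice of Appell degrees, with its own mean removed and its
   share of c_2 Y1 subtracted; the shares add up by [constant_coef_sum]. *)
pose Z p n w := if valid p then Y1 n w * U p n w - Ex P (fun w => Y1 n w * U p n w) -
 (if remaining p.1 p.2 == finset.set0 then rc p.1 p.2 else 0) * Y1 n w else 0.
have mZ p n : mfunT (Z p n).
 rewrite /Z; case: (valid p) => //; apply: measurable_funB; last exact: measurable_funM.
 by apply: measurable_funB => //; exact: measurable_funM.
have ZE n w : Y1 n w * Y2 n w - Ex P (fun w => Y1 n w * Y2 n w) - cc * Y1 n w =
  \sum_p Z p n w.
 rewrite /Z -big_mkcond/= !sumrB -mulr_suml -big_mkcondr/= constant_coef_sum.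
 rewrite Y2E mulr_sumr; congr (_ - _ - _).
 rewrite -Ex_big; last by move=> p vp; apply: L2M_integ; [exact: L2_Y1|exact: LU].
 by apply: eq_Ex => w'; rewrite Y2E mulr_sumr.
have exC p : exists2 C : R, 0 <= C & forall a0 b : nat,
  (e2 P (fun w => \sum_(n < b) Z p (a0 + n)%N w)%R <= (C * b%:R `^ theta)%:E)%E.
 have zero a0 b : (forall n, e2 P (Z p n) = 0%E) ->
   (e2 P (fun w => \sum_(n < b) Z p (a0 + n)%N w)%R <= (0 * b%:R `^ theta)%:E)%E.
  move=> Z0; apply: le_trans (@e2_sum _ _ _ P _ (fun n : 'I_b => Z p (a0 + n)%N) _) _ => //.
  by rewrite big1 ?mule0 ?mul0r.
 have [vp|nvp] := boolP (valid p); last first.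
  exists 0 => // a0 b; apply: zero => n; rewrite /Z (negbTE nvp) /e2.
  by under eq_integral do rewrite expr0n/=; rewrite integral0.
 case/andP: (vp) => pip lp.
 have [r0|rne] := eqVneq (remaining p.1 p.2) finset.set0.
  exists 0 => // a0 b; apply: zero => n; rewrite /Z vp r0 eqxx.
  exact: (constant_term (HU p vp) n r0).
 have [C C0 HC] := random_term pip (HU p vp) rne q0 kaq qku.
 exists C => [|a0 b]; first exact: ltW.
 apply: le_trans (HC a0 b); rewrite le_eqVlt; apply/orP; left; apply/eqP.
 apply: eq_e2 => w; apply: eq_bigr => n _; rewrite /Z vp (negbTE rne) mul0r subr0.
 by [].
have [C HC] := choice (fun p => let: ex_intro2 C C0 H := exC p in ex_intro _ C (conj C0 H)).
pose I : finType := ({set {set 'I_k2}} * {ffun {set 'I_k2} -> 'I_k2.+1})%type.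
exists (#|I|%:R * \sum_p C p + 1), theta; split.
- by rewrite ltr_wpDl// mulr_ge0// sumr_ge0// => p _; have [] := HC p.
- by rewrite /theta; lra.
- by rewrite /theta; lra.
move=> a0 b; pose S p w := \sum_(n < b) Z p (a0 + n)%N w.
have -> : (fun w => \sum_(n < b) (Y1 (a0 + n) w * Y2 (a0 + n) w -
   Ex P (fun w => Y1 (a0 + n) w * Y2 (a0 + n) w) - cc * Y1 (a0 + n) w)) =
  (fun w => \sum_p S p w).
 apply/funext => w; rewrite /S exchange_big/=; apply: eq_bigr => n _; exact: ZE.
apply: le_trans (@e2_sum _ _ _ P _ S _) _; first by move=> p; exact: measurable_sum.
rewrite mulrDl mul1r -[leLHS]adde0 EFinD leeD ?lee_fin ?powR_ge0//.
rewrite -mulrA EFinM lee_pmul ?lee_fin ?ler0n//.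
 by apply: sume_ge0 => p _; exact: e2_ge0.
rewrite mulr_suml -sumEFin; apply: lee_sum => p _.
by have [_] := HC p; apply.
Qed.

End remainder.

(** * Dyadic maximal inequality *)

Section maximal_inequality.
Context {R : realType}.

(** An explicit square function that dominates all partial sums of a dyadic block. A sum that ends
    in the second half is cut in the middle, and (x + y)^2 <= (1 + 1/h) x^2 + (1 + h) y^2. *)
Fixpoint maximal_square {T : Type} (h : R) (D : nat -> T -> R) (l a : nat) (w : T) : R :=
 if l is l'.+1 then
  (1 + h) * (maximal_square h D l' a w + maximal_square h D l' (a + 2 ^ l') w) +
  (1 + h^-1) * (\sum_(n < 2 ^ l') D (a + n)%N w) ^+ 2
 else D a w ^+ 2.

Lemma maximal_square_ge0 (T : Type) (h : R) (D : nat -> T -> R) l a w :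
 0 < h -> 0 <= maximal_square h D l a w.
Proof.
move=> h0; have h1 : 0 <= 1 + h by rewrite addr_ge0// ltW.
have h2 : 0 <= 1 + h^-1 by rewrite addr_ge0// invr_ge0 ltW.
elim: l a => [|l IH] a /=; first exact: sqr_ge0.
by rewrite addr_ge0// mulr_ge0 ?sqr_ge0// addr_ge0.
Qed.

Lemma maximal_square_bound (T : Type) (h : R) (D : nat -> T -> R) l a w j :
 0 < h -> (j <= 2 ^ l)%N ->
 (\sum_(n < j) D (a + n)%N w) ^+ 2 <= maximal_square h D l a w.
Proof.
move=> h0; have h2 : 0 <= 1 + h^-1 by rewrite addr_ge0// invr_ge0 ltW.
elim: l a j => [|l IH] a j /=.
 case: j => [_|[_|//]]; first by rewrite big_ord0 expr0n/= sqr_ge0.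
 by rewrite big_ord1 addn0.
move=> jl; have M1 := maximal_square_ge0 D l a w h0.
have M2 := maximal_square_ge0 D l (a + 2 ^ l)%N w h0.
have [jl'|jl'] := leqP j (2 ^ l).
 apply: le_trans (IH a j jl') _.
 rewrite -[leLHS]addr0 lerD//; last by rewrite mulr_ge0 ?sqr_ge0.
 by move: h0 M1 M2; set x := maximal_square _ _ _ _ _; set y := maximal_square _ _ _ _ _; nra.
have jE : j = (2 ^ l + (j - 2 ^ l))%N by rewrite subnKC// ltnW.
have j2 : (j - 2 ^ l <= 2 ^ l)%N by rewrite leq_subLR addnn -mul2n -expnS.
move: (j - 2 ^ l)%N jE j2 => k jE j2; subst j.
have := IH (a + 2 ^ l)%N _ j2.
rewrite big_split_ord/=; under eq_bigr do rewrite -addnA.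
set x := \sum_(i < 2 ^ l) _; set y := \sum_(i < k) _ => yM.
apply: (@le_trans _ _ ((1 + h) * y ^+ 2 + (1 + h^-1) * x ^+ 2)); last first.
 rewrite lerD2r ler_wpM2l//; first by rewrite addr_ge0// ltW.
 by apply: le_trans yM _; rewrite lerDr.
have hE : h * h^-1 = 1 by rewrite divff// gt_eqF.
have hi : 0 < h^-1 by rewrite invr_gt0.
have := mulr_ge0 (ltW h0) (sqr_ge0 (y - h^-1 * x)).
have -> : h * (y - h^-1 * x) ^+ 2 = h * y ^+ 2 - 2 * (h * h^-1) * (x * y) + (h * h^-1) * (h^-1 * x ^+ 2) by ring.
by rewrite hE; nra.
Qed.

(** Two half blocks together have the fraction 2^(1 - theta) of the size expected for the whole
    block. Since theta > 1 this is below 1, so for small h the recursion closes with a fixed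
    constant and no logarithm of the length is lost. *)
Lemma maximal_window (C theta : R) : 0 <= C -> 1 < theta -> exists2 C' : R, 0 < C' &
 forall (d : measure_display) (T : measurableType d) (P : probability T R) (D : nat -> T -> R),
 (forall n, mfunT (D n)) ->
 (forall a b : nat, (e2 P (fun w => \sum_(n < b) D (a + n)%N w)%R <= (C * b%:R `^ theta)%:E)%E) ->
 forall a l : nat, exists Q : T -> R,
  [/\ mfunT Q, forall w, 0 <= Q w,
    (\int[P]_w (Q w)%:E <= (C' * (2 ^ l)%:R `^ theta)%:E)%E &
    forall w j, (j <= 2 ^ l)%N -> (\sum_(n < j) D (a + n)%N w) ^+ 2 <= Q w].
Proof.
move=> C0 th; pose g : R := 2 `^ theta; have g2 : 2 < g.
 have : (1 : R) `^ (theta - 1) < 2 `^ (theta - 1).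
  by apply: gt0_ltr_powR; rewrite ?subr_gt0// ?nnegrE//; lra.
 have : g = 2 * 2 `^ (theta - 1) by rewrite mulr_powRB1//; lra.
 by rewrite powR1; lra.
(* With this h one has 2 (1 + h) = (g + 2) / 2 < g, and [C'] is then taken so large that 2 (1 + h)
   C' + (1 + 1/h) C <= g C'. *)
pose h := (g - 2) / 4; have h0 : 0 < h by rewrite /h; lra.
have hi : 0 < h^-1 by rewrite invr_gt0.
have gh : 0 < g - 2 * (1 + h) by rewrite /h; lra.
pose C' := C + 1 + (1 + h^-1) * C / (g - 2 * (1 + h)).
have X0 : 0 <= (1 + h^-1) * C / (g - 2 * (1 + h)).
 by apply: divr_ge0; [apply: mulr_ge0 => //; lra|exact: ltW].
have C'0 : 0 < C' by rewrite /C'; lra.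
have C'E : 2 * (1 + h) * C' + (1 + h^-1) * C <= g * C'.
 have : (g - 2 * (1 + h)) * C' >= (1 + h^-1) * C; last by lra.
 rewrite /C' mulrDr [X in _ <= _ + X]mulrC divfK ?gt_eqF//.
 by rewrite lerDr; apply: mulr_ge0; lra.
exists C' => // d T P D mD De a l; exists (maximal_square h D l a).
have mM l' a' : mfunT (maximal_square h D l' a').
 elim: l' a' => [|l' IH] a' /=; first exact: measurable_funX.
 apply: measurable_funD; apply: measurable_funM => //; first exact: measurable_funD.
 by apply: measurable_funX; exact: measurable_sum.
split => //; first by move=> w; exact: maximal_square_ge0.
 elim: l a => [|l IH] a.
  have := De a 1%N; rewrite expn0 powR1 !mulr1 => H.
  apply: (@le_trans _ _ C%:E); last by rewrite lee_fin /C'; lra.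
  by apply: le_trans H; rewrite /e2; under [leRHS]eq_integral do rewrite big_ord1 addn0.
 have M0 l' a' w := maximal_square_ge0 D l' a' w h0.
 rewrite [leLHS](_ : _ = \int[P]_w ((1 + h)%:E * ((maximal_square h D l a w)%:E +
   (maximal_square h D l (a + 2 ^ l) w)%:E) +
   (1 + h^-1)%:E * ((\sum_(n < 2 ^ l) D (a + n)%N w) ^+ 2)%:E))%E; last first.
  by [].
 have mE l' a' : mfunT (fun w => (maximal_square h D l' a' w)%:E).
  by apply/measurable_EFinP.
 have mS : mfunT (fun w => ((\sum_(n < 2 ^ l) D (a + n)%N w) ^+ 2)%:E).
  by apply: measurable_sqr; exact: measurable_sum.
 rewrite ge0_integralD//; last first.
 - by apply: emeasurable_funM.
 - by move=> w _; rewrite -EFinM lee_fin; apply: mulr_ge0; [lra|exact: sqr_ge0].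
 - by apply: emeasurable_funM => //; exact: emeasurable_funD.
 - by move=> w _; rewrite -EFinD -EFinM lee_fin; apply: mulr_ge0; [lra|exact: addr_ge0].
 rewrite ge0_integralZl_EFin//; last 3 first.
 - by move=> w _; rewrite -EFinD lee_fin addr_ge0.
 - by apply: emeasurable_funD.
 - by lra.
 rewrite ge0_integralZl_EFin//; last 2 first.
 - by move=> w _; rewrite lee_fin sqr_ge0.
 - by lra.
 rewrite ge0_integralD//; try by move=> w _; rewrite lee_fin.
 set B := (2 ^ l)%:R `^ theta in IH *.
 have BE : (2 ^ l.+1)%:R `^ theta = g * B :> R.
  by rewrite expnS natrM powRM.
 have B0 : 0 <= B by exact: powR_ge0.
 apply: (@le_trans _ _ ((1 + h)%:E * ((C' * B)%:E + (C' * B)%:E) + (1 + h^-1)%:E * (C * B)%:E)%E).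
  apply: leeD; apply: lee_pmul => //.
  - by rewrite lee_fin; lra.
  - by apply: adde_ge0; apply: integral_ge0 => w _; rewrite lee_fin.
  - exact: leeD.
  - by rewrite lee_fin; lra.
  - exact: (e2_ge0 P (fun w => \sum_(n < 2 ^ l) D (a + n)%N w)).
  - exact: De.
 rewrite -[leLHS]/(((1 + h) * (C' * B + C' * B) + (1 + h^-1) * (C * B))%:E) lee_fin BE.
 have := ler_wpM2r B0 C'E; lra.
by move=> w j jl; exact: maximal_square_bound.
Qed.

End maximal_inequality.

Section uniform_chaos_window.
Context {R : realType} {V : finType} (A : {set V}) (a : {ffun V -> nat} -> R) (K ka ca : R).
Hypothesis K1 : 1 <= K.
Hypotheses (A0 : (0 < #|A|)%N) (ca0 : 0 <= ca).
Hypotheses (pa : powbound A a ka ca) (kaI : 0 < ka < 1 / 2).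

(** Stated for truncated chaoses and for every probability space at once, as it will be applied to
    eps and to Brownian increments alike. *)
Lemma chaosT_window : exists2 C : R, 0 < C &
 forall (d : measure_display) (T : measurableType d) (P : probability T R)
  (eps : int -> {RV P >-> R}) (e : V -> R -> R),
 mutually_independent P (fun i : int => eps i : T -> R) ->
 (forall v, mfunT (e v)) ->
 (forall v z, v \in A -> Ex P (fun w => e v (eps z w)) = 0) ->
 (forall v z, v \in A -> (e2 P (fun w => e v (eps z w)) <= K%:E)%E) ->
 forall M a0 b : nat,
 (e2 P (fun w => \sum_(n < b) chaosT eps A a e M (a0 + n) w)%R <= (C * b%:R `^ (2 - 2 * ka))%:E)%E.
Proof.
have q0 : 0 < (1 / 2 - ka) / 2 by move/andP: kaI; lra.
have kaq : ka + (1 / 2 - ka) / 2 < 1 / 2 by move/andP: kaI; lra.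
have [C C0 HC] := @window_variance R V 'I_0 A finset.set0 a (@triv_u R) ka ((1 / 2 - ka) / 2) ca 1
 ((1 / 2 - ka) / 2) K A0 ca0 ler01 pa (@powbound_triv R _) kaI q0 kaq (lexx _) K1.
exists C => // d T P eps e ei me e0 es2 M a0 b.
pose X z : {RV P >-> R} := eps (z%:Z + (a0%:Z - M%:Z)).
have := HC _ _ P X e (@triv_e R) b M (indep_shift ei _) me (fun v => ltac:(by case: v))
 (fun v z => e0 v (z%:Z + (a0%:Z - M%:Z))) (fun v z h => ltac:(by rewrite inE in h))
 (fun v z => es2 v (z%:Z + (a0%:Z - M%:Z))) (fun v z h => ltac:(by rewrite inE in h))
 (fun v v' z _ h => ltac:(by rewrite inE in h)).
have FE : (fun w => \sum_(n < b) chaosM A a e X M n w * chaosM finset.set0 (@triv_u R) (@triv_e R) X M n w) =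
  (fun w => \sum_(n < b) chaosT eps A a e M (a0 + n) w).
 by apply/funext => w; apply: eq_bigr => n _; rewrite chaosM_triv mulr1 chaosTE.
rewrite /= FE cards0 eqxx => -[L2F]; rewrite Ex_big; last first.
 by move=> n _; apply: L2_integ; exact: (L2_chaosT ei _ K1 me es2).
rewrite big1 => [|n _]; last exact: (Ex_chaosT ei _ K1 me e0 es2).
rewrite (L2_e2E L2F) lee_fin; apply: le_trans; rewrite le_eqVlt; apply/orP; left; apply/eqP.
by apply: eq_Ex => w; rewrite subr0 -(congr1 (fun f => f w) FE).
Qed.

End uniform_chaos_window.

(** * Off-diagonal polynomials in independent variables *)

Section linear_forms.
Context {d} {T : measurableType d} {R : realType} (P : probability T R).
Variable X : nat -> {RV P >-> R}.
Hypothesis X_indep : mutually_independent P (fun i => X i : T -> R).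
Hypothesis X0 : forall i, Ex P (X i) = 0.
Hypothesis X2 : forall i, (e2 P (X i) <= 1%:E)%E.
Context {k n : nat}.
Hypothesis k0 : (0 < k)%N.
Implicit Types W : {ffun 'I_k -> 'I_n} -> R.

Definition multiform W (x : nat -> R) : R :=
 \sum_(l : {ffun 'I_k -> 'I_n} | injectiveb l) W l * \prod_q x (l q).

Let S := {l : {ffun 'I_k -> 'I_n} | injectiveb l}.
Let A1 := [set: 'I_k]%SET.
Let A2 := (finset.set0 : {set 'I_0}).
Let u1 (v : 'I_k) (x : R) := x.
Let u2 (v : 'I_0) (x : R) : R := 0.
Let mu1 v : mfunT (u1 v). Proof. exact: measurable_id. Qed.
Let mu2 v : mfunT (u2 v). Proof. by case: v. Qed.
Let z1 v z : v \in A1 -> Ex P (fun w => u1 v (X z w)) = 0. Proof. by move=> _; exact: X0. Qed.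
Let z2 v z : v \in A2 -> Ex P (fun w => u2 v (X z w)) = 0. Proof. by rewrite inE. Qed.
Let s1 v z : v \in A1 -> (e2 P (fun w => u1 v (X z w)) <= 1%:E)%E. Proof. by move=> _; exact: X2. Qed.
Let s2 v z : v \in A2 -> (e2 P (fun w => u2 v (X z w)) <= 1%:E)%E. Proof. by rewrite inE. Qed.
Let s12 v v' z : v \in A1 -> v' \in A2 ->
 (e2 P (fun w => (u1 v (X z w) * u2 v' (X z w))%R) <= 1%:E)%E. Proof. by rewrite [v' \in _]inE. Qed.
Let p1 (l : S) : 'I_k -> 'I_n := val l.
Let p2 (l : S) (v : 'I_0) : 'I_n := widen_ord (leq0n n) v.
Let i1 l : {in A1 &, injective (p1 l)}.
Proof. by move=> x y _ _; exact: (injectiveP _ (valP l)). Qed.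
Let i2 l : {in A2 &, injective (p2 l)}. Proof. by move=> x y; rewrite inE. Qed.

Let formE W : form X A1 A2 u1 u2 (fun l : S => W (val l)) p1 p2 = (fun w => multiform W (X ^~ w)).
Proof.
apply/funext => w; rewrite /form /multiform.
rewrite (big_sub (fun l : {ffun 'I_k -> 'I_n} => injectiveb l) (fun l => W l * \prod_q X (l q) w))/=.
apply: eq_bigr => l _; congr (_ * _); rewrite /mono /A2 big_set0 mulr1.
by apply: eq_bigl => v; rewrite inE.
Qed.

Lemma L2_multiform W : L2 P (fun w => multiform W (X ^~ w)).
Proof. by rewrite -formE; exact: (L2_form X_indep mu1 mu2 (lexx 1) s1 s2 s12 _ i1 i2). Qed.

(** Without a second family, compatibility with Q says that the occupied sites are exactly Q. At
    most k^k placements share one Q, whence Cauchy-Schwarz, and each placement counts for a single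
    Q. *)
Lemma e2_multiform W : (e2 P (fun w => multiform W (X ^~ w)) <=
 ((k ^ k)%:R * \sum_(l : {ffun 'I_k -> 'I_n} | injectiveb l) W l ^+ 2)%:E)%E.
Proof.
have L := L2_multiform W; rewrite (L2_e2E L) lee_fin.
have := variance_form X_indep mu1 mu2 (lexx 1) z1 z2 s1 s2 s12 (fun l : S => W (val l)) i1 i2.
have -> : Ex P (form X A1 A2 u1 u2 (fun l : S => W (val l)) p1 p2) = 0.
 have iM l : integ P (mono X A1 A2 u1 u2 p1 p2 l).
  have := L2_form X_indep mu1 mu2 (lexx 1) s1 s2 s12 (fun l' => (l' == l)%:R) i1 i2.
  move=> /L2_integ; rewrite /form; congr (integ P _); apply/funext => w.
  by rewrite (bigD1 l)//= eqxx mul1r big1 ?addr0// => l' /negbTE ->; exact: mul0r.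
 rewrite /form Ex_big => [|l _]; last exact: integZ.
 rewrite big1// => l _; rewrite ExZ//.
 by rewrite (@Ex_mono0 _ _ _ _ _ X_indep _ _ _ _ _ _ _ _ mu1 mu2 1 (lexx 1) z1 s1 s2 s12 p1 p2 i1 i2 l (Ordinal k0))// ?inE// mulr0.
under eq_Ex do rewrite subr0; rewrite formE expr1n mul1r => H; apply: le_trans H _.
have inS Q l : compat A1 A2 p1 p2 Q l -> forall z, (z \in Q) = [exists q, val l q == z].
 move=> /forallP H z; have := H z; have l2N : lab A2 (p2 l) z = None.
  by case E : (lab _ _ _) => [v|//]; have [] := lab_Some E; rewrite inE.
 rewrite l2N/= orbF; have [zQ|zQ] := boolP (z \in Q).
  case E : (lab _ _ _) => [v|//] _; have [_ <-] := lab_Some E.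
  by apply/esym/existsP; exists v.
 case E : (lab _ _ _) => [//|] _; apply/esym/negbTE/existsPn => q.
 by apply: (labN E); rewrite inE.
apply: (@le_trans _ _ (\sum_(Q : {set 'I_n} | Q != finset.set0)
  (k ^ k)%:R * \sum_(l | compat A1 A2 p1 p2 Q l) W (val l) ^+ 2)).
 apply: ler_sum => Q _; apply: le_trans (sqr_sum_le _ _) _.
 under eq_bigr do rewrite real_normK ?num_real//.
 have [l0 cl0|none] := pickP (compat A1 A2 p1 p2 Q); last first.
  by rewrite !big_pred0// !mulr0.
 rewrite ler_wpM2r ?sumr_ge0// => [l _|]; first exact: sqr_ge0.
 rewrite ler_nat; have Qk : (#|Q| <= k)%N.
  have -> : Q = [set val l0 q | q : 'I_k]%SET.
   apply/setP => z; rewrite (inS _ _ cl0); apply/existsP/imsetP => [[q /eqP <-]|[q _ ->]]; exists q => //.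
  by apply: leq_trans (leq_imset_card _ _) _; rewrite card_ord.
 apply: (@leq_trans #|ffun_on (mem Q) : {pred {ffun 'I_k -> 'I_n}}|); last first.
  by rewrite card_ffun_on card_ord leq_exp2r.
 rewrite -(card_imset _ val_inj) subset_leq_card//; apply/fintype.subsetP => f /imsetP[l cl ->].
 by apply/ffun_onP => q; rewrite (inS _ _ cl); apply/existsP; exists q.
rewrite -mulr_sumr ler_wpM2l// (exchange_big_dep xpredT)//=.
rewrite (big_sub (fun l : {ffun 'I_k -> 'I_n} => injectiveb l) (fun l => W l ^+ 2))/=.
apply: ler_sum => l _; rewrite sumr_const -[leRHS]mulr1 -mulr_natr ler_wpM2l ?sqr_ge0//.
rewrite -[1]/(1%:R) ler_nat; apply/card_le1_eqP => Q Q'; rewrite !unfold_in => /andP[_ cQ] /andP[_ cQ'].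
by apply/setP => z; rewrite (inS _ _ cQ) (inS _ _ cQ').
Qed.

End linear_forms.

(** * Cubic B-splines *)

Section cubic_spline.
Context {R : realType}.
Implicit Types x y : R.

Definition cube_pos x : R := Num.max x 0 ^+ 3.

(** The cardinal cubic B-spline with support [0, 4]. *)
Definition spline x : R := (cube_pos x - 4 * cube_pos (x - 1) + 6 * cube_pos (x - 2)
 - 4 * cube_pos (x - 3) + cube_pos (x - 4)) / 6.

(** Antiderivative of the quadratic B-spline, going from 0 to 1 on [0, 3]. Its unit differences are
    the cubic spline, so sums of shifted splines telescope. *)
Definition smoothstep x : R := (cube_pos x - 3 * cube_pos (x - 1) + 3 * cube_pos (x - 2)
 - cube_pos (x - 3)) / 6.

Lemma cube_posE x : 0 <= x -> cube_pos x = x ^+ 3.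
Proof. by move=> x0; rewrite /cube_pos max_l. Qed.

Lemma cube_pos0 x : x <= 0 -> cube_pos x = 0.
Proof. by move=> x0; rewrite /cube_pos max_r// expr0n. Qed.

Lemma measurable_spline : mfunT spline.
Proof.
have mc c : mfunT (fun x => cube_pos (x - c)).
 by apply: measurable_funX; apply: measurable_maxr => //; exact: measurable_funB.
have m0 : mfunT cube_pos.
 by apply: measurable_funX; exact: measurable_maxr.
apply: measurable_funM => //; apply: measurable_funD => //.
do ?[exact: mc|exact: m0|apply: measurable_funB|apply: measurable_funD|apply: measurable_funM] => //.
Qed.

(** The coefficients are the first two Taylor coefficients of x^3 for x > 0 and 0 otherwise; the
    four cases are the signs of x and x + y. *)
Lemma cube_pos_taylor x : exists a b : R,
 forall y, `|cube_pos (x + y) - cube_pos x - a * y - b * y ^+ 2| <= `|y| ^+ 3.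
Proof.
exists (3 * Num.max x 0 ^+ 2), (3 * Num.max x 0) => y.
have [x0|x0] := leP x 0; have [z0|z0] := leP (x + y) 0.
- by rewrite !cube_pos0// expr0n/= !(mulr0, mul0r, subr0) normr0 exprn_ge0.
- rewrite (cube_posE (ltW z0)) (cube_pos0 x0) expr0n/= !(mulr0, mul0r, subr0).
 have y0 : 0 <= y by lra.
 rewrite (ger0_norm y0) ger0_norm; last by rewrite exprn_ge0// ltW.
 by apply: lerXn2r; rewrite ?nnegrE; lra.
- rewrite (cube_pos0 z0) (cube_posE (ltW x0)).
 have y0 : y <= 0 by lra.
 rewrite (ler0_norm y0) (_ : _ - _ = (x + y) ^+ 3 *- 1 + y ^+ 3); last by ring.
 have : 0 <= - (x + y) ^+ 3 <= - y ^+ 3.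
  have -> : - (x + y) ^+ 3 = (- (x + y)) ^+ 3 by ring.
  have -> : - y ^+ 3 = (- y) ^+ 3 by ring.
  by apply/andP; split; [apply: exprn_ge0; lra|apply: lerXn2r; rewrite ?nnegrE; lra].
 by rewrite (_ : (- y) ^+ 3 = - y ^+ 3); [rewrite ler_norml; lra|ring].
- rewrite (cube_posE (ltW x0)) (cube_posE (ltW z0)).
 rewrite -normrX (_ : _ - _ = y ^+ 3)//; ring.
Qed.

(** The cubic errors add up with total factor (1 + 4 + 6 + 4 + 1) / 6 = 16 / 6 < 3. *)
Lemma spline_taylor x : exists a b : R,
 forall y, `|spline (x + y) - spline x - a * y - b * y ^+ 2| <= 3 * `|y| ^+ 3.
Proof.
have T z := cube_pos_taylor z.
have [a0 [b0 H0]] := T x; have [a1 [b1 H1]] := T (x - 1); have [a2 [b2 H2]] := T (x - 2).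
have [a3 [b3 H3]] := T (x - 3); have [a4 [b4 H4]] := T (x - 4).
exists ((a0 - 4 * a1 + 6 * a2 - 4 * a3 + a4) / 6), ((b0 - 4 * b1 + 6 * b2 - 4 * b3 + b4) / 6) => y.
move: (H0 y) (H1 y) (H2 y) (H3 y) (H4 y) => {H0 H1 H2 H3 H4 T}.
set D0 := (X in `|X| <= _ -> _); set D1 := (X in _ -> `|X| <= _ -> _).
set D2 := (X in _ -> _ -> `|X| <= _ -> _); set D3 := (X in _ -> _ -> _ -> `|X| <= _ -> _).
set D4 := (X in _ -> _ -> _ -> _ -> `|X| <= _ -> _).
rewrite (_ : spline (x + y) - _ - _ - _ = (D0 - 4 * D1 + 6 * D2 - 4 * D3 + D4) / 6).
 by rewrite !ler_norml; move: (`|y| ^+ 3) => Y; clearbody D0 D1 D2 D3 D4; lra.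
rewrite /spline /D0 /D1 /D2 /D3 /D4.
rewrite (addrAC x y (- 1)) (addrAC x y (- 2)) (addrAC x y (- 3)) (addrAC x y (- 4)); by field.
Qed.

Lemma splineE x : spline x = smoothstep x - smoothstep (x - 1).
Proof.
rewrite /spline /smoothstep; have E (a b c : R) : a + b = c -> x - a - b = x - c by move=> <-; lra.
by rewrite (E 1 1 2) ?(E 1 2 3) ?(E 1 3 4); lra.
Qed.

Lemma smoothstep0 x : x <= 0 -> smoothstep x = 0.
Proof. by move=> x0; rewrite /smoothstep !cube_pos0; lra. Qed.

Lemma smoothstep1 x : 3 <= x -> smoothstep x = 1.
Proof. by move=> x0; rewrite /smoothstep !cube_posE; [lra|lra|lra|lra|lra]. Qed.

Lemma smoothstep_ge0_le1 x : 0 <= smoothstep x <= 1.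
Proof.
have [x0|x0] := leP x 0; first by rewrite smoothstep0// lexx ler01.
have [x3|x3] := leP 3 x; first by rewrite smoothstep1// ler01 lexx.
rewrite /smoothstep [cube_pos (x - 3)]cube_pos0; last by lra.
rewrite [cube_pos x]cube_posE; last by lra.
have [x1|x1] := leP x 1.
 rewrite [cube_pos (x - 1)]cube_pos0 ?[cube_pos (x - 2)]cube_pos0; [|lra..].
 have : x ^+ 3 <= 1 by rewrite exprn_ile1// ltW.
 have : 0 <= x ^+ 3 by rewrite exprn_ge0// ltW.
 lra.
rewrite [cube_pos (x - 1)]cube_posE; last by lra.
have [x2|x2] := leP x 2.
 rewrite [cube_pos (x - 2)]cube_pos0; last by lra.
 have [t [xE t0 t1]] : exists t, [/\ x = 1 + t, 0 <= t & t <= 1] by exists (x - 1); split; lra.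
 rewrite xE; have -> : (1 + t - 1) = t by ring.
 have : 0 <= t ^+ 2 by rewrite sqr_ge0.
 have : t ^+ 3 <= t ^+ 2 by rewrite exprS ler_piMl// sqr_ge0.
 have : 0 <= 2 * t ^+ 3 - 3 * t ^+ 2 + 1.
  have -> : 2 * t ^+ 3 - 3 * t ^+ 2 + 1 = (1 - t) ^+ 2 * (2 * t + 1) by ring.
  by apply: mulr_ge0; [exact: sqr_ge0|lra].
 have : 0 <= t ^+ 3 by rewrite exprn_ge0.
 have -> : (1 + t) ^+ 3 = 1 + 3 * t + 3 * t ^+ 2 + t ^+ 3 by ring.
 lra.
rewrite [cube_pos (x - 2)]cube_posE; last by lra.
have [t [xE t0 t1]] : exists t, [/\ x = 3 - t, 0 <= t & t <= 1] by exists (3 - x); split; lra.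
rewrite xE.
have -> : (3 - t) ^+ 3 - 3 * (3 - t - 1) ^+ 3 + 3 * (3 - t - 2) ^+ 3 - 0 = 6 - t ^+ 3 by ring.
have : t ^+ 3 <= 1 by rewrite exprn_ile1.
have : 0 <= t ^+ 3 by rewrite exprn_ge0.
lra.
Qed.

Lemma spline_ge0 x : 0 <= spline x.
Proof.
have [x0|x0] := leP x 0.
 by rewrite splineE !smoothstep0 ?subrr//; lra.
have [x4|x4] := leP 4 x.
 by rewrite splineE !smoothstep1 ?subrr//; lra.
have [x3|x3] := leP 3 x.
 by rewrite splineE smoothstep1// subr_ge0; have /andP[] := smoothstep_ge0_le1 (x - 1).
have [x1|x1] := leP x 1.
 by rewrite splineE (smoothstep0 (x := x - 1)) ?subr0; [have /andP[] := smoothstep_ge0_le1 x|lra].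
rewrite /spline [cube_pos (x - 3)]cube_pos0 ?[cube_pos (x - 4)]cube_pos0; [|lra..].
rewrite [cube_pos x]cube_posE ?[cube_pos (x - 1)]cube_posE; [|lra..].
have [x2|x2] := leP x 2.
 rewrite [cube_pos (x - 2)]cube_pos0; last by lra.
 have [t [xE t0 t1]] : exists t, [/\ x = 1 + t, 0 <= t & t <= 1] by exists (x - 1); split; lra.
 rewrite xE; have -> : (1 + t - 1) = t by ring.
 have t2 : 0 <= t ^+ 2 by rewrite sqr_ge0.
 have : t ^+ 3 <= t ^+ 2 by rewrite exprS ler_piMl// sqr_ge0.
 have -> : (1 + t) ^+ 3 = 1 + 3 * t + 3 * t ^+ 2 + t ^+ 3 by ring.
 lra.
rewrite [cube_pos (x - 2)]cube_posE; last by lra.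
have [t [xE t0 t1]] : exists t, [/\ x = 3 - t, 0 <= t & t <= 1] by exists (3 - x); split; lra.
rewrite xE.
have -> : (3 - t) ^+ 3 - 4 * (3 - t - 1) ^+ 3 + 6 * (3 - t - 2) ^+ 3 - 4 * 0 + 0 =
 1 + 3 * t + 3 * t ^+ 2 - 3 * t ^+ 3 by ring.
have t2 : 0 <= t ^+ 2 by rewrite sqr_ge0.
have : t ^+ 3 <= t ^+ 2 by rewrite exprS ler_piMl// sqr_ge0.
lra.
Qed.

Lemma spline_supp x : spline x != 0 -> 0 < x < 4.
Proof.
move=> b0; rewrite !ltNge -negb_or; apply: contra b0 => /orP[x0|x4].
 by rewrite splineE !smoothstep0 ?subrr//; lra.
by rewrite splineE !smoothstep1 ?subrr//; lra.
Qed.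

Lemma spline_le1 x : spline x <= 1.
Proof.
by rewrite splineE; have /andP[_ ?] := smoothstep_ge0_le1 x;
 have /andP[? _] := smoothstep_ge0_le1 (x - 1); lra.
Qed.

Lemma spline_sum y (n : nat) : \sum_(j < n) spline (y - j%:R) = smoothstep y - smoothstep (y - n%:R).
Proof.
elim: n => [|n IH]; first by rewrite big_ord0 subr0 subrr.
rewrite big_ord_recr/= IH splineE (_ : y - n%:R - 1 = y - n.+1%:R); first by lra.
by rewrite -natr1; lra.
Qed.

End cubic_spline.

(** * Replacement of one coordinate at a time *)

Section lindeberg_hybrid.
Context {R : realType}.
Local Notation law := (probability R R).

Definition upd n (t : n.-tuple R) (i : 'I_n) (y : R) : n.-tuple R :=
 [tuple if j == i then y else tnth t j | j < n].

(** All that the replacement uses of smoothness. The three coefficients may depend on the other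
    coordinates but not on the value inserted. *)
Definition third_order n (F : n.-tuple R -> R) (K : R) :=
 forall i t, exists c a b : R, forall y,
  `|F (upd t i y) - c - a * y - b * y ^+ 2| <= K * `|y| ^+ 3.

Definition std_law (rho : R) (mu : law) :=
 [/\ integ mu (fun x => `|x| ^+ 3), Ex mu (fun x => x) = 0, Ex mu (fun x => x ^+ 2) = 1 &
   Ex mu (fun x => `|x| ^+ 3) <= rho].

Lemma upd_cons0 n x y (t : n.-tuple R) : upd (consR (x, t)) ord0 y = consR (y, t).
Proof.
apply: eq_from_tnth => j; rewrite tnth_mktuple.
case: (unliftP ord0 j) => [j'|] -> //=.
by rewrite /consR/= !tnthS.
Qed.

Lemma upd_consS n x y (t : n.-tuple R) i :
 upd (consR (x, t)) (lift ord0 i) y = consR (x, upd t i y).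
Proof.
apply: eq_from_tnth => j; rewrite tnth_mktuple.
case: (unliftP ord0 j) => [j'|] ->.
 by rewrite (inj_eq lift_inj) /consR/= !tnthS tnth_mktuple.
by rewrite (negbTE (neq_lift ord0 i)).
Qed.

Let pow_le (x : R) : `|x| <= 1 + `|x| ^+ 3 /\ x ^+ 2 <= 1 + `|x| ^+ 3.
Proof.
rewrite -[x ^+ 2]real_normK ?num_real//; move: (normr_ge0 x); move: `|x| => z z0.
have z2 := sqr_ge0 z; have z3 : 0 <= z ^+ 3 by rewrite exprn_ge0.
have [z1|z1] := leP z 1.
 by split; [lra|have : z ^+ 2 <= z by rewrite expr2 ler_piMl]; lra.
have : z <= z ^+ 2 by rewrite expr2 ler_peMl// ltW.
have : z ^+ 2 <= z ^+ 3 by rewrite exprS ler_peMl// ltW.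
by split; lra.
Qed.

Let meas_id : mfunT (fun x : R => x).
Proof. exact: measurable_id. Qed.

Lemma std_law_integ rho mu : std_law rho mu -> integ mu (fun x => x) /\ integ mu (fun x => x ^+ 2).
Proof.
move=> [i3 _ _ _]; have i13 : integ mu (fun x => 1 + `|x| ^+ 3).
 by apply: integD => //; exact: integ_cst.
split; apply: integ_le i13 => //; try exact: measurable_funX.
 move=> x; have [H _] := pow_le x; apply: le_trans H _; exact: ler_norm.
move=> x; rewrite ger0_norm ?sqr_ge0//; have [_ H] := pow_le x; apply: le_trans H _; exact: ler_norm.
Qed.

(** Mean 0 and variance 1 give both expectations the same main term c + b, and only the cubic error
    is left. *)
Lemma third_order_site rho (mu nu : law) (f : R -> R) (c a b K C : R) :
 0 <= K -> mfunT f -> (forall x, `|f x| <= C) ->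
 std_law rho mu -> std_law rho nu ->
 (forall y, `|f y - c - a * y - b * y ^+ 2| <= K * `|y| ^+ 3) ->
 `|Ex mu f - Ex nu f| <= 2 * (K * rho).
Proof.
move=> K0 mf fC smu snu H.
have one m : std_law rho m -> `|Ex m f - (c + b)| <= K * rho.
 move=> sm; have [i1 i2] := std_law_integ sm; have [i3 E1 E2 E3] := sm.
 have fi : integ m f by exact: integ_bounded fC.
 have -> : c + b = Ex m (fun y => c + (a * y + b * y ^+ 2)).
  rewrite ExD ?ExD ?ExZ ?E1 ?E2 ?Ex_cst//; first by ring.
  all: do ?[exact: integ_cst|exact: integZ|apply: integD].
 have i4 : integ m (fun y => c + (a * y + b * y ^+ 2)).
  by do ?[exact: integ_cst|exact: integZ|apply: integD].
 rewrite -ExB//; apply: le_trans (Ex_abs _) _; first exact: integB.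
 apply: le_trans (_ : Ex m (fun y => K * `|y| ^+ 3) <= _); last by rewrite ExZ// ler_wpM2l.
 apply: Ex_le => [||y]; [exact/integ_abs/integB|exact: integZ|].
 by apply: le_trans (H y); rewrite le_eqVlt; apply/orP; left; apply/eqP; congr `|_|; ring.
have := one _ smu; have := one _ snu; rewrite !ler_norml; lra.
Qed.

Lemma Ex_ptupleS n (mu : nat -> law) (F : n.+1.-tuple R -> R) (C : R) :
 mfunT F -> (forall t, `|F t| <= C) ->
 [/\ mfunT (fun x => Ex (ptuple n (fun i => mu i.+1)) (fun t => F (consR (x, t)))),
   mfunT (fun t : n.-tuple R => Ex (mu 0%N) (fun x => F (consR (x, t)))),
   Ex (ptuple n.+1 mu) F = Ex (mu 0%N) (fun x =>
    Ex (ptuple n (fun i => mu i.+1)) (fun t => F (consR (x, t)))) &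
   Ex (ptuple n.+1 mu) F = Ex (ptuple n (fun i => mu i.+1)) (fun t =>
    Ex (mu 0%N) (fun x => F (consR (x, t))))].
Proof.
move=> mF FC; set mu' := fun i => mu i.+1.
pose m1 := mu 0%N; pose m2 := ptuple n mu'.
have mF2 : mfunT (fun z : R * n.-tuple R => F (consR z)).
 exact: measurableT_comp mF (@measurable_consR _ n).
have i2 : (m1 \x m2)%E.-integrable setT (fun z => (F (consR z))%:E).
 exact: (@integ_bounded _ _ _ (m1 \x m2)%E _ C mF2).
have fF x : fubini_F m2 (fun z => (F (consR z))%:E) x = (Ex m2 (fun t => F (consR (x, t))))%:E.
 rewrite /fubini_F/= ExE//; apply: (@integ_bounded _ _ _ _ _ C) => //.
 by apply: measurableT_comp mF2 _; exact: measurable_pair1.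
have fG t : fubini_G m1 (fun z => (F (consR z))%:E) t = (Ex m1 (fun x => F (consR (x, t))))%:E.
 rewrite /fubini_G/= ExE//; apply: (@integ_bounded _ _ _ _ _ C) => //.
 by apply: measurableT_comp mF2 _; exact: measurable_pair2.
have iF := measurable_fubini_F i2; have iG := measurable_fubini_G i2.
have E0 : (\int[ptuple n.+1 mu]_t (F t)%:E = \int[m1 \x m2]_z (F (consR z))%:E)%E.
 rewrite integral_distribution//; first exact/measurable_EFinP.
split.
- apply/measurable_EFinP; move: iF; congr (measurable_fun _ _); apply/funext => x; exact: fF.
- apply/measurable_EFinP; move: iG; congr (measurable_fun _ _); apply/funext => x; exact: fG.
- by rewrite [LHS]/Ex E0 -(integral12_prod_meas1 i2); congr fine; apply: eq_integral => x _; exact: fF.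
- by rewrite [LHS]/Ex E0 -(integral21_prod_meas1 i2); congr fine; apply: eq_integral => x _; exact: fG.
Qed.

Lemma Ex_bounded d (T : measurableType d) (P : probability T R) (f : T -> R) C :
 mfunT f -> (forall x, `|f x| <= C) -> `|Ex P f| <= C.
Proof.
move=> mf fC; have fi := integ_bounded P mf fC; apply: le_trans (Ex_abs fi) _.
rewrite -[leRHS](Ex_cst P); apply: Ex_le => //; [exact: integ_abs|exact: integ_cst].
Qed.

(** The first coordinate is exchanged with the others held fixed, then the others with the first
    held fixed. Each exchange costs one local error. *)
Theorem hybrid rho n (mu nu : nat -> law) (F : n.-tuple R -> R) (C K : R) :
 0 <= K -> mfunT F -> (forall t, `|F t| <= C) -> third_order F K ->
 (forall i, std_law rho (mu i)) -> (forall i, std_law rho (nu i)) ->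
 `|Ex (ptuple n mu) F - Ex (ptuple n nu) F| <= n%:R * (2 * (K * rho)).
Proof.
move=> K0; elim: n mu nu F => [|n IH] mu nu F mF FC F3 smu snu.
 by rewrite subrr normr0 mul0r.
have [a1 a2 a3 a4] := Ex_ptupleS mu mF FC.
have [b1 b2 b3 b4] := Ex_ptupleS nu mF FC.
pose mu' i := mu i.+1; pose nu' i := nu i.+1.
(* the hybrid law takes its first coordinate from nu and the others from mu *)
pose mid := Ex (nu 0%N) (fun x => Ex (ptuple n mu') (fun t => F (consR (x, t)))).
have mFx x : mfunT (fun t : n.-tuple R => F (consR (x, t))).
 by apply: measurableT_comp mF _; apply: measurableT_comp (@measurable_consR _ n) _; exact: measurable_pair1.
have mFt (t : n.-tuple R) : mfunT (fun x => F (consR (x, t))).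
 by apply: measurableT_comp mF _; apply: measurableT_comp (@measurable_consR _ n) _; exact: measurable_pair2.
have [c1 c2 c3 c4] := Ex_ptupleS (fun i => if i is i'.+1 then mu i'.+1 else nu 0%N) mF FC.
have midE : mid = Ex (ptuple n mu') (fun t => Ex (nu 0%N) (fun x => F (consR (x, t)))).
 by rewrite /mid -c3 c4.
have s1 : `|Ex (ptuple n.+1 mu) F - mid| <= 2 * (K * rho).
 rewrite a4 midE -ExB; [|by apply: (integ_bounded _ a2) => t; exact: Ex_bounded|
   by apply: (integ_bounded _ c2) => t; exact: Ex_bounded].
 apply: Ex_bounded; first exact: measurable_funB.
 move=> t; have [c [a [b H]]] := F3 ord0 (consR (0, t)).
 apply: (@third_order_site rho _ _ _ c a b K C) => // y.
 by have := H y; rewrite upd_cons0.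
have s2 : `|mid - Ex (ptuple n.+1 nu) F| <= n%:R * (2 * (K * rho)).
 rewrite b3 /mid -ExB; [|by apply: (integ_bounded _ c1) => x; exact: Ex_bounded|
   by apply: (integ_bounded _ b1) => x; exact: Ex_bounded].
 apply: Ex_bounded; first exact: measurable_funB.
 move=> x; apply: IH => [||i t|i|i]; [exact: mFx|by move=> t; exact: FC| |exact: smu|exact: snu].
 by have [c [a [b H]]] := F3 (lift ord0 i) (consR (x, t)); exists c, a, b => y; rewrite -upd_consS.
rewrite -nat1r mulrDl mul1r; apply: le_trans (lerD s1 s2).
by apply: le_trans (ler_normD _ _); rewrite addrA subrK.
Qed.

End lindeberg_hybrid.

(** * Spline approximation of functions of finitely many variables *)

Section spline_approximation.
Context {R : realType} {n : nat}.
Variable Psi : {ffun 'I_n -> R} -> R.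

Definition node (h : R) (J : nat) (j : {ffun 'I_n -> 'I_(2 * J).+1}) : {ffun 'I_n -> R} :=
 [ffun Z => h * ((j Z)%:R - J%:R)].

(** Node values averaged with tensor spline weights. The shift by J centres the finitely many nodes
    at the origin. Smoothness comes from the weights alone, so it costs no regularity of [Psi]. *)
Definition spline_approx (h : R) (J : nat) (u : {ffun 'I_n -> R}) : R :=
 \sum_(j : {ffun 'I_n -> 'I_(2 * J).+1}) Psi (node h j) * \prod_Z spline (u Z / h + J%:R - (j Z)%:R).

Let wsum h J (u : {ffun 'I_n -> R}) :
 \sum_(j : {ffun 'I_n -> 'I_(2 * J).+1}) \prod_Z spline (u Z / h + J%:R - (j Z)%:R) =
 \prod_Z (smoothstep (u Z / h + J%:R) - smoothstep (u Z / h + J%:R - (2 * J).+1%:R)).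
Proof.
rewrite -(bigA_distr_bigA (fun Z (x : 'I_(2 * J).+1) => spline (u Z / h + J%:R - x%:R)))/=.
by apply: eq_bigr => Z _; rewrite spline_sum.
Qed.

Let w0 h J (u : {ffun 'I_n -> R}) (j : {ffun 'I_n -> 'I_(2 * J).+1}) :
 0 <= \prod_Z spline (u Z / h + J%:R - (j Z)%:R).
Proof. by apply: prodr_ge0 => Z _; exact: spline_ge0. Qed.

Lemma spline_approx_bounded (C h : R) J u : 0 <= C -> (forall u, `|Psi u| <= C) ->
 `|spline_approx h J u| <= C.
Proof.
move=> C0 PC; apply: le_trans (ler_norm_sum _ _ _) _.
apply: (@le_trans _ _ (C * \sum_(j : {ffun 'I_n -> 'I_(2 * J).+1}) \prod_Z spline (u Z / h + J%:R - (j Z)%:R))).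
 by rewrite mulr_sumr; apply: ler_sum => j _; rewrite normrM (ger0_norm (w0 _ _ _)) ler_wpM2r.
rewrite wsum ler_piMr//; apply: (@le_trans _ _ (\prod_(Z < n) 1)); last by rewrite big1.
apply: ler_prod => Z _; rewrite -spline_sum sumr_ge0 => [|j _]; last exact: spline_ge0.
rewrite spline_sum; have /andP[_ ?] := smoothstep_ge0_le1 (u Z / h + J%:R).
by have /andP[? _] := smoothstep_ge0_le1 (u Z / h + J%:R - (2 * J).+1%:R); lra.
Qed.

(** Well inside the box the weights sum to 1, and a node with nonzero weight is at distance at most
    4 h, the width of the support. *)
Lemma spline_approx_close (h e : R) J (u : {ffun 'I_n -> R}) : 0 < h ->
 (forall Z, `|u Z| / h + 3 <= J%:R) ->
 (forall v : {ffun 'I_n -> R}, (forall Z, `|u Z - v Z| <= 4 * h) -> `|Psi u - Psi v| <= e) ->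
 `|Psi u - spline_approx h J u| <= e.
Proof.
move=> h0 uJ He.
have w1 : \sum_(j : {ffun 'I_n -> 'I_(2 * J).+1}) \prod_Z spline (u Z / h + J%:R - (j Z)%:R) = 1.
 rewrite wsum big1// => Z _; have := uJ Z; have := ler_norm (u Z); have := ler_norm (- u Z).
 rewrite normrN => N1 N2 H; have hi : 0 < h^-1 by rewrite invr_gt0.
 have : - (`|u Z| / h) <= u Z / h <= `|u Z| / h.
  by rewrite -mulNr !ler_pM2r//; lra.
 move=> B; rewrite smoothstep1 ?smoothstep0; [lra| |lra].
 by rewrite -natr1 natrM; lra.
set S := \sum_(j : _) _ in w1.
have -> : Psi u = Psi u * S by rewrite w1 mulr1.
have -> : e = e * S by rewrite w1 mulr1.
rewrite /S !mulr_sumr -sumrB; apply: le_trans (ler_norm_sum _ _ _) _.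
apply: ler_sum => j _; rewrite -mulrBl normrM (ger0_norm (w0 _ _ _)).
have [->|wne] := eqVneq (\prod_Z spline (u Z / h + J%:R - (j Z)%:R)) 0; first by rewrite !mulr0.
rewrite ler_wpM2r//; apply: He => Z; rewrite ffunE.
have : spline (u Z / h + J%:R - (j Z)%:R) != 0.
 by apply: contra_neq wne => E; rewrite (bigD1 Z)//= E mul0r.
move/spline_supp => H.
have -> : u Z - h * ((j Z)%:R - J%:R) = h * (u Z / h + J%:R - (j Z)%:R).
 by rewrite !mulrDr mulrCA divff ?gt_eqF//; lra.
rewrite normrM gtr0_norm// mulrC ler_pM2r// ger0_norm; lra.
Qed.

Lemma measurable_spline_approx d (T : measurableType d) h J (U : T -> {ffun 'I_n -> R}) :
 (forall Z, mfunT (fun w => U w Z)) ->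
 mfunT (fun w => spline_approx h J (U w)).
Proof.
move=> mU; apply: measurable_sum => j; apply: measurable_funM => //.
apply: measurable_prod => Z _; apply: (measurableT_comp measurable_spline).
by apply: measurable_funB => //; apply: measurable_funD => //; exact: measurable_funM.
Qed.

(** Only [u] is confined to the box. That [v] may leave it covers the spline nodes near the
    boundary. *)
Definition unif_on_boxes := forall r e : R, 0 < e -> exists2 h : R, 0 < h &
 forall u v : {ffun 'I_n -> R}, (forall Z, `|u Z| <= r) -> (forall Z, `|u Z - v Z| <= h) ->
  `|Psi u - Psi v| <= e.

(** Spline approximants with step 1 / (i + 1) and J = (i + 1)^2 converge pointwise: the box covered
    by the nodes grows while the step shrinks. *)
Lemma measurable_unif d (T : measurableType d) (U : T -> {ffun 'I_n -> R}) : unif_on_boxes ->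
 (forall Z, mfunT (fun w => U w Z)) ->
 mfunT (fun w => Psi (U w)).
Proof.
move=> uP mU; pose a (i : nat) w := spline_approx (i.+1%:R^-1) (i.+1 * i.+1)%N (U w).
apply: (@measurable_fun_cvg _ _ _ _ a) => [i|w _]; first exact: measurable_spline_approx.
pose r := \sum_Z `|U w Z|.
have rZ Z : `|U w Z| <= r by rewrite /r (bigD1 Z)//= lerDl sumr_ge0.
apply/cvgrPdist_le => e e0; have [h h0 Hh] := uP r e e0.
near=> i; apply: spline_approx_close => [|Z|v Hv]; first by rewrite invr_gt0.
 rewrite invrK; apply: (@le_trans _ _ (r * i.+1%:R + 3 * i.+1%:R)).
  rewrite lerD ?ler_wpM2r// ler_peMr// ler1n//.
 rewrite -mulrDl natrM ler_wpM2r// -[i.+1%:R]natr1 -[leLHS]addr0 lerD//.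
 by near: i; exact: nbhs_infty_ger.
apply: Hh => // Z; apply: le_trans (Hv Z) _.
rewrite ler_pdivrMr// mulrC -ler_pdivrMr// -[i.+1%:R]natr1 -[leLHS]addr0 lerD//.
by near: i; exact: nbhs_infty_ger.
Unshelve. all: by end_near.
Qed.

End spline_approximation.

(** * Normalised block sums *)

Section block_sums.
Context {R : realType} {n : nat}.

Definition bsum (m : nat) (x : nat -> R) : {ffun 'I_n -> R} :=
 [ffun Z : 'I_n => (Num.sqrt m%:R)^-1 * \sum_(r < m) x (Z * m + r)%N].

Variables (Psi : {ffun 'I_n -> R} -> R) (C : R).
Hypotheses (C0 : 0 <= C) (PC : forall u, `|Psi u| <= C).

Definition spline_blocks h J m (t : (n * m).-tuple R) := spline_approx Psi h J (bsum m (nth 0 t)).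

Lemma bsum_upd m (t : (n * m).-tuple R) (i : 'I_(n * m)) y Z :
 bsum m (nth 0 (upd t i y)) Z = bsum m (nth 0 (upd t i 0)) Z +
  (if (Z == i %/ m :> nat)%N then (Num.sqrt m%:R)^-1 * y else 0).
Proof.
have m0 : (0 < m)%N by case: m t i => // t; rewrite muln0 => -[].
have nthE z (r : 'I_m) : nth 0 (upd t i z) (Z * m + r) = if (Z * m + r == i)%N then z else nth 0 t (Z * m + r).
 have lt : (Z * m + r < n * m)%N.
  apply: (@leq_trans (Z.+1 * m)%N); first by rewrite mulSn addnC ltn_add2r.
  by rewrite leq_mul2r ltn_ord orbT.
 by rewrite -[(Z * m + r)%N]/(nat_of_ord (Ordinal lt)) -!tnth_nth tnth_mktuple.
rewrite !ffunE; under eq_bigr do rewrite nthE.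
under [in RHS]eq_bigr do rewrite nthE.
case: ifPn => [/eqP ZE|ZE]; last first.
 rewrite addr0; congr (_ * _); apply: eq_bigr => r _.
 case: eqP => // E; case/negP: ZE; rewrite -E divnMDl// divn_small ?addn0//.
rewrite -mulrDr; congr (_ * _).
pose r0 := Ordinal (ltn_pmod i m0).
have E0 : (Z * m + r0 == i)%N by rewrite ZE /= -divn_eq.
rewrite (bigD1 r0)//= [in RHS](bigD1 r0)//= E0 add0r addrC; congr (_ + _).
apply: eq_bigr => r rne; case: eqP => // E; case/negP: rne; apply/eqP/val_inj => /=.
by rewrite -E modnMDl modn_small.
Qed.

(** An entry y moves one spline argument by y / (h sqrt m), whose cube brings the factor m^(- 3/2).
    The other weights are at most C, for each of the (2 J + 1)^n nodes. *)
Lemma third_order_approx h J m : 0 < h -> (0 < m)%N ->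
 third_order (@spline_blocks h J m) (C * ((2 * J).+1 ^ n)%:R * 3 / (h * Num.sqrt m%:R) ^+ 3).
Proof.
move=> h0 m0 i t.
have sm : 0 < Num.sqrt (m%:R : R) by rewrite sqrtr_gt0 ltr0n.
have ltZ : (i %/ m < n)%N by rewrite ltn_divLR.
pose Z0 := Ordinal ltZ; pose u0 := bsum m (nth 0 (upd t i 0)).
pose s := (h * Num.sqrt m%:R)^-1.
have s0 : 0 < s by rewrite invr_gt0 mulr_gt0.
pose I : finType := {ffun 'I_n -> 'I_(2 * J).+1}.
pose x0 (j : I) := u0 Z0 / h + J%:R - (j Z0)%:R.
have [a Ha] := choice (fun j : I => spline_taylor (x0 j)).
have [b Hb] := choice Ha.
pose wt (j : I) := Psi (node h j) * \prod_(Z | Z != Z0) spline (u0 Z / h + J%:R - (j Z)%:R).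
have wtC j : `|wt j| <= C.
 rewrite normrM -[leRHS]mulr1 ler_pM// ger0_norm; last by apply: prodr_ge0 => Z _; exact: spline_ge0.
 apply: (@le_trans _ _ (\prod_(Z < n | Z != Z0) 1)); last by rewrite big1.
 by apply: ler_prod => Z _; rewrite spline_ge0 spline_le1.
exists (\sum_j wt j * spline (x0 j)), (\sum_j wt j * (a j * s)), (\sum_j wt j * (b j * s ^+ 2)) => y.
have FE : @spline_blocks h J m (upd t i y) = \sum_j wt j * spline (x0 j + s * y).
 apply: eq_bigr => j _; rewrite /wt -mulrA; congr (_ * _).
 rewrite (bigD1 Z0)// [LHS]mulrC; congr (_ * _).
  apply: eq_bigr => Z ZZ0; by rewrite bsum_upd ifN ?addr0.
 rewrite bsum_upd eqxx /x0 /u0; congr spline.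
 by rewrite /s invfM; ring.
rewrite FE !mulr_suml -!sumrB; apply: le_trans (ler_norm_sum _ _ _) _.
apply: (@le_trans _ _ (\sum_(j : I) C * (3 * `|s * y| ^+ 3))).
 apply: ler_sum => j _; have := Hb j (s * y).
 set X := (X in `|X| <= _) => HX.
 have -> : wt j * spline (x0 j + s * y) - wt j * spline (x0 j) - wt j * (a j * s) * y -
  wt j * (b j * s ^+ 2) * y ^+ 2 = wt j * X by rewrite /X; ring.
 by rewrite normrM ler_pM.
rewrite sumr_const card_ffun !card_ord -mulr_natr normrM (gtr0_norm s0) exprMn /s exprVn.
rewrite le_eqVlt; apply/orP; left; apply/eqP; ring.
Qed.

Lemma measurable_spline_blocks h J m : mfunT (@spline_blocks h J m).
Proof.
apply: measurable_spline_approx => Z; under eq_fun do rewrite ffunE.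
apply: measurable_funM => //; apply: measurable_sum => r.
have lt : (Z * m + r < n * m)%N.
 apply: (@leq_trans (Z.+1 * m)%N); first by rewrite mulSn addnC ltn_add2r.
 by rewrite leq_mul2r ltn_ord orbT.
have -> : (fun t : (n * m).-tuple R => nth 0 t (Z * m + r)) = (fun t => tnth t (Ordinal lt)).
 by apply/funext => t; rewrite (tnth_nth 0).
exact: measurable_tnth.
Qed.

End block_sums.

Lemma indep_inj {d} {T : measurableType d} {R : realType} (P : probability T R)
  (I J : choiceType) (X : I -> T -> R) (f : J -> I) : injective f ->
 mutually_independent P X -> mutually_independent P (fun j => X (f j)).
Proof.
move=> finj ind S A mA.
pose A' i := if [pick j : S | f (val j) == i] is Some j then A (val j) else setT.
have A'E j : j \in S -> A' (f j) = A j.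
 move=> jS; rewrite /A'; case: pickP => [j' /eqP /finj -> //|/(_ [` jS]%fset)].
 by rewrite /= eqxx.
have mA' i : measurable (A' i) by rewrite /A'; case: pickP.
have := ind [fset f j | j in S]%fset A' mA'; rewrite big_imfset/=; last by move=> x y _ _ /finj.
rewrite big_seq (eq_bigr (fun j => P (X (f j) @^-1` A j))) => [|j jS]; last by rewrite A'E.
rewrite -big_seq => <-; congr (P _); apply/seteqP; split=> w H /=.
 by move=> i /imfsetP[j /= jS ->]; rewrite A'E//; exact: H.
by move=> j jS; have := H (f j); rewrite A'E//; apply; apply/imfsetP; exists j.
Qed.

Section standard_noise.
Context {d} {T : measurableType d} {R : realType} (P : probability T R).
Variable X : nat -> {RV P >-> R}.

Definition std_noise (rho : R) := mutually_independent P (fun i => X i : T -> R) /\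
 forall i, [/\ integ P (fun w => `|X i w| ^+ 3), Ex P (X i) = 0, Ex P (fun w => X i w ^+ 2) = 1 &
  Ex P (fun w => `|X i w| ^+ 3) <= rho].

Variable rho : R.
Hypothesis sX : std_noise rho.

Lemma L2_noise i : L2 P (X i).
Proof.
have [_ /(_ i)[i3 _ _ _]] := sX; apply: integ_sqr_L2 => //.
apply: (@integ_le _ _ _ _ _ (fun w => 1 + `|X i w| ^+ 3)).
- exact: measurable_funX.
- move=> w; rewrite ger0_norm ?sqr_ge0// -[X i w ^+ 2]real_normK ?num_real//.
 apply: le_trans (ler_norm _); move: (normr_ge0 (X i w)); move: `|X i w| => z z0.
 have z3 : 0 <= z ^+ 3 by rewrite exprn_ge0.
 have [z1|z1] := leP z 1; first by have : z ^+ 2 <= 1 by [rewrite exprn_ile1|]; lra.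
 by have : z ^+ 2 <= z ^+ 3 by [rewrite exprS ler_peMl ?sqr_ge0// ltW|]; lra.
- by apply: integD => //; exact: integ_cst.
Qed.

Lemma std_noise_law i : std_law rho (distribution P (X i)).
Proof.
have [_ /(_ i)[i3 E1 E2 E3]] := sX.
have m3 : mfunT (fun x : R => `|x| ^+ 3) by apply: measurable_funX; exact: normr_measurable.
have m2 : mfunT (fun x : R => x ^+ 2) by exact: measurable_funX.
have [j3 F3] := integ_comp_law m3 i3.
have [_ F1] := integ_comp_law (@measurable_id _ _ setT) (L2_integ (L2_noise i)).
have [_ F2] := integ_comp_law m2 (L2_sqr_integ (L2_noise i)).
by split; rewrite ?F1 ?F2 ?F3.
Qed.

(** A block sum is an off-diagonal form of degree one with constant weight 1 / sqrt m. *)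
Lemma L2_bsum n m (Z : 'I_n) : (0 < m)%N ->
 L2 P (fun w => bsum m (X ^~ w) Z) /\ Ex P (fun w => bsum m (X ^~ w) Z ^+ 2) <= 1.
Proof.
move=> m0; pose X' r := X (Z * m + r)%N; have [ind mom] := sX.
have ind' : mutually_independent P (fun r => X' r : T -> R).
 by apply: (@indep_inj _ _ _ _ _ _ (fun i => X i : T -> R) (fun r => Z * m + r)%N) => // x y /addnI.
have X0 r : Ex P (X' r) = 0 by have [] := mom (Z * m + r)%N.
have X2 r : (e2 P (X' r) <= 1%:E)%E.
 by rewrite L2_e2E; [have [_ _ -> _] := mom (Z * m + r)%N|exact: L2_noise].
pose c : R := (Num.sqrt m%:R)^-1; pose W (l : {ffun 'I_1 -> 'I_m}) := c.
have WE w : multiform W (X' ^~ w) = bsum m (X ^~ w) Z.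
 rewrite /multiform ffunE mulr_sumr (reindex (fun r : 'I_m => [ffun _ : 'I_1 => r])) /=; last first.
  exists (fun l : {ffun 'I_1 -> 'I_m} => l ord0) => [r _|l _]; first by rewrite ffunE.
  by apply/ffunP => q; rewrite ffunE [q]ord1.
 apply: eq_big => [r|r _]; last by rewrite big_ord1 ffunE.
 by apply/injectiveP => x y _; rewrite !ord1.
have sm : Num.sqrt (m%:R : R) ^+ 2 = m%:R by rewrite sqr_sqrtr.
have cm : \sum_(l : {ffun 'I_1 -> 'I_m} | injectiveb l) W l ^+ 2 <= 1.
 apply: (@le_trans _ _ (\sum_(l : {ffun 'I_1 -> 'I_m}) c ^+ 2)).
  by rewrite [leRHS](bigID (fun l : {ffun 'I_1 -> 'I_m} => injectiveb l))/= lerDl sumr_ge0// => l _; exact: sqr_ge0.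
 by rewrite sumr_const card_ffun !card_ord expn1 /c exprVn sm -[_ *+ m]mulr_natr mulVf// pnatr_eq0 -lt0n.
have L := L2_multiform ind' X2 W; have E := e2_multiform ind' X0 X2 (ltn0Sn 0) W.
under eq_fun do rewrite -WE; split=> //.
under eq_Ex do rewrite -WE; rewrite -lee_fin -L2_e2E//; apply: le_trans E _.
by rewrite expn1 mul1r lee_fin.
Qed.

End standard_noise.

(** * Lindeberg's principle for block sums *)

Section lindeberg.
Context {R : realType} {n : nat}.
Variables (Psi : {ffun 'I_n -> R} -> R) (C rho : R).
Hypotheses (PC : forall u, `|Psi u| <= C) (uP : unif_on_boxes Psi).

(** n m exchanges of order m^(- 3/2) leave an error of order m^(- 1/2). The smoothing error is
    controlled on a box by uniform continuity and off the box by the second moments of the block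
    sums. The threshold is fixed before both probability spaces. *)
Theorem lindeberg (e : R) : 0 < e -> exists m0 : nat, forall m, (m0 <= m)%N ->
 forall (d d' : measure_display) (T : measurableType d) (T' : measurableType d')
  (P : probability T R) (P' : probability T' R)
  (X : nat -> {RV P >-> R}) (X' : nat -> {RV P' >-> R}),
 std_noise X rho -> std_noise X' rho ->
 `|Ex P (fun w => Psi (bsum m (X ^~ w))) - Ex P' (fun w => Psi (bsum m (X' ^~ w)))| <= e.
Proof.
move=> e0; have C0 : 0 <= C by apply: le_trans (PC [ffun=> 0]).
(* Radius of the box: the crude bound 2 C off the box, paid through Chebyshev's inequality for n
   coordinates, costs at most e / 8. *)
pose r0 := 16 * C * n%:R / e + 1.
have r01 : 1 <= r0 by rewrite /r0 lerDr; apply: divr_ge0; [rewrite !mulr_ge0|exact: ltW].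
have r02 : 2 * C * n%:R / r0 ^+ 2 <= e / 8.
 rewrite ler_pdivrMr ?exprn_gt0//; last by lra.
 apply: (@le_trans _ _ (e / 8 * r0)).
  have : 16 * C * n%:R / e * e = 16 * C * n%:R by rewrite divfK// gt_eqF.
  by rewrite /r0; lra.
 by apply: ler_wpM2l; [rewrite divr_ge0// ltW|rewrite expr2 ler_peMl//; lra].
have e8 : 0 < e / 8 by rewrite divr_gt0.
have [h' h'0 Hh] := uP r0 e8.
(* Division by 4 because a node with nonzero weight may be 4 h away. *)
pose h := h' / 4; have h0 : 0 < h by rewrite divr_gt0.
pose J := (Num.truncn (r0 / h + 3)).+1.
have JE : r0 / h + 3 <= J%:R by rewrite ltW// truncnS_gt.
pose c0 := C * ((2 * J).+1 ^ n)%:R * 3.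
have c00 : 0 <= c0 by rewrite !mulr_ge0.
have close u : `|Psi u - spline_approx Psi h J u| <= e / 8 + \sum_Z 2 * C / r0 ^+ 2 * u Z ^+ 2.
 have r2 : 0 < r0 ^+ 2 by rewrite exprn_gt0//; lra.
 have t0 Z : 0 <= 2 * C / r0 ^+ 2 * u Z ^+ 2.
  by apply: mulr_ge0; [apply: divr_ge0; [exact: mulr_ge0|exact: sqr_ge0]|exact: sqr_ge0].
 have [/forallP inb|/existsP[Z]] := boolP [forall Z, `|u Z| <= r0].
  apply: le_trans (_ : e / 8 <= _); last by rewrite lerDl sumr_ge0.
  apply: spline_approx_close => [//|Z|v Hv].
   by apply: le_trans JE; rewrite lerD2r ler_pM2r ?invr_gt0.
  apply: Hh => // Z; apply: le_trans (Hv Z) _; rewrite /h; lra.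
 rewrite -ltNge => uZ; apply: (@le_trans _ _ (2 * C)).
  apply: le_trans (ler_normB _ _) _; have := PC u.
  by have := spline_approx_bounded h J u C0 PC; lra.
 apply: (@le_trans _ _ (2 * C / r0 ^+ 2 * u Z ^+ 2)).
  rewrite mulrAC ler_pdivlMr// ler_wpM2l ?mulr_ge0//.
  by rewrite -[leRHS]real_normK ?num_real//; apply: lerXn2r; rewrite ?nnegrE//; lra.
 have : 0 <= \sum_(i | i != Z) 2 * C / r0 ^+ 2 * u i ^+ 2 by apply: sumr_ge0.
 by rewrite [X in _ <= _ + X](bigD1 Z)//=; lra.
(* Total replacement error multiplied by sqrt m; [m0] is chosen so that Kr / sqrt m is at most e /
   2. *)
pose Kr := 2 * (c0 / h ^+ 3 * `|rho|) * n%:R.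
have Kr0 : 0 <= Kr by rewrite !mulr_ge0// invr_ge0 exprn_ge0// ltW.
pose m0 := (Num.truncn ((2 * Kr / e) ^+ 2)).+1.
exists m0 => m mm0 d d' T T' P P' X X' sX sX'.
have m0' : (0 < m)%N by exact: leq_trans mm0.
have mR : 0 < (m%:R : R) by rewrite ltr0n.
have sm : 0 < Num.sqrt (m%:R : R) by rewrite sqrtr_gt0.
have sm2 : Num.sqrt (m%:R : R) ^+ 2 = m%:R by rewrite sqr_sqrtr.
have smle : 2 * Kr / e <= Num.sqrt (m%:R : R).
 rewrite -(@ler_pXn2r _ 2)// ?nnegrE; [|by apply: divr_ge0; [exact: mulr_ge0|exact: ltW]|exact: ltW].
 rewrite sm2; apply: le_trans (_ : m0%:R <= _); last by rewrite ler_nat.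
 by rewrite ltW// truncnS_gt.
have side d1 (T1 : measurableType d1) (P1 : probability T1 R) (Y : nat -> {RV P1 >-> R}) :
  std_noise Y rho ->
  `|Ex P1 (fun w => Psi (bsum m (Y ^~ w))) -
   Ex (ptuple (n * m) (fun i => distribution P1 (Y i))) (@spline_blocks R n Psi h J m)| <= e / 4.
 move=> sY; have [ind mom] := sY.
 have mB (Z : 'I_n) : mfunT (fun w => bsum m (Y ^~ w) Z : R).
  by have [[]] := L2_bsum sY Z m0'.
 have mPsi := measurable_unif uP mB.
 have mA := measurable_spline_approx Psi h J mB.
 have iPsi := integ_bounded P1 mPsi (fun w => PC _).
 have iA := integ_bounded P1 mA (fun w => spline_approx_bounded h J _ C0 PC).
 have bE w : bsum m (nth 0 (xtuple Y (n * m) w)) = bsum m (Y ^~ w) :> {ffun 'I_n -> R}.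
  apply/ffunP => Z; rewrite !ffunE; congr (_ * _); apply: eq_bigr => r _.
  have lt : (Z * m + r < n * m)%N.
   apply: (@leq_trans (Z.+1 * m)%N); first by rewrite mulSn addnC ltn_add2r.
   by rewrite leq_mul2r ltn_ord orbT.
  by rewrite -[(Z * m + r)%N]/(nat_of_ord (Ordinal lt)) -tnth_nth tnth_mktuple.
 rewrite -(integral_xtuple ind (measurable_spline_blocks Psi h J (m := m))); last first.
  by move: iA; congr (integ P1 _); apply/funext => w; rewrite /spline_blocks bE.
 have -> : (fun w => spline_blocks Psi h J (xtuple Y (n * m) w)) =
   (fun w => spline_approx Psi h J (bsum m (Y ^~ w))).
  by apply/funext => w; rewrite /spline_blocks bE.
 rewrite -ExB//; apply: le_trans (Ex_abs _) _; first exact: integB.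
 have i2 (Z : 'I_n) : integ P1 (fun w => bsum m (Y ^~ w) Z ^+ 2 : R).
  by apply: L2_sqr_integ; have [] := L2_bsum sY Z m0'.
 apply: (@le_trans _ _ (Ex P1 (fun w => e / 8 + \sum_Z 2 * C / r0 ^+ 2 * bsum m (Y ^~ w) Z ^+ 2))).
  apply: Ex_le => [||w]; [exact/integ_abs/integB| |exact: close].
  by apply: integD; [exact: integ_cst|apply: integ_big => Z _; exact: integZ].
 rewrite ExD ?Ex_cst ?Ex_big; [|by move=> Z _; exact: integZ|exact: integ_cst|
  by apply: integ_big => Z _; exact: integZ].
 apply: (@le_trans _ _ (e / 8 + \sum_(Z < n) 2 * C / r0 ^+ 2)).
  rewrite lerD2l; apply: ler_sum => Z _; rewrite ExZ//; apply: ler_piMr.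
   by apply: divr_ge0; [exact: mulr_ge0|exact: sqr_ge0].
  by have [] := L2_bsum sY Z m0'.
 rewrite sumr_const card_ord -mulr_natr mulrAC; lra.
have := side _ _ P X sX; have := side _ _ P' X' sX'.
have hyb := @hybrid R `|rho| (n * m) (fun i => distribution P (X i)) (fun i => distribution P' (X' i))
 (@spline_blocks R n Psi h J m) C _ _ (measurable_spline_blocks Psi h J (m := m))
 (fun t => spline_approx_bounded h J _ C0 PC) (third_order_approx PC J h0 m0').
have weak (mu : probability R R) : std_law rho mu -> std_law `|rho| mu.
 by move=> [? ? ? H]; split=> //; apply: le_trans H (ler_norm _).
have {}hyb := hyb _ (fun i => weak _ (std_noise_law sX i)) (fun i => weak _ (std_noise_law sX' i)).
have K0 : 0 <= c0 / (h * Num.sqrt m%:R) ^+ 3 by apply: divr_ge0 => //; apply: exprn_ge0; apply: ltW; exact: mulr_gt0.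
have {}hyb := hyb K0.
have small : (n * m)%:R * (2 * (c0 / (h * Num.sqrt m%:R) ^+ 3 * `|rho|)) <= e / 2.
 have -> : (n * m)%:R * (2 * (c0 / (h * Num.sqrt m%:R) ^+ 3 * `|rho|)) = Kr / Num.sqrt m%:R.
  rewrite /Kr exprMn natrM -{1}sm2; move: (Num.sqrt (m%:R : R)) sm => x x0.
  by field; rewrite !gt_eqF.
 rewrite ler_pdivrMr//; move: smle; rewrite ler_pdivrMr//; lra.
move: hyb; rewrite -/c0 => hyb; have {}hyb := le_trans hyb small.
move: hyb; rewrite !ler_norml; lra.
Qed.

End lindeberg.

(** * Power integrals on the line *)

Section power_integrals.
Context {R : realType}.
Local Notation mu := (@lebesgue_measure R).

(** The truncated power, whose value 0 for y <= 0 encodes the support condition s > x of the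
    kernels. *)
Definition powp (p y : R) : R := if 0 < y then y `^ (- p) else 0.

Lemma powRN_mul (h p : R) : 0 < h -> h `^ (- p) * h = h `^ (1 - p).
Proof.
move=> h0; rewrite -{2}(powRr1 (ltW h0)) -powRD; first by rewrite addrC.
by rewrite (gt_eqF h0) implybT.
Qed.

Lemma powp_ge0 p y : 0 <= powp p y.
Proof. by rewrite /powp; case: ifP => // _; exact: powR_ge0. Qed.

Lemma measurable_powp p : mfunT (powp p).
Proof.
apply: measurable_fun_if => //; first exact: measurable_fun_ltr.
 exact: measurable_funS (measurable_powR _).
Qed.

Let itv_integral (F : nat -> set R) (f : R -> R) (b : nat -> R) (B : R) :
 (forall n, measurable (F n)) -> trivIset setT F -> mfunT f ->
 (forall x, 0 <= f x) ->
 (forall n, \int[mu]_(x in F n) (f x)%:E <= (b n)%:E)%E ->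
 (forall M, \sum_(n < M) b n <= B) ->
 (\int[mu]_(x in \bigcup_n F n) (f x)%:E <= B%:E)%E.
Proof.
move=> mF tF mf f0 Fb bB; rewrite ge0_integral_bigcup//=; last 2 first.
- by apply/measurable_EFinP; exact: measurable_funTS.
- by move=> x _; rewrite lee_fin.
apply: lime_le.
 by apply: is_cvg_nneseries => n _ _; apply: integral_ge0 => x _; rewrite lee_fin.
apply: nearW => M; rewrite big_mkord; apply: le_trans (_ : (\sum_(n < M) b n)%:E <= _)%E; last by rewrite lee_fin.
by rewrite -sumEFin; apply: lee_sum => n _; exact: Fb.
Qed.

Let itv_const (i : interval R) (f : R -> R) (c l : R) : mfunT f -> (forall x, 0 <= f x) ->
 (mu [set` i] <= l%:E)%E -> 0 <= c -> (forall x, x \in i -> f x <= c) ->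
 (\int[mu]_(x in [set` i]) (f x)%:E <= (c * l)%:E)%E.
Proof.
move=> mf f0 il c0 fc.
apply: (@le_trans _ _ (\int[mu]_(x in [set` i]) c%:E)%E).
 apply: ge0_le_integral => //=; try by move=> x; rewrite lee_fin.
 - by apply/measurable_EFinP; exact: measurable_funTS.
by rewrite integral_cst//= EFinM; apply: lee_wpmul2l; rewrite ?lee_fin.
Qed.

(** Cells of length h, on each of which the integrand is at most its value at the left end, reduce
    the integral to the series of n^(- p). *)
Lemma powp_tail p : 1 < p -> exists2 C : R, 0 < C & forall h, 0 < h ->
 (\int[mu]_(y in [set y : R | (h <= y)%R]) (powp p y)%:E <= (C * h `^ (1 - p))%:E)%E.
Proof.
move=> p1; have [C C0 HC] := sum_powRN_bounded p1; exists C => // h h0.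
pose F (n : nat) := `[h * n.+1%:R, h * n.+2%:R[%classic : set R.
have -> : [set y : R | (h <= y)%R] = \bigcup_n F n.
 apply/seteqP; split=> y /=.
  move=> hy; have yh : 1 <= y / h by rewrite ler_pdivlMr// mul1r.
  have y0 : 0 <= y / h by rewrite (le_trans ler01).
  have /andP[t1 t2] := truncn_itv y0; move: t1 t2; set t := Num.truncn _ => t1 t2.
  have tp : (0 < t)%N by rewrite lt0n; apply: contraTneq t2 => ->; rewrite -leNgt.
  exists t.-1 => //; rewrite /F/= in_itv/= prednK//.
  by apply/andP; split; [rewrite mulrC -ler_pdivlMr|rewrite mulrC -ltr_pdivrMr].
 move=> [n _]; rewrite /F/= in_itv/= => /andP[+ _]; apply: le_trans.
 by apply: ler_peMr; [exact: ltW|rewrite ler1n].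
apply: (@itv_integral F (powp p) (fun n => (h * n.+1%:R) `^ (- p) * h)).
- by move=> n; exact: measurable_itv.
- apply/trivIsetP => i j _ _; wlog ij : i j / (i < j)%N.
  by move=> H ne; have [?|?|e] := ltngtP i j; [exact: H|rewrite setIC; apply: H; rewrite // eq_sym|rewrite e eqxx in ne].
 move=> _; apply/seteqP; split=> // y []; rewrite /F/= !in_itv/= => /andP[_ y1] /andP[y2 _].
 have : h * i.+2%:R <= h * j.+1%:R by rewrite ler_pM2l// ler_nat.
 by rewrite leNgt; case/negP; exact: le_lt_trans y1.
- exact: measurable_powp.
- exact: powp_ge0.
- move=> n; apply: itv_const.
 + exact: measurable_powp.
 + exact: powp_ge0.
 + rewrite lebesgue_measure_itv/= lte_fin ltr_pM2l// ltr_nat ltnS leqnn -EFinD lee_fin -mulrBr.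
  by rewrite -[n.+2%:R]natr1 addrAC subrr add0r mulr1.
 + exact: powR_ge0.
 + move=> y; rewrite in_itv/= => /andP[hy _]; have hn : 0 < h * n.+1%:R by rewrite mulr_gt0.
  have y0 : 0 < y by exact: lt_le_trans hy.
  by rewrite /powp y0 !powRN lef_pV2 ?posrE ?powR_gt0//; apply: ge0_ler_powR; rewrite ?nnegrE ?(ltW hn) ?(ltW y0) ?hy//; lra.
- move=> M; apply: (@le_trans _ _ (\sum_(n < M) n.+1%:R `^ (- p) * h `^ (1 - p))).
  rewrite le_eqVlt; apply/orP; left; apply/eqP; apply: eq_bigr => n _.
  rewrite (powRM _ (ltW h0) (ler0n _ _)) -mulrA mulrCA; congr (_ * _).
  exact: powRN_mul.
 by rewrite -mulr_suml ler_wpM2r ?powR_ge0.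
Qed.

(** The cells ]h / (n + 2), h / (n + 1)] accumulate at 0. Value times length is at most h^(1 - p) (n
    + 1)^(- (2 - p)), and 2 - p > 1. *)
Lemma powp_head p : 0 < p < 1 -> exists2 C : R, 0 < C & forall h, 0 < h ->
 (\int[mu]_(y in [set y : R | (y <= h)%R]) (powp p y)%:E <= (C * h `^ (1 - p))%:E)%E.
Proof.
move=> pI; have [p0 p1] := andP pI; have [|C C0 HC] := @sum_powRN_bounded R (2 - p); first by lra.
exists C => // h h0.
pose F (n : nat) := `]h / n.+2%:R, h / n.+1%:R]%classic : set R.
have mG : measurable ([set y : R | (y <= h)%R] : set R).
 by rewrite (_ : [set y | _] = `]-oo, h]%classic)//; apply/seteqP; split=> y /=; rewrite in_itv.
have -> : (\int[mu]_(y in [set y : R | (y <= h)%R]) (powp p y)%:E = \int[mu]_(y in \bigcup_n F n) (powp p y)%:E)%E.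
 rewrite integral_mkcond [RHS]integral_mkcond; apply: eq_integral => y _.
 rewrite !patchE; case: (ltP 0 y) => y0; last first.
  by rewrite /powp ltNge y0/= !if_same.
 suff -> : (y \in [set y : R | (y <= h)%R]) = (y \in \bigcup_n F n) by [].
 apply/idP/idP; rewrite !inE/=.
  move=> hy; have yh : 1 <= h / y by rewrite ler_pdivlMr// mul1r.
  have y1 : 0 <= h / y by rewrite (le_trans ler01).
  have /andP[t1 t2] := truncn_itv y1; move: t1 t2; set t := Num.truncn _ => t1 t2.
  have tp : (0 < t)%N by rewrite lt0n; apply: contraTneq t2 => ->; rewrite -leNgt.
  exists t.-1 => //; rewrite /F/= in_itv/= prednK//; apply/andP; split.
   by rewrite ltr_pdivrMr// mulrC -ltr_pdivrMr.
  by rewrite ler_pdivlMr ?ltr0n// mulrC -ler_pdivlMr.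
 move=> [n _]; rewrite /F/= in_itv/= => /andP[_]; move/le_trans; apply.
 by rewrite ler_pdivrMr//; apply: ler_peMr; [exact: ltW|rewrite ler1n].
apply: (@itv_integral F (powp p) (fun n => (h / n.+2%:R) `^ (- p) * (h / n.+1%:R - h / n.+2%:R))).
- by move=> n; exact: measurable_itv.
- apply/trivIsetP => i j _ _; wlog ij : i j / (i < j)%N.
  by move=> H ne; have [?|?|e] := ltngtP i j; [exact: H|rewrite setIC; apply: H; rewrite // eq_sym|rewrite e eqxx in ne].
 move=> _; apply/seteqP; split=> // y []; rewrite /F/= !in_itv/= => /andP[y1 _] /andP[_ y2].
 have : h / j.+1%:R <= h / i.+2%:R by rewrite ler_pM2l// lef_pV2 ?posrE// ler_nat.
 by rewrite leNgt; case/negP; exact: lt_le_trans y2.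
- exact: measurable_powp.
- exact: powp_ge0.
- move=> n; have lt : h / n.+2%:R < h / n.+1%:R by rewrite ltr_pM2l// ltf_pV2 ?posrE// ltr_nat.
 apply: itv_const.
 + exact: measurable_powp.
 + exact: powp_ge0.
 + by rewrite lebesgue_measure_itv/= lte_fin lt -EFinD.
 + exact: powR_ge0.
 + move=> y; rewrite in_itv/= => /andP[hy _]; have hn : 0 < h / n.+2%:R by rewrite divr_gt0.
  have y0 : 0 < y by exact: lt_trans hy.
  by rewrite /powp y0 !powRN lef_pV2 ?posrE ?powR_gt0//; apply: ge0_ler_powR; rewrite ?nnegrE ?(ltW hn) ?(ltW y0) ?(ltW hy)// ltW.
- move=> M; apply: (@le_trans _ _ (\sum_(n < M) n.+1%:R `^ (- (2 - p)) * h `^ (1 - p))).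
  apply: ler_sum => n _; have n1 : 0 < n.+1%:R :> R by [].
  have n2 : 0 < n.+2%:R :> R by [].
  have -> : h / n.+1%:R - h / n.+2%:R = h * (n.+1%:R^-1 * n.+2%:R^-1).
   by rewrite -[n.+2%:R]natr1 in n2 *; field; rewrite !gt_eqF.
  have E1 : (h / n.+2%:R) `^ (- p) = h `^ (- p) * n.+2%:R `^ p.
   rewrite (powRM _ (ltW h0)) ?invr_ge0//; congr (_ * _).
   by rewrite -[n.+2%:R^-1]powR_inv1// -powRrM mulN1r opprK.
  have E2 : h `^ (- p) * h = h `^ (1 - p).
   exact: powRN_mul.
  have E3 : n.+2%:R `^ p * n.+2%:R^-1 = n.+2%:R `^ (p - 1).
   by rewrite powRD ?pnatr_eq0 ?implybT// powR_inv1.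
  rewrite E1 -E2 (_ : _ * _ = (n.+1%:R^-1 * (n.+2%:R `^ p * n.+2%:R^-1)) * (h `^ (- p) * h)); last by ring.
  rewrite E3 E2 ler_wpM2r ?powR_ge0// (_ : - (2 - p) = - 1 + (p - 1)); last by ring.
  rewrite [leRHS]powRD ?pnatr_eq0 ?implybT// powR_inv1// ler_wpM2l ?invr_ge0//.
  rewrite (_ : p - 1 = - (1 - p)); last by ring.
  rewrite !powRN lef_pV2 ?posrE ?powR_gt0//.
  by apply: ge0_ler_powR; rewrite ?nnegrE ?ler_nat//; lra.
 by rewrite -mulr_suml ler_wpM2r ?powR_ge0.
Qed.

(** Uniqueness of Lebesgue measure from half-open intervals: reflection swaps the closed end, which
    does not affect the length. *)
Lemma lebesgue_measure_reflect (s : R) (A : set R) : measurable A ->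
 pushforward mu ((fun x => s - x) : _ -> measurableTypeR R) A = mu A.
Proof.
move=> mA; apply/esym; move: A mA.
have mr : mfunT ((fun x => s - x) : R -> measurableTypeR R) by exact: measurable_funB.
apply: lebesgue_measure_unique => //= _ [[a b]] _ <-.
rewrite /pushforward (_ : _ @^-1` _ = `[s - b, s - a[%classic); last first.
 by apply/seteqP; split=> x /=; rewrite !in_itv/= => /andP[? ?]; apply/andP; split; lra.
rewrite !lebesgue_measure_itv/= !lte_fin ltrD2l ltrN2 -!EFinD; case: ifP => // _.
by congr EFin; lra.
Qed.

Lemma ge0_integral_reflect (s : R) (F : R -> \bar R) : mfunT F -> (forall y, 0 <= F y)%E ->
 (\int[mu]_x F (s - x)%R = \int[mu]_y F y)%E.
Proof.
move=> mF F0.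
have mr : mfunT ((fun x => s - x) : R -> measurableTypeR R) by exact: measurable_funB.
transitivity (\int[pushforward mu ((fun x => s - x)%R : R -> measurableTypeR R)]_y F y)%E.
 by rewrite ge0_integral_pushforward//= preimage_setT.
by apply: eq_measure_integral => //= A mA AS; exact: lebesgue_measure_reflect.
Qed.

End power_integrals.

(** * Lebesgue measure on tuples *)

Section lebesgue_tuple_facts.
Context {R : realType}.
Local Notation mu := (@lebesgue_measure R).
Local Notation lam := (@lebesgue_tuple R).

Definition consT k (x : R) (t : k.-tuple R) : k.+1.-tuple R := [the k.+1.-tuple R of x :: t].

Lemma measurable_consT k : mfunT (fun z : R * k.-tuple R => consT z.1 z.2).
Proof. exact: (@measurable_cons_pair R k). Qed.

Lemma ge0_integral_lamS k (F : k.+1.-tuple R -> \bar R) : mfunT F ->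
 (forall t, 0 <= F t)%E ->
 (\int[lam k.+1]_t F t = \int[mu]_x \int[lam k]_t F (consT x t))%E.
Proof.
move=> mF F0.
transitivity (\int[pushforward (mu \x lam k)%E (@cons_pair R k)]_t F t)%E; first by [].
rewrite ge0_integral_pushforward//=; last exact: measurable_cons_pair.
rewrite preimage_setT fubini_tonelli1//=.
by apply: measurableT_comp => //; exact: measurable_cons_pair.
Qed.

Lemma ge0_integral_lamS2 k (F : k.+1.-tuple R -> \bar R) : mfunT F ->
 (forall t, 0 <= F t)%E ->
 (\int[lam k.+1]_t F t = \int[lam k]_t \int[mu]_x F (consT x t))%E.
Proof.
move=> mF F0.
transitivity (\int[pushforward (mu \x lam k)%E (@cons_pair R k)]_t F t)%E; first by [].
rewrite ge0_integral_pushforward//=; last exact: measurable_cons_pair.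
rewrite preimage_setT fubini_tonelli2//=.
by apply: measurableT_comp => //; exact: measurable_cons_pair.
Qed.

Lemma measurable_tnth_prod k (f : nat -> R -> R) : (forall q, mfunT (f q)) ->
 mfunT (fun t : k.-tuple R => \prod_(q < k) f q (tnth t q)).
Proof.
move=> mf; apply: measurable_prod => q _.
by apply: (measurableT_comp (mf q)); exact: measurable_tnth.
Qed.

Lemma lam_prod k (f : nat -> R -> R) : (forall q, mfunT (f q)) ->
 (forall q x, 0 <= f q x) ->
 (\int[lam k]_t (\prod_(q < k) f q (tnth t q))%:E = \prod_(q < k) \int[mu]_x (f q x)%:E)%E.
Proof.
elim: k f => [|k IH] f mf f0.
 rewrite big_ord0; under eq_integral do rewrite big_ord0.
 by rewrite integral_cst//= diracE mem_set// mule1.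
have mP : mfunT (fun t : k.-tuple R => (\prod_(q < k) f q.+1 (tnth t q))%:E).
 by apply/measurable_EFinP; exact: (measurable_tnth_prod (f := fun q => f q.+1)).
rewrite ge0_integral_lamS; last 2 first.
- by apply/measurable_EFinP; exact: measurable_tnth_prod.
- by move=> t; rewrite lee_fin prodr_ge0.
rewrite big_ord_recl/= -(IH (fun q => f q.+1))//.
set I := (\int[lam k]_t _)%E.
have I0 : (0 <= I)%E by apply: integral_ge0 => t _; rewrite lee_fin prodr_ge0.
transitivity (\int[mu]_x ((f 0%N x)%:E * I))%E.
 apply: eq_integral => x _; rewrite /I -ge0_integralZl_EFin//; last first.
  by move=> t _; rewrite lee_fin prodr_ge0.
 apply: eq_integral => t _; rewrite big_ord_recl/= tnth0 EFinM; congr (_ * _%:E)%E.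
 by apply: eq_bigr => q _; rewrite /consT/= tnthS.
rewrite ge0_integralZr//; first by apply/measurable_EFinP; exact: mf.
by move=> x _; rewrite lee_fin; exact: f0.
Qed.

Definition reflect_tuple k (s : R) (t : k.-tuple R) : k.-tuple R := [tuple s - tnth t q | q < k].

Lemma measurable_reflect_tuple k :
 mfunT (fun z : R * k.-tuple R => reflect_tuple z.1 z.2).
Proof.
apply/measurable_fun_tnthP => q.
rewrite (_ : _ \o _ = fun z : R * k.-tuple R => z.1 - tnth z.2 q); last first.
 by apply/funext => z /=; rewrite tnth_mktuple.
apply: measurable_funB; first exact: measurable_fst.
exact: (measurableT_comp (measurable_tnth q) measurable_snd).
Qed.

Lemma reflect_consT k s x (t : k.-tuple R) :
 reflect_tuple s (consT x t) = consT (s - x) (reflect_tuple s t).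
Proof.
apply: eq_from_tnth => j; rewrite tnth_mktuple.
case: (unliftP ord0 j) => [j'|] -> //.
by rewrite /consT/= !tnthS tnth_mktuple.
Qed.

Lemma lam_reflect k s (F : k.-tuple R -> \bar R) : mfunT F -> (forall t, 0 <= F t)%E ->
 (\int[lam k]_t F (reflect_tuple s t) = \int[lam k]_t F t)%E.
Proof.
have mr j : mfunT (fun t : j.-tuple R => reflect_tuple s t).
 apply/measurable_fun_tnthP => q.
 rewrite (_ : _ \o _ = fun t : j.-tuple R => s - tnth t q).
  by apply: measurable_funB => //; exact: measurable_tnth.
 by apply/funext => t /=; rewrite tnth_mktuple.
elim: k F => [|k IH] F mF F0.
 by apply: eq_integral => t _; congr F; apply: eq_from_tnth => -[].
rewrite ge0_integral_lamS; last 2 first.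
- exact: (measurableT_comp mF (mr k.+1)).
- by move=> t; exact: F0.
rewrite [RHS]ge0_integral_lamS//.
have mc x : mfunT (fun t : k.-tuple R => F (consT x t)).
 by apply: (measurableT_comp mF); apply: measurable_cons; [exact: measurable_cst|exact: measurable_id].
transitivity (\int[mu]_x (fun y => \int[lam k]_t F (consT y t)) (s - x)%R)%E.
 apply: eq_integral => x _; rewrite -(IH (fun t => F (consT (s - x)%R t)))//.
 by apply: eq_integral => t _; rewrite reflect_consT.
apply: ge0_integral_reflect; last by move=> y; exact: integral_ge0.
apply: (@measurable_fun_fubini_tonelli_F _ _ _ _ R (lam k) (fun z : R * k.-tuple R => F (consT z.1 z.2))) => //.
by apply: measurableT_comp => //; exact: measurable_consT.
Qed.

Lemma measurable_not_uniq k : measurable [set t : k.-tuple R | ~~ uniq t].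
Proof.
have -> : [set t : k.-tuple R | ~~ uniq t] =
  \bigcup_(p in [set: 'I_k * 'I_k]) [set t | (p.1 != p.2) && (tnth t p.1 == tnth t p.2)].
 apply/seteqP; split=> t /=.
  move/(uniqPn 0) => [i [j [ij js E]]]; rewrite size_tuple in js.
  exists (Ordinal (ltn_trans ij js), Ordinal js) => //=.
  by rewrite !(tnth_nth 0)/= E eqxx andbT neq_ltn ij.
 move=> [[p q] _ /= /andP[pq /eqP E]]; apply/(uniqPn 0).
 have [lt|lt|/val_inj e] := ltngtP p q; last by rewrite e eqxx in pq.
  by exists p, q; split=> //; rewrite ?size_tuple// -!tnth_nth.
 by exists q, p; split=> //; rewrite ?size_tuple// -!tnth_nth.
apply: fin_bigcup_measurable => // -[p q] _ /=.
case: eqVneq => [_|_]/=; first by rewrite (_ : [set _ | _] = set0)//; apply/seteqP; split.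
have mB : mfunT (fun t : k.-tuple R => tnth t p - tnth t q).
 by apply: measurable_funB; exact: measurable_tnth.
have -> : [set t : k.-tuple R | tnth t p == tnth t q] =
  setT `&` (fun t : k.-tuple R => tnth t p - tnth t q) @^-1` [set 0].
 apply/seteqP; split=> t /=; rewrite -subr_eq0; first by move/eqP.
 by move=> [_ /eqP].
exact: mB.
Qed.

(** Tonelli in the first coordinate: over a tuple without repetition the values to be avoided form a
    finite set. *)
Lemma lam_not_uniq k : lam k [set t : k.-tuple R | ~~ uniq t] = 0%E.
Proof.
elim: k => [|k IH].
 by rewrite (_ : [set _ | _] = set0) ?measure0//; apply/seteqP; split=> // t; rewrite /= tuple0.
have mU := @measurable_not_uniq.
set U := [set t : k.+1.-tuple R | ~~ uniq t].
have -> : lam k.+1 U = (\int[lam k.+1]_t (\1_U t : R)%:E)%E by rewrite integral_indic ?setIT//; exact: mU.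
have mI : mfunT (fun t : k.+1.-tuple R => (\1_U t : R)%:E).
 by apply/measurable_EFinP; apply: measurable_indic; exact: mU.
rewrite ge0_integral_lamS2//.
rewrite (ae_eq_integral (cst 0%E))//; first by rewrite integral0.
- apply: (@measurable_fun_fubini_tonelli_G _ _ _ _ R mu (fun z : R * k.-tuple R => (\1_U (consT z.1 z.2) : R)%:E)) => //=.
  by apply: (measurableT_comp mI); exact: measurable_consT.
- exists [set t : k.-tuple R | ~~ uniq t]; split; [exact: mU|exact: IH|].
 move=> t /= H; apply/negP => ut; apply: H => _.
 rewrite (_ : (fun x => (\1_U (consT x t) : R)%:E) = (fun x => (\1_[set` (t : seq R)] x : R)%:E)); last first.
  apply/funext => x; rewrite !indicE; congr (_%:R%:E); congr nat_of_bool.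
  by apply/idP/idP => /set_mem H; apply/mem_set; move: H; rewrite /U/= ut andbT negbK.
 have ct : countable [set` (t : seq R)] by apply: finite_set_countable; exact: finite_seq.
 rewrite integral_indic ?setIT//; last by apply: countable_measurable => //; exact: measurable_set1.
 exact: countable_lebesgue_measure0.
Qed.

End lebesgue_tuple_facts.

Lemma ae_imp {d} {T : measurableType d} {R : realType} (m : {measure set T -> \bar R})
  (A C : T -> Prop) : (forall x, A x -> C x) -> (\forall x \ae m, A x) -> \forall x \ae m, C x.
Proof. by move=> AC; exact: filterS. Qed.

Lemma ae_imp2 {d} {T : measurableType d} {R : realType} (m : {measure set T -> \bar R})
  (A B C : T -> Prop) : (forall x, A x -> B x -> C x) ->
 (\forall x \ae m, A x) -> (\forall x \ae m, B x) -> \forall x \ae m, C x.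
Proof. by move=> AC; exact: filterS2. Qed.

(** * Dominated convergence for kernels integrated in time *)

Section kernel_dct.
Context {R : realType} (k : nat).
Local Notation mu := (@lebesgue_measure R).
Local Notation lam := (@lebesgue_tuple R k).
Variable g : R.
Hypotheses (g12 : 1 / 2 < g < 1) (kg : k%:R * (2 * g - 1) < 1) (k0 : (0 < k)%N).

Let gl : 1 / 2 < g. Proof. by case/andP: g12. Qed.
Let gu : g < 1. Proof. by case/andP: g12. Qed.
Let g0 : 0 < g. Proof. by move: gl; lra. Qed.

Let mIle (h : R) : measurable [set y : R | (y <= h)%R].
Proof. by rewrite (_ : [set y | _] = `]-oo, h]%classic); [exact: measurable_itv|apply/seteqP; split=> y; rewrite /= in_itv]. Qed.
Let mIge (h : R) : measurable [set y : R | (h <= y)%R].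
Proof. by rewrite (_ : [set y | _] = `[h, +oo[%classic); [exact: measurable_itv|apply/seteqP; split=> y; rewrite /= in_itv/= andbT]. Qed.
Let mIlt (h : R) : measurable [set y : R | (h < y)%R].
Proof. by rewrite (_ : [set y | _] = `]h, +oo[%classic); [exact: measurable_itv|apply/seteqP; split=> y; rewrite /= in_itv/= andbT]. Qed.

Let mpow p : mfunT (fun y : R => (powp p y)%:E).
Proof. by apply/measurable_EFinP; exact: measurable_powp. Qed.

Let mpowB p s : mfunT (fun y : R => powp p (s - y)).
Proof. by apply: (measurableT_comp (measurable_powp p)); exact: measurable_funB. Qed.

Lemma powp_anti p (y z : R) : 0 <= p -> 0 < y -> y <= z -> powp p z <= powp p y.
Proof.
move=> p0 y0 yz; rewrite /powp y0 (lt_le_trans y0 yz) !powRN lef_pV2 ?posrE ?powR_gt0//.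
 by apply: ge0_ler_powR; rewrite ?nnegrE//; [exact: ltW|exact: le_trans (ltW y0) yz].
exact: lt_le_trans y0 yz.
Qed.

(** Let y be the distance from x to the smaller time and h the distance of the two times. Below h
    the far factor is at most h^(- g); above h both factors are at most y^(- g), and 2 g > 1 makes
    the tail integrable. *)
Lemma powp_conv : exists2 C : R, 0 < C & forall s s' : R, s != s' ->
 (\int[mu]_x (powp g (s - x) * powp g (s' - x))%:E <= (C * powp (2 * g - 1) `|s - s'|)%:E)%E.
Proof.
have [C1 C10 H1] := @powp_head R g ltac:(by rewrite g0 gu).
have [C2 C20 H2] := @powp_tail R (2 * g) ltac:(by move: gl; lra).
exists (C1 + C2); first exact: addr_gt0.
move=> s s'; wlog lt : s s' / s < s'.
 move=> W ss'; have := ss'; rewrite neq_lt => /orP[h|h]; first exact: W.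
 by rewrite distrC; under eq_integral do rewrite mulrC; apply: W; rewrite // eq_sym.
move=> _; rewrite distrC gtr0_norm ?subr_gt0//.
set h := s' - s; have h0 : 0 < h by rewrite subr_gt0.
pose F y : \bar R := (powp g y * powp g (y + h))%:E.
have F0 y : (0 <= F y)%E by rewrite lee_fin; apply: mulr_ge0; exact: powp_ge0.
have mF : mfunT F.
 apply/measurable_EFinP; apply: measurable_funM; first exact: measurable_powp.
 by apply: (measurableT_comp (measurable_powp g)); exact: measurable_funD.
rewrite (_ : (fun x => _) = fun x => F (s - x)); last first.
 by apply/funext => x; rewrite /F/h; congr (powp _ _ * powp _ _)%:E; ring.
rewrite ge0_integral_reflect//.
have -> : [set: R] = [set y : R | (y <= h)%R] `|` [set y : R | (h < y)%R].
 by apply/seteqP; split=> // y _ /=; case: (leP y h) => ?; [left|right].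
rewrite ge0_integral_setU; last 5 first.
- exact: mIle.
- exact: mIlt.
- exact: measurable_funTS.
- by [].
- by apply/disj_setPS => y [/= a b]; move: (le_lt_trans a b); rewrite ltxx.
have hp : powp (2 * g - 1) h = h `^ (1 - 2 * g) by rewrite /powp h0 opprB.
rewrite mulrDl EFinD; apply: leeD.
- apply: (@le_trans _ _ (\int[mu]_(y in [set y : R | (y <= h)%R]) ((h `^ (- g))%:E * (powp g y)%:E))%E).
  apply: ge0_le_integral; [exact: mIle|by []|exact: measurable_funTS| |].
   by apply: measurable_funTS; apply/measurable_EFinP; apply: measurable_funM => //; exact: measurable_powp.
  move=> y /= yh; rewrite -EFinM lee_fin [leRHS]mulrC {1 3}/powp; case: ifP => y0; last by rewrite !mul0r.
  rewrite ler_wpM2l ?powR_ge0//.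
  have -> : h `^ (- g) = powp g h by rewrite /powp h0.
  by apply: powp_anti => //; [exact: ltW|rewrite lerDr ltW].
 rewrite ge0_integralZl_EFin; last 4 first.
 - exact: mIle.
 - by move=> y _; rewrite lee_fin powp_ge0.
 - by apply: measurable_funTS; exact: mpow.
 - exact: powR_ge0.
 apply: le_trans (lee_wpmul2l _ (H1 _ h0)) _; first by rewrite lee_fin powR_ge0.
 rewrite -EFinM lee_fin hp mulrCA -powRD; last by rewrite (gt_eqF h0) implybT.
 by rewrite (_ : - g + (1 - g) = 1 - 2 * g)//; ring.
- apply: (@le_trans _ _ (\int[mu]_(y in [set y : R | (h <= y)%R]) (powp (2 * g) y)%:E)%E).
  apply: (@le_trans _ _ (\int[mu]_(y in [set y : R | (h < y)%R]) (powp (2 * g) y)%:E)%E).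
   apply: ge0_le_integral; [exact: mIlt|by []|exact: measurable_funTS|by apply: measurable_funTS; exact: mpow|].
   move=> y /= yh; rewrite lee_fin; have y0 := lt_trans h0 yh.
   apply: (@le_trans _ _ (powp g y * powp g y)).
    by rewrite ler_wpM2l ?powp_ge0//; apply: powp_anti => //; [exact: ltW|rewrite lerDl ltW].
   rewrite /powp y0 -powRD; last by rewrite (gt_eqF y0) implybT.
   by rewrite (_ : - g + - g = - (2 * g))//; ring.
  apply: ge0_subset_integral.
  - exact: mIlt.
  - exact: mIge.
  - by apply: measurable_funTS; exact: mpow.
  - by move=> y _; rewrite lee_fin powp_ge0.
  - by move=> y /= /ltW.
 by rewrite hp; exact: H2.
Qed.

(** Common majorant, up to a constant, of the discrete and the limiting integrands. *)
Definition pow_prod (s : R) (x : k.-tuple R) : R :=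
 \1_(`[0, 1]%classic : set R) s * \prod_(q < k) powp g (s - tnth x q).

Lemma pow_prod_ge0 s x : 0 <= pow_prod s x.
Proof. by apply: mulr_ge0 => //; apply: prodr_ge0 => q _; exact: powp_ge0. Qed.

Lemma measurable_pow_prod : mfunT (fun z : R * k.-tuple R => pow_prod z.1 z.2).
Proof.
apply: measurable_funM.
 by apply: (measurableT_comp _ measurable_fst); apply: measurable_indic; exact: measurable_itv.
apply: measurable_prod => q _; apply: (measurableT_comp (measurable_powp g)).
apply: measurable_funB; first exact: measurable_fst.
exact: (measurableT_comp (measurable_tnth q) measurable_snd).
Qed.

Definition pow_int (x : k.-tuple R) : \bar R := (\int[mu]_s (pow_prod s x)%:E)%E.

Lemma pow_int_ge0 x : (0 <= pow_int x)%E.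
Proof. by apply: integral_ge0 => s _; rewrite lee_fin pow_prod_ge0. Qed.

Let mPE : mfunT (fun z : R * k.-tuple R => (pow_prod z.1 z.2)%:E).
Proof. by apply/measurable_EFinP; exact: measurable_pow_prod. Qed.

Lemma measurable_pow_int : mfunT pow_int.
Proof.
apply: (@measurable_fun_fubini_tonelli_G _ _ _ _ R mu _ mPE) => z /=.
by rewrite lee_fin pow_prod_ge0.
Qed.

Lemma measurable_pow_prodr s : mfunT (pow_prod s).
Proof.
have := measurableT_comp measurable_pow_prod (measurable_pair1 s).
by [].
Qed.

Lemma measurable_pow_prodl x : mfunT (pow_prod ^~ x).
Proof.
have := measurableT_comp measurable_pow_prod (measurable_pair2 x).
by [].
Qed.

Lemma ae_neq (s : R) : \forall x \ae mu, x != s.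
Proof.
exists [set s]; split=> //; first exact: lebesgue_measure_set1.
by move=> x /= /negP; rewrite negbK => /eqP.
Qed.

(** The square is a double integral over s and s'. The integral in x factorises into k
    one-dimensional ones and is at most C^k |s - s'|^(- k (2 g - 1)), which is integrable on the
    unit square because k (2 g - 1) < 1. *)
Lemma pow_int_sq : exists K : R, (\int[lam]_x (pow_int x * pow_int x) <= K%:E)%E.
Proof.
have [C C0 HC] := powp_conv.
have q1 : 0 <= k%:R * (2 * g - 1) < 1.
 by rewrite kg andbT; apply: mulr_ge0 => //; move: gl; lra.
have kp : 0 < k%:R * (2 * g - 1) < 1.
 by rewrite kg andbT; apply: mulr_gt0; rewrite ?ltr0n//; move: gl; lra.
have [D D0 HD] := @powp_head R _ kp.
have h1 := HD 1 ltr01; rewrite powR1 mulr1 in h1.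
pose I01 : set R := `[0, 1]%classic.
have mI : measurable I01 by exact: measurable_itv.
have pint2 s s' : s != s' -> (\int[lam]_x (pow_prod s x * pow_prod s' x)%:E <=
  (\1_I01 s * \1_I01 s')%:E * (C ^+ k * powp (k%:R * (2 * g - 1)) `|s - s'|)%:E)%E.
 move=> ss'.
 have -> : (fun x => (pow_prod s x * pow_prod s' x)%:E) = (fun x => (\1_I01 s * \1_I01 s')%:E *
   (\prod_(q < k) (powp g (s - tnth x q) * powp g (s' - tnth x q)))%:E)%E.
  by apply/funext => x; rewrite /pow_prod -EFinM big_split/=; congr EFin; rewrite -/I01; ring.
 have mm : mfunT (fun y : R => powp g (s - y) * powp g (s' - y)) by exact: measurable_funM.
 have pp y : 0 <= powp g (s - y) * powp g (s' - y) by apply: mulr_ge0; exact: powp_ge0.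
 rewrite ge0_integralZl_EFin; last 4 first.
 - by [].
 - by move=> x _; rewrite lee_fin; apply: prodr_ge0.
 - by apply/measurable_EFinP; apply: (measurable_tnth_prod (f := fun _ y => powp g (s - y) * powp g (s' - y))).
 - exact: mulr_ge0.
 apply: lee_wpmul2l; first by rewrite lee_fin; exact: mulr_ge0.
 rewrite (lam_prod k (f := fun _ y => powp g (s - y) * powp g (s' - y)))//.
 have h0 : 0 < `|s - s'| by rewrite normr_gt0 subr_eq0.
 set h := `|s - s'| in h0 *.
 have -> : C ^+ k * powp (k%:R * (2 * g - 1)) h = \prod_(q < k) (C * powp (2 * g - 1) h).
  rewrite prodr_const card_ord exprMn; congr (_ * _).
  by rewrite /powp h0 -powR_mulrn ?powR_ge0// -powRrM; congr (_ `^ _); ring.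
 suff [] : (0 <= \prod_(q < k) (\int[mu]_x (powp g (s - x) * powp g (s' - x))%:E))%E /\
  (\prod_(q < k) (\int[mu]_x (powp g (s - x) * powp g (s' - x))%:E) <=
   (\prod_(q < k) (C * powp (2 * g - 1) h))%:E)%E by [].
 elim/big_ind2: _ => [||q _].
 - by split; rewrite ?lee01.
 - move=> a b a' b' [a0 ab] [a'0 ab']; split; first exact: mule_ge0.
  by rewrite EFinM; apply: lee_pmul.
 - by split; [apply: integral_ge0 => x _; rewrite lee_fin|exact: HC].
(* On the unit square |s - s'| is at most 1. The power of |s - s'| is bounded by the sum of the
   powers of s - s' and of s' - s, of which [powp] kills the one with the wrong sign; each is a
   translate or a reflection of [H]. *)
pose H : R -> \bar R := (fun y : R => (powp (k%:R * (2 * g - 1)) y)%:E) \_ [set y : R | (y <= 1)%R].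
have H0 y : (0 <= H y)%E by apply: erestrict_ge0 => z _; rewrite lee_fin powp_ge0.
have mH : mfunT H.
 by apply/(measurable_restrictT _ (mIle 1)); apply: measurable_funTS; exact: mpow.
have iH : (\int[mu]_y H y <= D%:E)%E by rewrite /H -integral_mkcond.
have mHB s : mfunT (fun y : R => H (s - y)).
 by apply: (measurableT_comp mH); exact: measurable_funB.
have mHA s : mfunT (fun y : R => H (y - s)).
 by apply: (measurableT_comp mH); exact: measurable_funB.
have iHA s : (\int[mu]_y H (y - s)%R <= D%:E)%E.
 have -> : (\int[mu]_y H (y - s)%R = \int[mu]_y (fun z => H (0 - z)%R) (s - y)%R)%E.
  by apply: eq_integral => y _; congr H; ring.
 rewrite (ge0_integral_reflect s (mHB 0) (fun y => H0 _)).
 by rewrite (ge0_integral_reflect 0 mH H0).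
have iHB s : (\int[mu]_y H (s - y)%R <= D%:E)%E by rewrite ge0_integral_reflect.
have PE z : (0 <= (pow_prod z.1 z.2)%:E)%E by rewrite lee_fin pow_prod_ge0.
have slice s : (\int[lam]_x ((pow_prod s x)%:E * pow_int x) <= (\1_I01 s * (C ^+ k * (D + D)))%:E)%E.
 have -> : (\int[lam]_x ((pow_prod s x)%:E * pow_int x) = \int[lam]_x \int[mu]_s' (pow_prod s x * pow_prod s' x)%:E)%E.
  apply: eq_integral => x _; rewrite /pow_int -ge0_integralZl_EFin ?pow_prod_ge0//.
  - by move=> s' _; rewrite lee_fin pow_prod_ge0.
  - by apply/measurable_EFinP; exact: measurable_pow_prodl.
 rewrite -(@fubini_tonelli _ _ _ _ R mu lam (fun z => (pow_prod s z.2 * pow_prod z.1 z.2)%:E))/=; last 2 first.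
 - apply/measurable_EFinP; apply: measurable_funM; last exact: measurable_pow_prod.
  exact: (measurableT_comp (measurable_pow_prodr s) measurable_snd).
 - by move=> z; rewrite lee_fin mulr_ge0 ?pow_prod_ge0.
 pose c := \1_I01 s * C ^+ k.
 have c0 : 0 <= c by apply: mulr_ge0 => //; apply: exprn_ge0; exact: ltW.
 apply: (@le_trans _ _ (\int[mu]_s' (c%:E * (H (s - s')%R + H (s' - s)%R)))%E); last first.
  rewrite ge0_integralZl_EFin; last 4 first.
  - by [].
  - by move=> y _; exact: adde_ge0.
  - by apply: emeasurable_funD; [exact: mHB|exact: mHA].
  - exact: c0.
  rewrite mulrA -/c [X in (_ <= X)%E]EFinM; apply: lee_wpmul2l; first by rewrite lee_fin.
  rewrite ge0_integralD; [|by []|by []|exact: mHB|by []|exact: mHA].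
  by rewrite EFinD; apply: leeD; [exact: iHB|exact: iHA].
 apply: ae_ge0_le_integral => //.
 - by move=> s' _; apply: integral_ge0 => x _; rewrite lee_fin mulr_ge0 ?pow_prod_ge0.
 - apply: (@measurable_fun_fubini_tonelli_F _ _ _ _ R lam (fun z => (pow_prod s z.2 * pow_prod z.1 z.2)%:E)).
   apply/measurable_EFinP; apply: measurable_funM; last exact: measurable_pow_prod.
   exact: (measurableT_comp (measurable_pow_prodr s) measurable_snd).
  by move=> z; rewrite lee_fin mulr_ge0 ?pow_prod_ge0.
 - by move=> s' _; apply: mule_ge0; [rewrite lee_fin|exact: adde_ge0].
 - by apply: emeasurable_funM => //; apply: emeasurable_funD; [exact: mHB|exact: mHA].
 - apply: ae_imp (ae_neq s) => s' ss' _; rewrite eq_sym in ss'.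
  apply: le_trans (pint2 _ _ ss') _.
  have [sI|sI] := boolP (s \in I01); last first.
   by rewrite /c indicE (negbTE sI) !mul0r !mul0e.
  rewrite /c !indicE sI !mul1r.
  have [sI'|sI'] := boolP (s' \in I01); last first.
   by rewrite mul0e; apply: mule_ge0; [rewrite lee_fin; apply: exprn_ge0; exact: ltW|exact: adde_ge0].
  rewrite mul1e EFinM; apply: lee_wpmul2l; first by rewrite lee_fin; apply: exprn_ge0; exact: ltW.
  move: sI sI'; rewrite !inE /I01/= !in_itv/= => sI sI'.
  have [lt|ge] := leP s' s.
   rewrite ger0_norm ?subr_ge0// -[leLHS]adde0; apply: leeD => //.
   by rewrite /H patchE mem_set//=; lra.
  rewrite ltr0_norm ?subr_lt0// opprB -[leLHS]add0e; apply: leeD => //.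
  by rewrite /H patchE mem_set//=; lra.
exists (C ^+ k * (D + D)).
have -> : (\int[lam]_x (pow_int x * pow_int x) = \int[lam]_x \int[mu]_s ((pow_prod s x)%:E * pow_int x))%E.
 apply: eq_integral => x _; rewrite ge0_integralZr//.
 - by apply/measurable_EFinP; exact: measurable_pow_prodl.
 - by move=> s _; rewrite lee_fin pow_prod_ge0.
 - exact: pow_int_ge0.
rewrite -(@fubini_tonelli _ _ _ _ R mu lam (fun z => ((pow_prod z.1 z.2)%:E * pow_int z.2)%E))/=; last 2 first.
- apply: emeasurable_funM => //; exact: (measurableT_comp measurable_pow_int measurable_snd).
- by move=> z; apply: mule_ge0 => //; exact: pow_int_ge0.
apply: (@le_trans _ _ (\int[mu]_s ((C ^+ k * (D + D))%:E * (\1_I01 s)%:E))%E).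
 apply: ge0_le_integral_any => s; last by rewrite -EFinM mulrC; exact: slice.
 by apply: integral_ge0 => x _; apply: mule_ge0; [rewrite lee_fin pow_prod_ge0|exact: pow_int_ge0].
have cD : 0 <= C ^+ k * (D + D).
 by apply: mulr_ge0; [apply: exprn_ge0; exact: ltW|apply: addr_ge0; exact: ltW].
rewrite ge0_integralZl_EFin; [|by []|by []|by apply/measurable_EFinP; exact: measurable_indic|exact: cD].
have i1 : mu I01 = 1%E by rewrite /I01 lebesgue_measure_itv/= lte01 oppr0 adde0.
by rewrite integral_indic ?setIT// -[X in (_ * X <= _)%E]/(mu I01) i1 mule1.
Qed.

(** Tonelli together with invariance of the measure under x -> s 1 - x, for every s. *)
Lemma ae_reflect (U : set (k.-tuple R)) : measurable U -> lam U = 0%E ->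
 \forall x \ae lam, (\int[mu]_s (\1_U (reflect_tuple s x) : R)%:E = 0)%E.
Proof.
move=> mU U0.
 pose h z := (\1_U (reflect_tuple z.1 z.2) : R)%:E.
 have mh : mfunT (h : R * k.-tuple R -> \bar R).
  apply/measurable_EFinP; apply: (measurableT_comp _ (@measurable_reflect_tuple R k)).
  exact: measurable_indic.
 have h0 z : (0 <= h z)%E by rewrite lee_fin.
 have mG := @measurable_fun_fubini_tonelli_G _ _ _ _ R mu _ mh h0.
 have G0 x : (0 <= fubini_G mu h x)%E by apply: integral_ge0 => s _.
 have E : (\int[lam]_x `|fubini_G mu h x| = 0)%E.
  under eq_integral do rewrite gee0_abs//.
  rewrite /fubini_G -(@fubini_tonelli _ _ _ _ R mu lam h mh h0).
  rewrite integral0_eq// => s _; rewrite /h/=.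
  rewrite (lam_reflect s (F := fun x => (\1_U x : R)%:E))//; last first.
   by apply/measurable_EFinP; exact: measurable_indic.
  by rewrite integral_indic ?setIT.
 have /ae_eq_integral_abs := E; move=> /(_ measurableT mG).
 by apply: filterS => x; apply.
Qed.

(** Dominated convergence is used twice: in s for almost every fixed x, with majorant [pow_prod],
    then in x with the square of [pow_int]. The exceptional x have infinite [pow_int], a repeated
    coordinate, or reflections that meet [U] for a non-negligible set of times. *)
Lemma kernel_dct (D : nat -> R -> k.-tuple R -> R) (C t : R) (U : set (k.-tuple R)) :
 (forall n, mfunT (fun z : R * k.-tuple R => D n z.1 z.2)) ->
 (forall n s x, `|D n s x| <= C * pow_prod s x) ->
 measurable U -> lam U = 0%E ->
 (forall (s : R) (x : k.-tuple R), s != t -> 0 <= s <= 1 -> uniq x -> ~ U (reflect_tuple s x) -> (fun n => D n s x) @ \oo --> (0 : R)) ->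
 (fun n => \int[lam]_x ((\int[mu]_s `|D n s x|%:E) * (\int[mu]_s `|D n s x|%:E)))%E @ \oo --> 0%E.
Proof.
move=> mD DC0 mU U0 cD.
pose C' := `|C|; have C'0 : 0 <= C' by exact: normr_ge0.
have DC n s x : `|D n s x| <= C' * pow_prod s x.
 by apply: le_trans (DC0 n s x) _; rewrite ler_wpM2r ?pow_prod_ge0// ler_norm.
have mDE n : mfunT (fun z : R * k.-tuple R => `|D n z.1 z.2|%:E).
 by apply/measurable_EFinP; exact: measurableT_comp.
pose F n x := (\int[mu]_s `|D n s x|%:E)%E.
have F0 n x : (0 <= F n x)%E by apply: integral_ge0 => s _; rewrite lee_fin.
have mF n : mfunT (F n).
 by apply: (@measurable_fun_fubini_tonelli_G _ _ _ _ R mu _ (mDE n)) => z /=; rewrite lee_fin.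
have mPl x : mfunT (fun s => (pow_prod s x)%:E).
 by apply/measurable_EFinP; exact: measurable_pow_prodl.
have FC n x : (F n x <= C'%:E * pow_int x)%E.
 rewrite /pow_int -ge0_integralZl_EFin; last 4 first.
 - by [].
 - by move=> s _; rewrite lee_fin pow_prod_ge0.
 - exact: mPl.
 - exact: C'0.
 by apply: ge0_le_integral_any => s; rewrite ?lee_fin// -EFinM lee_fin; exact: DC.
have [K HK] := pow_int_sq.
have mPI := measurable_pow_int.
have pp x : (0 <= pow_int x * pow_int x)%E by apply: mule_ge0; exact: pow_int_ge0.
have ip : lam.-integrable setT (fun x => pow_int x * pow_int x)%E.
 apply/integrableP; split; first exact: emeasurable_funM.
 under eq_integral do rewrite gee0_abs//.
 exact: le_lt_trans HK (ltry _).
have aeU := ae_reflect mU U0.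
have aeQ : \forall x \ae lam, uniq (x : k.-tuple R).
 exists [set x : k.-tuple R | ~~ uniq x]; split; [exact: measurable_not_uniq|exact: lam_not_uniq|].
 by move=> x /= /negP.
have cF : \forall x \ae lam, setT x -> (fun n => F n x * F n x)%E @ \oo --> 0%E.
 apply: filterS3 (integrable_ae measurableT ip) aeU aeQ => x fx ux qx _.
 have pf : (pow_int x < +oo)%E.
  move: (fx I) (pow_int_ge0 x); case: (pow_int x) => [r||]//.
  by rewrite ltry.
 have iP : mu.-integrable setT (fun s => C'%:E * (pow_prod s x)%:E)%E.
  apply: integrableZl => //; apply/integrableP; split; first exact: mPl.
  apply: le_lt_trans pf; apply: ge0_le_integral_any => s //.
  by rewrite gee0_abs// lee_fin pow_prod_ge0.
 have mU1 : mfunT (fun s => (\1_U (reflect_tuple s x) : R)%:E).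
  apply/measurable_EFinP; apply: (@measurableT_comp _ _ _ _ _ _ (\1_U : k.-tuple R -> R)); first exact: measurable_indic.
  exact: (measurableT_comp (@measurable_reflect_tuple R k) (measurable_pair2 x)).
 have aes : \forall s \ae mu, ~ U (reflect_tuple s x).
  have E : (\int[mu]_s `|(\1_U (reflect_tuple s x) : R)%:E| = 0)%E.
   by rewrite -[RHS]ux; apply: eq_integral => s _; rewrite gee0_abs.
  have /ae_eq_integral_abs := E; move=> /(_ measurableT mU1).
  apply: filterS => s /(_ I) /eqP; rewrite eqe indicE pnatr_eq0 eqb0 => /negP H ?.
  by apply: H; rewrite inE.
 have [] := @dominated_convergence _ _ R mu setT measurableT (fun n s => `|D n s x|%:E) (cst 0%E)
  (fun s => C'%:E * (pow_prod s x)%:E)%E _ _ _ iP _.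
 - by move=> n; exact: (measurableT_comp (mDE n) (measurable_pair2 x)).
 - exact: measurable_cst.
 - apply: ae_imp2 (ae_neq t) aes => s st Us _.
  have [s01|s01] := boolP (0 <= s <= 1).
   apply: cvg_EFin; first exact: nearW.
   have H : (fun n => `|D n s x|) @ \oo --> (0 : R).
    by rewrite -[X in _ --> X](normr0 R); exact: cvg_norm (cD s x st s01 qx Us).
   exact: H.
  have -> : (fun n => `|D n s x|%:E) = cst 0%E; last exact: cvg_cst.
  apply/funext => n /=; congr EFin; apply/eqP; rewrite -normr_le0.
  rewrite normr_id; apply: le_trans (DC n s x) _.
  rewrite /pow_prod indicE memNset ?mul0r ?mulr0//= in_itv/=; exact/negP.
 - by apply: nearW => s n _; rewrite gee0_abs ?lee_fin// -EFinM lee_fin; exact: DC.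
 - move=> _ _; rewrite integral_cst// mul0e => H.
  have := cvgeM (mule_def_fin _ _) H H; rewrite mule0; apply => //.
have [] := @dominated_convergence _ _ R lam setT measurableT (fun n x => F n x * F n x)%E (cst 0%E)
 (fun x => (C' * C')%:E * (pow_int x * pow_int x))%E _ _ cF _ _.
- by move=> n; exact: emeasurable_funM.
- exact: measurable_cst.
- exact: integrableZl.
- apply: nearW => x n _; rewrite gee0_abs ?mule_ge0//.
 by rewrite EFinM muleACA; apply: lee_pmul.
- by move=> _ _; rewrite integral_cst// mul0e.
Qed.
End kernel_dct.

(** * Moments of the normal law *)

Section normal_moments.
Context {R : realType}.
Local Notation mu := (@lebesgue_measure R).
Variable sg : R.
Hypothesis sg0 : 0 < sg.
Let sgN : sg != 0. Proof. by rewrite gt_eqF. Qed.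

(* the density of N(0, t^2), up to its normalisation *)
Let nf (t x : R) := normal_fun 0 t x.

Let nf_pdf t x : t != 0 -> normal_pdf 0 t x = normal_peak t * nf t x.
Proof. by move=> t0; rewrite normal_pdfE. Qed.

Let peakE t : 0 < t -> normal_peak t * t = normal_peak 1 :> R.
Proof.
move=> t0; rewrite /normal_peak expr1n mul1r -mulrnAr sqrtrM ?sqr_ge0// sqrtr_sqr gtr0_norm//.
by rewrite invfM mulrAC mulVf ?mul1r// gt_eqF.
Qed.

Let int_nf t : 0 < t -> (\int[mu]_x (nf t x)%:E = (t / normal_peak 1)%:E)%E.
Proof.
move=> t0; have tN : t != 0 by rewrite gt_eqF.
have pk : 0 < normal_peak t by exact: normal_peak_gt0.
have := integral_normal_pdf 0 t; under eq_integral do rewrite nf_pdf// EFinM.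
rewrite ge0_integralZl_EFin//; last 3 first.
- by move=> x _; rewrite lee_fin expR_ge0.
- by apply/measurable_EFinP; exact: measurable_normal_fun.
- exact: ltW.
move=> E; have : ((normal_peak t)^-1%:E * ((normal_peak t)%:E * \int[mu]_x (nf t x)%:E) = (normal_peak t)^-1%:E)%E.
 by rewrite E mule1.
rewrite muleA -EFinM mulVf ?gt_eqF// mul1e => ->.
by rewrite -(peakE t0); congr EFin; field; rewrite (gt_eqF t0) (gt_eqF pk).
Qed.

Local Notation N := (normal_prob 0 sg : probability _ R).

(** Doubling the standard deviation absorbs the quartic: with y = (x / sg)^2 the two exponentials
    differ by the factor exp (3 y / 8), which is at least (y / 8)^2. *)
Lemma normal_quartic (x : R) : (x / sg) ^+ 4 * nf sg x <= 64 * nf (2 * sg) x.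
Proof.
rewrite /nf /normal_fun subr0.
set y := (x / sg) ^+ 2; have y0 : 0 <= y by exact: sqr_ge0.
have -> : (x / sg) ^+ 4 = y ^+ 2 by rewrite /y -exprM.
have -> : - x ^+ 2 / (sg ^+ 2 *+ 2) = - (y / 2) by rewrite /y; field; rewrite ?sgN.
have -> : - x ^+ 2 / ((2 * sg) ^+ 2 *+ 2) = - (y / 8).
 by rewrite /y; field; rewrite ?sgN.
have -> : - (y / 2) = - (y / 8) + - (3 * y / 8) by field.
rewrite expRD mulrCA [64 * _]mulrC ler_wpM2l ?expR_ge0//.
rewrite expRN ler_pdivrMr ?expR_gt0//.
have -> : 3 * y / 8 = y / 8 + y / 8 + y / 8 by field.
rewrite !expRD; have e1 := expR_ge1Dx (y / 8).
have : 1 + y / 8 <= expR (y / 8) by [].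
move: (expR (y / 8)) => E HE; have E1 : 1 <= E by apply: le_trans HE; lra.
have E2 : (y / 8) ^+ 2 <= E ^+ 2 by apply: lerXn2r; rewrite ?nnegrE; lra.
have -> : y ^+ 2 = 64 * (y / 8) ^+ 2 by field.
rewrite ler_pM2l//; apply: le_trans E2 _; rewrite expr2; apply: ler_peMr => //.
by rewrite mulr_ge0; lra.
Qed.

Let mpdf : mfunT (fun x => (normal_pdf 0 sg x)%:E).
Proof. by apply/measurable_EFinP; exact: measurable_normal_pdf. Qed.

Lemma integral_normal_prob (f : R -> \bar R) : mfunT f ->
 (\int[N]_x `|f x| < +oo)%E ->
 (\int[N]_x f x = \int[mu]_x (f x * (normal_pdf 0 sg x)%:E))%E.
Proof.
move=> mf finf; have dom := @normal_prob_dominates R 0 sg.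
rewrite -(Radon_Nikodym_change_of_variables dom)//=; last first.
 by apply/integrableP; split.
apply: ae_eq_integral => //.
- apply: emeasurable_funM => //; apply: (measurable_int mu).
- exact: emeasurable_funM.
- apply: ae_eqe_mul2l => /=.
 rewrite Radon_NikodymE//=; case: cid => /= h [h1 h2 h3].
 by apply: integral_ae_eq => //= E _ mE; rewrite -h3.
Qed.

(** The change of density formula asks for integrability, so f is truncated at n and both sides
    converge monotonically. *)
Lemma ge0_integral_normal_prob (f : R -> R) : mfunT f -> (forall x, 0 <= f x) ->
 (\int[N]_x (f x)%:E = \int[mu]_x (f x * normal_pdf 0 sg x)%:E)%E.
Proof.
move=> mf f0.
pose fn (n : nat) x := Num.min (f x) n%:R.
have fn0 n x : 0 <= fn n x by rewrite le_min f0 ler0n.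
have mfn n : mfunT (fn n) by exact: measurable_minr.
have ndfn : forall x : R, {homo fn^~ x : m n / (m <= n)%N >-> m <= n}.
 by move=> x m n mn; rewrite /fn le_min ge_min lexx/= ge_min ler_nat mn orbT.
have cfn x : fn^~ x @ \oo --> f x.
 apply: (@cvg_trans _ (cst (f x) @ \oo)); last exact: cvg_cst.
 apply: near_eq_cvg; near=> n; rewrite /fn min_l//.
 near: n; exact: nbhs_infty_ger.
have p0 x : 0 <= normal_pdf 0 sg x by exact: normal_pdf_ge0.
have L : (fun n => \int[N]_x (fn n x)%:E)%E @ \oo --> (\int[N]_x (f x)%:E)%E.
 have <- : (\int[N]_x limn (fun n => (fn n x)%:E) = \int[N]_x (f x)%:E)%E.
  apply: eq_integral => x _; apply/cvg_lim => //; apply: cvg_EFin; first exact: nearW.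
  exact: cfn.
 apply: cvg_monotone_convergence => //.
 - by move=> n; apply/measurable_EFinP; exact: (mfn n).
 - by move=> n x _; rewrite lee_fin.
 - by move=> x _ m n mn; rewrite lee_fin; exact: ndfn.
have L' : (fun n => \int[mu]_x (fn n x * normal_pdf 0 sg x)%:E)%E @ \oo -->
  (\int[mu]_x (f x * normal_pdf 0 sg x)%:E)%E.
 have <- : (\int[mu]_x limn (fun n => (fn n x * normal_pdf 0 sg x)%:E) =
   \int[mu]_x (f x * normal_pdf 0 sg x)%:E)%E.
  apply: eq_integral => x _; apply/cvg_lim => //; apply: cvg_EFin; first exact: nearW.
  by apply: cvgMr_tmp; exact: cfn.
 apply: cvg_monotone_convergence => //.
 - by move=> n; apply/measurable_EFinP; apply: (measurable_funM (mfn n)); exact: measurable_normal_pdf.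
 - by move=> n x _; rewrite lee_fin mulr_ge0.
 - by move=> x _ m n mn; rewrite lee_fin ler_wpM2r//; exact: ndfn.
rewrite -(cvg_lim _ L)// -(cvg_lim _ L')//; congr (lim (_ @ \oo)).
apply/funext => n; rewrite integral_normal_prob.
- by apply: eq_integral => x _; rewrite EFinM.
- by apply/measurable_EFinP; exact: (mfn n).
- apply: (@le_lt_trans _ _ (\int[N]_x (n%:R)%:E)%E).
  apply: ge0_le_integral_any => x //.
  by rewrite lee_fin ger0_norm// /fn ge_min lexx orbT.
 rewrite integral_cst//=; apply: (@le_lt_trans _ _ (n%:R%:E * 1)%E); last by rewrite mule1 ltry.
 by apply: lee_wpmul2l; [rewrite lee_fin|exact: probability_le1].
Unshelve. all: end_near. Qed.

Let pk0 : 0 < normal_peak sg. Proof. exact: normal_peak_gt0. Qed.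

Let int_nfp t : 0 < t -> ((normal_peak sg)%:E * \int[mu]_x (nf t x)%:E = (t / sg)%:E)%E.
Proof.
move=> t0; rewrite int_nf// -EFinM -(peakE sg0); congr EFin; field.
by rewrite ?gt_eqF.
Qed.

Let mnf t : mfunT (nf t). Proof. exact: measurable_normal_fun. Qed.
Let nf0 t x : 0 <= nf t x. Proof. exact: expR_ge0. Qed.

Let intNE (f : R -> R) : mfunT f -> (forall x, 0 <= f x) ->
 (\int[N]_x (f x)%:E = (normal_peak sg)%:E * \int[mu]_x (f x * nf sg x)%:E)%E.
Proof.
move=> mf f0; rewrite ge0_integral_normal_prob// -ge0_integralZl_EFin//; last 3 first.
- by move=> x _; rewrite lee_fin mulr_ge0.
- by apply/measurable_EFinP; exact: (measurable_funM mf (mnf sg)).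
- exact: ltW.
by apply: eq_integral => x _; rewrite nf_pdf// -EFinM; congr EFin; ring.
Qed.

Let mdiv p : mfunT (fun x : R => (x / sg) ^+ p).
Proof. by apply: measurable_funX; exact: measurable_funM. Qed.

(** The constant is 64 from the pointwise bound times 2, the ratio of the two normalisations. *)
Lemma normal_moment4 : (\int[N]_x ((x / sg) ^+ 4)%:E <= 128%:E)%E.
Proof.
have q0 (x : R) : 0 <= (x / sg) ^+ 4 by rewrite (_ : 4 = 2 * 2)%N// exprM sqr_ge0.
rewrite intNE//.
apply: (@le_trans _ _ ((normal_peak sg)%:E * \int[mu]_x (64%:E * (nf (2 * sg) x)%:E))%E).
 apply: lee_wpmul2l; first by rewrite lee_fin ltW.
 apply: ge0_le_integral_any => x; first by rewrite lee_fin; exact: mulr_ge0 (q0 x) (nf0 _ x).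
 by rewrite -EFinM lee_fin; exact: normal_quartic.
rewrite ge0_integralZl_EFin//; last 2 first.
- by move=> x _; rewrite lee_fin.
- by apply/measurable_EFinP; exact: mnf.
rewrite muleCA int_nfp ?mulr_gt0// -EFinM lee_fin mulfK//; lra.
Qed.

(** A derivative in the scale, in disguise. The ratio of the exponentials at scales r sg and sg is
    exp u with u proportional to (x / sg)^2. Integrating 1 + u <= exp u gives one inequality for r >
    1 and one for r < 1, and r tends to 1. *)
Lemma normal_moment2 : (\int[N]_x ((x / sg) ^+ 2)%:E = 1%:E)%E.
Proof.
have s0 (x : R) : 0 <= (x / sg) ^+ 2 by exact: sqr_ge0.
rewrite intNE//; set J := (\int[mu]_x _)%E.
have J0 : (0 <= J)%E by apply: integral_ge0 => x _; rewrite lee_fin mulr_ge0.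
set M := (_ * J)%E.
have key r (x : R) : 0 < r -> nf (r * sg) x = nf sg x * expR ((1 - r ^- 2) / 2 * (x / sg) ^+ 2).
 move=> r0; rewrite /nf /normal_fun subr0 -expRD; congr expR; field.
 by rewrite sgN (gt_eqF r0).
have e1 (u : R) : 1 + u <= expR u by exact: expR_ge1Dx.
have up r : 1 < r -> (1%:E + ((1 - r ^- 2) / 2)%:E * M <= r%:E)%E.
 move=> r1; have r0 : 0 < r by lra.
 have c0 : 0 <= (1 - r ^- 2) / 2.
  by apply: divr_ge0 => //; rewrite subr_ge0 invf_le1 ?exprn_gt0// exprn_ege1 ?ltW.
 rewrite -[X in (_ <= X)%E](_ : ((r * sg) / sg)%:E = r%:E); last by rewrite mulfK.
 rewrite -int_nfp ?mulr_gt0//.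
 rewrite -[X in (X%:E + _)%E](_ : sg / sg = 1); last by rewrite divff.
 rewrite -int_nfp// muleCA -ge0_muleDr; last 2 first.
 - by apply: integral_ge0 => x _; rewrite lee_fin.
 - by apply: mule_ge0.
 apply: lee_wpmul2l; first by rewrite lee_fin ltW.
 rewrite -ge0_integralZl_EFin//; last 2 first.
 - by move=> x _; rewrite lee_fin mulr_ge0.
 - by apply/measurable_EFinP; exact: (measurable_funM (mdiv 2) (mnf sg)).
 rewrite -ge0_integralD//; last 4 first.
 - by move=> x _; rewrite lee_fin.
 - by apply/measurable_EFinP; exact: mnf.
 - by move=> x _; rewrite -EFinM lee_fin; exact: mulr_ge0 c0 (mulr_ge0 (s0 x) (nf0 sg x)).
 - by apply: emeasurable_funM => //; apply/measurable_EFinP; exact: (measurable_funM (mdiv 2) (mnf sg)).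
 apply: ge0_le_integral_any => x; rewrite -EFinM -EFinD lee_fin; first exact: addr_ge0 (nf0 sg x) (mulr_ge0 c0 (mulr_ge0 (s0 x) (nf0 sg x))).
 rewrite key//; apply: le_trans (ler_wpM2l (nf0 sg x) (e1 _)).
 by rewrite le_eqVlt; apply/orP; left; apply/eqP; ring.
have lo r : 0 < r -> r < 1 -> (1%:E <= r%:E + ((r ^- 2 - 1) / 2)%:E * M)%E.
 move=> r0 r1.
 have c0 : 0 <= (r ^- 2 - 1) / 2.
  by apply: divr_ge0 => //; rewrite subr_ge0 invf_ge1 ?exprn_gt0// exprn_ile1 ?ltW.
 rewrite -[X in (_ <= X%:E + _)%E](_ : ((r * sg) / sg) = r); last by rewrite mulfK.
 rewrite -int_nfp ?mulr_gt0//.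
 rewrite -[X in (X%:E <= _)%E](_ : sg / sg = 1); last by rewrite divff.
 rewrite -int_nfp// muleCA -ge0_muleDr; last 2 first.
 - by apply: integral_ge0 => x _; rewrite lee_fin.
 - by apply: mule_ge0.
 apply: lee_wpmul2l; first by rewrite lee_fin ltW.
 rewrite -ge0_integralZl_EFin//; last 2 first.
 - by move=> x _; rewrite lee_fin mulr_ge0.
 - by apply/measurable_EFinP; exact: (measurable_funM (mdiv 2) (mnf sg)).
 rewrite -ge0_integralD//; last 4 first.
 - by move=> x _; rewrite lee_fin.
 - by apply/measurable_EFinP; exact: mnf.
 - by move=> x _; rewrite -EFinM lee_fin; exact: mulr_ge0 c0 (mulr_ge0 (s0 x) (nf0 sg x)).
 - by apply: emeasurable_funM => //; apply/measurable_EFinP; exact: (measurable_funM (mdiv 2) (mnf sg)).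
 apply: ge0_le_integral_any => x; rewrite -?EFinM -?EFinD lee_fin//.
 rewrite key//; set u := (x / sg) ^+ 2.
 have := ler_wpM2l (nf0 sg x) (e1 ((1 - r ^- 2) / 2 * u)).
 set E := nf sg x * expR _; lra.
have M0 : (0 <= M)%E by apply: mule_ge0 => //; rewrite lee_fin ltW.
case: M M0 up lo => [m||]//; last first.
 move=> _ /(_ 2 ltac:(lra)); rewrite gt0_muley ?lte_fin//.
 by rewrite divr_gt0// subr_gt0 invf_lt1 ?exprn_gt0//; lra.
rewrite lee_fin => m0 up lo; congr EFin; apply/eqP; rewrite eq_le; apply/andP; split.
(* With r^2 = 1 + e, division by r - 1 turns the inequality into (r + 1) m / 2 <= r^2, and (r + 1) /
   2 >= 1. *)
- apply/ler_addgt0Pr => e e0; set r := Num.sqrt (1 + e).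
 have r1 : 1 < r by rewrite -{1}sqrtr1 ltr_sqrt; lra.
 have r2 : r ^+ 2 = 1 + e by rewrite sqr_sqrtr//; lra.
 have := up r r1; rewrite -EFinM -EFinD lee_fin => H.
 have d0 : 0 < r ^+ 2 by rewrite r2; lra.
 have : (1 + (1 - r ^- 2) / 2 * m) * r ^+ 2 <= r * r ^+ 2 by rewrite ler_wpM2r// ltW.
 rewrite (_ : (1 + (1 - r ^- 2) / 2 * m) * r ^+ 2 = r ^+ 2 + (r ^+ 2 - 1) / 2 * m); last first.
  by field; rewrite gt_eqF//; lra.
 rewrite -r2 => K.
 have K2 : (r + 1) / 2 * m <= r ^+ 2.
  have r10 : 0 < r - 1 by rewrite subr_gt0.
  rewrite -(ler_pM2l r10).
  have -> : (r - 1) * ((r + 1) / 2 * m) = (r ^+ 2 - 1) / 2 * m by field.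
  rewrite (_ : (r - 1) * r ^+ 2 = r * r ^+ 2 - r ^+ 2); [lra|ring].
 apply: le_trans K2; rewrite -[leLHS]mul1r; apply: ler_wpM2r => //; lra.
- apply/ler_addgt0Pr => e e0.
 have [e1'|e1'] := leP 1 e; first by lra.
 set r := Num.sqrt (1 - e).
 have rr0 : 0 < r by rewrite sqrtr_gt0; lra.
 have r1 : r < 1 by rewrite -[X in _ < X]sqrtr1 ltr_sqrt; lra.
 have r2 : r ^+ 2 = 1 - e by rewrite sqr_sqrtr//; lra.
 have := lo r rr0 r1; rewrite -EFinM -EFinD lee_fin => H.
 have d0 : 0 < r ^+ 2 by rewrite r2; lra.
 have : 1 * r ^+ 2 <= (r + (r ^- 2 - 1) / 2 * m) * r ^+ 2 by rewrite ler_wpM2r// ltW.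
 rewrite (_ : (r + (r ^- 2 - 1) / 2 * m) * r ^+ 2 = r * r ^+ 2 + (1 - r ^+ 2) / 2 * m); last first.
  by field; rewrite gt_eqF.
 move=> K.
 have K2 : r ^+ 2 <= (1 + r) / 2 * m.
  have r10 : 0 < 1 - r by rewrite subr_gt0.
  rewrite -(ler_pM2l r10).
  have -> : (1 - r) * ((1 + r) / 2 * m) = (1 - r ^+ 2) / 2 * m by field.
  rewrite (_ : (1 - r) * r ^+ 2 = r ^+ 2 - r * r ^+ 2); [lra|ring].
 have : r ^+ 2 <= m.
  apply: le_trans K2 _; rewrite -[leRHS]mul1r; apply: ler_wpM2r => //; lra.
 by rewrite r2; lra.
Qed.

(** Reflection exchanges the positive and the negative part, and their common integral is finite by
    the second moment. *)
Lemma normal_mean : (\int[N]_x (x / sg)%:E = 0)%E.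
Proof.
pose fp (x : R) := Num.max (x / sg) 0; pose fm (x : R) := Num.max (- (x / sg)) 0.
have mx : mfunT (fun x : R => x / sg) by exact: measurable_funM.
have mp : mfunT fp by apply: measurable_maxr.
have mm : mfunT fm by apply: measurable_maxr => //; exact: measurableT_comp.
have fp0 x : 0 <= fp x by rewrite le_max lexx orbT.
have fm0 x : 0 <= fm x by rewrite le_max lexx orbT.
have E : (\int[N]_x (fp x)%:E = \int[N]_x (fm x)%:E)%E.
 rewrite !ge0_integral_normal_prob//.
 rewrite -(ge0_integral_reflect 0 (F := fun x => (fp x * normal_pdf 0 sg x)%:E))//; last 2 first.
 - by apply/measurable_EFinP; apply: measurable_funM => //; exact: measurable_normal_pdf.
 - by move=> y; rewrite lee_fin mulr_ge0// normal_pdf_ge0.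
 apply: eq_integral => x _; congr (_ * _)%:E; first by rewrite /fp /fm sub0r mulNr.
 by rewrite !nf_pdf// /nf /normal_fun !subr0 sub0r sqrrN.
rewrite integralE.
have -> : (\int[N]_x ((fun x => (x / sg)%:E)^\+)%E x = \int[N]_x (fp x)%:E)%E.
 by apply: eq_integral => x _; rewrite funeposE EFin_max.
have -> : (\int[N]_x ((fun x => (x / sg)%:E)^\-)%E x = \int[N]_x (fm x)%:E)%E.
 by apply: eq_integral => x _; rewrite funenegE EFin_max EFinN.
rewrite E subee//.
apply/fin_numPlt; rewrite (lt_le_trans _ (integral_ge0 _ _)) ?ltNyr//=; last by move=> x _; rewrite lee_fin.
apply: (@le_lt_trans _ _ (\int[N]_x (1%:E + ((x / sg) ^+ 2)%:E))%E).
 apply: ge0_le_integral_any => x; rewrite -?EFinD lee_fin// /fm ge_max; apply/andP; split; last first.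
  by rewrite addr_ge0 ?sqr_ge0.
 by set y := x / sg; nra.
rewrite ge0_integralD//; last 2 first.
- by move=> x _; rewrite lee_fin sqr_ge0.
- by apply/measurable_EFinP; exact: mdiv.
rewrite normal_moment2 integral_cst//= mul1e; apply: lte_add_pinfty; last exact: ltry.
by apply: le_lt_trans (ltry 1); exact: probability_le1.
Qed.
End normal_moments.

(** * Integrals modulo null sets *)

Section integral_any.
Context {d} {T : measurableType d} {R : realType} (m : {measure set T -> \bar R}).

(** A measurable majorant valid everywhere is obtained by putting +oo on the null set; f itself may
    fail to be measurable, as kernels that are only Lebesgue measurable do. *)
Lemma ae_le_integral_any (f h : T -> \bar R) (U : set T) : measurable U -> m U = 0%E ->
 (forall x, 0 <= f x)%E -> mfunT h -> (forall x, 0 <= h x)%E ->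
 (forall x, ~ U x -> f x <= h x)%E -> (\int[m]_x f x <= \int[m]_x h x)%E.
Proof.
move=> mU U0 f0 mh h0 fh.
pose H x := if x \in U then +oo%E else h x.
have mH : mfunT H.
 apply: measurable_fun_ifT => //.
 by apply: (measurable_fun_bool true); rewrite setTI (_ : _ @^-1` _ = U)//;
  apply/seteqP; split=> x /=; [move/set_mem|move/mem_set].
have H0 x : (0 <= H x)%E by rewrite /H; case: ifP.
apply: (@le_trans _ _ (\int[m]_x H x)%E).
 apply: ge0_le_integral_any => // x; rewrite /H; case: ifPn => [_|/negP xU]; first exact: leey.
 by apply: fh => ?; apply: xU; exact: mem_set.
rewrite le_eqVlt; apply/orP; left; apply/eqP; apply: ge0_ae_eq_integral => //.
exists U; split=> // x /= K; apply: contrapT => Ux; apply: K => _.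
by rewrite /H memNset.
Qed.

Lemma ge0_ae_integral_any (f h : T -> \bar R) (U : set T) : measurable U -> m U = 0%E ->
 (forall x, 0 <= f x)%E -> mfunT h -> (forall x, 0 <= h x)%E ->
 (forall x, ~ U x -> f x = h x) -> (\int[m]_x f x = \int[m]_x h x)%E.
Proof.
move=> mU U0 f0 mh h0 fh; apply/eqP; rewrite eq_le; apply/andP; split.
 by apply: (ae_le_integral_any mU) => // x /fh ->.
pose H x := if x \in U then 0%E else h x.
have mH : mfunT H.
 apply: measurable_fun_ifT => //.
 by apply: (measurable_fun_bool true); rewrite setTI (_ : _ @^-1` _ = U)//;
  apply/seteqP; split=> x /=; [move/set_mem|move/mem_set].
have H0 x : (0 <= H x)%E by rewrite /H; case: ifP.
apply: (@le_trans _ _ (\int[m]_x H x)%E); last first.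
 apply: ge0_le_integral_any => // x; rewrite /H; case: ifPn => [_|/negP xU]; first exact: f0.
 by rewrite fh// => ?; apply: xU; exact: mem_set.
rewrite le_eqVlt; apply/orP; left; apply/eqP; apply: ge0_ae_eq_integral => //.
exists U; split=> // x /= K; apply: contrapT => Ux; apply: K => _.
by rewrite /H memNset.
Qed.

Lemma ae_integral_any (f h : T -> \bar R) (U : set T) : measurable U -> m U = 0%E ->
 mfunT h -> (forall x, ~ U x -> f x = h x) -> (\int[m]_x f x = \int[m]_x h x)%E.
Proof.
move=> mU U0 mh fh; rewrite [LHS]integralE [RHS]integralE; congr (_ - _)%E.
- apply: (ge0_ae_integral_any mU) => //; first exact: measurable_funepos.
 by move=> x Ux; rewrite !funeposE fh.
- apply: (ge0_ae_integral_any mU) => //; first exact: measurable_funeneg.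
 by move=> x Ux; rewrite !funenegE fh.
Qed.

Lemma integrable_indic_fin (A : set T) : measurable A -> (m A < +oo)%E ->
 m.-integrable setT (fun x => (\1_A x : R)%:E).
Proof.
move=> mA A0; apply/integrableP; split; first by apply/measurable_EFinP; exact: measurable_indic.
under eq_integral do rewrite gee0_abs ?lee_fin//.
by rewrite integral_indic ?setIT.
Qed.

Lemma measurable_countable_comp (V : countType) (Z : T -> V) (h : V -> R) :
 (forall v, measurable [set w | Z w = v]) -> mfunT (fun w => h (Z w)).
Proof.
move=> mZ _ A mA; rewrite setTI.
have -> : (fun w => h (Z w)) @^-1` A = \bigcup_(v in [set: V]) (if h v \in A then [set w | Z w = v] else set0).
 apply/seteqP; split=> w /=.
  by move=> Aw; exists (Z w) => //; rewrite mem_set.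
 by move=> [v _]; case: ifP => [/set_mem Av|_] //= ->.
apply: countable_bigcupT_measurable => [|v]; first exact: countableP.
by case: ifP.
Qed.
End integral_any.

Section sq_small.
Context {d} {T : measurableType d} {R : realType} (m : {measure set T -> \bar R}).

(* [u] need not be measurable *)
Definition sq_small (u : T -> R) (e : R) := exists (G : T -> \bar R) (W : set T),
 [/\ mfunT G, (forall x, 0 <= G x)%E, (\int[m]_x G x <= e%:E)%E,
   measurable W /\ m W = 0%E & forall x, ~ W x -> ((u x ^+ 2)%:E <= G x)%E].

Lemma sq_small_integral u e : sq_small u e -> (\int[m]_x (u x ^+ 2)%:E <= e%:E)%E.
Proof.
move=> [G [W [mG G0 Ge [mW W0] HW]]]; apply: le_trans Ge.
by apply: (ae_le_integral_any mW W0) => // x; rewrite lee_fin sqr_ge0.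
Qed.

Lemma sq_small_eq u v e : (forall x, u x = v x) -> sq_small u e -> sq_small v e.
Proof. by move=> /funext ->. Qed.

Lemma sq_smallB u v e e' : sq_small u e -> sq_small v e' ->
 sq_small (fun x => u x - v x) (2 * e + 2 * e').
Proof.
move=> [G [W [mG G0 Ge [mW W0] HW]]] [G' [W' [mG' G'0 Ge' [mW' W'0] HW']]].
exists (fun x => 2%:E * G x + 2%:E * G' x)%E, (W `|` W'); split.
- by apply: emeasurable_funD; apply: emeasurable_funM.
- by move=> x; apply: adde_ge0; apply: mule_ge0.
- rewrite ge0_integralD//; last 4 first.
 + by move=> x _; apply: mule_ge0.
 + exact: emeasurable_funM.
 + by move=> x _; apply: mule_ge0.
 + exact: emeasurable_funM.
 rewrite [X in (_ <= X)%E]EFinD; apply: leeD.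
  by rewrite ge0_integralZl_EFin// [X in (_ <= X)%E]EFinM; apply: lee_wpmul2l.
 by rewrite ge0_integralZl_EFin// [X in (_ <= X)%E]EFinM; apply: lee_wpmul2l.
- by split; [exact: measurableU|rewrite measureU0].
move=> x /not_orP[n1 n2]; apply: (@le_trans _ _ (2%:E * (u x ^+ 2)%:E + 2%:E * (v x ^+ 2)%:E)%E).
 rewrite -!EFinM -EFinD lee_fin -subr_ge0.
 by rewrite (_ : _ - _ = (u x + v x) ^+ 2); [exact: sqr_ge0|ring].
by apply: leeD; apply: lee_wpmul2l => //; [exact: HW|exact: HW'].
Qed.
End sq_small.

(** * Discretised kernels converge to the time kernel *)

Section kernel.
Context {R : realType} (k : nat).
Local Notation mu := (@lebesgue_measure R).
Local Notation lam := (@lebesgue_tuple R k).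

(** Number z of the cell ](z - 1) / N, z / N] that contains s; the cells are open on the left like
    those of [simple_kernel]. *)
Definition zceil (N : nat) (s : R) : int := Num.ceil (N%:R * s).

Lemma zceilP N s (z : int) : (zceil N s == z) = ((z - 1)%:~R < N%:R * s <= z%:~R).
Proof. exact: ceil_eq. Qed.

Lemma measurable_zceil N z : measurable [set s : R | zceil N s = z].
Proof.
have mN : mfunT (fun s : R => N%:R * s) by exact: measurable_funM.
rewrite (_ : [set s | _] = setT `&` (fun s : R => N%:R * s) @^-1` `](z - 1)%:~R, z%:~R]).
 by apply: mN => //; exact: measurable_itv.
apply/seteqP; split=> s /=; rewrite in_itv/= -zceilP; first by move/eqP.
by move=> [_ /eqP].
Qed.

(** Extension by 0 puts causality, the truncation at M and the exclusion of diagonals into one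
    coefficient on integer lags. *)
Definition cell_coef (a : {ffun 'I_k -> nat} -> R) (M : nat) (i : {ffun 'I_k -> int}) : R :=
 if [forall q, (1 <= i q) && (i q <= M%:Z)] && injectiveb i then a [ffun q => `|i q|%N] else 0.

Variables (g : 'rV[R]_k -> R) (L : {ffun 'I_k -> nat} -> R) (alpha : R).
Hypotheses (k0 : (0 < k)%N) (gB : is_GHKB alpha g) (adm : admissible L).
Let a (i : {ffun 'I_k -> nat}) := g (row_of_index i) * L i.

(** Riemann sum for the time kernel on the cell z: N^(- alpha) rescales the homogeneous coefficient
    and N^(- 1) is the mesh in time. *)
Definition grid_kernel (N M b : nat) (z : {ffun 'I_k -> int}) : R :=
 N%:R `^ (- 1 - alpha) * \sum_(n < b) cell_coef a M [ffun q => n.+1%:Z - z q].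

Definition zceil_tuple N (x : k.-tuple R) : {ffun 'I_k -> int} := [ffun q => zceil N (tnth x q)].

(** The homogeneity shared equally among the k coordinates. The interval allowed for alpha is
    exactly what makes 1/2 < gam and k (2 gam - 1) < 1. *)
Let gam := - alpha / k%:R.
Let k0R : 0 < k%:R :> R. Proof. by rewrite ltr0n. Qed.
Let kgam : k%:R * gam = - alpha. Proof. by rewrite /gam mulrC divfK// gt_eqF. Qed.
Let albound : - (k%:R + 1) / 2 < alpha < - k%:R / 2. Proof. by case: gB => -[]. Qed.

Let gam12 : 1 / 2 < gam < 1.
Proof.
have /andP[a1 a2] := albound; have k1 : 1 <= k%:R :> R by rewrite ler1n.
by rewrite /gam ltr_pdivlMr// ltr_pdivrMr//; apply/andP; split; lra.
Qed.

Let kg1 : k%:R * (2 * gam - 1) < 1.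
Proof.
have -> : k%:R * (2 * gam - 1) = 2 * (k%:R * gam) - k%:R by ring.
by rewrite kgam; have /andP[a1 a2] := albound; lra.
Qed.

Let gam0 : 0 < gam. Proof. by move: gam12 => /andP[]; lra. Qed.

Let expk (x : R) : x ^+ k = \prod_(q < k) x.
Proof. by rewrite prodr_const card_ord. Qed.

Lemma sum_pow_le (y : 'I_k -> R) : (forall q, 0 < y q) ->
 (\sum_q y q) `^ alpha <= \prod_q (y q) `^ (- gam).
Proof.
move=> y0; have S0 : 0 < \sum_q y q.
 by rewrite (bigD1 (Ordinal k0))//=; apply: ltr_pwDl => //; apply: sumr_ge0 => q _; exact: ltW.
have -> : alpha = - gam * k%:R by rewrite mulNr mulrC kgam opprK.
rewrite powRrM powR_mulrn ?powR_ge0// expk.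
apply: ler_prod => q _; rewrite powR_ge0/= !powRN lef_pV2 ?posrE ?powR_gt0//.
apply: ge0_ler_powR; rewrite ?nnegrE ?(ltW S0) ?(ltW (y0 q)) ?(ltW gam0)//.
by rewrite (bigD1 q)//= lerDl; apply: sumr_ge0 => p _; exact: ltW.
Qed.

Definition good (y : k.-tuple R) f0 := orthant (row_tuple y) ->
 [/\ g (row_tuple y) = f0 y & {for row_tuple y, continuous g}].

(** [g] is Borel only up to a null set and uncontrolled off the orthant. Clamping a Borel version
    between plus and minus the power bound keeps it measurable and bounded everywhere, and makes it
    0 off the orthant, where [powp] vanishes. *)
Lemma borel_version : exists (f0 : k.-tuple R -> R) (c : R) (U : set (k.-tuple R)),
 [/\ mfunT f0, 0 < c,
   forall y, `|f0 y| <= c * \prod_q powp gam (tnth y q),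
   measurable U /\ lam U = 0%E & forall y, ~ U y -> good y f0].
Proof.
have [[_ [f mf [U1 [mU1 U10 HU1]]] _ _] [U2 [mU2 U20 HU2]] [c c0 Hc]] := gB.
pose ok (y : k.-tuple R) := [forall q, 0 < tnth y q].
have okP y : ok y -> orthant (row_tuple y).
 by move=> /forallP h q; rewrite /row_tuple mxE.
have okP' y : orthant (row_tuple y) -> ok y.
 by move=> h; apply/forallP => q; have := h q; rewrite /row_tuple mxE.
pose bd (y : k.-tuple R) := \prod_(q < k) powp gam (tnth y q).
have mbd : mfunT bd.
 by apply: (measurable_tnth_prod (f := fun _ => powp gam)) => _; exact: measurable_powp.
pose f0 y := Num.max (- (c * bd y)) (Num.min (f y) (c * bd y)).
have bd0 y : 0 <= bd y by apply: prodr_ge0 => q _; exact: powp_ge0.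
exists f0, c, (U1 `|` U2); split=> //.
- apply: measurable_maxr; first by apply: measurableT_comp => //; exact: measurable_funM.
 by apply: measurable_minr => //; exact: measurable_funM.
- move=> y; rewrite -/(bd y) ler_norml /f0 le_max lexx/= ge_max ge_min lexx orbT andbT.
 by have := mulr_ge0 (ltW c0) (bd0 y); lra.
- split; first exact: measurableU.
 by rewrite measureU0.
- move=> y /not_orP[n1 n2] oy; split; last first.
  by apply: contrapT => h; apply: n2; apply: HU2 => /= /(_ oy).
 have gf : g (row_tuple y) = f y by apply: contrapT => h; apply: n1; apply: HU1 => /= /(_ oy).
 have : `|g (row_tuple y)| <= c * bd y.
  apply: le_trans (Hc _ oy) _; rewrite ler_wpM2l ?(ltW c0)//.
  under eq_bigr do rewrite /row_tuple mxE.
  have /forallP oky := okP' _ oy.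
  apply: le_trans (sum_pow_le oky) _; rewrite le_eqVlt; apply/orP; left; apply/eqP.
  by apply: eq_bigr => q _; rewrite /powp oky.
 by rewrite /f0 gf ler_norml => /andP[l1 l2]; rewrite min_l// max_r.
Qed.

(** A lag i >= 1 between the cells of x and s satisfies N (s - x) < i + 1 <= 2 i, so i / N is at
    least (s - x) / 2. This costs a factor 2^gam per coordinate. *)
Lemma cell_coef_bound : exists2 C : R, 0 < C & forall N M (s : R) (x : k.-tuple R), (0 < N)%N ->
 `|N%:R `^ (- alpha) * cell_coef a M [ffun q => zceil N s - zceil_tuple N x q]| <=
 C * \prod_q powp gam (s - tnth x q).
Proof.
have [_ _ [c c0 Hc]] := gB; have [[CL HL] _] := adm.
pose C1 := Num.max CL 1.
exists (c * C1 * (2 `^ gam) ^+ k).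
 by apply: mulr_gt0; [apply: mulr_gt0 => //; rewrite lt_max ltr01 orbT|rewrite exprn_gt0 ?powR_gt0].
move=> N M s x N0; have NR : 0 < N%:R :> R by rewrite ltr0n.
have C10 : 0 < C1 by rewrite lt_max ltr01 orbT.
have P0 : 0 <= \prod_q powp gam (s - tnth x q) by apply: prodr_ge0 => q _; exact: powp_ge0.
have R0 : 0 <= c * C1 * (2 `^ gam) ^+ k * \prod_q powp gam (s - tnth x q).
 by rewrite !mulr_ge0 ?(ltW c0) ?(ltW C10) ?exprn_ge0 ?powR_ge0.
rewrite /cell_coef; case: ifP => [/andP[/forallP hi _]|_]; last by rewrite mulr0 normr0.
set i := [ffun q => `|_|%N].
have i0 q : (0 < i q)%N by rewrite ffunE; have := hi q; clear; lia.
have iE q : (i q)%:R = (zceil N s - zceil N (tnth x q))%:~R :> R.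
 have := hi q; rewrite !ffunE => /andP[h _].
 rewrite -[RHS]ger0_norm ?ler0z; first by rewrite -intr_norm -abszE.
 by move: h; clear; lia.
have sx q : 0 < s - tnth x q /\ (s - tnth x q) / 2 <= (i q)%:R / N%:R.
 have /andP[b1 b2] := ceil_itv (N%:R * s); have /andP[b3 b4] := ceil_itv (N%:R * tnth x q).
 have i1 : 1 <= (i q)%:R :> R by rewrite ler1n.
 have e := iE q; rewrite /zceil intrB in e; rewrite !intrB in b1 b3.
 have h1 : 0 < N%:R * (s - tnth x q) by rewrite mulrBr; lra.
 split; first by rewrite pmulr_rgt0 in h1.
 by rewrite ler_pdivlMr//; have : N%:R * (s - tnth x q) < (i q)%:R + 1; [rewrite mulrBr; lra|lra].
rewrite normrM ger0_norm ?powR_ge0// /a normrM.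
have og : orthant (row_of_index i : 'rV[R]_k) by move=> q; rewrite mxE ltr0n.
apply: (@le_trans _ _ (N%:R `^ (- alpha) * (c * (\sum_q (i q)%:R) `^ alpha * C1))).
 rewrite ler_wpM2l ?powR_ge0//; apply: ler_pM => //.
  apply: le_trans (Hc _ og) _; rewrite (eq_bigr (fun q => (i q)%:R))// => q _; by rewrite mxE.
 by apply: le_trans (HL _ i0) _; rewrite le_max lexx.
have -> : N%:R `^ (- alpha) * (c * (\sum_q (i q)%:R) `^ alpha * C1) =
  c * C1 * (\sum_q (i q)%:R / N%:R) `^ alpha.
 rewrite -mulr_suml powRM ?sumr_ge0// ?invr_ge0 ?ler0n//.
 by rewrite -powR_inv1 ?ler0n// -powRrM mulN1r; ring.
rewrite -!mulrA; apply: ler_wpM2l; first exact: ltW.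
apply: ler_wpM2l; first exact: ltW.
have iN q : 0 < (i q)%:R / N%:R :> R by rewrite divr_gt0// ltr0n.
apply: le_trans (sum_pow_le iN) _.
rewrite expk -big_split/=; apply: ler_prod => q _.
rewrite powR_ge0/=; have [s0 s1] := sx q.
rewrite /powp s0; have -> : 2 `^ gam * (s - tnth x q) `^ (- gam) = ((s - tnth x q) / 2) `^ (- gam).
 rewrite powRM ?(ltW s0) ?invr_ge0// mulrC; congr (_ * _).
 by rewrite -powR_inv1// -powRrM mulN1r opprK.
rewrite !powRN lef_pV2 ?posrE ?powR_gt0 ?divr_gt0 ?ltr0n//.
by apply: ge0_ler_powR; rewrite ?nnegrE ?(ltW gam0) ?(ltW (iN q)) ?divr_ge0 ?(ltW s0).
Qed.

Lemma fin_bound (I : finType) (f : I -> R) : exists n : nat, forall q, f q <= n%:R.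
Proof.
exists (\sum_q (Num.truncn (f q)).+1)%N => q.
have [f0|f0] := leP 0 (f q); last by apply: le_trans (ltW f0) _.
apply: (@le_trans _ _ (Num.truncn (f q)).+1%:R).
 by have /andP[_ /ltW] := truncn_itv f0.
by rewrite ler_nat (bigD1 q)//= leq_addr.
Qed.

Lemma integral_zceil N b (G : int -> R) : (0 < N)%N ->
 mu.-integrable setT (fun s => (\sum_(n < b) G n.+1%:Z * (zceil N s == n.+1%:Z)%:R)%:E) /\
 (\int[mu]_s (\sum_(n < b) G n.+1%:Z * (zceil N s == n.+1%:Z)%:R)%:E =
  (N%:R^-1 * \sum_(n < b) G n.+1%:Z)%:E)%E.
Proof.
move=> N0; have NR : 0 < N%:R :> R by rewrite ltr0n.
have cell n : mu [set s | zceil N s = n.+1%:Z] = (N%:R^-1)%:E.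
 rewrite (_ : [set s | _] = `]n%:R / N%:R, n.+1%:R / N%:R]%classic); last first.
  apply/seteqP; split=> s /=; rewrite in_itv/= ltr_pdivrMr// ler_pdivlMr// [s * _]mulrC.
   by move/eqP; rewrite zceilP (_ : n.+1%:Z - 1 = n%:Z)//; clear; lia.
  by move=> h; apply/eqP; rewrite zceilP (_ : n.+1%:Z - 1 = n%:Z)//; clear; lia.
 rewrite lebesgue_measure_itv/= lte_fin ltr_pM2r ?invr_gt0// ltr_nat leqnn.
 by rewrite -EFinB -mulrBl -natrB// subSnn mul1r.
elim: b => [|b [IH1 IH2]].
 split; last by under eq_integral do rewrite big_ord0; rewrite integral0 big_ord0 mulr0.
 by under eq_fun do rewrite big_ord0; exact: integrable0.
have E s : (zceil N s == b.+1%:Z)%:R = \1_[set s | zceil N s = b.+1%:Z] s :> R.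
 by rewrite indicE; congr (nat_of_bool _)%:R; apply/eqP/idP => [h|/set_mem//]; exact/mem_set.
have ii : mu.-integrable setT (fun s => (G b.+1%:Z * (zceil N s == b.+1%:Z)%:R)%:E).
 under eq_fun do rewrite E EFinM.
 apply: integrableZl => //; apply: integrable_indic_fin; first exact: measurable_zceil.
 by rewrite -[X in (X < _)%E]/(mu [set s | zceil N s = b.+1%:Z]) cell ltry.
split.
 by under eq_fun do rewrite big_ord_recr/= EFinD; exact: integrableD.
under eq_integral do rewrite big_ord_recr/= EFinD.
rewrite integralD// IH2 big_ord_recr/= mulrDr EFinD; congr (_ + _)%E.
under eq_integral do rewrite E EFinM.
rewrite integralZl//; last by apply: integrable_indic_fin; [exact: measurable_zceil|rewrite -[X in (X < _)%E]/(mu [set s | zceil N s = b.+1%:Z]) cell ltry].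
by rewrite integral_indic ?setIT//; [rewrite -[X in (_ * X)%E]/(mu _) cell -EFinM mulrC|exact: measurable_zceil].
Qed.

Section with_version.
Variables (f0 : k.-tuple R -> R) (c : R) (U : set (k.-tuple R)).
Hypotheses (mf0 : mfunT f0) (c0 : 0 < c)
 (f0c : forall y, `|f0 y| <= c * \prod_q powp gam (tnth y q))
 (mU : measurable U) (U0 : lam U = 0%E) (HU : forall y, ~ U y -> good y f0).
Variable t : R.
Hypothesis t01 : 0 <= t <= 1.
Let tb N := Num.truncn (N%:R * t).

Let Gc N M s x := N%:R `^ (- alpha) * cell_coef a M [ffun q => zceil N s - zceil_tuple N x q].

Let dn1 N M s x : R := \1_(`]0, (tb N)%:R / N%:R]%classic : set R) s * Gc N M s x.
Let dn2 s x : R := \1_(`]0, t]%classic : set R) s * f0 (reflect_tuple s x).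
(** Error inside the time integral: the discrete part stops at the last grid time before t, the
    continuous part at t itself. *)
Let dn N M s x := dn1 N M s x - dn2 s x.

Let Nt0 N : 0 <= N%:R * t. Proof. by case/andP: t01 => *; exact: mulr_ge0. Qed.

Let measurable_dn2 : mfunT (fun z : R * k.-tuple R => dn2 z.1 z.2).
Proof.
apply: measurable_funM.
 by apply: (measurableT_comp _ measurable_fst); apply: measurable_indic; exact: measurable_itv.
exact: (measurableT_comp mf0 (@measurable_reflect_tuple R k)).
Qed.

Let measurable_dn N M : mfunT (fun z : R * k.-tuple R => dn N M z.1 z.2).
Proof.
apply: measurable_funB; last exact: measurable_dn2.
apply: measurable_funM.
 by apply: (measurableT_comp _ measurable_fst); apply: measurable_indic; exact: measurable_itv.
pose Z (z : R * k.-tuple R) := (zceil N z.1, zceil_tuple N z.2).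
pose h (v : int * {ffun 'I_k -> int}) := N%:R `^ (- alpha) * cell_coef a M [ffun q => v.1 - v.2 q].
apply: (measurable_countable_comp (Z := Z) h) => -[v0 v].
rewrite (_ : [set w | _] = (fst @^-1` [set s | zceil N s = v0]) `&`
  \bigcap_(q in [set: 'I_k]) ((fun z : R * k.-tuple R => tnth z.2 q) @^-1` [set s | zceil N s = v q])).
 apply: measurableI.
  by rewrite -[X in measurable X]setTI; apply: measurable_fst => //; exact: measurable_zceil.
 apply: fin_bigcap_measurable => // q _.
 have mt : mfunT (fun z : R * k.-tuple R => tnth z.2 q).
  exact: (measurableT_comp (measurable_tnth q) measurable_snd).
 by rewrite -[X in measurable X]setTI; apply: mt => //; exact: measurable_zceil.
apply/seteqP; split=> z /=; rewrite /Z.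
 by move=> [<- <-]; split=> // q _ /=; rewrite ffunE.
by move=> [-> h2]; congr pair; apply/ffunP => q; rewrite ffunE; exact: h2.
Qed.

Let dn2_bound s x : `|dn2 s x| <= c * pow_prod gam s x.
Proof.
rewrite /dn2 /pow_prod normrM !indicE.
have -> : \prod_(q < k) powp gam (s - tnth x q) = \prod_q powp gam (tnth (reflect_tuple s x) q).
 by apply: eq_bigr => q _; rewrite tnth_mktuple.
have P0 : 0 <= \prod_q powp gam (tnth (reflect_tuple s x) q).
 by apply: prodr_ge0 => q _; exact: powp_ge0.
case: (boolP (s \in _)) => [/set_mem/=|_]; last first.
 by rewrite normr0 mul0r mulr_ge0 ?(ltW c0)// mulr_ge0.
rewrite in_itv/= => /andP[s0 st]; rewrite mem_set/=; first by rewrite normr1 !mul1r.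
by rewrite in_itv/= (ltW s0)/=; case/andP: t01 => _; exact: le_trans st.
Qed.

Let dn_bound : exists C : R, forall N M s x, (0 < N)%N -> `|dn N M s x| <= C * pow_prod gam s x.
Proof.
have [C C0 HC] := cell_coef_bound; exists (C + c) => N M s x N0.
apply: le_trans (ler_normB _ _) _; rewrite mulrDl; apply: lerD; last exact: dn2_bound.
rewrite /dn1 /pow_prod normrM !indicE.
have P0 : 0 <= \prod_q powp gam (s - tnth x q) by apply: prodr_ge0 => q _; exact: powp_ge0.
case: (boolP (s \in _)) => [/set_mem/=|_]; last first.
 by rewrite normr0 mul0r mulr_ge0 ?(ltW C0)// mulr_ge0.
rewrite in_itv/= => /andP[s0 st]; rewrite mem_set/=; first by rewrite normr1 !mul1r; exact: HC.
rewrite in_itv/= (ltW s0)/=; apply: le_trans st _; rewrite ler_pdivrMr ?ltr0n// mul1r.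
have := truncn_le (N%:R * t); rewrite Nt0 => h; apply: le_trans h _.
by rewrite ler_piMr//; case/andP: t01.
Qed.

Let dn1E N M x s : (0 < N)%N -> dn1 N M s x =
 \sum_(n < tb N) (fun z => N%:R `^ (- alpha) * cell_coef a M [ffun q => z - zceil_tuple N x q]) n.+1%:Z *
   (zceil N s == n.+1%:Z)%:R.
Proof.
move=> N0; have NR : 0 < N%:R :> R by rewrite ltr0n.
rewrite /dn1 /Gc indicE.
pose G (z : int) := N%:R `^ (- alpha) * cell_coef a M [ffun q => z - zceil_tuple N x q].
have -> : (s \in (`]0, (tb N)%:R / N%:R]%classic : set R)) = (0 < zceil N s) && (zceil N s <= (tb N)%:Z).
 rewrite /zceil ceil_le_int ceil_gt_int mulr0z pmulr_rgt0// [N%:R * s]mulrC -ler_pdivlMr//.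
 by apply/idP/idP => [/set_mem|h]; [|apply/mem_set]; rewrite /= in_itv.
have -> : N%:R `^ (- alpha) * cell_coef a M [ffun q => zceil N s - zceil_tuple N x q] = G (zceil N s) by [].
move: (zceil N s) => z; have [/andP[z0 zb]|zn] := boolP ((0 < z) && (z <= (tb N)%:Z)).
 have [m zE] : exists m : nat, z = m.+1%:Z.
  by exists `|z|.-1; move: z0; clear; lia.
 have mb : (m < tb N)%N by move: zb; rewrite zE; clear; lia.
 rewrite (bigD1 (Ordinal mb))//= zE eqxx mulr1 mul1r big1 ?addr0// => i im.
 by case: eqP => [h|_]; rewrite ?mulr0//; case/eqP: im; apply: val_inj => /=; move: h; clear; lia.
rewrite mul0r big1// => i _; case: eqP => [h|_]; rewrite ?mulr0//.
by case/negP: zn; have := ltn_ord i; rewrite h; clear; lia.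
Qed.

(** For fixed s and x the restrictions on the discrete coefficient hold eventually: lags are
    positive, below M because M / N grows, and distinct because the coordinates are. What remains
    converges by continuity of [g] at s 1 - x and admissibility of [L]. *)
Let dn_cvg (NN MM : nat -> nat) (s : R) (x : k.-tuple R) : (forall r, r < NN r)%N -> (forall r, NN r * r <= MM r)%N ->
 s != t -> 0 <= s <= 1 -> uniq x -> ~ U (reflect_tuple s x) ->
 (fun r => dn (NN r) (MM r) s x) @ \oo --> (0 : R).
Proof.
move=> HN HM st s01 ux nU.
have N0 r : (0 < NN r)%N by apply: leq_ltn_trans (HN r).
have NR r : 0 < (NN r)%:R :> R by rewrite ltr0n.
have out2 : s \notin (`]0, t]%classic : set R) \/ ~~ [forall q, tnth x q < s] -> dn2 s x = 0.
 rewrite /dn2 indicE => -[/negbTE ->|]; first by rewrite mul0r.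
 rewrite negb_forall => /existsP[q]; rewrite -leNgt => qs.
 apply/eqP; rewrite mulf_eq0; apply/orP; right; rewrite -normr_le0; apply: le_trans (f0c _) _.
 by rewrite (bigD1 q)//= tnth_mktuple /powp subr_gt0 ltNge qs mul0r mulr0.
have dn10 r : s \notin (`]0, (tb (NN r))%:R / (NN r)%:R]%classic : set R) \/ ~~ [forall q, tnth x q < s] ->
  dn1 (NN r) (MM r) s x = 0.
 rewrite /dn1 indicE => -[/negbTE ->|]; first by rewrite mul0r.
 rewrite negb_forall => /existsP[q]; rewrite -leNgt => qs.
 rewrite /Gc /cell_coef; case: ifP; rewrite ?mulr0// => /andP[/forallP/(_ q)].
 rewrite !ffunE => /andP[h _] _; exfalso.
 have : zceil (NN r) s <= zceil (NN r) (tnth x q) by apply: le_ceil; rewrite ler_pM2l.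
 by move: h; clear; lia.
have out : (s <= 0) || (t < s) || ~~ [forall q, tnth x q < s] ->
  (fun r => dn (NN r) (MM r) s x) @ \oo --> (0 : R).
 move=> h; rewrite (_ : (fun r => _) = cst 0); first exact: cvg_cst.
 apply/funext => r; rewrite /dn out2 ?dn10 ?subrr//.
  move: h => /orP[h|->]; [left|by right]; apply/negP => /set_mem/=; rewrite in_itv/=.
  rewrite ler_pdivlMr// => /andP[s0 sN]; case/orP: h => h; first by move: (lt_le_trans s0 h); rewrite ltxx.
  have := truncn_le ((NN r)%:R * t); rewrite Nt0 => h2; have := le_trans sN h2.
  by rewrite mulrC ler_pM2l// leNgt h.
 move: h => /orP[h|->]; [left|by right]; apply/negP => /set_mem/=; rewrite in_itv/=.
 by case/orP: h => h /andP[]; [rewrite ltNge h|rewrite leNgt h].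
have [/out//|/norP[/norP[]]] := boolP ((s <= 0) || (t < s) || ~~ [forall q, tnth x q < s]).
rewrite -ltNge -leNgt negbK => s0 st' /forallP xs; have {}st : s < t by rewrite lt_neqAle st.
clear out out2 dn10.
have oy : orthant (row_tuple (reflect_tuple s x)).
 by move=> q; rewrite /row_tuple mxE tnth_mktuple subr_gt0.
have [gy cg] := HU nU oy.
pose zd N q : int := zceil N s - zceil N (tnth x q).
pose iN N : {ffun 'I_k -> nat} := [ffun q => `|zd N q|%N].
pose y q : R := s - tnth x q.
have y0 q : 0 < y q by rewrite subr_gt0.
have zdP N q : N%:R * y q - 1 < (zd N q)%:~R < N%:R * y q + 1.
 have := ceil_itv (N%:R * s); have := ceil_itv (N%:R * tnth x q).
 rewrite /zd /zceil /y !intrB => /andP[? ?] /andP[? ?].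
 by apply/andP; split; lra.
(* Thresholds: p makes every lag positive, Y compares the lags with N, w separates the cells of
   distinct coordinates, and v puts s before the last grid time. *)
have [p Hp] := fin_bound (fun q => 2 / y q).
have [Y HY] := fin_bound y.
have [w Hw] := fin_bound (fun v : 'I_k * 'I_k => 2 / `|tnth x v.1 - tnth x v.2|).
have [v /(_ tt) Hv] := fin_bound (fun _ : unit => (t - s)^-1).
have big2 N q : (p <= N)%N -> 2 <= N%:R * y q.
 move=> pN; rewrite -ler_pdivrMr//; apply: le_trans (Hp q) _; by rewrite ler_nat.
have iE N q : (p <= N)%N -> (iN N q)%:R = (zd N q)%:~R :> R.
 move=> pN; have := big2 N q pN; have /andP[h _] := zdP N q => h2.
 have : 0 < (zd N q)%:~R :> R by lra.
 by rewrite ltr0z ffunE => h3; rewrite -[RHS]ger0_norm ?ler0z ?ltW// -intr_norm -abszE.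
have ipos N q : (p <= N)%N -> (0 < iN N q)%N.
 move=> pN; rewrite -(ltr0n R) iE//; have := big2 N q pN; have /andP[h _] := zdP N q; lra.
pose F N : R := g (N%:R^-1 *: row_of_index (iN N)) * L (iN N).
have cF : F @ \oo --> g (row_tuple (reflect_tuple s x)).
 rewrite -[X in _ --> X]mulr1; apply: cvgM.
  suff cR : (fun N => N%:R^-1 *: row_of_index (iN N) : 'rV[R]_k) @ \oo --> row_tuple (reflect_tuple s x).
   exact: (cvg_comp _ _ cR cg).
  apply/cvg_ballP => e e0.
  have [n1 /(_ tt) Hn1] := fin_bound (fun _ : unit => e^-1).
  exists (maxn p n1).+1 => //= N /=; rewrite gtn_max => /andP[pN nN].
  have NR' : 0 < N%:R :> R by rewrite ltr0n (leq_ltn_trans _ pN).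
  split=> // i j; rewrite ord1 !mxE tnth_mktuple -/(y j) /ball/=.
  rewrite iE ?(ltnW pN)//; have /andP[h1 h2] := zdP N j.
  have -> : y j - N%:R^-1 * (zd N j)%:~R = (N%:R * y j - (zd N j)%:~R) / N%:R.
   by field; rewrite gt_eqF.
  rewrite normrM [X in _ * X]gtr0_norm ?invr_gt0// ltr_pdivrMr//.
  apply: (@lt_le_trans _ _ 1); first by rewrite ltr_norml; apply/andP; split; lra.
  have := Hn1; rewrite -ler_pdivrMl// mulr1 => h; apply: le_trans h _.
  by rewrite ler_nat ltnW.
 have [_ HL] := adm.
 rewrite -(cvg_shiftn p).
 (* [L] is evaluated at [n y] + b(n) with 1 <= b(n) <= p Y + 2. The scale is n + p rather than n,
    because p y >= 2 forces the lag strictly above [n y]. *)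
 pose b n : {ffun 'I_k -> nat} := [ffun q => (iN (n + p) q - Num.truncn (n%:R * y q))%N].
 have tr n q : (Num.truncn (n%:R * y q))%:R + 1 <= (iN (n + p) q)%:R :> R /\
   (iN (n + p) q)%:R <= (Num.truncn (n%:R * y q) + (p * Y + 2))%:R :> R.
  have ny : 0 <= n%:R * y q by rewrite mulr_ge0// ltW.
  have /andP[t1 t2] := truncn_itv ny.
  have /andP[h1 h2] := zdP (n + p)%N q; rewrite iE ?leq_addl//.
  have h3 := big2 p q (leqnn p); rewrite natrD mulrDl in h1 h2.
  have h4 : p%:R * y q <= p%:R * Y%:R by rewrite ler_wpM2l.
  rewrite !natrD natrM; rewrite -natr1 in t2; split; lra.
 have leq n q : (Num.truncn (n%:R * y q) < iN (n + p) q)%N.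
  by rewrite -(ltr_nat R); have [h _] := tr n q; apply: lt_le_trans h; rewrite ltrDl.
 have := HL (row_tuple (reflect_tuple s x)) b oy.
 have -> : (fun n => L [ffun q => (Num.truncn (n%:R * row_tuple (reflect_tuple s x) ord0 q) + b n q)%N]) =
   (fun n => L (iN (n + p)%N)).
  apply/funext => n; congr L; apply/ffunP => q; rewrite [LHS]ffunE [b n q]ffunE.
  by rewrite /row_tuple mxE tnth_mktuple -/(y q) subnKC// ltnW.
 apply; first by move=> n q; rewrite ffunE subn_gt0.
 exists (p * Y + 2)%N => n q; rewrite ffunE leq_subLR -(ler_nat R).
 by have [_] := tr n q.
have cF2 : (fun r => F (NN r) - f0 (reflect_tuple s x)) @ \oo --> (0 : R).
 rewrite -(subrr (f0 (reflect_tuple s x))); apply: cvgB; last exact: cvg_cst.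
 rewrite -gy; apply: (cvg_comp NN F _ cF).
 move=> A [n _ An]; exists n => //= r nr; apply: An => /=.
 by apply: leq_trans nr _; apply: ltnW.
apply: cvg_trans cF2; apply: near_eq_cvg.
exists (maxn p (maxn w (maxn v Y))).+1 => //= r /=.
rewrite !gtn_max => /and4P[/ltnW pr /ltnW wr /ltnW vr /ltnW Yr].
have prN : (p <= NN r)%N by apply: leq_trans pr (ltnW (HN r)).
have rN (n : nat) : (n <= r)%N -> n%:R <= (NN r)%:R :> R.
 by move=> h; rewrite ler_nat (leq_trans h)// ltnW.
rewrite /dn /dn1 /dn2 !indicE mem_set ?mem_set/=; last 2 first.
- by rewrite in_itv/= s0 ltW.
- rewrite in_itv/= s0/= ler_pdivlMr// mulrC.
 have /andP[_ t2] := truncn_itv (Nt0 (NN r)); rewrite -natr1 in t2.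
 suff : 1 <= (NN r)%:R * (t - s) by rewrite mulrBr; lra.
 rewrite -ler_pdivrMr ?subr_gt0// mul1r; apply: le_trans Hv _; exact: rN.
rewrite !mul1r; congr (_ - _); rewrite /Gc /cell_coef ifT; last first.
 apply/andP; split.
  apply/forallP => q; rewrite !ffunE -/(zd (NN r) q).
  have := ipos (NN r) q prN; have /andP[_ h] := zdP (NN r) q.
  have e := iE (NN r) q prN.
  have : (iN (NN r) q <= MM r)%N.
   apply: leq_trans (HM r); rewrite -ltnS -(ltr_nat R) e; apply: lt_le_trans h _.
   rewrite -natr1 natrM lerD2r ler_wpM2l//; apply: le_trans (HY q) _; by rewrite ler_nat.
  have : 0 < (zd (NN r) q)%:~R :> R by rewrite -e ltr0n ipos.
  by rewrite ltr0z ffunE; clear; lia.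
 apply/injectiveP => q q'; rewrite !ffunE => e; apply: contrapT => qq'.
 have xx : tnth x q != tnth x q'.
  by apply/eqP => /(tuple_uniqP _ ux); exact: qq'.
 have d0 : 0 < `|tnth x q - tnth x q'| by rewrite normr_gt0 subr_eq0.
 have := Hw (q, q'); rewrite ler_pdivrMr//= => h.
 have {}h : 2 <= `|(NN r)%:R * tnth x q - (NN r)%:R * tnth x q'|.
  rewrite -mulrBr normrM ger0_norm//; apply: le_trans h _; rewrite ler_wpM2r//; exact: rN.
 have {}e : zceil (NN r) (tnth x q) = zceil (NN r) (tnth x q') by move: e; clear; lia.
 have := ceil_itv ((NN r)%:R * tnth x q); have := ceil_itv ((NN r)%:R * tnth x q').
 rewrite -/(zceil (NN r) _) -/(zceil (NN r) _) e !intrB => /andP[? ?] /andP[? ?].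
 move: h; apply/negP; rewrite -ltNge ltr_norml; apply/andP; split; lra.
rewrite /a /F mulrA; have [[_ _ hom _] _ _] := gB.
have oi : orthant (row_of_index (iN (NN r)) : 'rV[R]_k) by move=> q; rewrite mxE ltr0n ipos.
have -> : [ffun q => `|[ffun q0 => (zceil (NN r) s - zceil_tuple (NN r) x q0)%R] q|%N] = iN (NN r).
 by apply/ffunP => q; rewrite !ffunE.
by rewrite hom ?invr_gt0// -powR_inv1 ?ler0n// -powRrM mulN1r.
Qed.

Let measurable_dnl N M x : mfunT (fun s => dn N M s x).
Proof. by have := measurableT_comp (measurable_dn N M) (measurable_pair2 x). Qed.

Let measurable_dn2l x : mfunT (fun s => dn2 s x).
Proof. by have := measurableT_comp measurable_dn2 (measurable_pair2 x). Qed.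

(** Where [pow_int] is finite and almost every reflected point is good, both kernels are integrals
    of the two parts of [dn], so their difference is at most the integral of |dn|. All other points
    go into the null set. *)
Let kernel_diff N M e : (0 < N)%N ->
 (\int[lam]_x ((\int[mu]_s `|dn N M s x|%:E) * (\int[mu]_s `|dn N M s x|%:E)) <= e%:E)%E ->
 sq_small lam (fun x => grid_kernel N M (tb N) (zceil_tuple N x) - time_kernel g t (row_tuple x)) e.
Proof.
move=> N0 He; have NR : 0 < N%:R :> R by rewrite ltr0n.
have [K HK] := pow_int_sq gam12 kg1 k0.
have pp x : (0 <= pow_int gam x * pow_int gam x)%E by apply: mule_ge0; exact: pow_int_ge0.
have ip : lam.-integrable setT (fun x => pow_int gam x * pow_int gam x)%E.
 apply/integrableP; split; first by apply: emeasurable_funM; exact: measurable_pow_int.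
 under eq_integral do rewrite gee0_abs//.
 exact: le_lt_trans HK (ltry _).
have [W [mW W0 HW]] : \forall x \ae lam, (pow_int gam x < +oo)%E /\
  (\int[mu]_s (\1_U (reflect_tuple s x) : R)%:E = 0)%E.
 apply: ae_imp2 (integrable_ae measurableT ip) (ae_reflect mU U0) => x fx ux; split=> //.
 move: (fx I) (pow_int_ge0 gam x); case: (pow_int gam x) => [r||]//.
 by rewrite ltry.
have mDE : mfunT (fun z : R * k.-tuple R => `|dn N M z.1 z.2|%:E).
 by apply/measurable_EFinP; apply: measurableT_comp => //; exact: measurable_dn.
exists (fun x => (\int[mu]_s `|dn N M s x|%:E) * (\int[mu]_s `|dn N M s x|%:E))%E, W; split=> //.
- have mG : mfunT (fun x => \int[mu]_s `|dn N M s x|%:E)%E.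
  by apply: (@measurable_fun_fubini_tonelli_G _ _ _ _ R mu _ mDE) => z /=; rewrite lee_fin.
 exact: emeasurable_funM.
- by move=> x; apply: mule_ge0; apply: integral_ge0 => s _; rewrite lee_fin.
move=> x nW; have {nW} [pf ux] : (pow_int gam x < +oo)%E /\ (\int[mu]_s (\1_U (reflect_tuple s x) : R)%:E = 0)%E.
 by apply: contrapT => h; apply: nW; apply: HW.
have mS : mfunT (fun s : R => reflect_tuple s x).
 exact: (measurableT_comp (@measurable_reflect_tuple R k) (measurable_pair2 x)).
(* The point s = 0 joins the exceptional set because [dn2] lives on ]0, t] while [time_kernel]
   integrates over [0, t]. *)
pose S : set R := [set s | U (reflect_tuple s x)] `|` [set 0].
have mS1 : measurable [set s | U (reflect_tuple s x)].
 by rewrite -[X in measurable X]setTI; exact: mS.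
have S0 : mu S = 0%E.
 rewrite measureU0//; last exact: lebesgue_measure_set1.
 rewrite -[RHS]ux; have -> : (fun s => (\1_U (reflect_tuple s x) : R)%:E) =
   (fun s => (\1_[set s | U (reflect_tuple s x)] s : R)%:E) by [].
 by rewrite integral_indic ?setIT.
have mS' : measurable S by exact: measurableU.
have pint : mu.-integrable setT (fun s => (pow_prod gam s x)%:E).
 apply/integrableP; split; first by apply/measurable_EFinP; exact: measurable_pow_prodl.
 apply: le_lt_trans pf; apply: ge0_le_integral_any => s //.
 by rewrite gee0_abs// lee_fin pow_prod_ge0.
have i2 : mu.-integrable setT (fun s => (dn2 s x)%:E).
 apply: (@le_integrable _ _ _ mu setT measurableT _ (fun s => c%:E * (pow_prod gam s x)%:E)%E).
 - by apply/measurable_EFinP; exact: measurable_dn2l.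
 - move=> s _; rewrite -EFinM [leRHS]gee0_abs; first exact: dn2_bound.
  by rewrite lee_fin; apply: mulr_ge0; [exact: ltW|exact: pow_prod_ge0].
 - exact: integrableZl.
have [i1 e1] := @integral_zceil N (tb N) (fun z => N%:R `^ (- alpha) * cell_coef a M [ffun q => z - zceil_tuple N x q]) N0.
have gE : (grid_kernel N M (tb N) (zceil_tuple N x))%:E = (\int[mu]_s (dn1 N M s x)%:E)%E.
 under eq_integral do rewrite (dn1E M x _ N0).
 rewrite e1 /grid_kernel -mulr_sumr mulrA; congr (_ * _)%:E.
 rewrite -powR_inv1 ?ler0n// -powRD; last by rewrite (gt_eqF NR) implybT.
 by [].
have tE : time_kernel g t (row_tuple x) = fine (\int[mu]_s (dn2 s x)%:E)%E.
 rewrite /time_kernel /Rintegral; congr fine; rewrite integral_mkcond.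
 refine (@ae_integral_any _ _ _ mu _ (fun s => (dn2 s x)%:E) S mS' S0 _ _).
  by apply/measurable_EFinP; exact: measurable_dn2l.
 move=> s /not_orP[nU s0]; rewrite patchE /dn2 indicE.
 have [sI|sI] := boolP (s \in (`[0, t]%classic : set R)); last first.
  rewrite memNset ?mul0r//= => h; case/negP: sI; apply/mem_set => /=; move: h.
  by rewrite !in_itv/= => /andP[/ltW -> ->].
 move/set_mem: (sI); rewrite /= in_itv/= => /andP[s1 s2].
 have sp : 0 < s by rewrite lt_neqAle s1 andbT; apply/eqP => h; apply: s0.
 rewrite mem_set/=; last by rewrite in_itv/= sp.
 rewrite mul1r; case: ifPn => [/forallP h|].
  have oy : orthant (row_tuple (reflect_tuple s x)).
   by move=> q; rewrite /row_tuple mxE tnth_mktuple subr_gt0; have := h q; rewrite mxE.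
  have [<- _] := HU nU oy; congr (g _)%:E; apply/rowP => q; rewrite !mxE tnth_mktuple//.
 rewrite negb_forall => /existsP[q]; rewrite mxE -leNgt => qs; congr EFin; apply/esym.
 apply/eqP; rewrite -normr_le0; apply: le_trans (f0c _) _.
 by rewrite (bigD1 q)//= tnth_mktuple /powp subr_gt0 ltNge qs mul0r mulr0.
have f2 : (\int[mu]_s (dn2 s x)%:E)%E \is a fin_num by exact: integrable_fin_num.
have i1' : mu.-integrable setT (fun s => (dn1 N M s x)%:E).
 by apply: eq_integrable i1 => // s _; rewrite (dn1E M x _ N0).
have key : (`|grid_kernel N M (tb N) (zceil_tuple N x) - time_kernel g t (row_tuple x)|%:E <=
  \int[mu]_s `|dn N M s x|%:E)%E.
 rewrite -[leLHS]/(`|(grid_kernel N M (tb N) (zceil_tuple N x) - time_kernel g t (row_tuple x))%:E|)%E.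
 rewrite EFinB gE tE fineK// -integralB//.
 by apply: le_trans (le_abse_integral _ _ _) _ => //; apply/measurable_EFinP; exact: measurable_dnl.
rewrite -real_normK ?num_real// expr2 EFinM; apply: lee_pmul => //; exact: lee_fin.
Qed.

(** By contradiction: a failure beyond every threshold r yields a sequence of pairs (N, M) with r <
    N and N r <= M, and dominated convergence along this sequence refutes it. *)
Lemma grid_kernel_cvg_aux (e : R) : 0 < e -> exists n1, forall N M, (n1 <= N)%N -> (N * n1 <= M)%N ->
 sq_small lam (fun x => grid_kernel N M (tb N) (zceil_tuple N x) - time_kernel g t (row_tuple x)) e.
Proof.
move=> e0; apply: contrapT => /forallNP H.
have {}H r : exists NM : nat * nat, [/\ (r < NM.1)%N, (NM.1 * r <= NM.2)%N &
  ~ sq_small lam (fun x => grid_kernel NM.1 NM.2 (tb NM.1) (zceil_tuple NM.1 x) - time_kernel g t (row_tuple x)) e].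
 apply: contrapT => /forallNP K; apply: (H r.+1) => N M rN NM.
 apply: contrapT => h; apply: (K (N, M)); split=> //=.
 by apply: leq_trans NM; rewrite leq_mul2l leqnSn orbT.
have [F HF] := choice H.
pose NN r := (F r).1; pose MM r := (F r).2.
have HN r : (r < NN r)%N by have [] := HF r.
have HM r : (NN r * r <= MM r)%N by have [] := HF r.
have [C HC] := dn_bound.
have := @kernel_dct R k gam gam12 kg1 k0 (fun r => dn (NN r) (MM r)) C t U _ _ mU U0 _.
move=> /(_ (fun r => measurable_dn _ _) (fun r s x => HC _ _ s x (leq_ltn_trans (leq0n r) (HN r)))).
move=> /(_ (fun s x => @dn_cvg NN MM s x HN HM)) cv.
have : \forall r \near \oo, (\int[lam]_x ((\int[mu]_s `|dn (NN r) (MM r) s x|%:E) *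
  (\int[mu]_s `|dn (NN r) (MM r) s x|%:E)) < e%:E)%E.
 apply: (cv (fun y : \bar R => (y < e%:E)%E)); apply: open_nbhs_nbhs.
 by split; [exact: open_ereal_lt_ereal|rewrite /= lte_fin].
move=> [r _ /(_ r (leqnn r)) /= h].
have [_ _] := HF r; apply; apply: kernel_diff (ltW h).
exact: leq_ltn_trans (HN r).
Qed.
End with_version.

Theorem grid_kernel_cvg (t e : R) : 0 <= t <= 1 -> 0 < e ->
 exists n1, forall N M, (n1 <= N)%N -> (N * n1 <= M)%N ->
 sq_small lam (fun x => grid_kernel N M (Num.truncn (N%:R * t)) (zceil_tuple N x) -
   time_kernel g t (row_tuple x)) e.
Proof.
move=> t01 e0; have [f0 [c [U [mf0 c0 f0c [mU U0] HU]]]] := borel_version.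
exact: (grid_kernel_cvg_aux mf0 c0 f0c mU U0 HU t01 e0).
Qed.
End kernel.

(** Brownian motion provides independence along increasing sequences of times indexed by naturals;
    any finite set of integers is reached after a shift c. *)
Lemma indep_int {d} {T : measurableType d} {R : realType} (P : probability T R) (X : int -> T -> R) :
 (forall c : nat, mutually_independent P (fun n : nat => X (n%:Z + 1 - c%:Z))) ->
 mutually_independent P X.
Proof.
move=> H J A mA.
pose c := (\max_(z <- J) `|z|).+1%N.
have zc z : z \in J -> (0 <= z - 1 + c%:Z)%R.
 move=> zJ; have : (`|z|%N <= \max_(z <- J) `|z|)%N by exact: (leq_bigmax_seq z).
 by rewrite /c => ?; lia.
pose ix (z : int) : nat := `|(z - 1 + c%:Z)%R|%N.
have ixK z : z \in J -> (ix z)%:Z + 1 - c%:Z = z.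
 by move=> /zc h; rewrite /ix; lia.
pose J' := [fset ix z | z in J]%fset.
have HH := H c J' (fun n => A (n%:Z + 1 - c%:Z)) (fun n => mA _).
transitivity (P [set w | forall i, i \in J' -> A (i%:Z + 1 - c%:Z) (X (i%:Z + 1 - c%:Z) w)]).
 congr (P _); apply/seteqP; split=> w /= h i iJ.
  by move/imfsetP: iJ => [z /= zJ ->]; rewrite ixK//; exact: h.
 by have := h (ix i); rewrite ixK//; apply; apply/imfsetP; exists i.
rewrite HH /J' big_imfset/=; last first.
 by move=> y z yJ zJ e; rewrite -(ixK y yJ) -(ixK z zJ) e.
by rewrite big_seq [RHS]big_seq; apply: eq_bigr => z zJ; rewrite ixK.
Qed.

(** * Brownian increments as standard noise *)

Section brownian_noise.
Context {d} {T : measurableType d} {R : realType} (P : probability T R).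
Variable B : R -> {RV P >-> R}.
Hypothesis HB : is_brownian P (fun t => B t).

Definition bm_noise (N : nat) (z : int) (w : T) : R :=
 Num.sqrt N%:R * (B (z%:~R / N%:R) w - B ((z - 1)%:~R / N%:R) w).

Lemma measurable_bm_noise N z : mfunT (bm_noise N z).
Proof. by apply: measurable_funM => //; apply: measurable_funB. Qed.

HB.instance Definition _ N z := @isMeasurableFun.Build _ _ _ _ (bm_noise N z) (measurable_bm_noise N z).

Definition bm_rv N (z : int) : {RV P >-> R} := bm_noise N z.

Variable N : nat.
Hypothesis N0 : (0 < N)%N.
Let sN : 0 < Num.sqrt N%:R :> R. Proof. by rewrite sqrtr_gt0 ltr0n. Qed.

Lemma bm_indep : mutually_independent P (fun z : int => bm_rv N z : T -> R).
Proof.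
have [_ _ _ Hi] := HB.
apply: indep_int => c.
pose t n : R := (n%:Z - c%:Z)%:~R / N%:R.
have tn n : t n < t n.+1.
 by rewrite /t ltr_pM2r ?invr_gt0 ?ltr0n// ltr_int; lia.
have := Hi t tn; set Y := fun n w => _ => HY.
have E n w : bm_rv N (n%:Z + 1 - c%:Z) w = Num.sqrt N%:R * Y n w.
 rewrite /bm_rv /bm_noise /Y /t; congr (_ * (B (_ / _) w - B (_ / _) w)); congr (_%:~R); lia.
move=> J A mA.
have mA' n : measurable ((fun y => Num.sqrt N%:R * y) @^-1` A n : set R).
 by rewrite -[X in measurable X]setTI; apply: (@measurable_funM _ _ _ setT (cst (Num.sqrt N%:R)) id).
have -> : [set w | forall i, i \in J -> A i (bm_rv N (i%:Z + 1 - c%:Z) w)] =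
  [set w | forall i, i \in J -> ((fun y => Num.sqrt N%:R * y) @^-1` A i) (Y i w)].
 by apply/seteqP; split=> w /= h i iJ; have := h i iJ; rewrite E.
rewrite (HY J _ mA'); apply: eq_bigr => i _; congr (P _).
by apply/seteqP; split=> w /=; rewrite E.
Qed.

Lemma bm_law z A : measurable A -> P [set w | A (bm_rv N z w)] =
 normal_prob 0 (Num.sqrt (N%:R^-1)) [set y : R | A (y / Num.sqrt (N%:R^-1))].
Proof.
have [_ _ Hl _] := HB => mA.
have lt : (z - 1)%:~R / N%:R < z%:~R / N%:R :> R.
 by rewrite ltr_pM2r ?invr_gt0 ?ltr0n// ltr_int; lia.
have mA' : measurable [set y : R | A (y / Num.sqrt (N%:R^-1))].
 by rewrite -[X in measurable X]setTI; apply: (@measurable_funM _ _ _ setT id (cst (Num.sqrt N%:R^-1)^-1)).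
have := Hl _ _ _ lt mA'.
have -> : z%:~R / N%:R - (z - 1)%:~R / N%:R = N%:R^-1 :> R.
 by rewrite -mulrBl -intrB opprB addrC subrK mul1r.
move=> <-; congr (P _); apply/seteqP; split=> w /=.
 by rewrite /bm_rv /bm_noise sqrtrV// invrK mulrC.
by rewrite /bm_rv /bm_noise sqrtrV// invrK mulrC.
Qed.

Let sg : R := Num.sqrt (N%:R^-1).
Let sg0 : 0 < sg. Proof. by rewrite sqrtr_gt0 invr_gt0 ltr0n. Qed.

Lemma bm_integral z (f : R -> \bar R) : mfunT f ->
 (\int[normal_prob 0 sg]_x `|f (x / sg)%R| < +oo)%E \/ (forall x, 0 <= f x)%E ->
 (\int[P]_w f (bm_rv N z w) = \int[normal_prob 0 sg]_x f (x / sg)%R)%E.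
Proof.
move=> mf fi.
have mg : mfunT (fun x : R => x / sg) by exact: measurable_funM.
have EA (h : R -> \bar R) : mfunT h -> (forall x, 0 <= h x)%E ->
  (\int[P]_w h (bm_rv N z w) = \int[normal_prob 0 sg]_x h (x / sg)%R)%E.
 move=> mh h0.
 have e1 := @ge0_integral_pushforward _ _ _ (measurableTypeR R) R _ (measurable_bm_noise N z) P setT h measurableT mh (fun x _ => h0 x).
 have e2 := @ge0_integral_pushforward _ _ (measurableTypeR R) (measurableTypeR R) R _ mg (normal_prob 0 sg : probability _ R) setT h measurableT mh (fun x _ => h0 x).
 rewrite !preimage_setT in e1 e2.
 refine (etrans (esym e1) (etrans _ e2)).
 apply: eq_measure_integral; try exact: measurable_bm_noise; try exact: mg.
 by move=> ? A mA _; exact: (bm_law z mA).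
case: fi => [fi|f0]; last exact: EA.
rewrite [LHS]integralE [RHS]integralE; congr (_ - _)%E.
- transitivity (\int[P]_w (f^\+)%E (bm_rv N z w))%E; first by apply: eq_integral => w _; rewrite !funeposE.
 rewrite (EA _ (measurable_funepos mf) (funepos_ge0 f)).
 by apply: eq_integral => x _; rewrite !funeposE.
- transitivity (\int[P]_w (f^\-)%E (bm_rv N z w))%E; first by apply: eq_integral => w _; rewrite !funenegE.
 rewrite (EA _ (measurable_funeneg mf) (funeneg_ge0 f)).
 by apply: eq_integral => x _; rewrite !funenegE.
Qed.

(** 129 = 1 + 128, from |y|^3 <= 1 + y^4 and the bound on the fourth moment. *)
Lemma bm_moments z : [/\ integ P (fun w => `|bm_rv N z w| ^+ 3), Ex P (bm_rv N z) = 0,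
 Ex P (fun w => bm_rv N z w ^+ 2) = 1 & Ex P (fun w => `|bm_rv N z w| ^+ 3) <= 129].
Proof.
have m3 : mfunT (fun y : R => `|y| ^+ 3) by apply: measurable_funX; exact: normr_measurable.
have E2 : (\int[P]_w (bm_rv N z w ^+ 2)%:E = 1)%E.
 have := bm_integral z (f := fun y : R => (y ^+ 2)%:E) _ _; rewrite normal_moment2//; apply.
  by apply/measurable_EFinP; exact: measurable_funX.
 by right=> x; rewrite lee_fin sqr_ge0.
have E4 : (\int[P]_w (bm_rv N z w ^+ 4)%:E <= 128%:E)%E.
 have q0 (y : R) : 0 <= y ^+ 4 by rewrite (_ : 4 = 2 * 2)%N// exprM sqr_ge0.
 have -> := bm_integral z (f := fun y : R => (y ^+ 4)%:E) _ _; first exact: normal_moment4.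
  by apply/measurable_EFinP; exact: measurable_funX.
 by right=> x; rewrite lee_fin.
have E3 : (\int[P]_w (`|bm_rv N z w| ^+ 3)%:E <= 129%:E)%E.
 apply: (@le_trans _ _ (\int[P]_w (1%:E + (bm_rv N z w ^+ 4)%:E))%E).
  apply: ge0_le_integral_any => w; rewrite -?EFinD lee_fin ?exprn_ge0//.
  have -> : bm_rv N z w ^+ 4 = `|bm_rv N z w| ^+ 4 by rewrite -[RHS]normrX ger0_norm// (_ : 4 = 2 * 2)%N// exprM sqr_ge0.
  have := normr_ge0 (bm_rv N z w); move: `|_| => y y0.
  have [y1|y1] := leP y 1.
   by apply: le_trans (exprn_ile1 _ _ y1) _ => //; rewrite lerDl exprn_ge0.
  apply: (@le_trans _ _ (y ^+ 4)); last by rewrite lerDr.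
  by apply: ler_weXn2l => //; exact: ltW.
 rewrite ge0_integralD//; last 2 first.
 - by move=> w _; rewrite lee_fin (_ : 4 = 2 * 2)%N// exprM sqr_ge0.
 - by apply/measurable_EFinP; apply: measurable_funX; exact: measurable_bm_noise.
 rewrite integral_cst//= probability_setT mule1.
 by apply: le_trans (leeD2l _ E4) _; rewrite -EFinD lee_fin; lra.
split.
- apply/integrableP; split.
  by apply/measurable_EFinP; apply: (measurableT_comp m3); exact: measurable_bm_noise.
 under eq_integral do rewrite gee0_abs ?lee_fin ?exprn_ge0//.
 exact: le_lt_trans E3 (ltry _).
- rewrite /Ex -/(EFin \o _) (bm_integral z (f := EFin)) ?normal_mean//.
 left; apply: (@le_lt_trans _ _ (\int[normal_prob 0 sg]_x (1%:E + ((x / sg) ^+ 2)%:E))%E).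
  apply: ge0_le_integral_any => x; rewrite -?EFinD ?lee_fin//.
  rewrite -(real_normK (num_real (x / sg))); move: `|_| (normr_ge0 (x / sg)) => y y0; nra.
 rewrite ge0_integralD//; last 2 first.
 - by move=> x _; rewrite lee_fin sqr_ge0.
 - by apply/measurable_EFinP; apply: measurable_funX; exact: measurable_funM.
 rewrite normal_moment2// integral_cst//= mul1e; apply: lte_add_pinfty; last exact: ltry.
 by apply: le_lt_trans (ltry 1); exact: probability_le1.
- by rewrite /Ex E2.
- rewrite -lee_fin /Ex fineK//; apply/fin_numPlt; rewrite (le_lt_trans E3 (ltry _)) andbT.
 by apply: lt_le_trans (ltNyr 0) _; apply: integral_ge0 => w _; rewrite lee_fin exprn_ge0.
Qed.

Lemma bm_std_noise (f : nat -> int) : injective f -> std_noise (fun j => bm_rv N (f j)) 129.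
Proof.
move=> fi; split; last by move=> i; exact: bm_moments.
exact: (indep_inj fi bm_indep).
Qed.

Lemma bm_e2 z : (e2 P (bm_rv N z) <= 1%:E)%E.
Proof.
rewrite /e2; have := bm_integral z (f := fun y : R => (y ^+ 2)%:E) _ _; rewrite normal_moment2// => ->//.
 by apply/measurable_EFinP; exact: measurable_funX.
by right=> x; rewrite lee_fin sqr_ge0.
Qed.
End brownian_noise.

(** * Chaos sums as polynomials in the noise of cells *)

Section chaos_form.
Context {d} {T : measurableType d} {R : realType} (P : probability T R).
Variable eps : int -> {RV P >-> R}.
Context {k : nat} (g : 'rV[R]_k -> R) (L : {ffun 'I_k -> nat} -> R) (alpha : R).
Hypothesis k0 : (0 < k)%N.
Let a (i : {ffun 'I_k -> nat}) := g (row_of_index i) * L i.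
Local Notation H := (alpha + k%:R / 2 + 1).

(** A finite array of cells from 1 - c to K - c. With memory M <= c and times 1, ..., b it contains
    all the noise involved as soon as b + c <= K + 1. *)
Definition cell_index (K c : nat) (l : {ffun 'I_k -> 'I_K}) : {ffun 'I_k -> int} :=
 [ffun q => (l q)%:Z + 1 - c%:Z].

Definition chaos_sum (e : int -> R) (M b : nat) : R := \sum_(n < b)
 \sum_(i : {ffun 'I_k -> 'I_M.+1} | offb [set: 'I_k]%SET i)
  a (tonat i) * \prod_q e (n.+1%:Z - (tonat i q)%:Z).

Lemma chaos_sum_term (e : int -> R) M n c K : (0 < K)%N -> (M <= c)%N -> (n + c <= K)%N ->
 \sum_(i : {ffun 'I_k -> 'I_M.+1} | offb [set: 'I_k]%SET i)
  a (tonat i) * \prod_q e (n.+1%:Z - (tonat i q)%:Z) =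
 \sum_(l : {ffun 'I_k -> 'I_K} | injectiveb l)
  cell_coef a M [ffun q => n.+1%:Z - cell_index c l q] * \prod_q e (cell_index c l q).
Proof.
move=> K0 Mc nK.
pose h (l : {ffun 'I_k -> 'I_K}) : {ffun 'I_k -> 'I_M.+1} := [ffun q => inord (n + c - l q)].
pose h' (i : {ffun 'I_k -> 'I_M.+1}) : {ffun 'I_k -> 'I_K} :=
 [ffun q => insubd (Ordinal K0) (n + c - i q)%N].
have pos (i : {ffun 'I_k -> 'I_M.+1}) q : offb [set: 'I_k]%SET i -> (0 < i q)%N.
 by move/offb_pos => /(_ q); rewrite finset.in_setT => <-.
have vh' (i : {ffun 'I_k -> 'I_M.+1}) q : offb [set: 'I_k]%SET i -> (h' i q : nat) = (n + c - i q)%N.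
 move=> /(pos _ q) i0; rewrite ffunE val_insubd ifT//.
 by have := ltn_ord (i q); move: i0 Mc nK; clear; lia.
have ar (v : nat) : (v <= M)%N -> (n + c - (n + c - v))%N = v by move: Mc; clear; lia.
rewrite (reindex_onto h h'); last first.
 move=> i oi; apply/ffunP => q; apply: val_inj; rewrite ffunE /= inordK (vh' _ _ oi).
  by rewrite ar// -ltnS; exact: ltn_ord.
 by rewrite ar; [exact: ltn_ord|rewrite -ltnS; exact: ltn_ord].
rewrite big_mkcond [RHS]big_mkcond; apply: eq_bigr => l _.
pose ok := [forall q, (1 <= n.+1%:Z - cell_index c l q) && (n.+1%:Z - cell_index c l q <= M%:Z)].
have [okl|nok] := boolP ok; last first.
 rewrite /cell_coef (eq_forallb (P2 := fun q => (1 <= n.+1%:Z - cell_index c l q) &&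
   (n.+1%:Z - cell_index c l q <= M%:Z))) => [|q]; last by rewrite ffunE.
 rewrite -/ok (negbTE nok)/= mul0r if_same ifF//; apply/negP => /andP[oi /eqP hl].
 case/negP: nok; apply/forallP => q.
 have := pos _ q oi; have := vh' _ q oi; rewrite hl !ffunE => e1.
 have := ltn_ord (h l q); rewrite ffunE; move: (inord _ : 'I_M.+1) e1 => j.
 by have := ltn_ord (l q); move: nK Mc; clear; lia.
have rng q : (1 <= n + c - l q)%N /\ (n + c - l q <= M)%N.
 have /forallP/(_ q)/andP[] := okl; rewrite /cell_index !ffunE.
 have := ltn_ord (l q); move: (nat_of_ord (l q)) Mc => v; clear.
 by move=> *; split; lia.
have hq q : (h l q : nat) = (n + c - l q)%N.
 by rewrite ffunE inordK// ltnS; have [_] := rng q.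
have hK : injectiveb l -> offb [set: 'I_k]%SET (h l).
 move=> /injectiveP il; apply/andP; split.
  by apply/forallP => q; rewrite finset.in_setT hq; have [->] := rng q.
 apply/forall_inP => q _; apply/forall_inP => q' _; apply/implyP => /eqP e1.
 apply/eqP/il/val_inj; have := hq q; rewrite e1 hq.
 have [] := rng q; have [] := rng q'; rewrite /=; clear; lia.
have h'K : offb [set: 'I_k]%SET (h l) -> h' (h l) = l.
 move=> oi; apply/ffunP => q; apply: val_inj; rewrite /= vh'// hq.
 by have [] := rng q; rewrite /=; clear; lia.
have e1 : (offb [set: 'I_k]%SET (h l) && (h' (h l) == l)) = injectiveb l.
 apply/idP/idP => [/andP[oi _]|il]; last by rewrite (hK il) (h'K (hK il)) eqxx.
 apply/injectiveP => q q' e2; apply: (offb_inj oi); rewrite ?finset.in_setT//.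
 by apply: val_inj; rewrite /= !hq e2.
rewrite e1; case: ifP => // il; congr (_ * _).
 rewrite /cell_coef ifT; last first.
  apply/andP; split; first by apply/forallP => q; have := forallP okl q; rewrite [X in _ -> (1 <= X) && _]ffunE [X in _ -> _ && (X <= _)]ffunE.
  apply/injectiveP => q q'; rewrite !ffunE => e2; apply: (injectiveP _ il); apply: val_inj.
  by move: e2; rewrite /=; clear; lia.
 congr a; apply/ffunP => q; rewrite [LHS]ffunE hq [RHS]ffunE.
 suff -> : [ffun q0 => (n.+1%:Z - cell_index c l q0)%R] q = (n + c - l q)%N%:Z by [].
 rewrite ffunE /cell_index ffunE; have [] := rng q; move: (nat_of_ord (l q)) => v; clear; lia.
apply: eq_bigr => q _; congr (e _); rewrite /tonat [X in _ - X%:Z = _]ffunE hq /cell_index ffunE.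
by have [] := rng q; move: (nat_of_ord (l q)) => v; clear; lia.
Qed.

(** Exchanging the sums collects, for each placement on distinct cells, the coefficients of all
    times. From - H = - k / 2 + (- 1 - alpha), the second part normalises the kernel and N^(- k / 2)
    is the noise of k cells. *)
Lemma chaos_sumE (e : int -> R) N M b c K : (0 < N)%N -> (0 < K)%N -> (M <= c)%N -> (b + c <= K.+1)%N ->
 N%:R `^ (- H) * chaos_sum e M b =
 \sum_(l : {ffun 'I_k -> 'I_K} | injectiveb l)
  N%:R `^ (- (k%:R / 2)) * grid_kernel g L alpha N M b (cell_index c l) * \prod_q e (cell_index c l q).
Proof.
move=> N0 K0 Mc bK; rewrite /chaos_sum.
under eq_bigr => n _.
 rewrite (@chaos_sum_term _ _ _ c K)//; last by have := ltn_ord n; move: bK; clear; lia.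
 over.
rewrite exchange_big/= mulr_sumr; apply: eq_bigr => l _.
rewrite -mulr_suml mulrA; congr (_ * _); rewrite /grid_kernel mulrA -powRD; last first.
 by rewrite pnatr_eq0 (gtn_eqF N0) implybT.
by rewrite (_ : - (k%:R / 2) + (- 1 - alpha) = - H)//; ring.
Qed.
End chaos_form.

Section cell_sums.
Context {R : realType} (k : nat).
Local Notation mu := (@lebesgue_measure R).
Local Notation lam := (@lebesgue_tuple R k).

Lemma measure_zceil N z : (0 < N)%N -> mu [set s : R | zceil N s = z] = (N%:R^-1)%:E.
Proof.
move=> N0; have NR : 0 < N%:R :> R by rewrite ltr0n.
rewrite (_ : [set s | _] = `](z - 1)%:~R / N%:R, z%:~R / N%:R]%classic); last first.
 apply/seteqP; split=> s /=; rewrite in_itv/= ltr_pdivrMr// ler_pdivlMr// [s * _]mulrC.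
  by move/eqP; rewrite zceilP.
 by move=> h; apply/eqP; rewrite zceilP.
rewrite lebesgue_measure_itv/= lte_fin ltr_pM2r ?invr_gt0// ltr_int ifT; last by clear; lia.
by rewrite -EFinB -mulrBl -intrB opprB addrC subrK mul1r.
Qed.

(** A cell has volume N^(- k), so each square is the integral over its cell of a function below F,
    and the cells are disjoint. *)
Lemma cell_sum_le N K c (V : {ffun 'I_k -> 'I_K} -> R) (F : k.-tuple R -> R) : (0 < N)%N ->
 (forall x, 0 <= F x) ->
 (forall l x, zceil_tuple N x = cell_index c l -> N%:R ^+ k * V l ^+ 2 <= F x) ->
 ((\sum_l V l ^+ 2)%:E <= \int[lam]_x (F x)%:E)%E.
Proof.
move=> N0 F0 HF; have NR : 0 < N%:R :> R by rewrite ltr0n.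
pose ind (l : {ffun 'I_k -> 'I_K}) (q : nat) (y : R) : R :=
 \1_[set s : R | zceil N s = nth 0 [seq cell_index c l q' | q' <- enum 'I_k] q] y.
have mind l q : mfunT (ind l q) by apply: measurable_indic; exact: measurable_zceil.
have nthE l (q : 'I_k) : nth 0 [seq cell_index c l q' | q' <- enum 'I_k] q = cell_index c l q.
 by rewrite (nth_map q) ?size_enum_ord// nth_ord_enum.
have I1 l : (\int[lam]_x (\prod_(q < k) ind l q (tnth x q))%:E = (N%:R ^- k)%:E)%E.
 rewrite (lam_prod k (f := ind l))//.
 transitivity (\prod_(q < k) (N%:R^-1)%:E : \bar R)%E.
  apply: eq_bigr => q _; rewrite integral_indic ?setIT//; last exact: measurable_zceil.
  exact: measure_zceil.
 suff -> : (N%:R ^- k)%:E = (\prod_(q < k) N%:R^-1 : R)%:E.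
  by elim/big_ind2: _ => // x1 x2 y1 y2 -> ->.
 by rewrite prodr_const card_ord exprVn.
have -> : ((\sum_l V l ^+ 2)%:E = \int[lam]_x (\sum_l (N%:R ^+ k * V l ^+ 2)%:E * (\prod_(q < k) ind l q (tnth x q))%:E))%E.
 rewrite ge0_integral_sum//; last 2 first.
 - move=> l; apply: emeasurable_funM => //; apply/measurable_EFinP; exact: (measurable_tnth_prod (f := ind l)).
 - by move=> l x _; apply: mule_ge0; rewrite lee_fin ?prodr_ge0// mulr_ge0 ?sqr_ge0 ?exprn_ge0.
 rewrite -sumEFin; apply: eq_bigr => l _; rewrite ge0_integralZl_EFin//; last 3 first.
 - by move=> x _; rewrite lee_fin prodr_ge0.
 - by apply/measurable_EFinP; exact: (measurable_tnth_prod (f := ind l)).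
 - by rewrite mulr_ge0 ?sqr_ge0 ?exprn_ge0.
 rewrite I1 -EFinM; congr EFin; rewrite mulrAC mulfV ?mul1r//.
 by rewrite expf_neq0// gt_eqF.
have indE l (x : k.-tuple R) : \prod_(q < k) ind l q (tnth x q) = (zceil_tuple N x == cell_index c l)%:R.
 have [e1|ne] := eqVneq.
  rewrite big1// => q _; rewrite /ind indicE mem_set//= nthE -e1 ffunE//.
 have [q hq] : exists q, zceil_tuple N x q != cell_index c l q.
  apply/existsP; rewrite -negb_forall; apply: contra ne => /forallP h.
  by apply/eqP/ffunP => q; exact/eqP/h.
 rewrite (bigD1 q)//= /ind indicE memNset ?mul0r//= nthE => h.
 by move: hq; rewrite ffunE h eqxx.
apply: ge0_le_integral_any => x.
 by apply: sume_ge0 => l _; apply: mule_ge0; rewrite lee_fin ?indE// mulr_ge0 ?sqr_ge0 ?exprn_ge0.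
under eq_bigr do rewrite indE -EFinM; rewrite sumEFin lee_fin.
have [/existsP[l0 /eqP h0]|/existsPn none] := boolP [exists l : {ffun 'I_k -> 'I_K}, zceil_tuple N x == cell_index c l]; last first.
 by rewrite big1// => l _; rewrite (negbTE (none l)) mulr0.
rewrite (bigD1 l0)//= h0 eqxx mulr1 big1 ?addr0; first exact: HF.
move=> l ll; case: eqP => [e1|_]; rewrite ?mulr0//; exfalso.
case/eqP: ll; apply/ffunP => q; apply: val_inj; have := congr1 (fun f : {ffun 'I_k -> int} => f q) e1.
by rewrite /cell_index !ffunE /=; clear; lia.
Qed.
End cell_sums.

Definition polyform {R : realType} {k n} (W : {ffun 'I_k -> 'I_n} -> R) (u : {ffun 'I_n -> R}) : R :=
 \sum_(l : {ffun 'I_k -> 'I_n} | injectiveb l) W l * \prod_q u (l q).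

Section refine.
Context {R : realType} {k : nat}.
Variables (K m : nat).
Hypothesis m0 : (0 < m)%N.

Lemma blk_subproof (j : 'I_(K * m)) : (j %/ m < K)%N.
Proof. by rewrite ltn_divLR. Qed.
Definition blk (l : {ffun 'I_k -> 'I_(K * m)}) : {ffun 'I_k -> 'I_K} := [ffun q => Ordinal (blk_subproof (l q))].

(** The block sums are expanded over their entries. Since W vanishes on repeated blocks, two entries
    of one block never occur together, and the result is off-diagonal in the entries. *)
Lemma polyform_bsum (W : {ffun 'I_k -> 'I_K} -> R) (x : nat -> R) :
 (forall l : {ffun 'I_k -> 'I_K}, ~~ injectiveb l -> W l = 0) ->
 polyform W (bsum m x) = multiform (fun l => Num.sqrt m%:R ^- k * W (blk l)) x.
Proof.
move=> W0; rewrite /polyform /multiform.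
transitivity (\sum_(v : {ffun 'I_k -> 'I_K} * {ffun 'I_k -> 'I_m})
  Num.sqrt m%:R ^- k * W v.1 * \prod_q x (v.1 q * m + v.2 q)%N).
 rewrite -(pair_bigA _ (fun (L : {ffun 'I_k -> 'I_K}) (r : {ffun 'I_k -> 'I_m}) => Num.sqrt m%:R ^- k * W L * \prod_q x (L q * m + r q)%N))/=.
 rewrite big_mkcond; apply: eq_bigr => L _; rewrite -mulr_sumr.
 case: ifPn => [_|/W0 ->]; last by rewrite mulr0 mul0r.
 rewrite [_ ^- k * _]mulrC -mulrA; congr (_ * _).
 under eq_bigr do rewrite ffunE.
 rewrite big_split/= prodr_const card_ord exprVn; congr (_ * _).
 by rewrite bigA_distr_bigA.
have lt (Z : 'I_K) (r : 'I_m) : (Z * m + r < K * m)%N.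
 apply: (@leq_trans (Z * m + m)); first by rewrite ltn_add2l.
 by rewrite -mulSnr leq_mul2r ltn_ord orbT.
pose pk (v : {ffun 'I_k -> 'I_K} * {ffun 'I_k -> 'I_m}) : {ffun 'I_k -> 'I_(K * m)} :=
 [ffun q => Ordinal (lt (v.1 q) (v.2 q))].
pose up (l : {ffun 'I_k -> 'I_(K * m)}) : {ffun 'I_k -> 'I_K} * {ffun 'I_k -> 'I_m} :=
 (blk l, [ffun q => Ordinal (ltn_pmod (l q) m0)]).
have pkK : cancel up pk.
 by move=> l; apply/ffunP => q; apply: val_inj; rewrite !ffunE/= -divn_eq.
have upK : cancel pk up.
 move=> [L r]; congr pair; apply/ffunP => q; apply: val_inj; rewrite !ffunE/=.
  by rewrite divnMDl// divn_small ?addn0.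
 by rewrite modnMDl modn_small.
rewrite (reindex up)/=; last by exists pk => v _; [exact: pkK|exact: upK].
rewrite [RHS]big_mkcond; apply: eq_bigr => l _; case: ifPn => [_|ni].
 by congr (_ * _); apply: eq_bigr => q _; rewrite !ffunE/= -divn_eq.
rewrite W0 ?mulr0 ?mul0r//; apply: contra ni => /injectiveP il; apply/injectiveP => q q' e.
by apply: il; rewrite !ffunE; apply: val_inj; rewrite /= e.
Qed.
End refine.

(** * Approximation by a polynomial in coarse noise, uniformly in time *)

Section core.
Context {R : realType} {k : nat} (g : 'rV[R]_k -> R) (L : {ffun 'I_k -> nat} -> R) (alpha : R).
Hypotheses (k0 : (0 < k)%N) (gB : is_GHKB alpha g) (adm : admissible L).
Let a (i : {ffun 'I_k -> nat}) := g (row_of_index i) * L i.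
Local Notation H := (alpha + k%:R / 2 + 1).
Local Notation lam := (@lebesgue_tuple R k).
Local Notation grid := (grid_kernel g L alpha).
Let k0R : 0 < k%:R :> R. Proof. by rewrite ltr0n. Qed.

Lemma grid_kernel_inj N M b (z : {ffun 'I_k -> int}) : ~~ injectiveb z -> grid N M b z = 0.
Proof.
move=> nz; rewrite /grid_kernel big1 ?mulr0// => n _.
rewrite /cell_coef ifF//; apply/negP => /andP[_ /injectiveP il]; case/negP: nz.
by apply/injectiveP => q q' e; apply: il; rewrite !ffunE e.
Qed.

Lemma cell_index_injb K c (l : {ffun 'I_k -> 'I_K}) : injectiveb (cell_index c l) -> injectiveb l.
Proof. by move=> /injectiveP il; apply/injectiveP => q q' e; apply: il; rewrite !ffunE e. Qed.

Let pw (n : nat) : (0 < n)%N -> n%:R ^+ k * (n%:R `^ (- (k%:R / 2))) ^+ 2 = 1 :> R.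
Proof.
move=> n0; rewrite -[X in X * _]powR_mulrn ?ler0n// expr2 -powRD; last by rewrite pnatr_eq0 (gtn_eqF n0) implybT.
rewrite -powRD; last by rewrite pnatr_eq0 (gtn_eqF n0) implybT.
by rewrite (_ : k%:R + (- (k%:R / 2) + - (k%:R / 2)) = 0) ?powRr0//; field.
Qed.

Section noise.
Context {d} {T : measurableType d} (P : probability T R).
Variable eps : int -> {RV P >-> R}.
Hypotheses (eps_indep : mutually_independent P (fun i : int => eps i : T -> R))
 (eps0 : forall z, Ex P (eps z) = 0) (eps2 : forall z, (e2 P (eps z) <= 1%:E)%E).
Local Notation CS M b := (fun w => chaos_sum g L (fun z => eps z w) M b).

Definition shift_noise (c : nat) (r : nat) : {RV P >-> R} := eps (r%:Z + 1 - c%:Z).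

Let sinj (c : nat) : injective (fun r : nat => r%:Z + 1 - c%:Z).
Proof. by move=> r r'; clear; lia. Qed.

Let s_indep c : mutually_independent P (fun r => shift_noise c r : T -> R).
Proof. exact: (indep_inj (@sinj c) eps_indep). Qed.

Let formE N M b c K : (0 < N)%N -> (0 < K)%N -> (M <= c)%N -> (b + c <= K.+1)%N ->
 (fun w => N%:R `^ (- H) * chaos_sum g L (fun z => eps z w) M b) =
 (fun w => multiform (fun l : {ffun 'I_k -> 'I_K} =>
   N%:R `^ (- (k%:R / 2)) * grid N M b (cell_index c l)) (shift_noise c ^~ w)).
Proof.
move=> N0 K0 Mc bK; apply/funext => w; rewrite (chaos_sumE _ _ alpha _ N0 K0 Mc bK).
by apply: eq_bigr => l _; congr (_ * _); apply: eq_bigr => q _; rewrite ffunE.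
Qed.

Lemma L2_chaos_sum M b : L2 P (CS M b).
Proof.
have := formE (isT : 0 < 1)%N (isT : (0 < (b + M).+1)%N) (leqnn M) (leqW (leqnSn _)).
rewrite (_ : 1%:R `^ (- H) = 1 :> R) ?powR1// => E.
have -> : CS M b = (fun w => 1 * chaos_sum g L (fun z => eps z w) M b).
 by apply/funext => w; rewrite mul1r.
rewrite E; exact: (L2_multiform (s_indep M) (fun r => eps2 _)).
Qed.

(** Both sums live on one array of cells, so their difference is an off-diagonal form whose squared
    coefficients sum to at most the squared L^2 distance of the kernels. *)
Lemma same_scale N M M' b (r : R) : (0 < N)%N ->
 sq_small lam (fun x => grid N M b (zceil_tuple N x) - grid N M' b (zceil_tuple N x)) r ->
 (e2 P (fun w => N%:R `^ (- H) * CS M b w - N%:R `^ (- H) * CS M' b w)%R <= ((k ^ k)%:R * r)%:E)%E.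
Proof.
move=> N0 /sq_small_integral Hr; pose c := maxn M M'; pose K := (b + c).+1.
have E1 := formE N0 (isT : (0 < K)%N) (leq_maxl M M') (leqW (leqnSn (b + c))).
have E2 := formE N0 (isT : (0 < K)%N) (leq_maxr M M') (leqW (leqnSn (b + c))).
pose V (l : {ffun 'I_k -> 'I_K}) := N%:R `^ (- (k%:R / 2)) *
 (grid N M b (cell_index c l) - grid N M' b (cell_index c l)).
rewrite (_ : (fun w => _) = fun w => multiform V (shift_noise c ^~ w)); last first.
 apply/funext => w; have := congr1 (fun f => f w) E1; have := congr1 (fun f => f w) E2.
 move=> /= -> ->; rewrite /multiform -sumrB; apply: eq_bigr => l _.
 by rewrite -mulrBl -mulrBr.
apply: le_trans (e2_multiform (s_indep c) (fun r => eps0 _) (fun r => eps2 _) k0 V) _.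
rewrite !EFinM; apply: lee_wpmul2l; first by rewrite lee_fin.
apply: le_trans Hr; apply: (@le_trans _ _ (\sum_l V l ^+ 2)%:E).
 rewrite lee_fin big_mkcond/=; apply: ler_sum => l _; case: ifP => // _; exact: sqr_ge0.
apply: (cell_sum_le N0 (c := c) (F := fun x => (grid N M b (zceil_tuple N x) - grid N M' b (zceil_tuple N x)) ^+ 2)).
 by move=> x; exact: sqr_ge0.
by move=> l x ->; rewrite /V exprMn mulrA pw// mul1r.
Qed.

(** A coarse cell is a union of m fine ones per coordinate, so the coarse kernel is constant on fine
    cells and the two kernels are compared on the fine array. *)
Lemma coarse_scale N0 m c0 b0 K0 (r : R) : (0 < N0)%N -> (0 < m)%N -> (0 < K0)%N -> (b0 + c0 <= K0)%N ->
 sq_small lam (fun x => grid (m * N0) (m * c0) (m * b0) (zceil_tuple (m * N0) x) -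
  grid N0 c0 b0 (zceil_tuple N0 x)) r ->
 (e2 P (fun w => (m * N0)%:R `^ (- H) * CS (m * c0) (m * b0) w -
   polyform (fun l : {ffun 'I_k -> 'I_K0} => N0%:R `^ (- (k%:R / 2)) * grid N0 c0 b0 (cell_index c0 l))
    (bsum m (shift_noise (m * c0) ^~ w)))%R <= ((k ^ k)%:R * r)%:E)%E.
Proof.
move=> N00 m0 K00 bK /sq_small_integral Hr; have mR : 0 < m%:R :> R by rewrite ltr0n.
have NR : 0 < N0%:R :> R by rewrite ltr0n.
have mN : (0 < m * N0)%N by rewrite muln_gt0 m0.
have bK' : (m * b0 + m * c0 <= (K0 * m).+1)%N.
 by apply: leqW; rewrite -mulnDr [(K0 * m)%N]mulnC leq_mul2l bK orbT.
have Km : (0 < K0 * m)%N by rewrite muln_gt0 K00.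
have E1 := formE mN Km (leqnn (m * c0)) bK'.
pose W (l : {ffun 'I_k -> 'I_K0}) := N0%:R `^ (- (k%:R / 2)) * grid N0 c0 b0 (cell_index c0 l).
have W0 (l : {ffun 'I_k -> 'I_K0}) : ~~ injectiveb l -> W l = 0.
 move=> nl; rewrite /W grid_kernel_inj ?mulr0//; apply: contra nl; exact: cell_index_injb.
pose V (l : {ffun 'I_k -> 'I_(K0 * m)}) := (m * N0)%:R `^ (- (k%:R / 2)) *
 (grid (m * N0) (m * c0) (m * b0) (cell_index (m * c0) l) - grid N0 c0 b0 (cell_index c0 (blk m0 l))).
have sm : Num.sqrt m%:R ^- k = m%:R `^ (- (k%:R / 2)) :> R.
 rewrite -powR12_sqrt// powRN -[RHS]invrK; congr (_^-1); rewrite invrK.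
 by rewrite -powR_mulrn ?powR_ge0// -powRrM; congr (_ `^ _); field.
rewrite (_ : (fun w => _) = fun w => multiform V (shift_noise (m * c0) ^~ w)); last first.
 apply/funext => w; have := congr1 (fun f => f w) E1 => /= ->.
 rewrite (polyform_bsum m0 _ W0) /multiform -sumrB; apply: eq_bigr => l _.
 rewrite -mulrBl sm /V /W; congr (_ * _); rewrite mulrBr; congr (_ - _).
 by rewrite natrM powRM ?ler0n// mulrA.
apply: le_trans (e2_multiform (s_indep _) (fun r => eps0 _) (fun r => eps2 _) k0 V) _.
rewrite !EFinM; apply: lee_wpmul2l; first by rewrite lee_fin.
apply: le_trans Hr; apply: (@le_trans _ _ (\sum_l V l ^+ 2)%:E).
 rewrite lee_fin big_mkcond/=; apply: ler_sum => l _; case: ifP => // _; exact: sqr_ge0.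
apply: (cell_sum_le mN (c := (m * c0)%N) (F := fun x => (grid (m * N0) (m * c0) (m * b0) (zceil_tuple (m * N0) x) -
  grid N0 c0 b0 (zceil_tuple N0 x)) ^+ 2)); first by move=> x; exact: sqr_ge0.
move=> l x zx; rewrite zx /V exprMn mulrA pw// mul1r.
suff -> : zceil_tuple N0 x = cell_index c0 (blk m0 l) by [].
apply/ffunP => q; have := congr1 (fun f : {ffun 'I_k -> int} => f q) zx.
rewrite !ffunE => /eqP; rewrite zceilP => /andP[h1 h2]; apply/eqP; rewrite zceilP.
rewrite -(ltr_pM2l mR) -(ler_pM2l mR) !mulrA -natrM.
have dv := divn_eq (l q) m; have md := ltn_pmod (l q) m0.
apply/andP; split.
 apply: le_lt_trans h1; rewrite -[m%:R]/(m%:Z%:~R) -intrM ler_int /=.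
 move: dv md; move: (l q : nat) (l q %/ m)%N (l q %% m)%N => u v s -> ; clear; nia.
apply: le_trans h2 _; rewrite -[m%:R]/(m%:Z%:~R) -intrM ler_int /=.
move: dv md; move: (l q : nat) (l q %/ m)%N (l q %% m)%N => u v s -> ; clear; nia.
Qed.
End noise.

Lemma coef_bound : exists2 c, 0 <= c & forall i : {ffun 'I_k -> nat}, (forall q, 0 < i q)%N ->
 `|a i| <= c * (\sum_q i q)%:R `^ alpha.
Proof.
have [_ _ [c c0 Hc]] := gB; have [[CL HL] _] := adm.
exists (c * Num.max CL 0).
 by apply: mulr_ge0; [exact: ltW|rewrite le_max lexx orbT].
move=> i i0; have oi : orthant (row_of_index i : 'rV[R]_k) by move=> q; rewrite mxE ltr0n.
rewrite /a normrM mulrAC; apply: ler_pM => //.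
 apply: le_trans (Hc _ oi) _; rewrite (eq_bigr (fun q => (i q)%:R)); last by move=> q _; rewrite mxE.
 by rewrite natr_sum.
by apply: le_trans (HL _ i0) _; rewrite le_max lexx.
Qed.

Lemma H_bounds : 1 / 2 < H < 1.
Proof. by have [[/andP[h1 h2] _ _ _] _ _] := gB; apply/andP; split; lra. Qed.

Local Notation chT eps M n := (chaosT eps [set: 'I_k]%SET a (fun _ x => x) M n).

Lemma chaos_window_core : exists2 C : R, 0 < C &
 forall (d : measure_display) (T : measurableType d) (P : probability T R) (eps : int -> {RV P >-> R}),
 mutually_independent P (fun i : int => eps i : T -> R) ->
 (forall z, Ex P (eps z) = 0) -> (forall z, (e2 P (eps z) <= 1%:E)%E) ->
 forall M a0 b, (e2 P (fun w => \sum_(n < b) chT eps M (a0 + n)%N w)%R <= (C * b%:R `^ (2 * H))%:E)%E.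
Proof.
have [c c0 Hc] := coef_bound; have /andP[H1 H2] := H_bounds.
have pb := powbound_hom c0 k0 Hc.
have kaI : 0 < - alpha - k%:R / 2 < 1 / 2 by apply/andP; split; lra.
have A0 : (0 < #|[set: 'I_k]%SET|)%N by rewrite cardsT card_ord.
have [C C0 HC] := chaosT_window (lexx 1) A0 c0 pb kaI.
exists C => // d T P eps ei e0 e2' M a0 b.
have -> : 2 * H = 2 - 2 * (- alpha - k%:R / 2) by ring.
exact: (HC d T P eps (fun _ x => x) ei (fun _ => @measurable_id _ _ _) (fun v z _ => e0 z) (fun v z _ => e2' z)).
Qed.

Lemma chaos_sum_chT {d} {T : measurableType d} (P : probability T R) (eps : int -> {RV P >-> R}) M b w :
 chaos_sum g L (fun z => eps z w) M b = \sum_(n < b) chT eps M n.+1 w.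
Proof.
apply: eq_bigr => n _; apply: eq_bigr => i _; congr (_ * _).
by apply: eq_bigl => q; rewrite finset.in_setT.
Qed.

(** Mesh 2^(- l) and a memory of 2^l units of time, so that resolution and memory improve
    together. *)
Definition coarse_poly (l b : nat) (u : {ffun 'I_(2 ^ l + 2 ^ l * 2 ^ l) -> R}) : R :=
 polyform (fun v : {ffun 'I_k -> _} => (2 ^ l)%:R `^ (- (k%:R / 2)) *
  grid (2 ^ l) (2 ^ l * 2 ^ l) b (cell_index (2 ^ l * 2 ^ l) v)) u.

Lemma pow_small (q e : R) : 0 < q -> 0 < e -> exists n0 : nat, forall n, (n0 <= n)%N -> n%:R `^ (- q) <= e.
Proof.
move=> q0 e0; pose x := e `^ (- q^-1); exists (Num.truncn x).+1 => n hn.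
have x0 : 0 < x by rewrite powR_gt0.
have xn : x <= n%:R.
 have /andP[_ /ltW h] := truncn_itv (ltW x0); apply: le_trans h _; by rewrite ler_nat.
have -> : e = x `^ (- q) by rewrite /x -powRrM mulrNN mulVf ?powRr1 ?ltW// gt_eqF.
rewrite !powRN lef_pV2 ?posrE ?powR_gt0//; last exact: lt_le_trans xn.
by apply: ge0_ler_powR; rewrite ?nnegrE//; exact: ltW.
Qed.

Lemma measurable_polyform {d} {T : measurableType d} {n} (W : {ffun 'I_k -> 'I_n} -> R) (u : T -> {ffun 'I_n -> R}) :
 (forall Z, mfunT (fun w => u w Z)) -> mfunT (fun w => polyform W (u w)).
Proof.
move=> mu; rewrite /polyform; under eq_fun do rewrite big_mkcond.
apply: measurable_sum => f; case: (injectiveb f); last exact: measurable_cst.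
apply: measurable_funM; first exact: measurable_cst.
by apply: measurable_prod => q _; exact: mu.
Qed.

(** Four errors: the oscillation between points of a time grid of mesh 2^(- p), where th > 1 makes
    about 2^p windows of length about N / 2^p negligible together; the passage from N to the
    multiple N' of 2^l; the truncation of the memory; the coarsening of the noise. A single [Q]
    bounds the square of the total for all t at once. *)
Lemma core_approx (E : R) : 0 < E -> exists (p l m0 : nat), (p <= l)%N /\
 forall (d : measure_display) (T : measurableType d) (P : probability T R) (eps : int -> {RV P >-> R}),
 mutually_independent P (fun i : int => eps i : T -> R) ->
 (forall z, Ex P (eps z) = 0) -> (forall z, (e2 P (eps z) <= 1%:E)%E) ->
 forall N M, (m0 <= N)%N -> (N * N <= M)%N -> (0 < N %/ 2 ^ l)%N /\
 exists Q : T -> R, [/\ mfunT Q, forall w, 0 <= Q w, (\int[P]_w (Q w)%:E <= E%:E)%E &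
  forall w (t : R), 0 <= t <= 1 ->
   (N%:R `^ (- H) * chaos_sum g L (fun z => eps z w) M (Num.truncn (N%:R * t)) -
    @coarse_poly l (Num.truncn ((2 ^ p)%N%:R * t) * 2 ^ (l - p))%N
     (bsum (N %/ 2 ^ l)%N (shift_noise eps (N %/ 2 ^ l * (2 ^ l * 2 ^ l))%N ^~ w))) ^+ 2 <= Q w].
Proof.
move=> E0; have /andP[H12 H1] := H_bounds; set th := 2 * H.
have th1 : 1 < th by rewrite /th; lra.
have [C C0 HC] := chaos_window_core.
have [C' C'0 HMW] := maximal_window (ltW C0) th1.
(* The J = 2^p + 1 windows together cost a multiple of 2^(p (1 - th)). The factor 18 is 9, for three
   squares sharing a factor 3, times 2 from J <= 2^(p + 1). *)
have [p Hp] : exists p : nat, 18 * C' * 4 `^ th * (2 ^ p)%:R `^ (1 - th) <= E.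
 have q0 : 0 < th - 1 by lra.
 have K0 : 0 < 18 * C' * 4 `^ th by rewrite !mulr_gt0 ?powR_gt0.
 have [n0 Hn] := pow_small q0 (divr_gt0 E0 K0).
 exists n0; rewrite -ler_pdivlMl// mulrC -opprB; apply: Hn.
 exact/ltnW/ltn_expl.
pose J := (2 ^ p).+1; pose tj (j : 'I_J) : R := j%:R / (2 ^ p)%:R.
have p20 : 0 < (2 ^ p)%:R :> R by rewrite ltr0n expn_gt0.
have tj01 j : 0 <= tj j <= 1.
 by rewrite /tj divr_ge0//= ler_pdivrMr// mul1r ler_nat -ltnS.
pose kk : R := (k ^ k)%:R; have kk0 : 0 < kk by rewrite ltr0n expn_gt0 k0.
have J0 : 0 < J%:R :> R by rewrite ltr0n.
(* Passing through the limit kernel, [T1] and [T2] cost 4 kk e each, hence their sum 16 kk e. *)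
pose e := E / (9 * J%:R * 16 * kk).
have e0 : 0 < e by rewrite divr_gt0// !mulr_gt0.
have [n1 Hn1] := choice (fun j : 'I_J => grid_kernel_cvg k0 gB adm (tj01 j) e0).
pose n2 := (\max_j n1 j)%N.
have n12 j : (n1 j <= n2)%N by exact: leq_bigmax.
pose l := maxn p n2; have pl : (p <= l)%N by exact: leq_maxl.
pose N0 := (2 ^ l)%N; have N00 : (0 < N0)%N by rewrite expn_gt0.
have n2N0 : (n2 <= N0)%N by apply: leq_trans (leq_maxr p n2) (ltnW (ltn_expl _ _)).
(* Makes the change of normalisation harmless: (rho - 1)^2 C is at most N0 C / N. *)
pose m1 := (Num.truncn (N0%:R * C * 9 * J%:R / E)).+1.
exists p, l, (maxn (N0 * 2 ^ p) m1); split=> // d T P eps ei eps0 eps2 N M.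
rewrite geq_max => /andP[N1 N2] NM; rewrite -/N0; set m := (N %/ N0)%N.
have Npos : (0 < N)%N by apply: leq_trans N1; rewrite muln_gt0 N00 expn_gt0.
have NR : 0 < N%:R :> R by rewrite ltr0n.
have m0 : (0 < m)%N.
 by rewrite divn_gt0//; apply: leq_trans N1; rewrite leq_pmulr// expn_gt0.
split=> //; pose N' := (m * N0)%N.
have N'pos : (0 < N')%N by rewrite muln_gt0 m0.
have N'R : 0 < N'%:R :> R by rewrite ltr0n.
have N'N : (N' <= N)%N by exact: leq_trunc_div.
have NN' : (N < N' + N0)%N by rewrite {1}(divn_eq N N0) ltn_add2l ltn_pmod.
pose c0 := (N0 * N0)%N.
pose b0 (j : nat) := (j * 2 ^ (l - p))%N; pose nj j := (m * b0 j)%N.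
have N0E : N0 = (2 ^ p * 2 ^ (l - p))%N by rewrite -expnD subnKC.
have njE j : (nj j)%:R = N'%:R * (j%:R / (2 ^ p)%:R) :> R.
 by rewrite /nj /b0 /N' N0E !natrM; field; rewrite gt_eqF.
have b0E j : (b0 j)%:R = N0%:R * (j%:R / (2 ^ p)%:R) :> R.
 by rewrite /b0 N0E !natrM; field; rewrite gt_eqF.
pose cs M' b w := chaos_sum g L (fun z => eps z w) M' b.
pose u w := bsum (n := N0 + N0 * N0) m (shift_noise eps (m * c0) ^~ w).
have csL M' b : L2 P (cs M' b) by exact: (L2_chaos_sum ei eps2).
pose B j w := N'%:R `^ (- H) * cs M (nj j) w.
pose T1 j w := B j w - N'%:R `^ (- H) * cs (m * c0)%N (nj j) w.
pose T2 j w := N'%:R `^ (- H) * cs (m * c0)%N (nj j) w - @coarse_poly l (b0 j) (u w).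
have kern (j : 'I_J) X Y : (n2 <= X)%N -> (X * n2 <= Y)%N ->
  forall b, b%:R = X%:R * (j%:R / (2 ^ p)%:R) :> R ->
  sq_small lam (fun x => grid X Y b (zceil_tuple X x) - time_kernel g (tj j) (row_tuple x)) e.
 move=> X1 Y1 b bE; have := Hn1 j X Y (leq_trans (n12 j) X1) (leq_trans _ Y1).
 by rewrite /tj -bE natrK; apply; rewrite leq_mul2l n12 orbT.
have kern2 (j : 'I_J) X Y b X' Y' b' : (n2 <= X)%N -> (X * n2 <= Y)%N -> (n2 <= X')%N -> (X' * n2 <= Y')%N ->
  b%:R = X%:R * (j%:R / (2 ^ p)%:R) :> R -> b'%:R = X'%:R * (j%:R / (2 ^ p)%:R) :> R ->
  sq_small lam (fun x => grid X Y b (zceil_tuple X x) - grid X' Y' b' (zceil_tuple X' x)) (4 * e).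
 move=> h1 h2 h3 h4 h5 h6; have := sq_smallB (kern j _ _ h1 h2 _ h5) (kern j _ _ h3 h4 _ h6).
 rewrite (_ : 2 * e + 2 * e = 4 * e); last by ring.
 by apply: sq_small_eq => x; ring.
have N'n2 : (n2 <= N')%N by apply: leq_trans n2N0 _; rewrite leq_pmull.
have c0n2 : (N0 * n2 <= c0)%N by rewrite leq_mul2l n2N0 orbT.
have mc0 : (N' * n2 <= m * c0)%N by rewrite -mulnA leq_mul2l c0n2 orbT.
have Mn2 : (N' * n2 <= M)%N.
 by apply: leq_trans NM; apply: leq_mul => //; exact: leq_trans N'n2 N'N.
have e2T1 (j : 'I_J) : (e2 P (T1 j) <= (kk * (4 * e))%:E)%E.
 by apply: (same_scale ei eps0 eps2 N'pos); apply: kern2 => //; exact: njE.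
have b0N0 (j : 'I_J) : (b0 j <= N0)%N.
 by rewrite /b0 N0E leq_mul2r -ltnS ltn_ord orbT.
have e2T2 (j : 'I_J) : (e2 P (T2 j) <= (kk * (4 * e))%:E)%E.
 apply: (coarse_scale ei eps0 eps2 N00 m0 (K0 := (N0 + N0 * N0)%N)).
 - by rewrite addn_gt0 N00.
 - by rewrite leq_add2r.
 - by apply: kern2 => //; try exact: njE; try exact: b0E.
have mB j : mfunT (B j) by have [] := L2Z (N'%:R `^ (- H)) (csL M (nj j)).
have mT1 j : mfunT (T1 j).
 by apply: measurable_funB => //; have [] := L2Z (N'%:R `^ (- H)) (csL (m * c0)%N (nj j)).
have L2n z : L2 P (eps z).
 by split; [exact: measurable_funP|exact: le_lt_trans (eps2 z) (ltry _)].
have L2u Z : L2 P (fun w => u w Z).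
 have -> : (fun w => u w Z) = (fun w => (Num.sqrt m%:R)^-1 * \sum_(r < m) shift_noise eps (m * c0) (Z * m + r) w).
  by apply/funext => w; rewrite /u /bsum ffunE.
 by apply: L2Z; apply: L2_big => r _; exact: L2n.
have mT2 j : mfunT (T2 j).
 apply: measurable_funB; first by have [] := L2Z (N'%:R `^ (- H)) (csL (m * c0)%N (nj j)).
 by apply: measurable_polyform => Z; have [] := L2u Z.
pose D n w := chT eps M n.+1 w.
have wD a0 b : (e2 P (fun w => \sum_(n < b) D (a0 + n)%N w)%R <= (C * b%:R `^ th)%:E)%E.
 rewrite /D; under eq_fun do under eq_bigr do rewrite -addSn; exact: HC.
have csD b w : cs M b w = \sum_(n < b) D n w by exact: chaos_sum_chT.
have mD n : mfunT (D n).
 rewrite (_ : D n = fun w => cs M n.+1 w - cs M n w).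
  by apply: measurable_funB; [have [] := csL M n.+1|have [] := csL M n].
 by apply/funext => w; rewrite !csD big_ord_recr/= [RHS]addrC addKr.
have NHH (n : nat) : (0 < n)%N -> (n%:R `^ (- H)) ^+ 2 = n%:R `^ (- th) :> R.
 move=> n0; rewrite -powR_mulrn ?powR_ge0// -powRrM; congr (_ `^ _); rewrite /th; ring.
have njN' (j : 'I_J) : (nj j <= N')%N by rewrite leq_mul2l b0N0 orbT.
have e2B (j : 'I_J) : (e2 P (B j) <= C%:E)%E.
 rewrite /B e2Z; last by have [] := csL M (nj j).
 have -> : cs M (nj j) = fun w => \sum_(n < nj j) D (0 + n)%N w.
  by apply/funext => w; rewrite csD.
 apply: le_trans (lee_wpmul2l _ (wD 0%N (nj j))) _; first by rewrite lee_fin sqr_ge0.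
 rewrite -EFinM lee_fin NHH// mulrCA -[leRHS]mulr1 ler_pM2l// powRN mulrC ler_pdivrMr ?powR_gt0// mul1r.
 by apply: ge0_ler_powR; rewrite ?nnegrE ?ler0n ?ler_nat//; lra.
(* A window goes from [nj j] to [N t] and has at most N / 2^p + N0 <= 2 N / 2^p terms. The dyadic
   length 2^Lw exceeds v by a factor of at most 2. *)
pose v := ((2 * N) %/ 2 ^ p)%N.
have v2 : (2 <= v)%N.
 rewrite leq_divRL ?expn_gt0// leq_mul2l /=; apply: leq_trans N1; by rewrite leq_pmull.
pose Lw := up_log 2 v.
have /andP[Lw1 Lw2] := up_log_bounds (isT : 1 < 2)%N (v2 : 1 < v)%N.
have Lw3 : (2 ^ Lw <= 2 * v)%N.
 have : (0 < Lw)%N by rewrite up_log_gt0; apply: leq_trans v2.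
 rewrite /Lw; case: (up_log 2 v) Lw1 => // n /= h _; by rewrite expnS leq_mul2l/= ltnW.
have Lw4 : (2 ^ Lw)%:R <= 4 * N%:R / (2 ^ p)%:R :> R.
 rewrite ler_pdivlMr// -!natrM ler_nat.
 apply: (@leq_trans (2 * v * 2 ^ p)); first by rewrite leq_mul2r Lw3 orbT.
 by rewrite -mulnA (_ : 4 = 2 * 2)%N// -mulnA leq_mul2l/= leq_trunc_div.
have [Qj HQ] := choice (fun j : 'I_J => HMW d T P D mD wD (nj j) Lw).
pose rho := N%:R `^ (- H) * N'%:R `^ H.
pose Q w := 3 * \sum_(j < J) ((N%:R `^ (- H)) ^+ 2 * Qj j w + (rho - 1) ^+ 2 * B j w ^+ 2 +
  (T1 j w + T2 j w) ^+ 2).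
have mT j : mfunT (fun w => T1 j w + T2 j w) by exact: measurable_funD.
have e2T (j : 'I_J) : (e2 P (fun w => T1 j w + T2 j w)%R <= (kk * (16 * e))%:E)%E.
 apply: le_trans (e2D _ (mT1 j) (mT2 j)) _.
 apply: le_trans (leeD (lee_wpmul2l _ (e2T1 j)) (lee_wpmul2l _ (e2T2 j))) _ => //.
 by rewrite -!EFinM -EFinD lee_fin le_eqVlt; apply/orP; left; apply/eqP; ring.
have mQ j : mfunT (Qj j) by have [] := HQ j.
have Q0 j w : 0 <= Qj j w by have [_ + _ _] := HQ j; apply.
have rho1 : (rho - 1) ^+ 2 <= N0%:R / N%:R.
 have rE : rho = (N'%:R / N%:R) `^ H.
  rewrite powRM ?ler0n ?invr_ge0 ?ler0n// /rho mulrC; congr (_ * _).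
  by rewrite -[N%:R^-1]powR_inv1 ?ler0n// -powRrM mulN1r.
 have x1 : N'%:R / N%:R <= 1 :> R by rewrite ler_pdivrMr// mul1r ler_nat.
 have x0 : 0 < N'%:R / N%:R :> R by rewrite divr_gt0.
 have r1 : rho <= 1.
  rewrite rE; apply: (@le_trans _ _ (1 `^ H)); last by rewrite powR1.
  by apply: ge0_ler_powR; rewrite ?nnegrE ?(ltW x0)//; lra.
 have r2 : N'%:R / N%:R <= rho.
  rewrite rE; set x := N'%:R / N%:R in x1 x0 *.
  have xE : x = x `^ H * x `^ (1 - H).
   rewrite -powRD; last by rewrite (gt_eqF x0) implybT.
   by rewrite addrC subrK powRr1// ltW.
  have xH : x `^ (1 - H) <= 1.
   apply: (@le_trans _ _ (1 `^ (1 - H))); last by rewrite powR1.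
   by apply: ge0_ler_powR; rewrite ?nnegrE ?(ltW x0)//; lra.
  by rewrite {1}xE ler_piMr ?powR_ge0.
 have r3 : 1 - N'%:R / N%:R <= N0%:R / N%:R :> R.
  rewrite lerBlDr -mulrDl ler_pdivlMr// mul1r -natrD ler_nat addnC; exact: ltnW.
 have r4 : N0%:R / N%:R <= 1 :> R.
  by rewrite ler_pdivrMr// mul1r ler_nat; apply: leq_trans N1; rewrite leq_pmulr// expn_gt0.
 have r5 : 0 <= 1 - rho by lra.
 rewrite -sqrrN opprB expr2; apply: le_trans (ler_piMr r5 _) _; lra.
have q1 j w : 0 <= (N%:R `^ (- H)) ^+ 2 * Qj j w by apply: mulr_ge0; [exact: sqr_ge0|exact: Q0].
have q2 j w : 0 <= (rho - 1) ^+ 2 * B j w ^+ 2 by apply: mulr_ge0; exact: sqr_ge0.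
have q3 j w : 0 <= (T1 j w + T2 j w) ^+ 2 by exact: sqr_ge0.
have q12 (j : 'I_J) w : 0 <= (N%:R `^ (- H)) ^+ 2 * Qj j w + (rho - 1) ^+ 2 * B j w ^+ 2 by apply: addr_ge0.
have q123 (j : 'I_J) w : 0 <= (N%:R `^ (- H)) ^+ 2 * Qj j w + (rho - 1) ^+ 2 * B j w ^+ 2 + (T1 j w + T2 j w) ^+ 2.
 by apply: addr_ge0.
exists Q; split.
- apply: measurable_funM; first exact: measurable_cst.
 apply: measurable_sum => j; apply: measurable_funD; last by apply: measurable_funX.
 apply: measurable_funD; first by apply: measurable_funM.
 by apply: measurable_funM => //; exact: measurable_funX.
- move=> w; apply: mulr_ge0 => //; apply: sumr_ge0 => j _; exact: q123.
- have mS (j : 'I_J) : mfunT (fun w => (N%:R `^ (- H)) ^+ 2 * Qj j w) by apply: measurable_funM.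
 have mS2 (j : 'I_J) : mfunT (fun w => (rho - 1) ^+ 2 * B j w ^+ 2).
  by apply: measurable_funM => //; exact: measurable_funX.
 have mS3 (j : 'I_J) : mfunT (fun w => (T1 j w + T2 j w) ^+ 2) by apply: measurable_funX.
 have term (j : 'I_J) : (\int[P]_w ((N%:R `^ (- H)) ^+ 2 * Qj j w + (rho - 1) ^+ 2 * B j w ^+ 2 +
   (T1 j w + T2 j w) ^+ 2)%:E <= (E / (3 * J%:R))%:E)%E.
  under eq_integral do rewrite !EFinD.
  rewrite ge0_integralD//; last 4 first.
  + by move=> w _; rewrite -EFinD lee_fin; exact: q12.
  + by apply: emeasurable_funD; apply/measurable_EFinP; [exact: mS|exact: mS2].
  + by move=> w _; rewrite lee_fin sqr_ge0.
  + by apply/measurable_EFinP; exact: mS3.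
  rewrite ge0_integralD//; last 4 first.
  + by move=> w _; rewrite lee_fin; exact: q1.
  + by apply/measurable_EFinP; exact: mS.
  + by move=> w _; rewrite lee_fin; exact: q2.
  + by apply/measurable_EFinP; exact: mS2.
  have -> : (E / (3 * J%:R))%:E = ((E / (9 * J%:R))%:E + (E / (9 * J%:R))%:E + (E / (9 * J%:R))%:E)%E.
   by rewrite -!EFinD; congr EFin; field; rewrite gt_eqF.
  apply: leeD; first apply: leeD.
  + under eq_integral do rewrite EFinM.
   rewrite ge0_integralZl_EFin ?sqr_ge0//; last 2 first.
   * by move=> w _; rewrite lee_fin.
   * by apply/measurable_EFinP; exact: mQ.
   have [_ _ h _] := HQ j; apply: le_trans (lee_wpmul2l _ h) _; first by rewrite lee_fin sqr_ge0.
   rewrite -EFinM lee_fin NHH// ler_pdivlMr ?mulr_gt0//.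
   have a1 : (2 ^ Lw)%:R `^ th <= (4 * N%:R / (2 ^ p)%:R) `^ th.
    by apply: ge0_ler_powR; rewrite ?nnegrE ?divr_ge0 ?mulr_ge0 ?ler0n//; lra.
   have a2 : (4 * N%:R / (2 ^ p)%:R) `^ th = 4 `^ th * N%:R `^ th * (2 ^ p)%:R `^ (- th).
    rewrite !powRM ?mulr_ge0 ?ler0n ?invr_ge0 ?ler0n//; congr (_ * _).
    by rewrite -[(2 ^ p)%:R^-1]powR_inv1 ?ler0n// -powRrM mulN1r.
   have a3 : N%:R `^ (- th) * N%:R `^ th = 1 :> R.
    by rewrite -powRD ?addNr ?powRr0// (gt_eqF NR) implybT.
   apply: (@le_trans _ _ (N%:R `^ (- th) * (C' * (4 `^ th * N%:R `^ th * (2 ^ p)%:R `^ (- th))) * (9 * J%:R))).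
    by rewrite -a2 ler_pM2r ?mulr_gt0// ler_pM2l ?powR_gt0// ler_pM2l.
   have -> : N%:R `^ (- th) * (C' * (4 `^ th * N%:R `^ th * (2 ^ p)%:R `^ (- th))) * (9 * J%:R) =
    9 * C' * 4 `^ th * (2 ^ p)%:R `^ (- th) * J%:R * (N%:R `^ (- th) * N%:R `^ th) by ring.
   rewrite a3 mulr1; apply: le_trans Hp.
   have -> : 18 * C' * 4 `^ th * (2 ^ p)%:R `^ (1 - th) = 9 * C' * 4 `^ th * (2 ^ p)%:R `^ (- th) * (2 * (2 ^ p)%:R).
    rewrite powRD ?(gt_eqF p20) ?implybT// powRr1 ?ler0n//; ring.
   rewrite ler_pM2l ?mulr_gt0 ?powR_gt0// /J -natrM ler_nat mul2n -addnn -addn1 leq_add2l.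
   by rewrite expn_gt0.
  + under eq_integral do rewrite EFinM.
   rewrite ge0_integralZl_EFin ?sqr_ge0//; last 2 first.
   * by move=> w _; rewrite lee_fin sqr_ge0.
   * by apply/measurable_EFinP; exact: measurable_funX.
   apply: le_trans (lee_wpmul2l _ (e2B j)) _; first by rewrite lee_fin sqr_ge0.
   rewrite -EFinM lee_fin; apply: le_trans (ler_wpM2r (ltW C0) rho1) _.
   rewrite ler_pdivlMr ?mulr_gt0//.
   have -> : N0%:R / N%:R * C * (9 * J%:R) = (N0%:R * C * 9 * J%:R) / N%:R by ring.
   rewrite ler_pdivrMr//.
   have x0 : 0 <= N0%:R * C * 9 * J%:R / E by rewrite divr_ge0 ?mulr_ge0 ?ler0n// ltW.
   have /andP[_ /ltW h] := truncn_itv x0.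
   have : N0%:R * C * 9 * J%:R / E <= N%:R by apply: le_trans h _; rewrite ler_nat.
   by rewrite ler_pdivrMr// [E * _]mulrC.
  + apply: le_trans (e2T j) _; rewrite lee_fin /e le_eqVlt; apply/orP; left; apply/eqP.
   by field; rewrite !gt_eqF.
 under eq_integral do rewrite EFinM.
 rewrite ge0_integralZl_EFin//; last 2 first.
 + by move=> w _; rewrite lee_fin; apply: sumr_ge0 => j _; exact: q123.
 + apply/measurable_EFinP; apply: measurable_sum => j; apply: measurable_funD; last exact: mS3.
  by apply: measurable_funD; [exact: mS|exact: mS2].
 under eq_integral do rewrite -sumEFin.
 rewrite ge0_integral_sum//; last 2 first.
 + move=> j; apply/measurable_EFinP; apply: measurable_funD; last exact: mS3.
  by apply: measurable_funD; [exact: mS|exact: mS2].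
 + by move=> j w _; rewrite lee_fin; exact: q123.
 apply: (@le_trans _ _ (3%:E * \sum_(j < J) (E / (3 * J%:R))%:E)%E).
  by apply: lee_wpmul2l => //; apply: lee_sum => j _; exact: term.
 rewrite sumEFin sumr_const card_ord -EFinM lee_fin -mulr_natr le_eqVlt; apply/orP; left; apply/eqP.
 by field; rewrite gt_eqF.
move=> w t /andP[t0 t1].
set j := Num.truncn ((2 ^ p)%N%:R * t); set b := Num.truncn (N%:R * t).
have /andP[j1 j2] : j%:R <= (2 ^ p)%:R * t < j.+1%:R by apply: truncn_itv; rewrite mulr_ge0.
have /andP[b1 b2] : b%:R <= N%:R * t < b.+1%:R by apply: truncn_itv; rewrite mulr_ge0.
have jJ : (j < J)%N.
 by rewrite /J ltnS -(ler_nat R); apply: le_trans j1 _; rewrite ler_piMr.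
pose j' := Ordinal jJ.
have njb : (nj j <= b)%N.
 rewrite /b truncn_ge_nat ?mulr_ge0// njE.
 have h1 : j%:R / (2 ^ p)%:R <= t by rewrite ler_pdivrMr// mulrC.
 apply: (@le_trans _ _ (N'%:R * t)); first by rewrite ler_pM2l.
 by rewrite ler_wpM2r// ler_nat.
have bn : (b - nj j <= 2 ^ Lw)%N.
 apply: leq_trans Lw2; rewrite leq_divRL ?expn_gt0// -(ler_nat R) !natrM natrB// njE.
 have N1R : N0%:R * (2 ^ p)%:R <= N%:R :> R by rewrite -natrM ler_nat.
 have NN'R : N%:R <= N'%:R + N0%:R :> R by rewrite -natrD ler_nat ltnW.
 have j3 : (2 ^ p)%:R * t <= j%:R + 1 by rewrite natr1 ltW.
 have jp : j%:R <= (2 ^ p)%:R :> R by rewrite ler_nat -ltnS.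
 have -> : (b%:R - N'%:R * (j%:R / (2 ^ p)%:R)) * (2 ^ p)%:R = b%:R * (2 ^ p)%:R - N'%:R * j%:R :> R.
  by field; rewrite gt_eqF.
 have h1 : b%:R * (2 ^ p)%:R <= N%:R * ((2 ^ p)%:R * t).
  by rewrite mulrCA [leRHS]mulrC ler_pM2r.
 have h2 : N%:R * ((2 ^ p)%:R * t) <= N%:R * (j%:R + 1) by rewrite ler_pM2l.
 have h3 : N%:R * j%:R <= (N'%:R + N0%:R) * j%:R :> R by rewrite ler_wpM2r.
 have h4 : N0%:R * j%:R <= N0%:R * (2 ^ p)%:R :> R by rewrite ler_wpM2l.
 lra.
have wq : (\sum_(n < b - nj j) D (nj j + n)%N w) ^+ 2 <= Qj j' w.
 by have [_ _ _ h] := HQ j'; exact: h.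
have csb : cs M b w = cs M (nj j) w + \sum_(n < b - nj j) D (nj j + n)%N w.
 rewrite !csD; transitivity (\sum_(n < nj j + (b - nj j)) D n w); first by rewrite subnKC.
 by rewrite big_split_ord.
have rE : N%:R `^ (- H) = rho * N'%:R `^ (- H).
 by rewrite /rho -mulrA -powRD ?subrr ?powRr0 ?mulr1// (gt_eqF N'R) implybT.
set S := \sum_(n < b - nj j) _ in csb wq.
have -> : N%:R `^ (- H) * chaos_sum g L (fun z => eps z w) M b -
  @coarse_poly l (b0 j) (u w) = N%:R `^ (- H) * S + (rho - 1) * B j w + (T1 j w + T2 j w).
 rewrite -/(cs M b w) csb mulrDr {1}rE /T1 /T2 /B; ring.
rewrite /Q (bigD1 j')//=.
set rest := \sum_(i < J | i != j') _.
have rest0 : 0 <= rest by apply: sumr_ge0 => i _; exact: q123.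
apply: (@le_trans _ _ (3 * ((N%:R `^ (- H) * S) ^+ 2 + ((rho - 1) * B j w) ^+ 2 + (T1 j w + T2 j w) ^+ 2))).
 move: (N%:R `^ (- H) * S) ((rho - 1) * B j w) (T1 j w + T2 j w) => x y z.
 rewrite -subr_ge0.
 have -> : 3 * (x ^+ 2 + y ^+ 2 + z ^+ 2) - (x + y + z) ^+ 2 = (x - y) ^+ 2 + (y - z) ^+ 2 + (x - z) ^+ 2 by ring.
 by rewrite !addr_ge0 ?sqr_ge0.
rewrite ler_pM2l// !exprMn.
have : (N%:R `^ (- H)) ^+ 2 * S ^+ 2 <= (N%:R `^ (- H)) ^+ 2 * Qj j' w by rewrite ler_wpM2l ?sqr_ge0.
lra.
Qed.
End core.

(** * Skorokhod space tested by Lipschitz functionals *)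

Section sup_norm.
Context {R : realType}.
Implicit Types (x y z : R -> R) (F f : (R -> R) -> R).

Definition near r x y := forall t : R, 0 <= t <= 1 -> `|x t - y t| <= r.

Lemma near_ge0 r x y : near r x y -> 0 <= r.
Proof. by move=> /(_ 0); rewrite lexx ler01 => /(_ isT); exact: le_trans. Qed.

Lemma near_sym r x y : near r x y -> near r y x.
Proof. by move=> h t t01; rewrite distrC; exact: h. Qed.

Lemma near_trans r r' x y z : near r x y -> near r' y z -> near (r + r') x z.
Proof. by move=> h h' t t01; apply: le_trans (ler_distD (y t) _ _) _; apply: lerD; [exact: h|exact: h']. Qed.

(* bounded and Lipschitz for the supremum norm on [0,1] *)
Definition lip K C F := (forall x, cadlag x -> `|F x| <= C) /\
 forall r x y, cadlag x -> cadlag y -> near r x y -> F x <= F y + K * r.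

Lemma near_ball x y r : cadlag y -> near r x y -> skorokhod_ball x r y.
Proof.
move=> cy n; split=> //; exists id.
 split=> //.
 by apply: continuous_subspaceT => s A.
by move=> t t01; rewrite subrr normr0 (near_ge0 n); split=> //; exact: n.
Qed.

Section inf_conv.
Variables (f : (R -> R) -> R) (C : R).
Hypothesis fC : forall x, cadlag x -> `|f x| <= C.

(** Inf-convolution of f with k times the supremum distance, where r runs over the upper bounds of
    that distance: the largest minorant of f that is k-Lipschitz for it. *)
Definition inf_conv (k : R) x := inf [set v | exists y r, [/\ cadlag y, near r x y & v = f y + k * r]].

Let S k x := [set v | exists y r, [/\ cadlag y, near r x y & v = f y + k * r]].

Let near_refl x : near 0 x x. Proof. by move=> t _; rewrite subrr normr0. Qed.

Let Slb k x : 0 <= k -> lbound (S k x) (- C).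
Proof.
move=> k0 v [y [r [cy n ->]]]; have := fC cy; rewrite ler_norml => /andP[h _].
by have := mulr_ge0 k0 (near_ge0 n); lra.
Qed.

Let S_ne k x : cadlag x -> S k x !=set0.
Proof. by move=> cx; exists (f x); exists x, 0; rewrite mulr0 addr0. Qed.

Lemma inf_conv_le k x : 0 <= k -> cadlag x -> inf_conv k x <= f x.
Proof.
move=> k0 cx; apply: ge_inf; first by exists (- C); exact: Slb.
by exists x, 0; rewrite mulr0 addr0.
Qed.

Lemma inf_conv_lip k : 0 <= k -> lip k C (inf_conv k).
Proof.
move=> k0; split=> [x cx|r x y cx cy n].
 rewrite ler_norml; apply/andP; split; first by apply: lb_le_inf; [exact: S_ne|exact: Slb].
 by apply: le_trans (inf_conv_le k0 cx) _; have := fC cx; rewrite ler_norml => /andP[].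
rewrite -lerBlDr; apply: lb_le_inf; first exact: S_ne.
move=> v [z [r' [cz n' ->]]]; rewrite lerBlDr -addrA -mulrDr.
apply: ge_inf; first by exists (- C); exact: Slb.
by exists z, (r' + r); split=> //; rewrite addrC; exact: near_trans n n'.
Qed.

(** For y near x the values of f are above f x - e; farther than d the penalty k d alone compensates
    the lower bound - C. *)
Lemma inf_conv_ge x (e d : R) k : 0 < d -> 0 <= k -> cadlag x ->
 (forall y, skorokhod_ball x d y -> f x - e <= f y) -> f x - e <= - C + k * d -> f x - e <= inf_conv k x.
Proof.
move=> d0 k0 cx h1 h2; apply: lb_le_inf; first exact: S_ne.
move=> v [y [r [cy n ->]]]; have [rd|dr] := leP r d.
 have : f x - e <= f y.
  by apply: h1; apply: near_ball => // t t01; apply: le_trans rd; exact: n.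
 by have := mulr_ge0 k0 (near_ge0 n); lra.
have := fC cy; rewrite ler_norml => /andP[h _].
have : k * d <= k * r by rewrite ler_wpM2l// ltW.
lra.
Qed.
End inf_conv.

Section paths.
Context {d} {T : measurableType d} (P : probability T R) (X : T -> R -> R).
Hypothesis cX : forall w, cadlag (X w).
Hypothesis mX : forall K C F, 0 <= K -> lip K C F -> mfunT (fun w => F (X w)).

(** For the indicator of an open set U the inf-convolution is positive exactly on U, because a ball
    for the supremum distance lies in the Skorokhod ball. So measurability of Lipschitz functionals
    is enough. *)
Lemma lip_random_cadlag : random_cadlag X.
Proof.
split=> // U oU.
pose f x : R := if pselect (U x) then 1 else 0.
have fC x : cadlag x -> `|f x| <= 1 by move=> _; rewrite /f; case: (pselect (U x)) => ?; rewrite ?normr1 ?normr0.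
have L := inf_conv_lip fC (ler01 : 0 <= (1 : R)).
rewrite (_ : X @^-1` U = setT `&` (fun w => inf_conv f 1 (X w)) @^-1` `]0, +oo[%classic).
 by apply: (mX ler01 L) => //; exact: measurable_itv.
apply/seteqP; split=> w /=; rewrite in_itv/= andbT => h; last first.
 case: h => _ h; apply: contrapT => nU; have := inf_conv_le fC (ler01 : 0 <= (1 : R)) (cX w).
 have -> : f (X w) = 0 by rewrite /f; case: (pselect (U (X w))).
 by rewrite leNgt h.
split=> //; have [r r0 rU] := oU _ (cX w) h.
pose m := Num.min r 1; have m0 : 0 < m by rewrite lt_min r0 ltr01.
have fU y : U y -> f y = 1 by rewrite /f; case: (pselect (U y)).
apply: (@lt_le_trans _ _ m) => //.
apply: lb_le_inf; first by exists (f (X w)); exists (X w), 0; rewrite mulr0 addr0; split=> // t _; rewrite subrr normr0.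
move=> v [y [s [cy n ->]]]; rewrite mul1r.
have s0 := near_ge0 n.
have [sr|rs] := leP s r.
 rewrite fU; last by apply: rU; apply: near_ball => // t t01; apply: le_trans sr; exact: n.
 by rewrite ge_min; apply/orP; right; lra.
rewrite ge_min; apply/orP; left; have : 0 <= f y by rewrite /f; case: (pselect (U y)).
lra.
Qed.

Lemma jcont_measurable f : skorokhod_continuous f -> mfunT (fun w => f (X w)).
Proof.
move=> cf; have [_ hU] := lip_random_cadlag.
move=> mD; apply: (measurability _ (RGenOInfty.measurableE R)) => //.
move=> _ [_ [c ->] <-]; rewrite setTI.
rewrite (_ : _ @^-1` _ = X @^-1` [set x | c < f x]); last first.
 by apply/seteqP; split=> w /=; rewrite in_itv/= andbT.
apply: hU => x cx /= fx.
have [r r0 hr] := cf x cx (f x - c) ltac:(rewrite subr_gt0//).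
by exists r => // y /hr; rewrite ltr_norml => /andP[_]; rewrite /=; lra.
Qed.
End paths.

Lemma ExN {d} {T : measurableType d} (P : probability T R) (h : T -> R) : integ P h ->
 Ex P (fun w => - h w) = - Ex P h.
Proof. by move=> ih; rewrite -[RHS]mulN1r -ExZ//; congr Ex; apply/funext => w; rewrite mulN1r. Qed.

Section weak.
Context {d d'} {T : measurableType d} {T' : measurableType d'}
 (P : probability T R) (P' : probability T' R) (X : nat -> T -> R -> R) (Z : T' -> R -> R).
Hypotheses (cX : forall N w, cadlag (X N w)) (cZ : forall w, cadlag (Z w)).
Hypothesis mX : forall N K C F, 0 <= K -> lip K C F -> mfunT (fun w => F (X N w)).
Hypothesis mZ : forall K C F, 0 <= K -> lip K C F -> mfunT (fun w => F (Z w)).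
Hypothesis lipcvg : forall K C F e, 0 <= K -> lip K C F -> 0 < e ->
 exists N0, forall N, (N0 <= N)%N -> Ex P' (fun w => F (Z w)) - e <= Ex P (fun w => F (X N w)).

(** Lipschitz minorants of f converge to f along the paths of Z, so one of them loses at most e / 2
    under P'. On the side of X it is enough that it is a minorant. The upper bound comes later from
    - f. *)
Let weak_lower f C e : skorokhod_continuous f -> (forall x, cadlag x -> `|f x| <= C) -> 0 < e ->
 exists N0, forall N, (N0 <= N)%N -> Ex P' (fun w => f (Z w)) - e <= Ex P (fun w => f (X N w)).
Proof.
move=> cf fC e0.
have C0 : 0 <= C by apply: le_trans (fC _ (cZ point)).
have mf : mfunT (fun w => f (Z w)) by exact: (jcont_measurable cZ mZ cf).
have mk (n : nat) : mfunT (fun w => inf_conv f n%:R (Z w)).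
 exact: (mZ (ler0n _ n) (inf_conv_lip fC (ler0n _ n))).
have kC (n : nat) x : cadlag x -> `|inf_conv f n%:R x| <= C by have [h _] := inf_conv_lip fC (ler0n R n); exact: h.
have cv w : (fun n : nat => inf_conv f n%:R (Z w)) @ \oo --> f (Z w).
 apply/cvgrPdist_le => u u0; have [r r0 hr] := cf _ (cZ w) u u0.
 exists (Num.truncn ((2 * C + u) / r)).+1 => // n /= hn.
 rewrite ger0_norm ?subr_ge0 ?(inf_conv_le fC)//.
 rewrite lerBlDr -lerBlDl; apply: (inf_conv_ge fC r0) => //.
  by move=> y /hr; rewrite ltr_norml => /andP[_ ?]; lra.
 have q0 : 0 <= (2 * C + u) / r by apply: divr_ge0; lra.
 have /andP[_ q1] := truncn_itv q0.
 have : 2 * C + u <= n%:R * r.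
  by rewrite -ler_pdivrMr//; apply: le_trans (ltW q1) _; rewrite ler_nat.
 have := fC _ (cZ w); rewrite ler_norml => /andP[? ?]; lra.
have ik (n : nat) : integ P' (fun w => inf_conv f n%:R (Z w)).
 by apply: (@integ_bounded _ _ _ _ _ C) => // w; exact: kC.
have iZ : integ P' (fun w => f (Z w)) by apply: (@integ_bounded _ _ _ _ _ C) => // w; exact: fC.
have cE : (fun n : nat => Ex P' (fun w => inf_conv f n%:R (Z w))) @ \oo --> Ex P' (fun w => f (Z w)).
 have [||||_ _ cE] := @dominated_convergence _ _ R P' setT measurableT
  (fun n w => (inf_conv f n%:R (Z w))%:E) (fun w => (f (Z w))%:E) (fun=> C%:E) _ _ _ (integ_cst P' C).
 - by move=> n; apply/measurable_EFinP; exact: mk.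
 - by apply/measurable_EFinP.
 - by apply: nearW => w _; apply: cvg_EFin; [exact: nearW|exact: cv].
 - by apply: nearW => w n _; rewrite lee_fin; exact: kC.
 by apply: fine_cvg; rewrite -ExE.
move: cE.
move=> /cvgrPdist_le/(_ (e / 2)) [|n _ /(_ n (leqnn n)) /= hn]; first by rewrite divr_gt0.
have e2 : 0 < e / 2 by rewrite divr_gt0.
have [N0 H0] := lipcvg (ler0n _ n) (inf_conv_lip fC (ler0n _ n)) e2.
exists N0 => N /H0 h; move: hn; rewrite ler_norml => /andP[_ hn].
have : Ex P (fun w => inf_conv f n%:R (X N w)) <= Ex P (fun w => f (X N w)).
 apply: Ex_le.
 - apply: (@integ_bounded _ _ _ _ _ C); last by move=> w; exact: kC.
  exact: (@mX N _ _ _ (ler0n _ n) (inf_conv_lip fC (ler0n _ n))).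
 - apply: (@integ_bounded _ _ _ _ _ C); last by move=> w; exact: fC.
  exact: (jcont_measurable (cX N) (@mX N) cf).
 - by move=> w; exact: (inf_conv_le fC (ler0n _ n)).
lra.
Qed.

Theorem weak_cvg_lip : weak_cvg_skorokhod P X P' Z.
Proof.
split=> [N||f cf [C fC]]; [exact: (lip_random_cadlag (cX N) (@mX N))|exact: (lip_random_cadlag cZ mZ)|].
have mf N : mfunT (fun w => f (X N w)) by exact: (jcont_measurable (cX N) (@mX N) cf).
have mfZ : mfunT (fun w => f (Z w)) by exact: (jcont_measurable cZ mZ cf).
have iX N : integ P (fun w => f (X N w)) by apply: (@integ_bounded _ _ _ _ _ C) => // w; exact: fC.
have iZ : integ P' (fun w => f (Z w)) by apply: (@integ_bounded _ _ _ _ _ C) => // w; exact: fC.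
have -> : ('E_P'[fun w => f (Z w)] = (Ex P' (fun w => f (Z w)))%:E)%E by rewrite unlock ExE.
have -> : (fun N => 'E_P[fun w => f (X N w)])%E = (fun N => (Ex P (fun w => f (X N w)))%:E).
 by apply/funext => N; rewrite unlock ExE.
apply: cvg_EFin; first exact: nearW.
apply/cvgrPdist_le => e e0.
have [N1 H1] := weak_lower cf fC e0.
have cf' : skorokhod_continuous (fun x => - f x).
 move=> x cx u u0; have [r r0 h] := cf x cx u u0; exists r => // y /h.
 rewrite (_ : - f x - - f y = - (f x - f y)); last by ring.
 by rewrite normrN.
have fC' x : cadlag x -> `|- f x| <= C by rewrite normrN; exact: fC.
have [N2 H2] := weak_lower cf' fC' e0.
exists (maxn N1 N2) => // N /=; rewrite geq_max => /andP[n1 n2].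
have h1 := H1 N n1; have := H2 N n2.
rewrite !ExN// => h2; rewrite ler_norml; apply/andP; split; lra.
Qed.
End weak.

Lemma cadlag_step (K : nat) (v : nat -> R) : cadlag (fun t => v (Num.truncn (K%:R * t))).
Proof.
split=> t.
 move=> /andP[t0 t1]; apply: (@cvg_trans _ (cst (v (Num.truncn (K%:R * t))) @ t^'+)); last exact: cvg_cst.
 apply: near_eq_cvg.
 have kt : 0 <= K%:R * t by rewrite mulr_ge0.
 have /andP[h1 h2] := truncn_itv kt.
 pose s1 := t + ((Num.truncn (K%:R * t)).+1%:R - K%:R * t) / (K%:R + 1).
 have K1 : 0 < K%:R + 1 :> R by rewrite ltr_wpDl.
 have ts : t < s1 by rewrite ltrDl divr_gt0// subr_gt0.
 near=> s; congr v; apply/esym; apply: truncn_def; apply/andP; split.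
  by apply: le_trans h1 _; rewrite ler_wpM2l//; apply: ltW; near: s; exact: nbhs_right_gt.
 have st : t < s by near: s; exact: nbhs_right_gt.
 have ss : s < s1 by near: s; exact: nbhs_right_lt.
 have : (s - t) * (K%:R + 1) < (Num.truncn (K%:R * t)).+1%:R - K%:R * t.
  by rewrite -ltr_pdivlMr// ltrBlDl.
 by lra.
(* Just before t the index is ceil (K t) - 1, also when K t is an integer. *)
move=> /andP[t0 t1]; apply/cvg_ex; exists (v (`|Num.ceil (K%:R * t)|.-1)%N).
apply: (@cvg_trans _ (cst (v (`|Num.ceil (K%:R * t)|.-1)%N) @ t^'-)); last exact: cvg_cst.
apply: near_eq_cvg.
have [->|K0] := posnP K.
 by near=> s; congr v; rewrite !mul0r ceil0 truncn0.
have KR : 0 < K%:R :> R by rewrite ltr0n.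
have kt : 0 < K%:R * t by rewrite mulr_gt0.
have /andP[h1 h2] := ceil_itv (K%:R * t).
have c0 : 0 < Num.ceil (K%:R * t) by rewrite ceil_gt0.
pose m := `|Num.ceil (K%:R * t)|.-1.
have mE : Num.ceil (K%:R * t) = m.+1%:Z by rewrite /m; move: c0; clear; lia.
rewrite mE (_ : m.+1%:Z - 1 = m%:Z) in h1 h2; last by clear; lia.
have ts : m%:R / K%:R < t by rewrite ltr_pdivrMr// mulrC.
near=> s; congr v; apply/esym; rewrite -/m; apply: truncn_def; apply/andP; split.
 rewrite mulrC -ler_pdivrMr//; apply: ltW; near: s; exact: nbhs_left_gt.
apply: lt_le_trans h2; rewrite ltr_pM2l//; near: s; exact: nbhs_left_lt.
Unshelve. all: end_near. Qed.
End sup_norm.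

(** * Step paths whose values are polynomials *)

Section polynomial_steps.
Context {R : realType}.

Definition bounded_on_boxes {n} (f : {ffun 'I_n -> R} -> R) :=
 forall r, exists2 C : R, 0 < C & forall u : {ffun 'I_n -> R}, (forall Z, `|u Z| <= r) -> `|f u| <= C.

Lemma unif_add {n} (f h : {ffun 'I_n -> R} -> R) :
 unif_on_boxes f /\ bounded_on_boxes f -> unif_on_boxes h /\ bounded_on_boxes h ->
 unif_on_boxes (fun u => f u + h u) /\ bounded_on_boxes (fun u => f u + h u).
Proof.
move=> [uf bf] [uh bh]; split.
 move=> r e e0; have [a a0 Ha] := uf r (e / 2) ltac:(by rewrite divr_gt0).
 have [b b0 Hb] := uh r (e / 2) ltac:(by rewrite divr_gt0).
 exists (Num.min a b); first by rewrite lt_min a0.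
 move=> u v ur uv; have -> : f u + h u - (f v + h v) = (f u - f v) + (h u - h v) by ring.
 apply: le_trans (ler_normD _ _) _; rewrite [leRHS]splitr; apply: lerD.
  by apply: Ha => // Z; apply: le_trans (uv Z) _; rewrite ge_min lexx.
 by apply: Hb => // Z; apply: le_trans (uv Z) _; rewrite ge_min lexx orbT.
move=> r; have [a a0 Ha] := bf r; have [b b0 Hb] := bh r; exists (a + b); first exact: addr_gt0.
by move=> u ur; apply: le_trans (ler_normD _ _) _; apply: lerD; [exact: Ha|exact: Hb].
Qed.

Lemma unif_mul {n} (f h : {ffun 'I_n -> R} -> R) :
 unif_on_boxes f /\ bounded_on_boxes f -> unif_on_boxes h /\ bounded_on_boxes h ->
 unif_on_boxes (fun u => f u * h u) /\ bounded_on_boxes (fun u => f u * h u).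
Proof.
move=> [uf bf] [uh bh]; split; last first.
 move=> r; have [a a0 Ha] := bf r; have [b b0 Hb] := bh r; exists (a * b); first exact: mulr_gt0.
 by move=> u ur; rewrite normrM; apply: ler_pM => //; [exact: Ha|exact: Hb].
(* The point v may leave the box of u by at most 1, hence the bound of h on the larger box. *)
move=> r e e0; have [A A0 HA] := bf r; have [B B0 HB] := bh (r + 1).
have [a a0 Ha] := uf r (e / (2 * B)) ltac:(by rewrite divr_gt0// mulr_gt0).
have [b b0 Hb] := uh r (e / (2 * A)) ltac:(by rewrite divr_gt0// mulr_gt0).
exists (Num.min 1 (Num.min a b)); first by rewrite !lt_min ltr01 a0.
move=> u v ur uv; have -> : f u * h u - f v * h v = f u * (h u - h v) + (f u - f v) * h v by ring.
apply: le_trans (ler_normD _ _) _; rewrite [leRHS]splitr !normrM; apply: lerD.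
 have -> : e / 2 = A * (e / (2 * A)) by field; rewrite gt_eqF.
 apply: ler_pM => //; first exact: HA.
 by apply: Hb => // Z; apply: le_trans (uv Z) _; rewrite !ge_min lexx !orbT.
have -> : e / 2 = (e / (2 * B)) * B by field; rewrite gt_eqF.
apply: ler_pM => //.
 by apply: Ha => // Z; apply: le_trans (uv Z) _; rewrite !ge_min lexx !orbT.
apply: HB => Z; have -> : v Z = u Z - (u Z - v Z) by ring.
apply: le_trans (ler_normB _ _) _; apply: lerD => //.
by apply: le_trans (uv Z) _; rewrite ge_min lexx.
Qed.

Lemma unif_cst {n} (c : R) : unif_on_boxes (fun _ : {ffun 'I_n -> R} => c) /\
 bounded_on_boxes (fun _ : {ffun 'I_n -> R} => c).
Proof.
split=> [r e e0|r]; first by exists 1 => // u v _ _; rewrite subrr normr0 ltW.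
by exists (`|c| + 1); [rewrite ltr_wpDl|move=> u _; rewrite lerDl].
Qed.

Lemma unif_proj {n} (Z : 'I_n) : unif_on_boxes (fun u : {ffun 'I_n -> R} => u Z) /\
 bounded_on_boxes (fun u : {ffun 'I_n -> R} => u Z).
Proof.
split=> [r e e0|r]; first by exists e => // u v _; apply.
by exists (`|r| + 1); [rewrite ltr_wpDl|move=> u ur; apply: le_trans (ur Z) _; rewrite ler_wpDr// ler_norm].
Qed.

Lemma unif_polyform {k n} (W : {ffun 'I_k -> 'I_n} -> R) :
 unif_on_boxes (polyform W) /\ bounded_on_boxes (polyform W).
Proof.
have E : polyform W = fun u => \sum_(l <- enum [pred l : {ffun 'I_k -> 'I_n} | injectiveb l])
  W l * \prod_(q <- enum 'I_k) u (l q).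
 by apply/funext => u; rewrite /polyform big_enum; apply: eq_bigr => l _; rewrite big_enum.
rewrite E; elim: (enum _) => [|l s IH].
 by under eq_fun do rewrite big_nil; exact: unif_cst.
under eq_fun do rewrite big_cons; apply: unif_add => //; apply: unif_mul; first exact: unif_cst.
elim: (enum 'I_k) => [|q t IHq].
 by under eq_fun do rewrite big_nil; exact: unif_cst.
by under eq_fun do rewrite big_cons; apply: unif_mul => //; exact: unif_proj.
Qed.

(* a path that is constant on the intervals [j/K, (j+1)/K[ *)
Definition stepf (K : nat) (v : nat -> R) (t : R) : R := v (Num.truncn (K%:R * t)).

Lemma near_stepf K v v' r : (forall j, (j <= K)%N -> `|v j - v' j| <= r) -> near r (stepf K v) (stepf K v').
Proof.
move=> h t /andP[t0 t1]; apply: h.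
rewrite -(ler_nat R); apply: le_trans (_ : K%:R * t <= _); last by rewrite ler_piMr.
by have := truncn_le (K%:R * t); rewrite mulr_ge0.
Qed.

Lemma unif_stepf {n} K (v : nat -> {ffun 'I_n -> R} -> R) k C F : 0 <= k -> lip k C F ->
 (forall j, unif_on_boxes (v j)) -> unif_on_boxes (fun u => F (stepf K (v ^~ u))).
Proof.
move=> k0 [_ lF] uv r e e0.
have e' : 0 < e / (k + 1) by rewrite divr_gt0// ltr_wpDl.
have [h Hh] := choice (fun j => let: ex_intro2 h h0 H := uv j r _ e' in ex_intro (fun h => 0 < h /\ _) h (conj h0 H)).
have [m Hm] := fin_bound (fun j : 'I_K.+1 => (h j)^-1).
exists (m%:R + 1)^-1; first by rewrite invr_gt0 ltr_wpDl.
move=> u u' ur uu'.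
have n1 : near (e / (k + 1)) (stepf K (v ^~ u)) (stepf K (v ^~ u')).
 apply: near_stepf => j jK; have [h0 H] := Hh j; apply: H => // Z; apply: le_trans (uu' Z) _.
 rewrite -[leRHS]invrK lef_pV2 ?posrE ?invr_gt0 ?ltr_wpDl//.
 have := Hm (Ordinal (jK : (j < K.+1)%N)); rewrite /= => hm; apply: le_trans hm _; by rewrite lerDl.
have ke : k * (e / (k + 1)) <= e.
 rewrite mulrCA ler_piMr ?(ltW e0)// ler_pdivrMr ?ltr_wpDl// mul1r lerDl.
 exact: ler01.
have c1 := cadlag_step K (v ^~ u); have c2 := cadlag_step K (v ^~ u').
have h1 := lF _ _ _ c1 c2 n1; have h2 := lF _ _ _ c2 c1 (near_sym n1).
rewrite -/(stepf K (v ^~ u)) -/(stepf K (v ^~ u')) in h1 h2.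
by rewrite ler_norml; apply/andP; split; lra.
Qed.

(** If the supremum distance is at most r, a K-Lipschitz functional moves by at most K r <= eta +
    K^2 r^2 / (4 eta). A majorant [Q] of the squared distance thus controls expectations, and the
    supremum itself need not be measurable. *)
Lemma Ex_lip_le {d} {T : measurableType d} (P : probability T R) (X Y : T -> R -> R) (Q : T -> \bar R) K C F (E eta : R) :
 (forall w, cadlag (X w)) -> (forall w, cadlag (Y w)) ->
 mfunT (fun w => F (X w)) -> mfunT (fun w => F (Y w)) ->
 (forall w, 0 <= Q w)%E -> mfunT Q -> (\int[P]_w Q w <= E%:E)%E ->
 (forall w t, 0 <= t <= 1 -> (((X w t - Y w t) ^+ 2)%:E <= Q w)%E) ->
 0 < K -> lip K C F -> 0 < eta ->
 Ex P (fun w => F (X w)) <= Ex P (fun w => F (Y w)) + eta + K ^+ 2 / (4 * eta) * E.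
Proof.
move=> cX cY mX mY Q0 mQ QE XY K0 [bF lF] eta0.
pose D w := F (X w) - F (Y w) - eta; pose c := K ^+ 2 / (4 * eta).
have c0 : 0 < c by apply: divr_gt0; [exact: exprn_gt0|exact: mulr_gt0].
have DQ w : ((Num.max (D w) 0)%:E <= c%:E * Q w)%E.
 have cQ : (0 <= c%:E * Q w)%E by apply: mule_ge0 => //; rewrite lee_fin ltW.
 rewrite EFin_max ge_max cQ andbT.
 move: (Q0 w) (XY w); case: (Q w) => [q||]// q0 xy; last first.
  by rewrite gt0_muley ?leey// lte_fin.
 rewrite -EFinM lee_fin.
 have n : near (Num.sqrt q) (X w) (Y w).
  by move=> t t01; rewrite -sqrtr_sqr; apply: ler_wsqrtr; have := xy t t01; rewrite lee_fin.
 have := lF _ _ _ (cX w) (cY w) n; rewrite lee_fin in q0.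
 have sq := sqr_sqrtr q0; move: (Num.sqrt q) sq => s sq h.
 have : K * s <= eta + c * q.
  rewrite /c -sq -subr_ge0.
  have -> : eta + K ^+ 2 / (4 * eta) * s ^+ 2 - K * s = (eta - K * s / 2) ^+ 2 / eta by field; rewrite gt_eqF.
  by apply: divr_ge0; [exact: sqr_ge0|exact: ltW].
 by rewrite /D; lra.
have iX : integ P (fun w => F (X w)) by apply: (@integ_bounded _ _ _ _ _ C) => // w; exact: bF.
have iY : integ P (fun w => F (Y w)) by apply: (@integ_bounded _ _ _ _ _ C) => // w; exact: bF.
have iD : integ P D by apply: integB; [exact: integB|exact: integ_cst].
have iM : integ P (fun w => Num.max (D w) 0).
 apply: (integ_le _ _ iD); first by apply: measurable_maxr => //; exact: integ_meas iD.
 by move=> w; rewrite ger0_norm ?le_max ?lexx ?orbT// ge_max ler_norm normr_ge0.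
have : Ex P D <= c * E.
 apply: (@le_trans _ _ (Ex P (fun w => Num.max (D w) 0))).
  by apply: Ex_le => // w; rewrite le_max lexx.
 rewrite -lee_fin -ExE//; apply: (@le_trans _ _ (\int[P]_w (c%:E * Q w))%E).
  by apply: ge0_le_integral_any => // w; rewrite lee_fin le_max lexx orbT.
 rewrite ge0_integralZl_EFin ?(ltW c0)// [X in (_ <= X)%E]EFinM; apply: lee_wpmul2l => //.
 by rewrite lee_fin ltW.
rewrite /D ExB ?ExB ?Ex_cst//; [|exact: integB|exact: integ_cst].
by rewrite -/c; lra.
Qed.

Lemma lip_weaken (K K' C : R) (F : (R -> R) -> R) : K <= K' -> lip K C F -> lip K' C F.
Proof.
move=> KK' [bF lF]; split=> // r x y cx cy n; apply: le_trans (lF r x y cx cy n) _.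
by rewrite lerD2l ler_wpM2r// (near_ge0 n).
Qed.

(** One-sided limits pass to uniform limits; the left limits, not known in advance, come from the
    Cauchy criterion. *)
Lemma cadlag_near (z : R -> R) (x : nat -> R -> R) : (forall n, cadlag (x n)) ->
 (forall e, 0 < e -> exists n, near e z (x n)) -> cadlag z.
Proof.
move=> cx nz; split=> t.
 move=> /andP[t0 t1]; apply/cvgrPdist_le => e e0.
 have [n hn] := nz (e / 3) ltac:(by rewrite divr_gt0).
 have [/(_ t ltac:(by rewrite t0)) /cvgrPdist_le/(_ (e / 3) ltac:(by rewrite divr_gt0)) h _] := cx n.
 near=> s; have hs : `|x n t - x n s| <= e / 3 by near: s.
 have ts : t < s by near: s; exact: nbhs_right_gt.
 have s1 : s < 1 by near: s; exact: nbhs_right_lt.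
 have z1 := hn t ltac:(by rewrite t0 ltW).
 have z2 := hn s ltac:(by rewrite (ltW s1) andbT; exact: ltW (le_lt_trans t0 ts)).
 have -> : z t - z s = (z t - x n t) + (x n t - x n s) - (z s - x n s) by ring.
 apply: le_trans (ler_normB _ _) _; have := ler_normD (z t - x n t) (x n t - x n s); lra.
move=> /andP[t0 t1]; apply/cauchy_cvgP; apply/cauchy_exP => e e0.
have [n hn] := nz (e / 3) ltac:(by rewrite divr_gt0).
have [_ /(_ t ltac:(by rewrite t0)) cl] := cx n.
have /cvg_ex[l /cvgrPdist_le/(_ (e / 3) ltac:(by rewrite divr_gt0)) h] := cl.
suff Hs : \forall s \near t^'-, ball l e (z s) by exists l.
near=> s; have hs : `|l - x n s| <= e / 3 by near: s; exact: h.
have ts : s < t by near: s; exact: nbhs_left_lt.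
have s0 : 0 < s by near: s; exact: nbhs_left_gt.
have z2 := hn s ltac:(by rewrite (ltW s0) (le_trans (ltW ts))).
rewrite /ball/=; have -> : l - z s = (l - x n s) - (z s - x n s) by ring.
by apply: le_lt_trans (ler_normB _ _) _; lra.
Unshelve. all: end_near. Qed.
End polynomial_steps.

(** * Approximating levels on the Brownian space *)

Section limit.
Context {R : realType} {k : nat} (g : 'rV[R]_k -> R) (L : {ffun 'I_k -> nat} -> R) (alpha c2 : R).
Hypotheses (k0 : (0 < k)%N) (gB : is_GHKB alpha g) (adm : admissible L).
Local Notation H := (alpha + k%:R / 2 + 1).
Local Notation lam := (@lebesgue_tuple R k).
Local Notation grid := (grid_kernel g L alpha).

Definition block_poly (p l j : nat) (u : {ffun 'I_(2 ^ l + 2 ^ l * 2 ^ l) -> R}) : R :=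
 @coarse_poly R k g L alpha l (j * 2 ^ (l - p))%N u.

Lemma unif_block_poly p l j : unif_on_boxes (fun u => c2 * @block_poly p l j u).
Proof.
exact: (unif_mul (unif_cst c2) (@unif_polyform R k _ (fun v : {ffun 'I_k -> 'I_(2 ^ l + 2 ^ l * 2 ^ l)} =>
 (2 ^ l)%:R `^ (- (k%:R / 2)) * grid (2 ^ l) (2 ^ l * 2 ^ l) (j * 2 ^ (l - p))%N (cell_index (2 ^ l * 2 ^ l) v)))).1.
Qed.

Context {d} {T : measurableType d} (P : probability T R) (B : R -> {RV P >-> R}).
Hypothesis HB : is_brownian P (fun t => B t).

Definition bm_blocks l (w : T) : {ffun 'I_(2 ^ l + 2 ^ l * 2 ^ l) -> R} :=
 [ffun Z : 'I_(2 ^ l + 2 ^ l * 2 ^ l) => bm_rv B (2 ^ l) ((Z : nat)%:Z + 1 - (2 ^ l * 2 ^ l)%N%:Z) w].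

(** Increments telescope: block sums of fine Brownian noise are exactly coarse Brownian noise. The
    coarse polynomial in B therefore does not depend on the fine scale. *)
Lemma bsum_bm l m w : (0 < m)%N ->
 bsum m (shift_noise (bm_rv B (m * 2 ^ l)) (m * (2 ^ l * 2 ^ l)) ^~ w) = bm_blocks l w.
Proof.
move=> m0; apply/ffunP => Z; rewrite !ffunE; have mR : 0 < m%:R :> R by rewrite ltr0n.
have lR : 0 < (2 ^ l)%:R :> R by rewrite ltr0n expn_gt0.
pose t (r : nat) : R := ((Z * m + r)%N%:Z - (m * (2 ^ l * 2 ^ l))%N%:Z)%:~R / (m * 2 ^ l)%:R.
have -> : \sum_(r < m) shift_noise (bm_rv B (m * 2 ^ l)) (m * (2 ^ l * 2 ^ l)) (Z * m + r) w =
  Num.sqrt (m * 2 ^ l)%:R * (B (t m) w - B (t 0%N) w).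
 rewrite -(telescope_sumr (fun r => B (t r) w) (leq0n m)) big_mkord mulr_sumr.
 apply: eq_bigr => r _; rewrite /shift_noise /bm_rv /bm_noise /t; congr (_ * (B (_ / _) w - B (_ / _) w)).
  by congr (_%:~R); clear; lia.
 by congr (_%:~R); clear; lia.
rewrite natrM sqrtrM ?ler0n// mulrA mulrA mulVf ?mul1r; last by rewrite gt_eqF// sqrtr_gt0.
rewrite /bm_rv /bm_noise; congr (_ * (B _ w - B _ w)); rewrite /t.
 rewrite (_ : ((Z * m + m)%N%:Z - (m * (2 ^ l * 2 ^ l))%N%:Z) = m%:Z * ((Z : nat)%:Z + 1 - (2 ^ l * 2 ^ l)%N%:Z)); last first.
  by rewrite mulrBr mulrDr mulr1 !PoszM !PoszD PoszM [(Z : nat)%:Z * m%:Z]mulrC.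
 by rewrite intrM natrM -mulf_div divff ?mul1r// gt_eqF.
rewrite (_ : ((Z * m + 0)%N%:Z - (m * (2 ^ l * 2 ^ l))%N%:Z) = m%:Z * ((Z : nat)%:Z + 1 - (2 ^ l * 2 ^ l)%N%:Z - 1)); last first.
 by rewrite addrAC addrK mulrBr addn0 !PoszM [(Z : nat)%:Z * m%:Z]mulrC.
by rewrite intrM natrM -mulf_div divff ?mul1r// gt_eqF.
Qed.

Let bmN N : (0 < N)%N -> mutually_independent P (fun z : int => bm_rv B N z : T -> R).
Proof. exact: bm_indep. Qed.

Definition bm_path l (w : T) (t : R) : R := (2 ^ l)%:R `^ (- H) *
 chaos_sum g L (fun z => bm_rv B (2 ^ l) z w) (2 ^ l * 2 ^ l) (Num.truncn ((2 ^ l)%:R * t)).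

(** Small enough to stay summable after multiplication by the weights 4^i, which turn into the rate
    2^(- i) for paths. *)
Let E (i : nat) : R := 16 ^- i.
Let E0 i : 0 < E i. Proof. by rewrite invr_gt0 exprn_gt0. Qed.

Let core i := cid (core_approx k0 gB adm (E0 i)).
Let p i := sval (core i).
Let core2 i := cid (svalP (core i)).
Let l i := sval (core2 i).
Let core3 i := cid (svalP (core2 i)).
Let m0 i := sval (core3 i).

Definition level_p := p.
Definition level_l := l.

Lemma level_core i : (level_p i <= level_l i)%N /\
 exists m0 : nat, forall (d : measure_display) (T : measurableType d) (P : probability T R) (eps : int -> {RV P >-> R}),
 mutually_independent P (fun i : int => eps i : T -> R) ->
 (forall z, Ex P (eps z) = 0) -> (forall z, (e2 P (eps z) <= 1%:E)%E) ->
 forall N M, (m0 <= N)%N -> (N * N <= M)%N -> (0 < N %/ 2 ^ level_l i)%N /\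
 exists Q : T -> R, [/\ mfunT Q, forall w, 0 <= Q w, (\int[P]_w (Q w)%:E <= (E i)%:E)%E &
  forall w (t : R), 0 <= t <= 1 ->
   (N%:R `^ (- H) * chaos_sum g L (fun z => eps z w) M (Num.truncn (N%:R * t)) -
    stepf (2 ^ level_p i) (fun j => @block_poly (level_p i) (level_l i) j
     (bsum (N %/ 2 ^ level_l i) (shift_noise eps (N %/ 2 ^ level_l i * (2 ^ level_l i * 2 ^ level_l i)) ^~ w))) t) ^+ 2 <= Q w].
Proof.
have [h1 h2] := svalP (core3 i); split=> //; exists (m0 i) => *.
exact: h2.
Qed.

Let V i (w : T) : R -> R := stepf (2 ^ level_p i) (fun j => @block_poly (level_p i) (level_l i) j (bm_blocks (level_l i) w)).

Lemma bm_core i : exists L0, forall l', (L0 <= l')%N ->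
 exists Q : T -> R, [/\ mfunT Q, forall w, 0 <= Q w, (\int[P]_w (Q w)%:E <= (E i)%:E)%E &
  forall w (t : R), 0 <= t <= 1 -> (bm_path l' w t - V i w t) ^+ 2 <= Q w].
Proof.
have [_ [n0 h]] := level_core i; exists (n0 + level_l i)%N => l' hl.
have N0 : (0 < 2 ^ l')%N by rewrite expn_gt0.
have n0l : (n0 <= 2 ^ l')%N.
 by apply: leq_trans (ltnW (ltn_expl l' _)) => //; apply: leq_trans hl; exact: leq_addr.
have ll : (level_l i <= l')%N by apply: leq_trans hl; exact: leq_addl.
have [m0' [Q [mQ Q0 QE HQ]]] := h _ _ P (bm_rv B (2 ^ l')) (bmN N0) (fun z => let: And4 _ h _ _ := bm_moments HB N0 z in h)
 (fun z => bm_e2 HB N0 z) (2 ^ l')%N (2 ^ l' * 2 ^ l')%N n0l (leqnn _).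
exists Q; split=> // w t t01; have := HQ w t t01.
set m := (2 ^ l' %/ 2 ^ level_l i)%N in m0' *.
have mE : (2 ^ l' = m * 2 ^ level_l i)%N by rewrite divnK// dvdn_exp2l.
have bE : bsum m (fun x => shift_noise (bm_rv B (2 ^ l')) (m * (2 ^ level_l i * 2 ^ level_l i)) x w) =
  bm_blocks (level_l i) w by rewrite {1}mE bsum_bm.
by rewrite bE.
Qed.

(** Levels i and i + 1 are both close to [bm_path] at one sufficiently fine scale. *)
Let R_ex i : exists Q : T -> R, [/\ mfunT Q, forall w, 0 <= Q w, (\int[P]_w (Q w)%:E <= (4 * E i)%:E)%E &
  forall w (t : R), 0 <= t <= 1 -> (V i.+1 w t - V i w t) ^+ 2 <= Q w].
Proof.
have [L1 h1] := bm_core i; have [L2 h2] := bm_core i.+1.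
have [Q1 [mQ1 Q10 Q1E HQ1]] := h1 _ (leq_maxl L1 L2).
have [Q2 [mQ2 Q20 Q2E HQ2]] := h2 _ (leq_maxr L1 L2).
exists (fun w => 2 * Q1 w + 2 * Q2 w); split.
- by apply: measurable_funD; apply: measurable_funM.
- by move=> w; apply: addr_ge0; apply: mulr_ge0.
- under eq_integral do rewrite EFinD !EFinM.
 have mE1 : mfunT (fun w => (Q1 w)%:E) by apply/measurable_EFinP.
 have mE2 : mfunT (fun w => (Q2 w)%:E) by apply/measurable_EFinP.
 rewrite ge0_integralD//; last 4 first.
 + by move=> w _; apply: mule_ge0; rewrite // lee_fin.
 + exact: emeasurable_funM.
 + by move=> w _; apply: mule_ge0; rewrite // lee_fin.
 + exact: emeasurable_funM.
 rewrite !ge0_integralZl_EFin//; last 2 first.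
 + by move=> w _; rewrite lee_fin.
 + by move=> w _; rewrite lee_fin.
 apply: (@le_trans _ _ (2%:E * (E i)%:E + 2%:E * (E i)%:E)%E); last first.
  by rewrite -!EFinM -EFinD lee_fin; lra.
 apply: leeD; apply: lee_wpmul2l => //; apply: le_trans Q2E _.
 rewrite lee_fin /E lef_pV2 ?posrE ?exprn_gt0// exprS; apply: ler_peMl; last by lra.
 exact: exprn_ge0.
- move=> w t t01; have := HQ1 w t t01; have := HQ2 w t t01.
 set S := bm_path _ w t; move: (V i.+1 w t) (V i w t) => a b h3 h4.
 have -> : (a - b) ^+ 2 = 2 * (S - b) ^+ 2 + 2 * (S - a) ^+ 2 - (2 * S - a - b) ^+ 2 by ring.
 by have := sqr_ge0 (2 * S - a - b); lra.
Qed.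

Let Rq i := sval (cid (R_ex i)).
Let RqP i := svalP (cid (R_ex i)).
Let mRq i : mfunT (Rq i). Proof. by have [] := RqP i. Qed.
Let Rq0 i w : 0 <= Rq i w. Proof. by have [_ h _ _] := RqP i; exact: h. Qed.

(** Weighted square function of the increments between levels. Where it is finite, each increment is
    at most sqrt W times 2^(- i), uniformly in t. *)
Let W w : \bar R := (\sum_(i <oo) (4 ^+ i * Rq i w)%:E)%E.
Let W0 w : (0 <= W w)%E.
Proof. by apply: nneseries_ge0 => i _ _; rewrite lee_fin mulr_ge0// exprn_ge0. Qed.
Let mW4 i : mfunT (fun w => (4 ^+ i * Rq i w)%:E).
Proof. by apply/measurable_EFinP; apply: measurable_funM. Qed.
Let mW : mfunT W.
Proof. by apply: ge0_emeasurable_sum => // i w _ _; rewrite lee_fin mulr_ge0// exprn_ge0. Qed.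

Let WE : exists K : R, 0 <= K /\ (\int[P]_w W w <= K%:E)%E.
Proof.
exists 8; split=> //; rewrite /W integral_nneseries//; last first.
 by move=> i w _; rewrite lee_fin mulr_ge0// exprn_ge0.
apply: (@le_trans _ _ (\sum_(i <oo) (4 / (2 ^ i.+1)%:R * 2)%:E)%E).
 apply: lee_nneseries => [i _ _|i _].
  by apply: integral_ge0 => w _; rewrite lee_fin mulr_ge0// exprn_ge0.
 under eq_integral do rewrite EFinM.
 rewrite ge0_integralZl_EFin ?exprn_ge0//; last 2 first.
 - by move=> w _; rewrite lee_fin.
 - by apply/measurable_EFinP.
 have [_ _ h _] := RqP i; apply: le_trans (lee_wpmul2l _ h) _; first by rewrite lee_fin exprn_ge0.
 rewrite -EFinM lee_fin /E natrX exprS.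
 have -> : (16 : R) ^+ i = 4 ^+ i * 4 ^+ i by rewrite -exprMn; congr (_ ^+ _); lra.
 have f4 : (4 : R) ^+ i != 0 by rewrite expf_neq0.
 have f2 : (2 : R) ^+ i != 0 by rewrite expf_neq0.
 have -> : 4 ^+ i * (4 * (4 ^+ i * 4 ^+ i)^-1) = 4 * (4 ^+ i)^-1 :> R by field; rewrite f4.
 have -> : 4 / (2 * 2 ^+ i) * 2 = 4 * (2 ^+ i)^-1 :> R by field; rewrite f2.
 rewrite ler_pM2l// lef_pV2 ?posrE ?exprn_gt0//; apply: lerXn2r; rewrite ?nnegrE//; lra.
have e8 i : 4 / (2 ^ i.+1)%:R * 2 = 8 / (2 ^ i.+1)%:R :> R by rewrite mulrAC; congr (_ / _); ring.
under eq_eseriesr => i _ do rewrite e8.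
exact: epsilon_trick0.
Qed.

Let step_bound i w t : (W w < +oo)%E -> 0 <= t <= 1 -> `|V i.+1 w t - V i w t| <= Num.sqrt (fine (W w)) * 2 ^- i.
Proof.
move=> Wf t01; have [_ _ _ h] := RqP i; have := h w t t01 => h1.
have Wfin : W w \is a fin_num by rewrite ge0_fin_numE.
have h2 : 4 ^+ i * Rq i w <= fine (W w).
 rewrite -lee_fin fineK//; apply: le_trans (nneseries_lim_ge i.+1 _) => /=; last first.
  by move=> j _; rewrite lee_fin mulr_ge0// exprn_ge0.
 rewrite big_nat_recr//=; apply: leeDr; apply: sume_ge0 => j _; by rewrite lee_fin mulr_ge0// exprn_ge0.
have h3 : (V i.+1 w t - V i w t) ^+ 2 <= fine (W w) * (2 ^- i) ^+ 2.
 apply: le_trans h1 _; rewrite exprVn -exprM mulnC exprM (_ : (2 : R) ^+ 2 = 4); last by lra.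
 by rewrite ler_pdivlMr ?exprn_gt0// mulrC.
have s2 : 0 <= Num.sqrt (fine (W w)) * 2 ^- i by rewrite mulr_ge0 ?sqrtr_ge0// invr_ge0 exprn_ge0.
rewrite -ler_sqr ?nnegrE// real_normK ?num_real// exprMn sqr_sqrtr//; exact: fine_ge0.
Qed.

(** The levels [p i] and [l i] are common to the Brownian approximation and to that of arbitrary
    noise, so that Lindeberg's exchange compares the same polynomial in two kinds of blocks. *)
Theorem level_scheme : exists (p l : nat -> nat) (W : T -> \bar R) (K : R),
 let V i w := stepf (2 ^ p i) (fun j => @block_poly (p i) (l i) j (bm_blocks (l i) w)) in
 [/\ forall w, (0 <= W w)%E, mfunT W, 0 <= K /\ (\int[P]_w W w <= K%:E)%E &
  forall i w t, (W w < +oo)%E -> 0 <= t <= 1 -> `|V i.+1 w t - V i w t| <= Num.sqrt (fine (W w)) * 2 ^- i] /\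
 (forall i, exists L0, forall l', (L0 <= l')%N ->
  exists Q : T -> R, [/\ mfunT Q, forall w, 0 <= Q w, (\int[P]_w (Q w)%:E <= (16 ^- i)%:E)%E &
   forall w (t : R), 0 <= t <= 1 -> (bm_path l' w t - V i w t) ^+ 2 <= Q w]) /\
 (forall i, exists m0 : nat, forall (d : measure_display) (T : measurableType d) (P : probability T R) (eps : int -> {RV P >-> R}),
  mutually_independent P (fun i : int => eps i : T -> R) ->
  (forall z, Ex P (eps z) = 0) -> (forall z, (e2 P (eps z) <= 1%:E)%E) ->
  forall N M, (m0 <= N)%N -> (N * N <= M)%N -> (0 < N %/ 2 ^ l i)%N /\
  exists Q : T -> R, [/\ mfunT Q, forall w, 0 <= Q w, (\int[P]_w (Q w)%:E <= (16 ^- i)%:E)%E &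
   forall w (t : R), 0 <= t <= 1 ->
    (N%:R `^ (- H) * chaos_sum g L (fun z => eps z w) M (Num.truncn (N%:R * t)) -
     stepf (2 ^ p i) (fun j => @block_poly (p i) (l i) j
      (bsum (N %/ 2 ^ l i) (shift_noise eps (N %/ 2 ^ l i * (2 ^ l i * 2 ^ l i)) ^~ w))) t) ^+ 2 <= Q w]).
Proof.
have [K KE] := WE; exists level_p, level_l, W, K; split; [|split].
- by split=> // i w t; exact: step_bound.
- exact: bm_core.
- by move=> i; have [_ h] := level_core i.
Qed.
End limit.

(** * Geometric convergence and the limit path *)

Section geometric.
Context {R : realType}.
Implicit Types (v : nat -> R) (s x : R).

Let half (i : nat) : (2 : R) ^- i = 2 * 2 ^- i.+1.
Proof. by rewrite exprS invfM mulrA divff// mul1r. Qed.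

(** v j + 2 s 2^(- j) decreases while v j - 2 s 2^(- j) increases, so the infimum is a closed
    formula for the limit. *)
Lemma geom_lim v s : (forall i, `|v i.+1 - v i| <= s * 2 ^- i) ->
 forall i, `|inf (range (fun j => v j + 2 * s * 2 ^- j)) - v i| <= 2 * s * 2 ^- i.
Proof.
move=> h; set b := fun j => _; pose a j := v j - 2 * s * 2 ^- j.
have bd j : b j.+1 <= b j.
 by have := h j; rewrite /b ler_norml half => /andP[_]; move: (2 ^- j.+1) => y; lra.
have ad j : a j <= a j.+1.
 by have := h j; rewrite /a ler_norml half => /andP[+ _]; move: (2 ^- j.+1) => y; lra.
have s0 : 0 <= s.
 by have := le_trans (normr_ge0 _) (h 0%N); rewrite expr0 invr1 mulr1.
have ab j : a j <= b j.
 rewrite /a /b; have : 0 <= 2 * s * 2 ^- j :> R by rewrite !mulr_ge0// invr_ge0 exprn_ge0.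
 lra.
have am i n : a i <= a (i + n)%N by elim: n => [|n IH]; rewrite ?addn0// addnS; exact: le_trans IH (ad _).
have bm i n : b (i + n)%N <= b i by elim: n => [|n IH]; rewrite ?addn0// addnS; exact: le_trans (bd _) IH.
have abij i j : a i <= b j.
 by apply: le_trans (am i j) _; apply: le_trans (ab _) _; rewrite addnC; exact: bm.
move=> i; have lo : a i <= inf (range b).
 by apply: lb_le_inf; [exists (b 0%N); exists 0%N|move=> _ [j _ <-]].
have hi : inf (range b) <= b i.
 by apply: ge_inf; [exists (a 0%N) => _ [j _ <-]|exists i].
by move: lo hi; rewrite /a /b ler_norml => ? ?; apply/andP; split; lra.
Qed.

Lemma geom_cvg v s x : (forall i, `|x - v i| <= s * 2 ^- i) -> v i @[i --> \oo] --> x.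
Proof.
move=> h; apply/cvgrPdist_le => e e0.
have s0 : 0 <= s by have := le_trans (normr_ge0 _) (h 0%N); rewrite expr0 invr1 mulr1.
exists (Num.truncn (s / e)).+1 => // i /= hi; apply: le_trans (h i) _.
rewrite ler_pdivrMr ?exprn_gt0// mulrC -ler_pdivrMr//.
apply: le_trans (ltW (truncnS_gt _)) _; rewrite -natrX ler_nat.
by apply: leq_trans hi _; apply: ltnW; exact: ltn_expl.
Qed.
End geometric.

Section path_limit.
Context {d} {T : measurableType d} {R : realType} (P : probability T R).
Variables (V : nat -> T -> R -> R) (W : T -> \bar R).
Hypothesis W0 : forall w, (0 <= W w)%E.
Hypothesis mW : mfunT W.
Hypothesis step : forall i w t, (W w < +oo)%E -> 0 <= t <= 1 ->
 `|V i.+1 w t - V i w t| <= Num.sqrt (fine (W w)) * 2 ^- i.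
Hypothesis cV : forall i w, cadlag (V i w).
Hypothesis mV : forall i t, mfunT (fun w => V i w t).

Let S w := Num.sqrt (fine (W w)).
Let fin : set T := [set w | (W w < +oo)%E].
Let mfin : measurable fin.
Proof.
have -> : fin = setT `&` W @^-1` `[0%E, +oo%E[%classic.
 by rewrite setTI; apply/seteqP; split=> w /=; rewrite in_itv/= W0.
by apply: mW => //; exact: emeasurable_itv.
Qed.

(** The value 0 where W is infinite makes every path cadlag, without exceptional set. *)
Definition path_limit w t : R :=
 if (W w < +oo)%E then inf (range (fun j => V j w t + 2 * S w * 2 ^- j)) else 0.

Lemma path_limit_close i w t : (W w < +oo)%E -> 0 <= t <= 1 ->
 `|path_limit w t - V i w t| <= 2 * S w * 2 ^- i.
Proof. by move=> wf t01; rewrite /path_limit wf; apply: geom_lim => j; exact: step. Qed.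

(** Holds for every w: where W is infinite the right-hand side is +oo. *)
Lemma path_limit_sq i w t : 0 <= t <= 1 ->
 (((path_limit w t - V i w t) ^+ 2)%:E <= (4 * 4 ^- i)%:E * W w)%E.
Proof.
move=> t01; have c0 : 0 < 4 * 4 ^- i :> R by rewrite mulr_gt0// invr_gt0 exprn_gt0.
have [wf|] := boolP (W w < +oo)%E; last first.
 by rewrite ltey negbK => /eqP ->; rewrite gt0_muley ?leey// lte_fin.
have Wf : W w \is a fin_num by rewrite ge0_fin_numE.
rewrite -(fineK Wf) -EFinM lee_fin -(real_normK (num_real _)).
have f0 : 0 <= fine (W w) by exact: fine_ge0.
have := path_limit_close i wf t01 => h.
apply: le_trans (_ : (2 * S w * 2 ^- i) ^+ 2 <= _).
 by rewrite ler_sqr// ?nnegrE// (le_trans _ h).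
rewrite !exprMn sqr_sqrtr// exprVn -exprM mulnC exprM (_ : (2 : R) ^+ 2 = 4); last by ring.
by rewrite le_eqVlt; apply/orP; left; apply/eqP; ring.
Qed.

Let ind w : R := \1_fin w.
Let mind : mfunT ind.
Proof. exact: measurable_indic. Qed.

Let ind1 w : (W w < +oo)%E -> ind w = 1.
Proof. by move=> h; rewrite /ind indicE mem_set. Qed.
Let ind0 w : ~~ (W w < +oo)%E -> ind w = 0.
Proof. by move=> h; rewrite /ind indicE memNset//; exact/negP. Qed.

Lemma measurable_path_limit t : 0 <= t <= 1 -> mfunT (fun w => path_limit w t).
Proof.
move=> t01; apply: (measurable_fun_cvg (h := fun i w => V i w t * ind w)) => [i|w _].
 by apply: measurable_funM.
have [wf|wf] := boolP (W w < +oo)%E.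
 apply: (@geom_cvg _ _ (2 * S w)) => i; rewrite ind1// mulr1; exact: path_limit_close.
apply: (@geom_cvg _ _ 0) => i; rewrite /path_limit (negbTE wf) ind0// mulr0 subr0 normr0 mul0r.
by [].
Qed.

Variable c : R.
Let Z w t := c * path_limit w t.

Let small (r e : R) : 0 < e -> exists i : nat, r * 2 ^- i <= e.
Proof.
move=> e0; exists (Num.truncn (r / e)).+1.
rewrite ler_pdivrMr ?exprn_gt0// mulrC -ler_pdivrMr//.
apply: le_trans (ltW (truncnS_gt _)) _; rewrite -natrX ler_nat.
by apply: ltnW; exact: ltn_expl.
Qed.

Let nearZ i w : (W w < +oo)%E -> near (`|c| * (2 * S w) * 2 ^- i) (Z w) (fun t => c * V i w t).
Proof.
move=> wf t t01; rewrite /Z -mulrBr normrM -mulrA ler_wpM2l//.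
exact: path_limit_close.
Qed.

Lemma cadlag_scale (x : R -> R) : cadlag x -> cadlag (fun t => c * x t).
Proof.
move=> [h1 h2]; split=> t t01; first by apply: cvgMr; exact: h1.
by apply: is_cvgMr; exact: h2.
Qed.

Lemma cadlag_path_limit w : cadlag (fun t => c * path_limit w t).
Proof.
have [wf|wf] := boolP (W w < +oo)%E.
 apply: (@cadlag_near _ _ (fun i t => c * V i w t)) => [i|e e0]; first exact: cadlag_scale.
 have [i hi] := small (`|c| * (2 * S w)) e0; exists i => t t01.
 by apply: le_trans hi; exact: nearZ.
have -> : (fun t => c * path_limit w t) = cst 0.
 by apply/funext => t; rewrite /path_limit (negbTE wf) mulr0.
by split=> t t01; [exact: cvg_cst|exact: is_cvg_cst].
Qed.

(** A pointwise limit of measurable functions: F along the approximating paths where W is finite,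
    and the constant value of F at the zero path elsewhere. *)
Lemma measurable_lip_path_limit K C F : 0 <= K -> lip K C F ->
 (forall i, mfunT (fun w => F (fun t => c * V i w t))) ->
 mfunT (fun w => F (fun t => c * path_limit w t)).
Proof.
move=> K0 lF mF; have [bF FF] := lF.
apply: (measurable_fun_cvg (h := fun i w => F (fun t => c * V i w t) * ind w + F (cst 0) * (1 - ind w))) => [i|w _].
 by apply: measurable_funD; apply: measurable_funM => //; apply: measurable_funB.
have [wf|wf] := boolP (W w < +oo)%E.
 apply: (@geom_cvg _ _ (K * (`|c| * (2 * S w)))) => i; rewrite ind1// subrr mulr0 addr0 mulr1 -mulrA.
 have n1 := nearZ i wf.
 have n2 : near (`|c| * (2 * S w) * 2 ^- i) (fun t => c * V i w t) (Z w).
  by move=> t t01; rewrite distrC; exact: n1.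
 have cx := cadlag_path_limit w; have cy := cadlag_scale (cV i w).
 have := FF _ _ _ cx cy n1; have := FF _ _ _ cy cx n2 => ? ?.
 by rewrite ler_norml; apply/andP; split; lra.
apply: (@geom_cvg _ _ 0) => i; rewrite ind0// mulr0 add0r subr0 mulr1 mul0r.
have -> : (fun t => c * path_limit w t) = cst 0.
 by apply/funext => t; rewrite /path_limit (negbTE wf) mulr0.
by rewrite subrr normr0.
Qed.
End path_limit.

(** * The limit as a multiple Wiener-Ito integral *)

Section wiener.
Context {R : realType} {k : nat} (g : 'rV[R]_k -> R) (L : {ffun 'I_k -> nat} -> R) (alpha : R).
Hypotheses (k0 : (0 < k)%N) (gB : is_GHKB alpha g) (adm : admissible L).
Local Notation grid := (grid_kernel g L alpha).
Context {d} {T : measurableType d} (P : probability T R) (B : R -> {RV P >-> R}).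

Section grid_cells.
Variables (N M b : nat).
Hypothesis N0 : (0 < N)%N.
Local Notation K := (b + M).+1.
(** Partition starting at - M / N; its interval number n is the cell n + 1 - M. *)
Let tt (n : nat) : R := (n%:R - M%:R) / N%:R.
Let c (j : {ffun 'I_k -> 'I_K}) := grid N M b (cell_index M j).
Let NR : 0 < N%:R :> R. Proof. by rewrite ltr0n. Qed.

Lemma grid_coef_inj j : c j != 0 -> injective j.
Proof.
move=> cj; apply/injectiveP; apply: contraNT cj => jn; apply/eqP; apply: grid_kernel_inj.
by apply: contraNN jn => /injectiveP ci; apply/injectiveP => q q' e; apply: ci; rewrite !ffunE e.
Qed.

(** A cell carries a coefficient only at a lag between 1 and M before one of the times 1, ..., b,
    and all such cells belong to the array; elsewhere both sides vanish. *)
Lemma simple_kernel_grid x : simple_kernel tt c (row_tuple x) = grid N M b (zceil_tuple N x).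
Proof.
rewrite /simple_kernel.
have one (n : nat) (u : R) : \1_(`]tt n, tt n.+1]%classic) u = (n%:Z + 1 - M%:Z == zceil N u)%:R :> R.
 rewrite indicE eq_sym zceilP; congr (nat_of_bool _)%:R.
 have -> : (u \in `]tt n, tt n.+1]%classic) = (tt n < u <= tt n.+1).
  by apply/idP/idP; rewrite inE/= in_itv.
 rewrite /tt ltr_pdivrMr// ler_pdivlMr// [u * _]mulrC.
 have e1 : (n%:Z + 1 - M%:Z - 1)%:~R = n%:R - M%:R :> R.
  by rewrite !(rmorphB, rmorphD, rmorph1)/= -!pmulrn; ring.
 have e2 : (n%:Z + 1 - M%:Z)%:~R = n.+1%:R - M%:R :> R.
  by rewrite !(rmorphB, rmorphD, rmorph1)/= -!pmulrn -natr1; ring.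
 by rewrite e1 e2.
have ind (j : {ffun 'I_k -> 'I_K}) :
  \prod_(q < k) (\1_(`]tt (j q), tt (j q).+1]%classic) (row_tuple x ord0 q) : R) = (cell_index M j == zceil_tuple N x)%:R.
 under eq_bigr => q _ do rewrite mxE one.
 have [/eqP E|ne] := boolP (cell_index M j == _).
  rewrite big1// => q _; have := congr1 (fun f : {ffun 'I_k -> int} => f q) E.
  by rewrite !ffunE => ->; rewrite eqxx.
 have [q hq] : exists q, cell_index M j q != zceil_tuple N x q.
  apply/existsP; apply: contraNT ne; rewrite negb_exists => /forallP h.
  by apply/eqP/ffunP => q; have := h q; rewrite negbK => /eqP.
 by move: hq; rewrite !ffunE => hq; rewrite (bigD1 q)//= (negbTE hq) mul0r.
under eq_bigr => j _ do rewrite ind.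
move: (zceil_tuple N x) => z {ind}.
have [[j0 j0z]|zr] := pselect (exists j : {ffun 'I_k -> 'I_K}, cell_index M j = z).
 rewrite (bigD1 j0)//= j0z eqxx mulr1 big1 ?addr0 /c ?j0z// => j ne.
 rewrite (_ : (cell_index M j == z) = false) ?mulr0//; apply/negbTE; apply: contraNN ne => /eqP.
 rewrite -j0z => ej; apply/eqP/ffunP => q; apply: val_inj.
 by have := congr1 (fun f : {ffun 'I_k -> int} => f q) ej; rewrite !ffunE /=; clear; lia.
rewrite big1; last first.
 move=> j _; rewrite (_ : (cell_index M j == z) = false) ?mulr0//; apply/negbTE/eqP => h.
 by apply: zr; exists j.
apply/esym; rewrite /grid_kernel big1 ?mulr0// => n _; rewrite /cell_coef; case: ifPn => // /andP[/forallP h _].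
exfalso; apply: zr.
have hz q : (1 - M%:Z <= z q) /\ (z q <= (n : nat)%:Z).
 by have := h q; rewrite ffunE; move: (z q) (n : nat); clear; lia.
have bd q : (absz (z q - 1 + M%:Z)%R < K)%N.
 by have [] := hz q; have := ltn_ord n; move: (z q) (n : nat); clear; lia.
exists [ffun q => Ordinal (bd q)]; apply/ffunP => q; rewrite !ffunE /=.
by have [] := hz q; move: (z q) (n : nat); clear; lia.
Qed.

(** The factors sqrt N of the k normalised increments cancel N^(- k / 2). *)
Lemma simple_integral_grid w : simple_integral tt c (fun t => B t) w =
 N%:R `^ (- (alpha + k%:R / 2 + 1)) * chaos_sum g L (fun z => bm_rv B N z w) M b.
Proof.
rewrite (@chaos_sumE _ _ g L alpha _ N M b M K)//; last by apply: leqW; exact: leqnSn.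
rewrite /simple_integral (bigID (fun j : {ffun 'I_k -> 'I_K} => injectiveb j))/= [X in _ + X]big1 ?addr0; last first.
 move=> j jn; have [->|cj] := eqVneq (c j) 0; first exact: mul0r.
 by move/negP: jn; case; apply/injectiveP; exact: grid_coef_inj.
apply: eq_bigr => j _; rewrite -/(c j).
have -> : \prod_q bm_rv B N (cell_index M j q) w =
  Num.sqrt N%:R ^+ k * \prod_(q < k) (B (tt (j q).+1) w - B (tt (j q)) w).
 rewrite (eq_bigr (fun q => Num.sqrt N%:R * (B (tt (j q).+1) w - B (tt (j q)) w))).
  by rewrite big_split/= prodr_const card_ord.
 move=> q _; rewrite ffunE /bm_rv /= /bm_noise /tt; congr (_ * (B (_ / _) w - B (_ / _) w));
  by rewrite !(rmorphB, rmorphD, rmorph1)/= -!pmulrn -?natr1; ring.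
have sk : N%:R `^ (- (k%:R / 2)) * Num.sqrt N%:R ^+ k = 1 :> R.
 rewrite -powR12_sqrt ?ler0n// -powR_mulrn ?powR_ge0// -powRrM -powRD; last by rewrite (gt_eqF NR) implybT.
 by rewrite (_ : - (k%:R / 2) + 2^-1 * k%:R = 0) ?powRr0//; ring.
by rewrite mulrACA sk mul1r.
Qed.
End grid_cells.

(** At a fine enough dyadic scale one simple kernel meets both requirements: it is close to the time
    kernel, and its integral is [bm_path], close to I. *)
Lemma bm_wiener (t : R) (I : {RV P >-> R}) : 0 <= t <= 1 ->
 (forall e, 0 < e -> exists L0, forall l', (L0 <= l')%N ->
  (\int[P]_w (((I w - bm_path g L alpha B l' w t) ^+ 2)%R)%:E <= e%:E)%E) ->
 is_wiener_ito P (fun t => B t) (time_kernel g t) I.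
Proof.
move=> t01 hI e e0; have e20 : 0 < e / 2 by rewrite divr_gt0.
have [L0 hL] := hI _ e20; have [n1 hn] := grid_kernel_cvg k0 gB adm t01 e20.
pose l' := maxn L0 n1; pose N := (2 ^ l')%N; pose M := (N * N)%N; pose b := Num.truncn (N%:R * t).
have N0 : (0 < N)%N by rewrite expn_gt0.
have n1N : (n1 <= N)%N by apply: leq_trans (leq_maxr L0 n1) _; apply: ltnW; exact: ltn_expl.
have eh : ((e / 2)%:E < e%:E)%E by rewrite lte_fin; lra.
exists (b + M).+1, (fun n => (n%:R - M%:R) / N%:R), (fun j => grid N M b (cell_index M j)); split.
- by move=> n; rewrite ltr_pM2r ?invr_gt0 ?ltr0n// ltrD2r ltr_nat.
- exact: grid_coef_inj.
- apply: le_lt_trans eh; apply: le_trans (sq_small_integral (hn N M n1N (leq_mul (leqnn _) n1N))).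
 rewrite le_eqVlt; apply/orP; left; apply/eqP; apply: eq_integral => x _.
 by rewrite simple_kernel_grid// -sqrrN opprB.
- apply: le_lt_trans eh; rewrite unlock; apply: le_trans (hL l' (leq_maxl _ _)).
 rewrite le_eqVlt; apply/orP; left; apply/eqP; apply: eq_integral => w _.
 by rewrite simple_integral_grid.
Qed.
End wiener.

Section as_random_variable.
Context {d} {T : measurableType d} {R : realType} (P : probability T R).

(** An alias that keeps its measurability proof as an argument, so that the random variable
    structure can be attached to it. *)
Definition mk_rv (f : T -> R) (mf : mfunT f) : T -> R := f.

HB.instance Definition _ f mf := @isMeasurableFun.Build _ _ _ _ (@mk_rv f mf) mf.

Definition as_rv f mf : {RV P >-> R} := @mk_rv f mf.

Lemma integral_lin_le (F G : T -> \bar R) (a b x y : R) : 0 <= a -> 0 <= b ->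
 (forall w, 0 <= F w)%E -> (forall w, 0 <= G w)%E -> mfunT F -> mfunT G ->
 (\int[P]_w F w <= x%:E)%E -> (\int[P]_w G w <= y%:E)%E ->
 [/\ forall w, (0 <= a%:E * F w + b%:E * G w)%E,
   mfunT (fun w => a%:E * F w + b%:E * G w)%E &
   (\int[P]_w (a%:E * F w + b%:E * G w) <= (a * x + b * y)%:E)%E].
Proof.
move=> a0 b0 F0 G0 mF mG Fx Gy.
have aF w : (0 <= a%:E * F w)%E by apply: mule_ge0; rewrite ?lee_fin.
have bG w : (0 <= b%:E * G w)%E by apply: mule_ge0; rewrite ?lee_fin.
have maF : mfunT (fun w => a%:E * F w)%E by exact: measurable_funeM.
have mbG : mfunT (fun w => b%:E * G w)%E by exact: measurable_funeM.
split=> [w||]; [exact: adde_ge0|exact: emeasurable_funD|].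
rewrite ge0_integralD// !ge0_integralZl_EFin// EFinD !EFinM.
by apply: leeD; apply: lee_wpmul2l => //; rewrite lee_fin.
Qed.
End as_random_variable.

Lemma pow4_small {R : realType} (r e : R) : 0 < e -> exists i : nat, r * 4 ^- i <= e.
Proof.
move=> e0; exists (Num.truncn (r / e)).+1.
rewrite ler_pdivrMr ?exprn_gt0// mulrC -ler_pdivrMr//.
apply: le_trans (ltW (truncnS_gt _)) _; rewrite -natrX ler_nat.
by apply: ltnW; exact: ltn_expl.
Qed.

Lemma pow16_le {R : realType} (i : nat) : 16 ^- i <= 4 ^- i :> R.
Proof. by rewrite lef_pV2 ?posrE ?exprn_gt0//; apply: lerXn2r; rewrite ?nnegrE//; lra. Qed.

Lemma chain_le {R : realType} (e x1 x2 x3 x4 y1 y2 y3 : R) :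
 x1 <= x2 + e / 8 + y1 -> x3 <= x4 + e / 8 + (y2 + y3) -> x2 <= x3 + e / 4 ->
 y1 <= e / 16 -> y3 <= e / 16 -> y2 = e / 16 -> 0 < e -> x1 - e <= x4.
Proof. by lra. Qed.

(** * Convergence in law *)

Section convergence.
Context {R : realType} {k : nat} (g : 'rV[R]_k -> R) (L : {ffun 'I_k -> nat} -> R) (alpha c2 : R).
Hypotheses (k0 : (0 < k)%N) (gB : is_GHKB alpha g) (adm : admissible L).
Local Notation H := (alpha + k%:R / 2 + 1).
Context {d'} {T' : measurableType d'} (P' : probability T' R) (B : R -> {RV P' >-> R}).
Hypothesis HB : is_brownian P' (fun t => B t).
Context {d} {T : measurableType d} (P : probability T R) (eps : int -> {RV P >-> R}).
Hypothesis eps_indep : mutually_independent P (fun i : int => eps i : T -> R).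
Variable rho : R.
Hypothesis eps3 : forall z, [/\ integ P (fun w => `|eps z w| ^+ 3), Ex P (eps z) = 0,
 Ex P (fun w => eps z w ^+ 2) = 1 & Ex P (fun w => `|eps z w| ^+ 3) <= rho].
Hypothesis eps2 : forall z, (e2 P (eps z) <= 1%:E)%E.
Variable D : nat -> T -> nat -> R.
Hypothesis mD : forall N b, mfunT (fun w => D N w b).
Hypothesis DS : forall r, 0 < r -> exists N0, forall N, (N0 <= N)%N -> exists (M : nat) (Q : T -> \bar R),
 (N * N <= M)%N /\ [/\ mfunT Q, forall w, (0 <= Q w)%E, (\int[P]_w Q w <= r%:E)%E &
  forall w (t : R), 0 <= t <= 1 ->
   (((stepf N (D N w) t - c2 * (N%:R `^ (- H) * chaos_sum g L (fun z => eps z w) M (Num.truncn (N%:R * t)))) ^+ 2)%:E <= Q w)%E].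

(** On [0, 1] the path depends on finitely many values, those with index at most N. As a function of
    these the functional is uniformly continuous on boxes, hence Borel. *)
Lemma measurable_lip_step K C F N : 0 <= K -> lip K C F ->
 mfunT (fun w => F (stepf N (D N w))).
Proof.
move=> K0 lF; have [_ FF] := lF.
pose Psi (u : {ffun 'I_N.+1 -> R}) := F (stepf N (fun j => u (inord j))).
have uPsi : unif_on_boxes Psi.
 exact: (@unif_stepf R N.+1 N (fun j (u : {ffun 'I_N.+1 -> R}) => u (inord j)) K C F K0 lF
  (fun j => (unif_proj (inord j : 'I_N.+1)).1)).
have -> : (fun w => F (stepf N (D N w))) = (fun w => Psi [ffun j : 'I_N.+1 => D N w j]).
 apply/funext => w; rewrite /Psi.
 have n1 : near 0 (stepf N (D N w)) (stepf N (fun j => [ffun j : 'I_N.+1 => D N w j] (inord j))).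
  by apply: near_stepf => j jN; rewrite ffunE inordK// subrr normr0.
 have n2 : near 0 (stepf N (fun j => [ffun j : 'I_N.+1 => D N w j] (inord j))) (stepf N (D N w)).
  by apply: near_stepf => j jN; rewrite ffunE inordK// subrr normr0.
 have := FF _ _ _ (cadlag_step _ _) (cadlag_step _ _) n1; have := FF _ _ _ (cadlag_step _ _) (cadlag_step _ _) n2.
 by rewrite mulr0 !addr0 => h1 h2; apply/eqP; rewrite eq_le h2 h1.
apply: (measurable_unif uPsi) => Z; under eq_fun do rewrite ffunE; exact: mD.
Qed.

(** At a fixed level, Lipschitz functionals are compared along a chain: limit path, Brownian step
    path, step path of the noise (by Lindeberg's exchange), chaos sums, given sums. *)
Theorem limit_convergence : exists Z : T' -> R -> R,
 (forall t, 0 <= t <= 1 -> exists2 I : {RV P' >-> R},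
   is_wiener_ito P' (fun t => B t) (time_kernel g t) I & forall w, Z w t = c2 * I w) /\
 weak_cvg_skorokhod P (fun N w => stepf N (D N w)) P' Z.
Proof.
have [p [l [W [Kc /= [[W0 mW [Kc0 WK] stepV0] [bmc lvc]]]]]] := level_scheme k0 gB adm HB.
pose V i w := stepf (2 ^ p i) (fun j => @block_poly R k g L alpha (p i) (l i) j (bm_blocks B (l i) w)).
have stepV i w t : (W w < +oo)%E -> 0 <= t <= 1 -> `|V i.+1 w t - V i w t| <= Num.sqrt (fine (W w)) * 2 ^- i.
 exact: stepV0.
have cV i w : cadlag (V i w) by exact: cadlag_step.
have mblk n (Z : 'I_(2 ^ n + 2 ^ n * 2 ^ n)) : mfunT (fun w => bm_blocks B n w Z).
 under eq_fun do rewrite ffunE; exact: measurable_bm_noise.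
have mV i t : mfunT (fun w => V i w t).
 by rewrite /V /stepf /block_poly /coarse_poly; apply: measurable_polyform => Z; exact: mblk.
pose Psi (F : (R -> R) -> R) i (u : {ffun 'I_(2 ^ l i + 2 ^ l i * 2 ^ l i) -> R}) :=
 F (stepf (2 ^ p i) (fun j => c2 * @block_poly R k g L alpha (p i) (l i) j u)).
have uPsi K C F i : 0 <= K -> lip K C F -> unif_on_boxes (Psi F i).
 move=> K0 lF; have h := @unif_stepf R _ (2 ^ p i)%N (fun j u => c2 * @block_poly R k g L alpha (p i) (l i) j u) K C F K0 lF.
 by apply: h => j; exact: unif_block_poly.
have mFV K C F i : 0 <= K -> lip K C F -> mfunT (fun w => F (fun t => c2 * V i w t)).
 by move=> K0 lF; apply: (measurable_unif (uPsi _ _ _ i K0 lF)) => Z; exact: mblk.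
pose Z w t := c2 * path_limit V W w t.
have cZ w : cadlag (Z w) by apply: (cadlag_path_limit stepV cV).
have mZ K C F : 0 <= K -> lip K C F -> mfunT (fun w => F (Z w)).
 move=> K0 lF; have mF i := mFV K C F i K0 lF.
 first [exact: (measurable_lip_path_limit W0 mW stepV cV K0 lF mF)|exact: (measurable_lip_path_limit W0 mW stepV cV c2 K0 lF mF)].
exists Z; split.
 move=> t t01; have mI := measurable_path_limit W0 mW stepV mV t01.
 exists (as_rv P' mI) => //; apply: (bm_wiener k0 gB adm t01) => e e0.
 have [i hi] := pow4_small (8 * Kc + 2) e0; have [L0 hL] := bmc i.
 exists L0 => l' hl'; have [Q [mQ Q0 QE HQ]] := hL _ hl'.
 have mQ' : mfunT (fun w => (Q w)%:E) by apply/measurable_EFinP.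
 have Q0' w : (0 <= (Q w)%:E)%E by rewrite lee_fin.
 have c0 : 0 <= 2 * (4 * 4 ^- i) :> R by rewrite !mulr_ge0// invr_ge0 exprn_ge0.
 have [j1 j2 j3] := integral_lin_le c0 (ltac:(lra) : 0 <= 2 :> R) W0 Q0' mW mQ' WK QE.
 apply: (@le_trans _ _ (\int[P']_w ((2 * (4 * 4 ^- i))%:E * W w + 2%:E * (Q w)%:E))%E).
  apply: ge0_le_integral => //.
  - by move=> w _; rewrite lee_fin sqr_ge0.
  - apply/measurable_EFinP; apply: measurable_funX; apply: measurable_funB; first exact: mI.
   rewrite /bm_path; apply: measurable_funM => //.
   under eq_fun do rewrite chaos_sum_chT; apply: measurable_sum => n.
   have N0 : (0 < 2 ^ l')%N by rewrite expn_gt0.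
   have mid (v : 'I_k) : mfunT ((fun=> id) v : R -> R) by exact: measurable_id.
   have [h _] := L2_chaosT (bm_indep HB N0) (fun i => g (row_of_index i) * L i) (lexx 1) mid
    (fun (v : 'I_k) z (_ : v \in [set: 'I_k]%SET) => bm_e2 HB N0 z) (2 ^ l' * 2 ^ l') n.+1.
   exact: h.
  - move=> w _; have h1 := path_limit_sq W0 stepV i w t01; have h2 := HQ w t t01.
   apply: (@le_trans _ _ (2%:E * ((path_limit V W w t - V i w t) ^+ 2)%:E + 2%:E * (Q w)%:E)%E).
    rewrite -!EFinM -EFinD lee_fin; move: h2.
    rewrite -/(V i w t) /as_rv /= /mk_rv; move: (V i w t) (bm_path _ _ _ _ _ _ _) (path_limit _ _ _ _) => a b c h.
    by have := sqr_ge0 (c - a + (b - a)); nra.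
   by apply: leeD => //; rewrite [(2 * (4 * 4 ^- i))%:E]EFinM -muleA; apply: lee_wpmul2l.
 apply: le_trans j3 _; rewrite lee_fin; apply: le_trans hi.
 by have := @pow16_le R i; move: (4 ^- i) (16 ^- i) => x y; nra.
apply: weak_cvg_lip => [N w|//|N K C F K0 lF|//|K C F e K0 lF0 e0]; [exact: cadlag_step|exact: measurable_lip_step lF|].
(* The Lipschitz constant is raised to K + 1 because the comparison of expectations asks for a
   positive one. *)
have K1 : 0 < K + 1 by lra.
have lF : lip (K + 1) C F by apply: lip_weaken lF0; lra.
pose eta := e / 8; pose A := (K + 1) ^+ 2 / (4 * eta).
have eta0 : 0 < eta by rewrite divr_gt0.
have A0 : 0 < A by rewrite divr_gt0// ?exprn_gt0// mulr_gt0.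
have e16 : 0 < e / 16 by rewrite divr_gt0.
(* The level is fixed first, from the second moment errors on both spaces. N becomes large only
   afterwards, since the threshold of Lindeberg's exchange depends on the number of blocks. *)
have [i hi] := pow4_small (A * (c2 ^+ 2 * (4 * Kc + 2))) e16.
pose r := e / (32 * A).
have r0 : 0 < r by rewrite divr_gt0// mulr_gt0.
have [N1 hS] := DS r0; have [n0 hc] := lvc i.
have bPsi u : `|Psi F i u| <= C by have [bF _] := lF; apply: bF; exact: cadlag_step.
have e40 : 0 < e / 4 by rewrite divr_gt0.
(* The maximum is a third moment bound shared by eps and the Brownian increments. *)
have [m0 hl] := lindeberg (Num.max rho 129) bPsi (uPsi _ _ _ i (ltW K1) lF) e40.
exists (N1 + n0 + m0 * 2 ^ l i)%N => N hN.
have [M [Q1 [NM [mQ1 Q10 Q1E HQ1]]]] := hS N ltac:(by apply: leq_trans hN; rewrite -addnA leq_addr).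
have n0N : (n0 <= N)%N by apply: leq_trans hN; rewrite addnAC leq_addl.
have [mpos [Q2 [mQ2 Q20 Q2E HQ2]]] := hc _ _ P eps eps_indep (fun z => let: And4 _ h _ _ := eps3 z in h) eps2 N M n0N NM.
set m := (N %/ 2 ^ l i)%N in mpos HQ2.
have m0m : (m0 <= m)%N by rewrite leq_divRL ?expn_gt0//; apply: leq_trans hN; exact: leq_addl.
pose cc := (m * (2 ^ l i * 2 ^ l i))%N.
have N'0 : (0 < m * 2 ^ l i)%N by rewrite muln_gt0 mpos expn_gt0.
have sinj : injective (fun r : nat => r%:Z + 1 - cc%:Z) by move=> x y; clear; lia.
have sX : std_noise (shift_noise eps cc) (Num.max rho 129).
 split.
  change (mutually_independent P (fun r : nat => eps (r%:Z + 1 - cc%:Z) : T -> R)).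
  first [exact: (indep_inj sinj eps_indep)|exact: (indep_inj eps_indep sinj)|by apply: (indep_inj sinj)|by apply: (indep_inj eps_indep)|by apply: (@indep_inj _ _ _ _ _ _ _ _ sinj)].
 by move=> j; have [h1 h2 h3 h4] := eps3 (j%:Z + 1 - cc%:Z); split=> //; rewrite le_max h4.
have sX' : std_noise (shift_noise (bm_rv B (m * 2 ^ l i)) cc) (Num.max rho 129).
 have [h0 h] := bm_std_noise HB N'0 sinj; split; first exact: h0.
 by move=> j; have [h1 h2 h3 h4] := h j; split=> //; rewrite le_max h4 orbT.
have hlind := hl m m0m _ _ _ _ P P' _ _ sX sX'.
have bE w : bsum m (fun x => shift_noise (bm_rv B (m * 2 ^ l i)) cc x w) = bm_blocks B (l i) w by exact: bsum_bm.
pose VX w := stepf (2 ^ p i) (fun j => c2 * @block_poly R k g L alpha (p i) (l i) j (bsum m (shift_noise eps cc ^~ w))).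
have E1 : Ex P' (fun w => F (Z w)) <= Ex P' (fun w => F (fun t => c2 * V i w t)) + eta + A * (c2 ^+ 2 * (4 * 4 ^- i) * Kc).
 have c0 : 0 <= c2 ^+ 2 * (4 * 4 ^- i) by apply: mulr_ge0; [exact: sqr_ge0|rewrite mulr_ge0// invr_ge0 exprn_ge0].
 apply: (Ex_lip_le (Q := fun w => ((c2 ^+ 2 * (4 * 4 ^- i))%:E * W w)%E) (C := C)) => //.
 - by move=> w; exact: (cadlag_step (2 ^ p i)%N (fun j => c2 * @block_poly R k g L alpha (p i) (l i) j (bm_blocks B (l i) w))).
 - exact: mZ (ltW K1) lF.
 - exact: mFV (ltW K1) lF.
 - by move=> w; apply: mule_ge0; rewrite ?lee_fin.
 - exact: measurable_funeM.
 - by rewrite ge0_integralZl_EFin// [X in (_ <= X)%E]EFinM; apply: lee_wpmul2l; rewrite ?lee_fin.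
 - move=> w t t01; rewrite /Z -mulrBr exprMn EFinM (EFinM (c2 ^+ 2)) -muleA.
  by apply: lee_wpmul2l; [rewrite lee_fin sqr_ge0|exact: path_limit_sq].
have mVX : mfunT (fun w => F (VX w)).
 apply: (measurable_unif (uPsi _ _ _ i (ltW K1) lF)) => Y; under eq_fun do rewrite ffunE.
 by apply: measurable_funM => //; apply: measurable_sum => j; exact: measurable_funPT.
have E2 : Ex P (fun w => F (VX w)) <= Ex P (fun w => F (stepf N (D N w))) + eta + A * (2 * r + 2 * c2 ^+ 2 * 16 ^- i).
 have mQ2' : mfunT (fun w => (Q2 w)%:E) by apply/measurable_EFinP.
 have Q20' w : (0 <= (Q2 w)%:E)%E by rewrite lee_fin.
 have c0 : 0 <= 2 * c2 ^+ 2 :> R by rewrite mulr_ge0 ?sqr_ge0.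
 have [j1 j2 j3] := integral_lin_le (ltac:(lra) : 0 <= 2 :> R) c0 Q10 Q20' mQ1 mQ2' Q1E Q2E.
 apply: (Ex_lip_le (C := C) _ _ mVX (measurable_lip_step N (ltW K1) lF) j1 j2 j3) => //.
 - by move=> w; exact: (cadlag_step (2 ^ p i)%N (fun j => c2 * @block_poly R k g L alpha (p i) (l i) j (bsum m (shift_noise eps cc ^~ w)))).
 - by move=> w; exact: (cadlag_step N (D N w)).
 - move=> w t t01; have h1 := HQ1 w t t01; have h2 := HQ2 w t t01.
  rewrite -/cc in h2; move: h1 h2; rewrite /VX {2}/stepf [X in _ -> (X - _) ^+ 2 <= _ -> _]lock.
  rewrite -lock; set a := N%:R `^ _ * _; set s := stepf N _ t; set b := block_poly _ _ _ _ _ _.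
  rewrite /stepf -/b => h1 h2.
  apply: (@le_trans _ _ (2%:E * ((s - c2 * a) ^+ 2)%:E + (2 * c2 ^+ 2)%:E * ((a - b) ^+ 2)%:E)%E).
   rewrite -!EFinM -EFinD lee_fin; have := sqr_ge0 (s - c2 * a - c2 * (a - b)).
   by move: s a b c2 {h1 h2 c0 j1 j2 j3 E1} => s a b c; nra.
  by apply: leeD; apply: lee_wpmul2l; rewrite ?lee_fin.
have E3 : Ex P' (fun w => F (fun t => c2 * V i w t)) <= Ex P (fun w => F (VX w)) + e / 4.
 have -> : Ex P' (fun w => F (fun t => c2 * V i w t)) =
   Ex P' (fun w => Psi F i (bsum m (fun x => shift_noise (bm_rv B (m * 2 ^ l i)) cc x w))).
  by apply: eq_Ex => w; rewrite bE.
 by move: hlind; rewrite distrC ler_norml /VX /Psi => /andP[_]; move: (Ex P' _) (Ex P _) => x y; lra.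
have Ar : A * (2 * r) = e / 16 by rewrite /r; field; rewrite gt_eqF.
have p4 : 0 < 4 ^- i :> R by rewrite invr_gt0 exprn_gt0.
have b1 : A * (c2 ^+ 2 * (4 * 4 ^- i) * Kc) <= e / 16.
 apply: le_trans hi; rewrite -subr_ge0.
 rewrite (_ : _ - _ = A * (c2 ^+ 2 * 2) * 4 ^- i); last by ring.
 apply: mulr_ge0; last exact: ltW.
 by apply: mulr_ge0; [exact: ltW|rewrite mulr_ge0// sqr_ge0].
have b2 : A * (2 * c2 ^+ 2 * 16 ^- i) <= e / 16.
 apply: le_trans hi; apply: (@le_trans _ _ (A * (2 * c2 ^+ 2 * 4 ^- i))).
  by rewrite ler_pM2l//; apply: ler_wpM2l; [rewrite mulr_ge0// sqr_ge0|exact: pow16_le].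
 rewrite -subr_ge0 (_ : _ - _ = A * (c2 ^+ 2 * (4 * Kc)) * 4 ^- i); last by ring.
 apply: mulr_ge0; last exact: ltW.
 by apply: mulr_ge0; [exact: ltW|apply: mulr_ge0; [exact: sqr_ge0|exact: mulr_ge0]].
rewrite (mulrDr A (2 * r)) in E2.
exact: (chain_le E1 E2 E3 b1 b2 Ar e0).
Qed.
End convergence.

(** * From the given process to chaos sums *)

Section normalized_window.
Context {R : realType} {k : nat} (g : 'rV[R]_k -> R) (L : {ffun 'I_k -> nat} -> R) (alpha c2 C theta : R).
Local Notation H := (alpha + k%:R / 2 + 1).
Local Notation a := (fun i => g (row_of_index i) * L i).
Hypotheses (H12 : 0 < H) (C0 : 0 < C) (th1 : 1 < theta) (thH : theta < 2 * H).
Context {d} {T : measurableType d} (P : probability T R) (eps : int -> {RV P >-> R}).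
Hypothesis eps_indep : mutually_independent P (fun i : int => eps i : T -> R).
Hypothesis eps2 : forall z, (e2 P (eps z) <= 1%:E)%E.
Variables (Y : nat -> {RV P >-> R}) (X : nat -> T -> R).
Hypothesis mX : forall n, mfunT (X n).
Hypothesis Yc : forall n, is_offdiag_chaos P (fun i => eps i) a n (Y n).
Hypothesis XY : forall a0 b : nat,
 (e2 P (fun w => \sum_(n < b) (X (a0 + n)%N w - Ex P (X (a0 + n)%N) - c2 * Y (a0 + n)%N w))%R <= (C * b%:R `^ theta)%:E)%E.
Let id1 (_ : 'I_k) (x : R) := x.
Let chT M n := chaosT eps [set: 'I_k]%SET a id1 M n.
Let D N w b := N%:R `^ (- H) * \sum_(1 <= n < b.+1) (X n w - Ex P (X n)).
Let rem n w := X n w - Ex P (X n) - c2 * Y n w.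

Let mrem n : mfunT (rem n).
Proof. by apply: measurable_funB; [apply: measurable_funB|apply: measurable_funM]. Qed.

Let me1 v : mfunT (id1 v). Proof. exact: measurable_id. Qed.
Let es2 (v : 'I_k) (z : int) : v \in [set: 'I_k]%SET -> (e2 P (fun w => id1 v (eps z w)) <= 1%:E)%E.
Proof. by move=> _; exact: eps2. Qed.

Let Ysum N : L2_sum P (offdiag [set: 'I_k]%SET)
 (fun i w => a i * \prod_(v in [set: 'I_k]%SET) id1 v (eps (N%:Z - (i v)%:Z) w)) (Y N).
Proof.
have := Yc N; rewrite /is_offdiag_chaos; congr (L2_sum P _ _ _).
by apply/funext => i; apply/funext => w; congr (_ * _); apply: eq_bigl => q; rewrite inE.
Qed.

Let mY N : mfunT (Y N : T -> R). Proof. exact: measurable_funPT. Qed.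

Let L2T M N : L2 P (chT M N).
Proof. exact: (L2_chaosT eps_indep _ (lexx 1) me1 es2). Qed.

Let tail N (r : R) : 0 < r -> exists M : nat, (N * N <= M)%N /\
 forall n : 'I_N, (e2 P (fun w => `|Y n.+1 w - chT M n.+1 w|)%R <= r%:E)%E.
Proof.
move=> r0; have [f hf] := choice (fun n : nat => chaosT_cvg eps_indep (lexx 1) me1 es2 mY Ysum n.+1 r0).
(* The summand N * N is the memory that the kernel approximation demands. *)
exists (N * N + \max_(n < N) f n)%N; split=> [|n]; first exact: leq_addr.
have fn : (f n <= N * N + \max_(n < N) f n)%N.
 by apply: leq_trans (leq_addl _ _); exact: (leq_bigmax n).
have [h1 h2] := hf n _ fn.
have -> : e2 P (fun w => `|Y n.+1 w - chT (N * N + \max_(n < N) f n)%N n.+1 w|)%R =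
  e2 P (fun w => Y n.+1 w - chT (N * N + \max_(n < N) f n)%N n.+1 w)%R.
 by apply: eq_integral => w _; rewrite real_normK// num_real.
by rewrite (L2_e2E h1) lee_fin.
Qed.

(** N^(- 2 H) N^theta tends to 0, which removes the remainder uniformly in t. The part of Y beyond
    lag M is removed by choosing M after N, with a tolerance divided by N^2 for a sum of at most N
    terms. *)
Lemma normalized_window (r : R) : 0 < r -> exists N0, forall N, (N0 <= N)%N -> exists (M : nat) (Q : T -> \bar R),
 (N * N <= M)%N /\ [/\ mfunT Q, forall w, (0 <= Q w)%E, (\int[P]_w Q w <= r%:E)%E &
  forall w (t : R), 0 <= t <= 1 ->
   (((stepf N (D N w) t - c2 * (N%:R `^ (- H) * chaos_sum g L (fun z => eps z w) M (Num.truncn (N%:R * t)))) ^+ 2)%:E <= Q w)%E].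
Proof.
move=> r0; have [C' C'0 hmax] := maximal_window (ltW C0) th1.
have q0 : 0 < 2 * H - theta by rewrite subr_gt0.
have A0 : 0 < C' * 2 `^ theta by rewrite mulr_gt0// powR_gt0.
have r40 : 0 < r / (4 * (C' * 2 `^ theta)) by rewrite divr_gt0// mulr_gt0.
have [n0 hn] := pow_small q0 r40; exists n0.+1 => N hN.
have N0 : (0 < N)%N by apply: leq_trans hN.
have NR : 0 < N%:R :> R by rewrite ltr0n.
have r'0 : 0 < r / (4 * (c2 ^+ 2 + 1) * (N%:R * N%:R)).
 by rewrite divr_gt0// !mulr_gt0// ltr_wpDl// sqr_ge0.
have [M [NM hM]] := tail N r'0; exists M.
set r' := r / _ in r'0 hM.
(* 2^ll lies between N and 2 N, so one dyadic block starting at time 1 contains all the partial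
   sums. *)
pose ll := (trunc_log 2 N).+1.
have Nl : (N <= 2 ^ ll)%N by apply: ltnW; exact: trunc_log_ltn.
have lN : (2 ^ ll <= 2 * N)%N by rewrite expnS leq_pmul2l//; exact: trunc_logP.
have [Q1 [mQ1 Q10 Q1E HQ1]] := hmax _ _ P rem mrem XY 1%N ll.
pose y n w := `|Y n.+1 w - chT M n.+1 w|.
have my n : mfunT (y n).
 by apply: measurableT_comp => //; apply: measurable_funB => //; have [] := L2T M n.+1.
pose Q2 w := (\sum_(n < N) y n w) ^+ 2.
have Q2E : (\int[P]_w (Q2 w)%:E <= (N%:R * (N%:R * r'))%:E)%E.
 apply: le_trans (e2_sum P (fun n : 'I_N => my n)) _; rewrite card_ord EFinM.
 apply: lee_wpmul2l; first by rewrite lee_fin.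
 apply: le_trans (lee_sum _ (fun n _ => hM n)) _.
 have s0 : \sum_(i < N) r' = N%:R * r' by rewrite sumr_const card_ord mulr_natl.
 by rewrite sumEFin lee_fin s0.
set h := N%:R `^ (- H).
have h0 : 0 <= h by exact: powR_ge0.
have h1 : h <= 1.
 rewrite /h powRN invf_le1 ?powR_gt0//; rewrite -[leLHS](powRr0 N%:R).
 by apply: ler_powR; [rewrite ler1n|exact: ltW].
have mQ1' : mfunT (fun w => (Q1 w)%:E) by apply/measurable_EFinP.
have mQ2' : mfunT (fun w => (Q2 w)%:E).
 by apply/measurable_EFinP; apply: measurable_funX; apply: measurable_sum => n; exact: my.
have Q10' w : (0 <= (Q1 w)%:E)%E by rewrite lee_fin.
have Q20' w : (0 <= (Q2 w)%:E)%E by rewrite lee_fin sqr_ge0.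
have c1 : 0 <= 2 * h ^+ 2 by rewrite mulr_ge0// sqr_ge0.
have c3 : 0 <= 2 * c2 ^+ 2 by rewrite mulr_ge0// sqr_ge0.
have [j1 j2 j3] := integral_lin_le c1 c3 Q10' Q20' mQ1' mQ2' Q1E Q2E.
exists (fun w => (2 * h ^+ 2)%:E * (Q1 w)%:E + (2 * c2 ^+ 2)%:E * (Q2 w)%:E)%E; split=> //; split=> //.
 apply: le_trans j3 _; rewrite lee_fin.
 have b1 : 2 * h ^+ 2 * (C' * (2 ^ ll)%:R `^ theta) <= r / 2.
  apply: (@le_trans _ _ (2 * (C' * 2 `^ theta) * N%:R `^ (- (2 * H - theta)))).
   have -> : 2 * (C' * 2 `^ theta) * N%:R `^ (- (2 * H - theta)) = 2 * h ^+ 2 * (C' * (2 * N)%:R `^ theta).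
    rewrite natrM powRM// /h -powR_mulrn ?powR_ge0// -powRrM.
    rewrite (_ : - (2 * H - theta) = - H * 2%:R + theta); last by ring.
    have -> : N%:R `^ (- H * 2%:R + theta) = N%:R `^ (- H * 2%:R) * N%:R `^ theta.
     by rewrite powRD// (gt_eqF NR) implybT.
    by move: (N%:R `^ (_ * _)) (N%:R `^ theta) (2 `^ theta) => x1 x2 x3; ring.
   apply: ler_wpM2l => //; apply: ler_wpM2l; first exact: ltW.
   apply: ge0_ler_powR; [exact: le_trans ler01 (ltW th1)|by rewrite nnegrE|by rewrite nnegrE|].
   by rewrite ler_nat.
  have := hn N (ltnW hN); rewrite ler_pdivlMr; last by rewrite mulr_gt0.
  by move: (N%:R `^ _) (C' * _) => x z; lra.
 have b2 : 2 * c2 ^+ 2 * (N%:R * (N%:R * r')) <= r / 2.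
  have -> : 2 * c2 ^+ 2 * (N%:R * (N%:R * r')) = r / 2 * (c2 ^+ 2 / (c2 ^+ 2 + 1)).
   rewrite /r'; field; by rewrite (gt_eqF NR) /= gt_eqF// ltr_wpDl// sqr_ge0.
  rewrite ler_piMr//; try (by rewrite divr_ge0// ltW).
  by rewrite ler_pdivrMr ?mul1r ?lerDl// ltr_wpDl// sqr_ge0.
 by apply: (@le_trans _ _ (r / 2 + r / 2)); [exact: lerD|rewrite -splitr].
move=> w t /andP[t0 t1]; rewrite /stepf; set b := Num.truncn (N%:R * t).
have bN : (b <= N)%N.
 rewrite -(ler_nat R); apply: le_trans (_ : N%:R * t <= _); last by rewrite ler_piMr.
 by have := truncn_le (N%:R * t); rewrite mulr_ge0// => /esym ->.
have E1 : D N w b - c2 * (h * chaos_sum g L (fun z => eps z w) M b) =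
  h * \sum_(n < b) rem (1 + n)%N w + h * c2 * \sum_(n < b) (Y n.+1 w - chT M n.+1 w).
 rewrite /D chaos_sum_chT big_add1 /= big_mkord -/h.
 rewrite (_ : c2 * (h * _) = h * (c2 * \sum_(n < b) chT M n.+1 w)); last by rewrite mulrCA.
 rewrite -mulrBr -mulrA -mulrDr; congr (_ * _); rewrite !mulr_sumr -sumrB -big_split/=.
 by apply: eq_bigr => n _; rewrite /rem add1n; ring.
rewrite E1 -!EFinM -EFinD lee_fin.
have s1 := HQ1 w b (leq_trans bN Nl).
have s2 : (\sum_(n < b) (Y n.+1 w - chT M n.+1 w)) ^+ 2 <= Q2 w.
 rewrite /Q2 -[leLHS]real_normK ?num_real// ler_sqr ?nnegrE ?sumr_ge0// => [|n _]; last exact: normr_ge0.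
 apply: le_trans (ler_norm_sum _ _ _) _.
 rewrite -(big_mkord predT (fun n => y n w)) -(big_mkord predT (fun n => `|Y n.+1 w - chT M n.+1 w|)).
 rewrite (big_cat_nat (leq0n b) bN)/= lerDl; apply: sumr_ge0 => n _; exact: normr_ge0.
move: s1 s2; set u := \sum_(n < b) _; set v := \sum_(n < b) _ => s1 s2.
apply: (@le_trans _ _ (2 * h ^+ 2 * u ^+ 2 + 2 * c2 ^+ 2 * (h ^+ 2 * v ^+ 2))).
 by have := sqr_ge0 (h * u - h * c2 * v); move: h u v c2 {s1 s2 c1 c3 j1 j2 j3 E1 h0 h1} => h u v c; nra.
apply: lerD; apply: ler_wpM2l => //; apply: le_trans s2.
by rewrite ler_piMl ?sqr_ge0// expr_le1.
Qed.

End normalized_window.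

Theorem theorem3p8 (R : realType)
    (d : measure_display) (T : measurableType d) (P : probability T R)
    (k1 k2 : nat) (eps : int -> {RV P >-> R}) (delta alpha1 alpha2 : R)
    (g1 : 'rV[R]_k1 -> R) (g2 : 'rV[R]_k2 -> R)
    (L1 : {ffun 'I_k1 -> nat} -> R) (L2 : {ffun 'I_k2 -> nat} -> R)
    (A : nat -> {poly R}) (Y1 Y2 : nat -> {RV P >-> R})
    (a1 := fun i => g1 (row_of_index i) * L1 i)
    (a2 := fun i => g2 (row_of_index i) * L2 i)
    (X := fun (n : nat) (w : T) => Y1 n w * Y2 n w)
    (H1 := alpha1 + k1%:R / 2 + 1)
    (c2 := mean_const (moment P (eps 0)) a2) :
  (2 <= k1)%N -> (2 <= k2)%N ->
  mutually_independent P (fun i : int => eps i : T -> R) ->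
  identically_distributed P (fun i : int => eps i : T -> R) ->
  (forall i, 'E_P[eps i] = 0%:E)%E ->
  (forall i, 'V_P[eps i] = 1%:E)%E ->
  0 < delta ->
  (forall i, 'E_P[fun w => (`|eps i w| `^ (2 + 2 * k2%:R + delta))%R] < +oo)%E ->
  is_GHKB alpha1 g1 -> symmetric_kernel g1 ->
  is_GHKB alpha2 g2 -> symmetric_kernel g2 ->
  admissible L1 -> symmetric_coef a1 ->
  admissible L2 -> symmetric_coef a2 ->
  is_appell P (eps 0) k2 A ->
  (forall n, is_offdiag_chaos P (fun i => eps i) a1 n (Y1 n)) ->
  (forall n, is_diag_chaos P (fun i => eps i) A a2 n (Y2 n)) ->
  c2 != 0 ->
  forall (d' : measure_display) (T' : measurableType d')
    (P' : probability T' R) (B : R -> {RV P' >-> R}),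
  is_brownian P' (fun t => B t) ->
  exists Z : T' -> R -> R,
    (forall t, 0 <= t <= 1 -> exists2 I : {RV P' >-> R},
       is_wiener_ito P' (fun t => B t) (time_kernel g1 t) I &
       forall w, Z w t = c2 * I w) /\
    weak_cvg_skorokhod P (normalized_sum P H1 X) P' Z.
Proof.
move=> k12 k22 indep idd E0 V1 delta0 mom GB1 sg1 GB2 sg2 adm1 sa1 adm2 sa2 app Y1c Y2c c20 d' T' P' B HB.
have Ex0 z : Ex P (eps z) = 0 by have := E0 z; rewrite unlock /Ex => ->.
have e21 z : (e2 P (eps z) <= 1%:E)%E.
 rewrite le_eqVlt; apply/orP; left; apply/eqP; rewrite -(V1 z) /variance unlock (E0 z) unlock /e2.
 apply: eq_integral => w _; congr EFin.
 by change (eps z w ^+ 2 = (eps z w - 0) * (eps z w - 0)); rewrite subr0 expr2.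
have e2E z : Ex P (fun w => eps z w ^+ 2) = 1.
 rewrite /Ex; have : (\int[P]_w (eps z w ^+ 2)%:E = 1%:E)%E.
  rewrite -(V1 z) /variance unlock (E0 z) unlock.
  apply: eq_integral => w _; congr EFin.
 by change (eps z w ^+ 2 = (eps z w - 0) * (eps z w - 0)); rewrite subr0 expr2.
 by move=> ->.
(* The order of the available moment: at least 2 k_2 + 2 for the remainder and at least 3 for
   Lindeberg's exchange. *)
pose s : R := 2 + 2 * k2%:R + delta.
have ks : (2 * k2 + 2)%:R <= s by rewrite /s natrD natrM; lra.
have k2R : 2 <= k2%:R :> R by rewrite ler_nat.
have s3 : 3%:R <= s by rewrite /s; lra.
have int3 z : integ P (fun w => `|eps z w| ^+ 3) by exact: (integ_pow s3 (mom z)).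
have mcube : mfunT (fun x : R => `|x| ^+ 3).
 by apply: measurable_funX; first [exact: measurable_normr|exact: normr_measurable|exact: measurableT_comp|apply: measurableT_comp].
pose rho := Ex P (fun w => `|eps 0 w| ^+ 3).
have eps3 z : [/\ integ P (fun w => `|eps z w| ^+ 3), Ex P (eps z) = 0,
  Ex P (fun w => eps z w ^+ 2) = 1 & Ex P (fun w => `|eps z w| ^+ 3) <= rho].
 by split=> //; have [_ ->] := integ_id idd z mcube (int3 0).
have [c1 c10 a1le] := coef_bound GB1 adm1; have [c2' c20' a2le] := coef_bound GB2 adm2.
have [[/andP[al1 ar1] _ _ _] _ _] := GB1; have [[/andP[al2 ar2] _ _ _] _ _] := GB2.
(* Excess of each homogeneity over k / 2; in particular H_1 = 1 - ka. *)
pose ka := - alpha1 - k1%:R / 2; pose ku := - alpha2 - k2%:R / 2.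
have kaI : 0 < ka < 1 / 2 by rewrite /ka; apply/andP; split; lra.
have ku0 : 0 < ku by rewrite /ku; lra.
have a1le' (i : {ffun 'I_k1 -> nat}) : (forall q, 0 < i q)%N -> `|a1 i| <= c1 * (\sum_q i q)%N%:R `^ (- (k1%:R / 2 + ka)).
 by move=> i0; rewrite (_ : - _ = alpha1); [exact: a1le|rewrite /ka; ring].
have a2le' (i : {ffun 'I_k2 -> nat}) : (forall q, 0 < i q)%N -> `|a2 i| <= c2' * (\sum_q i q)%N%:R `^ (- (k2%:R / 2 + ku)).
 by move=> i0; rewrite (_ : - _ = alpha2); [exact: a2le|rewrite /ku; ring].
have k10 : (0 < k1)%N by exact: ltnW. have k20 : (0 < k2)%N by exact: ltnW.
have [C [theta [C0 th1 thH XY]]] := remainder_window indep idd Ex0 k10 k20 ks (mom 0) c10 c20' kaI ku0 a1le' a2le' app Y1c Y2c.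
have H0 : 0 < H1 by rewrite /H1; move: kaI; rewrite /ka => /andP[_ ?]; lra.
have thH' : theta < 2 * H1 by move: thH; rewrite /ka /H1; lra.
have mX n : mfunT (X n) by apply: measurable_funM.
have mD (N b : nat) : mfunT (fun w => N%:R `^ (- H1) * \sum_(1 <= n < b.+1) (X n w - Ex P (X n))).
 apply: measurable_funM => //; under eq_fun do rewrite big_add1 /= big_mkord.
 by apply: measurable_sum => n; apply: measurable_funB.
have DS := normalized_window H0 C0 th1 thH' indep e21 mX Y1c XY.
have EX n : fine 'E_P[X n] = Ex P (X n) by rewrite unlock.
(* The normalised sum depends on t through [N t] only, so it is a step path. *)
have -> : normalized_sum P H1 X = fun N w => stepf N (fun b => N%:R `^ (- H1) * \sum_(1 <= n < b.+1) (X n w - Ex P (X n))).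
 apply/funext => N; apply/funext => w; apply/funext => t; rewrite /normalized_sum /stepf.
 by congr (_ * _); apply: eq_bigr => n _; rewrite EX.
exact: (limit_convergence k10 GB1 adm1 HB indep eps3 e21 mD DS).
Qed.
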